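(* Let $M\subset\mathbb{C}^n$ be a generic real submanifold of class $C^{2,\epsilon}$, $0<\epsilon<1$, and of real codimension $m$, which is an open, relatively compact subset of a larger such manifold, and let $0<\delta<\epsilon$. There is a constant $R>0$ depending on $M$ such that, for every analytic disc $\phi$ of class $C^{1,\delta}$ with $\phi(\Gamma)\subset M$ and $|\phi|<R$, one has $$d(\phi)=\dim_{\mathbb{R}}V_\phi .$$ In particular $d(\phi)\le m=\operatorname{codim}M$.
   Context: $D\subset\mathbb{C}$ is the open unit disc and $\Gamma=\partial D$. $M$ is generic if for every $p\in M$ the real tangent space $T_pM$ spans $\mathbb{C}^n$ over $\mathbb{C}$. An analytic disc of class $C^{1,\delta}$ is a map $\phi:\bar D\to\mathbb{C}^n$ of class $C^{1,\delta}$ on $\bar D$ and holomorphic in $D$. Its size is $|\phi|=\inf_{z_0\in\mathbb{C}^n}\|\phi+z_0\|_{1,\delta}$, with $\|\cdot\|_{1,\delta}$ the $C^{1,\delta}$ norm. Defect $d(\phi)$: the holomorphic co-normal bundle $CM$ has as fiber at $p\in M$ the real vector space of forms $\omega=\sum_{j=1}^n a_j\,dz_j$ such that $\operatorname{Im}(\omega)$ vanishes on $T_pM$. A section $\sum_j a_j(\sigma)\,dz_j$ of $\phi^*CM\to\Gamma$ extends holomorphically to $D$ if every coefficient $a_j:\Gamma\to\mathbb{C}$ is the boundary value of a function continuous on $\bar D$ and holomorphic in $D$. The defect $d(\phi)$ is the dimension of the real vector space of all $C^{1,\delta}$-sections of $\phi^*CM$ which extend holomorphically to $D$. The space $V_\phi$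 (Tumanov's original definition of the defect, for small discs): $T_1:C^{1,\delta}(\Gamma)\to C^{1,\delta}(\Gamma)$ is the Hilbert transform normalized at $1$: for real $f$, $T_1f$ is the real function such that $f+iT_1f$ extends holomorphically to $D$ and $T_1f(1)=0$; it acts entrywise on matrices. If $|\phi|$ is smaller than a constant depending only on $M$, one can choose complex affine coordinates $(z=x+iy,w)\in\mathbb{C}^m\times\mathbb{C}^{n-m}$ with origin at $\phi(1)$ such that a neighbourhood of $\phi(\Gamma)$ in $M$ is contained in $\{x=h(w,y),\ |w|<r,\ |y|<r\}$, where $h:\{|w|<r,|y|<r\}\to\mathbb{R}^m$ is of class $C^{2,\epsilon}$, $h(0,0)=0$, $dh(0,0)=0$, and $h_y$ is so small that the equation $$G=1-T_1[G\,(h_y\circ\phi)]$$ has a unique solution $G:\Gamma\to GL(m,\mathbb{R})$ of class $C^{1,\delta}$, and the holomorphic extension to $\bar D$ of $G(1+i\,h_y\circ\phi)$ is a non-degenerate matrix at all points of $\bar D$. (The equation is equivalent to: $G(1+i\,h_y\circ\phi)$ extends holomorphically to $D$ and $G(1)=1$.) Here $h_y\circ\phi$ and $h_w\circ\phi$ are the $m\times m$ matrix of derivatives $\partial h_i/\partial y_j$ and the $m\times(n-m)$ matrix of derivatives $\partial h_i/\partial w_j$, evaluated at $(w(\sigma),y(\sigma))$, $\sigma\in\Gamma$, $\phi=(z(\cdot),w(\cdot))$. With such a choice, $$V_\phi=\{c\in\mathbb{R}^m:\ c\,G\,(h_w\circ\phi)\ \text{extends holomorphically to } D\},$$ $c$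 being regarded as a row vector. *)

(* Defs.v *)
From HB Require Import structures.
From mathcomp Require Import all_boot all_order all_algebra.
From mathcomp Require Import all_classical all_reals.
From mathcomp Require Import topology normedtype derive exp trigo.
From mathcomp Require Import complex.

Set Implicit Arguments.
Unset Strict Implicit.
Unset Printing Implicit Defensive.

Import Order.TTheory GRing.Theory Num.Theory.
Import numFieldNormedType.Exports.

Local Open Scope classical_set_scope.
Local Open Scope ring_scope.
Local Open Scope complex_scope.

(* C^n is ['rV[R[i]]_n]; [R[i]] carries the topology given by its modulus, and
   [derivable f z 1] for [f : R[i] -> V] is differentiability in the complex
   variable.  Vectors are normed by the maximum of the moduli of their
   entries. *)
HB.instance Definition _ (R : rcfType) := Vector.copy R[i] R[i]^o.
HB.instance Definition _ (R : rcfType) := NormedModule.copy R[i] R[i]^o.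

Section Realification.
Variable R : realType.

(* x + iy |-> (x, y), and its inverse *)
Definition realify n (u : 'rV[R[i]]_n) : 'rV[R]_(n + n) :=
  row_mx (map_mx (@complex.Re R) u) (map_mx (@complex.Im R) u).

Definition complexify n (v : 'rV[R]_(n + n)) : 'rV[R[i]]_n :=
  map_mx (real_complex R) (lsubmx v)
  + 'i *: map_mx (real_complex R) (rsubmx v).

Definition plane_to_C (v : 'rV[R]_2) : R[i] := v 0 0 +i* v 0 1.

(* A map between complex spaces, seen as a map between real spaces. *)
Definition real_form n (f : R[i] -> 'rV[R[i]]_n) : 'rV[R]_2 -> 'rV[R]_(n + n) :=
  fun v => realify (f (plane_to_C v)).

Lemma realifyK n : cancel (@realify n) (@complexify n).
Proof.
move=> u; apply/rowP => j; rewrite /realify /complexify row_mxKl row_mxKr !mxE.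
by rewrite [RHS]complexE.
Qed.

End Realification.

Section HolderClasses.
Variable R : realType.
Implicit Types (a : R) (N k : nat).

Definition locally_holder (V W : normedModType R) a (U : set V) (f : V -> W) :=
  forall p, U p -> exists e K : R, 0 < e /\
    forall x y, U x -> U y -> ball p e x -> ball p e y ->
      `|f x - f y| <= K * `|x - y| `^ a.

(* f is of class C^{k,a} on the open set U: its partial derivatives of order
   less than k are differentiable, those of order k are locally a-Hoelder. *)
Fixpoint class_Ck N N' k a (U : set 'rV[R]_N) (f : 'rV[R]_N -> 'rV[R]_N') :=
  match k with
  | 0 => locally_holder a U f
  | k'.+1 => (forall x, U x -> differentiable f x) /\
      forall i : 'I_N, class_Ck k' a U (fun x => 'D_(delta_mx 0 i) f x)
  end.

End HolderClasses.

Section Submanifolds.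
Variable R : realType.

(* An embedded submanifold of R^N of class C^{2,a} and codimension m: locally
   the zero set of a submersion to R^m. *)
Definition submanifold N (a : R) (m : nat) (S : set 'rV[R]_N) :=
  forall p, S p -> exists (U : set 'rV[R]_N) (rho : 'rV[R]_N -> 'rV[R]_m),
    [/\ open U, U p, class_Ck 2 a U rho,
        forall q, U q -> (S q <-> rho q = 0) &
        forall q, U q -> \rank ('J rho q) = m].

(* v is the velocity at p of a curve contained in S *)
Definition tangent N (S : set 'rV[R]_N) (p v : 'rV[R]_N) :=
  exists g : R -> 'rV[R]_N,
    [/\ g 0 = p, \forall t \near (0 : R), S (g t) & is_derive (0 : R) 1 g v].

Variable n : nat.
Implicit Types (M : set 'rV[R[i]]_n) (p v : 'rV[R[i]]_n).

(* T_pM, as a set of vectors of C^n *)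
Definition tangentC M p v := tangent (@realify R n @` M) (realify p) (realify v).

Definition generic M := forall p, M p -> forall u : 'rV[R[i]]_n,
  exists (k : nat) (c : 'I_k -> R[i]) (v : 'I_k -> 'rV[R[i]]_n),
    (forall i, tangentC M p (v i)) /\ u = \sum_(i < k) c i *: v i.

Definition generic_submanifold (a : R) (m : nat) M :=
  submanifold a m (@realify R n @` M) /\ generic M.

Definition relatively_compact_open_in M M' :=
  [/\ M `<=` M', exists2 O, open O & M = M' `&` O
    & compact (closure M `&` M')].

End Submanifolds.

Section DiscAndCircle.
Variable R : realType.

Definition disc : set R[i] := [set z | `|z| < 1].
Definition closed_disc : set R[i] := [set z | `|z| <= 1].

Definition circle := {z : R[i] | `|z| == 1}.

Fact circle_one_subproof : `|1 : R[i]| == 1. Proof. by rewrite normr1. Qed.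
Definition circle_one : circle := exist _ 1 circle_one_subproof.

Fact expi_subproof (t : R) : `|cos t +i* sin t| == 1 :> R[i].
Proof. by rewrite normc_def /= cos2Dsin2 sqrtr1. Qed.
Definition expi (t : R) : circle := exist _ (cos t +i* sin t) (expi_subproof t).

(* f is of class C^{1,d} on the unit circle *)
Definition C1_circle (V : normedModType R) (d : R) (f : circle -> V) :=
  let g t := f (expi t) in
  (forall t : R, derivable g t 1) /\
  exists K : R, forall s t : R,
    `|derive1 g s - derive1 g t| <= K * `|s - t| `^ d.

(* a is the boundary value of a function continuous on the closed disc and
   holomorphic in the open disc; [extension a F] says that F is one *)
Definition extension (a : circle -> R[i]) (F : R[i] -> R[i]) :=
  [/\ {within closed_disc, continuous F}, forall z, disc z -> derivable F z 1
    & forall s : circle, F (val s) = a s].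

Definition extends_holomorphically (a : circle -> R[i]) :=
  exists F, extension a F.

(* [is_T1 f g] : g is the Hilbert transform T_1 f *)
Definition is_T1 (f g : circle -> R) :=
  g circle_one = 0 /\ extends_holomorphically (fun s => f s +i* g s).

(* Same as disc and closed_disc, in the real coordinates. *)
Definition disc2 : set 'rV[R]_2 := @plane_to_C R @^-1` disc.
Definition closed_disc2 : set 'rV[R]_2 := @plane_to_C R @^-1` closed_disc.

(* A map of class C^{1,d} on the closed disc: the first order derivatives, being
   uniformly Hoelder on the open disc, extend to its closure, and the suprema
   below are the same over the open and over the closed disc. *)
Definition C1_disc n (d : R) (f : R[i] -> 'rV[R[i]]_n) :=
  let F := real_form f in
  [/\ {within closed_disc, continuous f},
      forall x, disc2 x -> differentiable F x &
      exists K : R, forall (i : 'I_2) x y, disc2 x -> disc2 y ->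
        `|'D_(delta_mx 0 i) F x - 'D_(delta_mx 0 i) F y| <= K * `|x - y| `^ d].

Definition C1_norm n (d : R) (f : R[i] -> 'rV[R[i]]_n) : R :=
  let F := real_form f in
  sup [set `|F x| | x in closed_disc2]
  + \sum_(i < 2) sup [set `|'D_(delta_mx 0 i) F x| | x in disc2]
  + \sum_(i < 2) sup [set q | exists x y, [/\ disc2 x, disc2 y, x <> y &
      q = `|'D_(delta_mx 0 i) F x - 'D_(delta_mx 0 i) F y| / `|x - y| `^ d]].

Definition analytic_disc n (d : R) (phi : R[i] -> 'rV[R[i]]_n) :=
  C1_disc d phi /\ forall z, disc z -> derivable phi z 1.

Definition disc_size n (d : R) (phi : R[i] -> 'rV[R[i]]_n) : R :=
  inf [set C1_norm d (fun z => phi z + z0) | z0 in [set: 'rV[R[i]]_n]].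

End DiscAndCircle.

(* S is a real vector space of dimension k, i.e. has a basis of k elements; S
   is contained in a module over K, whose scalars are restricted to R by iota. *)
Definition has_real_dim (R : realType) (K : nzRingType) (iota : R -> K)
    (V : lmodType K) (S : set V) (k : nat) :=
  exists b : 'I_k -> V,
    (forall c : 'I_k -> R,
       \sum_(i < k) iota (c i) *: b i = 0 -> forall i, c i = 0) /\
    (forall v, S v <-> exists c : 'I_k -> R, v = \sum_(i < k) iota (c i) *: b i).

Section Defect.
Variables (R : realType) (n : nat).
Implicit Types (M : set 'rV[R[i]]_n) (phi : R[i] -> 'rV[R[i]]_n).

(* the fibre at p of the holomorphic conormal bundle; the form
   sum_j a_j dz_j is represented by the vector a *)
Definition conormal M (p a : 'rV[R[i]]_n) :=
  forall v, tangentC M p v -> complex.Im (\sum_(j < n) a 0 j * v 0 j) = 0.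

Definition holomorphic_sections M (d : R) phi : set (circle R -> 'rV[R[i]]_n) :=
  [set a | [/\ forall s, conormal M (phi (val s)) (a s),
               C1_circle d (fun s => realify (a s)) &
               forall j, extends_holomorphically (fun s => a s 0 j)]].

(* d(phi) = k *)
Definition defect_is M (d : R) phi (k : nat) :=
  has_real_dim (real_complex R) (holomorphic_sections M d phi) k.

End Defect.

Section Tumanov.
Variables (R : realType) (n m : nat).

(* z = (u - u0) * chP and w = (u - u0) * chQ are the affine coordinates with
   origin u0, and x = chh w y is the graph over |w| < chr, |y| < chr *)
Record chart := Chart {
  chP : 'M[R[i]]_(n, m);
  chQ : 'M[R[i]]_(n, n - m);
  chr : R;
  chh : 'rV[R[i]]_(n - m) -> 'rV[R]_m -> 'rV[R]_m }.

Implicit Types (M : set 'rV[R[i]]_n) (phi : R[i] -> 'rV[R[i]]_n) (ch : chart).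
Implicit Types (G : circle R -> 'M[R]_m).

Definition coord_x ch (u0 u : 'rV[R[i]]_n) : 'rV[R]_m :=
  map_mx (@complex.Re R) ((u - u0) *m chP ch).
Definition coord_y ch (u0 u : 'rV[R[i]]_n) : 'rV[R]_m :=
  map_mx (@complex.Im R) ((u - u0) *m chP ch).
Definition coord_w ch (u0 u : 'rV[R[i]]_n) : 'rV[R[i]]_(n - m) :=
  (u - u0) *m chQ ch.

Definition in_polydisc ch (w : 'rV[R[i]]_(n - m)) (y : 'rV[R]_m) :=
  `|w| < (chr ch)%:C /\ `|y| < chr ch.

(* the domain of h, and h, in the real coordinates (Re w, Im w, y) *)
Definition h_domain ch : set 'rV[R]_((n - m) + (n - m) + m) :=
  [set v | in_polydisc ch (complexify (lsubmx v)) (rsubmx v)].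
Definition h_real ch : 'rV[R]_((n - m) + (n - m) + m) -> 'rV[R]_m :=
  fun v => chh ch (complexify (lsubmx v)) (rsubmx v).

Definition h_y ch (w : 'rV[R[i]]_(n - m)) (y : 'rV[R]_m) : 'M[R]_m :=
  \matrix_(i, j) derive1 (fun t : R => chh ch w (y + t *: delta_mx 0 j) 0 i) 0.

(* complex derivatives d/dw_j = (d/d(Re w_j) - i d/d(Im w_j)) / 2 *)
Definition h_w ch (w : 'rV[R[i]]_(n - m)) (y : 'rV[R]_m) : 'M[R[i]]_(m, n - m) :=
  \matrix_(i, j)
    (((derive1 (fun t : R => chh ch (w + t%:C *: delta_mx 0 j) y 0 i) 0)%:C
     - 'i * (derive1 (fun t : R =>
               chh ch (w + ('i * t%:C) *: delta_mx 0 j) y 0 i) 0)%:C) / 2%:R).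

Definition h_y_on ch phi (s : circle R) : 'M[R]_m :=
  h_y ch (coord_w ch (phi 1) (phi (val s))) (coord_y ch (phi 1) (phi (val s))).
Definition h_w_on ch phi (s : circle R) : 'M[R[i]]_(m, n - m) :=
  h_w ch (coord_w ch (phi 1) (phi (val s))) (coord_y ch (phi 1) (phi (val s))).

Definition adapted_chart (eps : R) M phi ch :=
  [/\ row_free (row_mx (chP ch) (chQ ch)) && row_full (row_mx (chP ch) (chQ ch)),
      0 < chr ch,
      class_Ck 2 eps (h_domain ch) (h_real ch),
      chh ch 0 0 = 0 /\ (forall v, 'd (h_real ch) 0 v = 0) &
      exists O : set 'rV[R[i]]_n, [/\ open O,
        forall s : circle R, O (phi (val s)) &
        forall u, M u -> O u ->
          in_polydisc ch (coord_w ch (phi 1) u) (coord_y ch (phi 1) u) /\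
          coord_x ch (phi 1) u
          = chh ch (coord_w ch (phi 1) u) (coord_y ch (phi 1) u)]].

(* G : circle -> GL(m,R) is a C^{1,d} solution of G = 1 - T_1[G (h_y o phi)] *)
Definition solves_G (d : R) phi ch G :=
  [/\ forall s, G s \in unitmx,
      C1_circle d G &
      exists T : circle R -> 'M[R]_m,
        (forall i j, is_T1 (fun s => (G s *m h_y_on ch phi s) i j)
                           (fun s => T s i j)) /\
        forall s, G s = 1%:M - T s].

(* G (1 + i h_y o phi) *)
Definition G_twisted phi ch G (s : circle R) : 'M[R[i]]_m :=
  map_mx (real_complex R) (G s)
  *m (1%:M + 'i *: map_mx (real_complex R) (h_y_on ch phi s)).

(* the choices of coordinates, h and G entering the definition of V_phi *)
Definition tumanov_choice (eps d : R) M phi ch G :=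
  [/\ adapted_chart eps M phi ch,
      solves_G d phi ch G,
      forall G', solves_G d phi ch G' -> G' = G &
      exists E : R[i] -> 'M[R[i]]_m,
        (forall i j, extension (fun s => G_twisted phi ch G s i j)
                               (fun z => E z i j)) /\
        forall z, closed_disc z -> E z \in unitmx].

Definition V_phi phi ch G : set 'rV[R]_m :=
  [set c | forall j, extends_holomorphically (fun s =>
     (map_mx (real_complex R) (c *m G s) *m h_w_on ch phi s) 0 j)].

End Tumanov.

(* Main.v *)
From HB Require Import structures.
Require Import Defs.
From mathcomp Require Import all_boot all_order all_algebra.
From mathcomp Require Import all_classical all_reals.
From mathcomp Require Import topology normedtype derive exp trigo.
From mathcomp Require Import complex.
From mathcomp Require Import realfun sequences landau measure lebesgue_measure lebesgue_integral ftc.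
From mathcomp Require Import ring lra.

Set Implicit Arguments.
Unset Strict Implicit.
Unset Printing Implicit Defensive.

Import Order.TTheory GRing.Theory Num.Theory.
Import numFieldNormedType.Exports.

Local Open Scope classical_set_scope.
Local Open Scope ring_scope.
Local Open Scope complex_scope.



Section DerivationRules.
Variable R : realType.
Section Scalar.
Variables (V : normedModType R) (f g : V -> R) (x v : V) (a b : R).

Lemma is_derive_add : is_derive x v f a -> is_derive x v g b ->
  is_derive x v (fun t => f t + g t) (a + b).
Proof. by move=> df dg; have := @is_deriveD _ _ _ f g x v a b df dg. Qed.

Lemma dB : is_derive x v f a -> is_derive x v g b ->
  is_derive x v (fun t => f t - g t) (a - b).
Proof. by move=> df dg; have := @is_deriveB _ _ _ f g x v a b df dg. Qed.

Lemma dZ k : is_derive x v f a -> is_derive x v (fun t => k * f t) (k * a).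
Proof. by move=> df; have := @is_deriveZ _ _ _ f k x v a df. Qed.

Lemma dM : is_derive x v f a -> is_derive x v g b ->
  is_derive x v (fun t => f t * g t) (a * g x + f x * b).
Proof.
move=> df dg; have := @is_deriveM _ _ f g x v a b df dg.
by rewrite addrC [g x *: a]mulrC.
Qed.

Lemma dE : is_derive x v f a -> a = b -> is_derive x v f b.
Proof. by move=> + <-. Qed.

End Scalar.

Lemma dcomp (f h : R -> R) (x a c : R) :
  is_derive (h x) 1 f a -> is_derive x 1 h c ->
  is_derive x 1 (fun t => f (h t)) (a * c).
Proof. by move=> df dh; have := @is_derive1_comp _ f h x a c df dh. Qed.

Lemma daffine (k l x : R) : is_derive x 1 (fun t => k * t + l) k.
Proof.
apply: dE (is_derive_add (dZ k (is_derive_id x 1)) (is_derive_cst l x 1)) _.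
by rewrite mulr1 addr0.
Qed.

Section Continuity.
Variable T : topologicalType.
Implicit Types f g : T -> R.

Lemma cont_cst (k : R) : continuous (fun _ : T => k).
Proof. by move=> x; exact: cvg_cst. Qed.

Lemma contD f g : continuous f -> continuous g -> continuous (fun t => f t + g t).
Proof. by move=> cf cg x; apply: cvgD; [exact: cf|exact: cg]. Qed.

Lemma contN f : continuous f -> continuous (fun t => - f t).
Proof. by move=> cf x; apply: cvgN; exact: cf. Qed.

Lemma contB f g : continuous f -> continuous g -> continuous (fun t => f t - g t).
Proof. by move=> cf cg; apply: contD => //; exact: contN. Qed.

Lemma contM f g : continuous f -> continuous g -> continuous (fun t => f t * g t).
Proof. by move=> cf cg x; apply: cvgM; [exact: cf|exact: cg]. Qed.

Lemma cont_comp (f : R -> R) g : continuous f -> continuous g ->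
  continuous (fun t => f (g t)).
Proof. by move=> cf cg x; apply: (continuous_comp (cg x)); exact: cf. Qed.

End Continuity.

End DerivationRules.

Section Newton.
Variable R : realType.
Implicit Types (f g : R -> R) (a b c x : R).

Definition primitive_on f P a b :=
  forall x, a <= x <= b -> is_derive x 1 P (f x).

Lemma mean_value_le f f' g g' a b : a <= b ->
  primitive_on f' f a b -> primitive_on g' g a b ->
  (forall x, a <= x <= b -> f' x <= g' x) ->
  f b - f a <= g b - g a.
Proof.
move=> ab df dg le_fg.
have dh x : x \in `[a, b] -> is_derive x 1 (fun t => g t - f t) (g' x - f' x).
  by rewrite in_itv /= => xab; exact: dB (dg x xab) (df x xab).
have dh' x : x \in `]a, b[ -> is_derive x 1 (fun t => g t - f t) (g' x - f' x).
  by move=> xab; apply: dh; exact: subset_itv_oo_cc.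
have ch : {within `[a, b], continuous (fun t => g t - f t)}.
  by apply: derivable_within_continuous => x /dh [].
have [c cab e] := MVT_segment ab dh' ch.
have : 0 <= (g' c - f' c) * (b - a) by rewrite mulr_ge0 ?subr_ge0// le_fg.
by rewrite -e; lra.
Qed.

Lemma primitive_ex f a : continuous f ->
  exists P : R -> R, forall x, a < x -> is_derive x 1 P (f x).
Proof.
move=> cf.
exists (fun x => (\int[lebesgue_measure]_(t in `[a, x]) f t)%R) => x ax.
have [] := @continuous_FTC1_closed R f a x (x + 1) _ _ ax (cf x).
- by rewrite ltrDl.
- apply: continuous_compact_integrable; first exact: segment_compact.
  by apply: continuous_subspaceT.
by move=> d <-; rewrite derive1E; apply: derivableP.
Qed.

Definition nint f a b : R :=
  let P := xget 0 [set P | forall x, a <= x <= b -> is_derive x 1 P (f x)] in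
  P b - P a.

Lemma nintE f P a b : a <= b -> primitive_on f P a b -> nint f a b = P b - P a.
Proof.
move=> ab dP; rewrite /nint; case: xgetP => [Q _ /= dQ|/(_ P)//].
by apply/eqP; rewrite eq_le !(@mean_value_le _ _ _ _ _ _ ab dQ dP, @mean_value_le _ _ _ _ _ _ ab dP dQ).
Qed.

Lemma nint_ex f a b : continuous f ->
  exists P, forall c d, a <= c -> c <= d -> d <= b ->
    primitive_on f P c d /\ nint f c d = P d - P c.
Proof.
move=> cf; have [P dP] := primitive_ex (a - 1) cf; exists P => c d ac cd db.
have h x : c <= x <= d -> is_derive x 1 P (f x).
  by move=> xx; apply: dP; lra.
by split => //; exact: nintE.
Qed.

Lemma nint_le f g a b : a <= b -> continuous f -> continuous g ->
  (forall x, a <= x <= b -> f x <= g x) -> nint f a b <= nint g a b.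
Proof.
move=> ab cf cg le_fg.
have [P /(_ a b)[]// dP ->] := nint_ex a b cf.
have [Q /(_ a b)[]// dQ ->] := nint_ex a b cg.
exact: (mean_value_le ab dP dQ).
Qed.

Lemma nintD f g a b : a <= b -> continuous f -> continuous g ->
  nint (fun x => f x + g x) a b = nint f a b + nint g a b.
Proof.
move=> ab cf cg.
have [P /(_ a b)[]// dP ->] := nint_ex a b cf.
have [Q /(_ a b)[]// dQ ->] := nint_ex a b cg.
rewrite (@nintE _ (fun x => P x + Q x)) //; first by ring.
by move=> x xab; exact: is_derive_add (dP x xab) (dQ x xab).
Qed.

Lemma nintZ f k a b : a <= b -> continuous f ->
  nint (fun x => k * f x) a b = k * nint f a b.
Proof.
move=> ab cf; have [P /(_ a b)[]// dP ->] := nint_ex a b cf.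
rewrite (@nintE _ (fun x => k * P x)) //; first by ring.
by move=> x xab; exact: dZ (dP x xab).
Qed.

Lemma nintB f g a b : a <= b -> continuous f -> continuous g ->
  nint (fun x => f x - g x) a b = nint f a b - nint g a b.
Proof.
move=> ab cf cg.
have [P /(_ a b)[]// dP ->] := nint_ex a b cf.
have [Q /(_ a b)[]// dQ ->] := nint_ex a b cg.
rewrite (@nintE _ (fun x => P x - Q x)) //; first by ring.
by move=> x xab; exact: dB (dP x xab) (dQ x xab).
Qed.

Lemma nint_cat f a b c : a <= b -> b <= c -> continuous f ->
  nint f a c = nint f a b + nint f b c.
Proof.
move=> ab bc cf; have ac := le_trans ab bc; have [P h] := nint_ex a c cf.
by rewrite (h a c _ _ _).2 // (h a b _ _ _).2 // (h b c _ _ _).2 //; ring.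
Qed.

Lemma nint_cst k a b : a <= b -> nint (fun=> k) a b = k * (b - a).
Proof.
move=> ab; rewrite (@nintE _ (fun x => k * x + 0)) //; first by ring.
by move=> x _; exact: daffine.
Qed.

Lemma nint_norm f g a b : a <= b -> continuous f -> continuous g ->
  (forall x, a <= x <= b -> `|f x| <= g x) -> `|nint f a b| <= nint g a b.
Proof.
move=> ab cf cg le_fg; rewrite ler_norml; apply/andP; split; last first.
  by apply: nint_le => // x /le_fg; rewrite ler_norml => /andP[].
rewrite -mulN1r -nintZ//; apply: nint_le => //.
  by apply: contM => //; exact: cont_cst.
by move=> x /le_fg; rewrite ler_norml => /andP[+ _]; rewrite mulN1r.
Qed.

Lemma nint_period f p a b : 0 <= p -> continuous f ->
  (forall x, f (x + p) = f x) -> nint f a (a + p) = nint f b (b + p).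
Proof.
move=> p0 cf fp; wlog ab : a b / a <= b.
  by move=> h; have [/h//|/ltW /h //] := leP a b.
have e : nint f a b = nint f (a + p) (b + p).
  have [P h] := nint_ex a (b + p) cf.
  rewrite (@nintE _ (fun x => P (1 * x + p))) //; last first.
    move=> x xab; rewrite -fp.
    have [|||dP _] := h (x + p) (x + p); [lra|lra|lra|].
    have := dP (x + p); rewrite lexx => /(_ isT) d.
    apply: dE (dcomp _ (daffine _ _ _)) _; last exact: mulr1.
    by rewrite mul1r.
  by rewrite !mul1r (h (a + p) (b + p) _ _ _).2 //; lra.
rewrite -[RHS](addKr (nint f a b)) -(@nint_cat _ a b (b+p)) //; last lra.
by rewrite (@nint_cat _ a (a + p) (b + p)) // -?e; [ring|lra|lra].
Qed.

End Newton.


Section Modulus.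
Variable R : realType.
Implicit Types (z w : R[i]) (x : R).

Definition cabs z : R := complex.Re `|z|.

Lemma cabsE z : `|z| = (cabs z)%:C.
Proof. by rewrite /cabs normc_def. Qed.

Lemma cabs_ge0 z : 0 <= cabs z.
Proof. by rewrite -lecR -cabsE normr_ge0. Qed.

Lemma cabsD z w : cabs (z + w) <= cabs z + cabs w.
Proof. by rewrite -lecR rmorphD /= -!cabsE ler_normD. Qed.

Lemma cabsM z w : cabs (z * w) = cabs z * cabs w.
Proof. by apply: (@complexI R); rewrite rmorphM /= -!cabsE normrM. Qed.

Lemma cabsN z : cabs (- z) = cabs z.
Proof. by rewrite /cabs normrN. Qed.

Lemma cabsC z w : cabs (z - w) = cabs (w - z).
Proof. by rewrite -cabsN opprB. Qed.

Lemma cabs0 : cabs 0 = 0 :> R.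
Proof. by rewrite /cabs normr0. Qed.

Lemma cabs1 : cabs 1 = 1 :> R.
Proof. by rewrite /cabs normr1. Qed.

Lemma cabs_eq0 z : (cabs z == 0) = (z == 0).
Proof. by rewrite -(inj_eq (@complexI R)) -cabsE normr_eq0. Qed.

Lemma cabs_gt0 z : (0 < cabs z) = (z != 0).
Proof. by rewrite lt_neqAle cabs_ge0 andbT eq_sym cabs_eq0. Qed.

Lemma cabsV z : cabs z^-1 = (cabs z)^-1.
Proof. by apply: (@complexI R); rewrite fmorphV /= -!cabsE normfV. Qed.

Lemma cabsX z n : cabs (z ^+ n) = cabs z ^+ n.
Proof. by elim: n => [|n ih]; rewrite ?cabs1 // !exprS cabsM ih. Qed.

Lemma cabs_sqr z : cabs z ^+ 2 = complex.Re z ^+ 2 + complex.Im z ^+ 2.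
Proof. by rewrite /cabs normc_def /= sqr_sqrtr // addr_ge0 ?sqr_ge0. Qed.

Lemma cabs_real x : cabs x%:C = `|x|.
Proof. by rewrite /cabs normc_def /= expr0n addr0 sqrtr_sqr. Qed.

Lemma Re_le_cabs z : `|complex.Re z| <= cabs z.
Proof.
rewrite -ler_sqr ?nnegrE ?cabs_ge0 // cabs_sqr real_normK ?num_real //.
by rewrite lerDl sqr_ge0.
Qed.

Lemma Im_le_cabs z : `|complex.Im z| <= cabs z.
Proof.
rewrite -ler_sqr ?nnegrE ?cabs_ge0 // cabs_sqr real_normK ?num_real //.
by rewrite lerDr sqr_ge0.
Qed.

Lemma cabs_le z : cabs z <= `|complex.Re z| + `|complex.Im z|.
Proof.
rewrite -ler_sqr ?nnegrE ?cabs_ge0 ?addr_ge0 // cabs_sqr sqrrD.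
rewrite !real_normK ?num_real //.
have := mulr_ge0 (normr_ge0 (complex.Re z)) (normr_ge0 (complex.Im z)); lra.
Qed.

Lemma cabsB_ge z w : cabs z - cabs w <= cabs (z - w).
Proof. by rewrite lerBlDr -{1}(subrK w z) cabsD. Qed.

Lemma cabs_dist z w y : cabs (z - w) <= cabs (z - y) + cabs (y - w).
Proof. by rewrite -{1}(subrK y z) -addrA cabsD. Qed.

Lemma discE z : disc z = (cabs z < 1) :> Prop.
Proof. by rewrite /disc /= cabsE -ltcR. Qed.

Lemma closed_discE z : closed_disc z = (cabs z <= 1) :> Prop.
Proof. by rewrite /closed_disc /= cabsE -lecR. Qed.

Lemma cabs_circle (s : circle R) : cabs (val s) = 1.
Proof. by case: s => z /= /eqP; rewrite /cabs => ->. Qed.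

Lemma expi_surj (s : circle R) : exists t, s = expi t.
Proof.
case: s => [[x y] hs].
have /= e := cabs_sqr (x +i* y).
move: e; rewrite /cabs (eqP hs) expr1n => e.
have hx : -1 <= x <= 1 by nra.
have hxi : x \in `[(-1), 1] by rewrite in_itv.
have sa := sin_acos hx.
have ey : Num.sqrt (1 - x ^+ 2) = `|y|.
  by rewrite e [X in X - _]addrC addrK sqrtr_sqr.
case: (lerP 0 y) => y0.
  exists (acos x); apply: val_inj => /=.
  by rewrite acosK // sa ey ger0_norm.
exists (- acos x); apply: val_inj => /=.
by rewrite cosN sinN acosK // sa ey ltr0_norm // opprK.
Qed.

Lemma expiD2pi t : expi (t + pi *+ 2) = expi t :> circle R.
Proof. by apply: val_inj; rewrite /= cosD2pi sinD2pi. Qed.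

Lemma near_cabs (P : R[i] -> Prop) z :
  (\forall w \near z, P w) <-> exists2 d : R, 0 < d & forall w, cabs (w - z) < d -> P w.
Proof.
split.
  move=> /nbhs_ballP[d /= d0 h].
  have de : d = (complex.Re d)%:C.
    by case: d d0 {h} => a b; rewrite ltcE /= => /andP[/eqP -> _].
  exists (complex.Re d); first by rewrite -ltcR -de.
  move=> w; rewrite cabsC -ltcR -cabsE -de => hw; apply: h.
  by rewrite -ball_normE.
move=> [d d0 h]; apply/nbhs_ballP; exists d%:C => /=; first by rewrite ltcR.
by move=> w; rewrite -ball_normE /= cabsE ltcR cabsC; exact: h.
Qed.

Definition cdiff (F : R[i] -> R[i]) z l := forall e : R, 0 < e ->
  exists2 d, 0 < d & forall w, cabs (w - z) < d ->
    cabs (F w - F z - l * (w - z)) <= e * cabs (w - z).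

Lemma derivable_cdiff F z : derivable F z 1 <-> exists l, cdiff F z l.
Proof.
split.
  move=> /cvg_ex[l /= /cvgrPdist_lt cl]; exists l => e e0.
  have := cl e%:C; rewrite ltcR => /(_ e0).
  rewrite near_withinE /= => /near_cabs[d d0 h]; exists d => // w wz.
  have [->|nwz] := eqVneq w z; first by rewrite !subrr mulr0 subrr cabs0 mulr0.
  have wz0 : w - z != 0 by rewrite subr_eq0.
  have := h (w - z); rewrite subr0 => /(_ wz wz0).
  rewrite cabsE ltcR /= [_ *: 1]mulr1 subrK => /ltW hw.
  have -> : F w - F z - l * (w - z) = - ((l - (w - z)^-1 * (F w - F z)) * (w - z)).
    by field.
  by rewrite cabsN cabsM ler_wpM2r ?cabs_ge0.
move=> [l hl]; apply/cvg_ex; exists l => /=; apply/cvgrPdist_le => e e0.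
have ee : e = (complex.Re e)%:C.
  by case: e e0 => a b; rewrite ltcE /= => /andP[/eqP -> _].
have [|d d0 h] := hl (complex.Re e); first by rewrite -ltcR -ee.
rewrite near_withinE /=; apply/near_cabs; exists d => // w.
rewrite subr0 => wd w0; have := h (w + z).
rewrite addrK => /(_ wd) hw; rewrite cabsE ee lecR [_ *: 1]mulr1.
have c0 : 0 < cabs w by rewrite cabs_gt0.
rewrite -(ler_pM2r c0) -cabsM -cabsN.
by have -> : - ((l - w^-1 * (F (w + z) - F z)) * w) = F (w + z) - F z - l * w by field.
Qed.

Lemma continuous_discP (F : R[i] -> R[i]) :
  {within @closed_disc R, continuous F} <->
  forall z, cabs z <= 1 -> forall e, 0 < e -> exists2 d, 0 < d &
    forall w, cabs w <= 1 -> cabs (w - z) < d -> cabs (F w - F z) <= e.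
Proof.
split=> [/subspace_continuousP cF z z1 e e0|cF].
  have := cF z; rewrite closed_discE => /(_ z1) /cvgrPdist_le /(_ e%:C).
  rewrite ltcR => /(_ e0); rewrite near_withinE => /near_cabs[d d0 h].
  exists d => // w w1 wz; have := h w wz; rewrite closed_discE => /(_ w1).
  by rewrite cabsE lecR cabsC.
apply/subspace_continuousP => z; rewrite closed_discE => z1.
apply/cvgrPdist_le => e e0.
have ee : e = (complex.Re e)%:C.
  by case: e e0 => a b; rewrite ltcE /= => /andP[/eqP -> _].
have [|d d0 h] := cF z z1 (complex.Re e); first by rewrite -ltcR -ee.
rewrite near_withinE; apply/near_cabs; exists d => // w wz.
by rewrite closed_discE => w1; rewrite cabsE ee lecR cabsC h.
Qed.

End Modulus.


Section Goursat.
Variable R : realType.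

Lemma nested_sup (x : nat -> R) (l : nat -> R) :
  (forall n, x n <= x n.+1) -> (forall n, x n.+1 + l n.+1 <= x n + l n) ->
  (forall n, 0 <= l n) -> exists X, forall n, x n <= X <= x n + l n.
Proof.
move=> up dn l0.
have up' n k : x n <= x (n + k)%N.
  by elim: k => [|k ih]; rewrite ?addn0 // addnS (le_trans ih).
have dn' n k : x (n + k)%N + l (n + k)%N <= x n + l n.
  by elim: k => [|k ih]; rewrite ?addn0 // addnS (le_trans _ ih).
have cross n k : x n <= x k + l k.
  case: (leqP n k) => [/subnKC <-|/ltnW/subnKC e].
    by apply: (le_trans (up' n (k - n)%N)); rewrite lerDl.
  by apply: le_trans (dn' k (n - k)%N); rewrite e lerDl.
have hs : has_sup (range x).
  by split; [exists (x 0%N), 0%N|exists (x 0%N + l 0%N) => _ [n _ <-]].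
exists (sup (range x)) => n; apply/andP; split.
  by apply: (ub_le_sup hs.2); exists n.
by apply: ge_sup => [|_ [k _ <-]]; [exact: hs.1|exact: cross].
Qed.

Variables P Q : R -> R -> R.

Definition circulation a b c d : R :=
  (nint (P^~ c) a b - nint (P^~ d) a b) + (nint (Q b) c d - nint (Q a) c d).

Variables (a b c d : R).
Hypotheses (ab : a <= b) (cd : c <= d).
Hypothesis (cP : forall y, continuous (P^~ y)) (cQ : forall x, continuous (Q x)).

Definition in_rect x y := (a <= x <= b) && (c <= y <= d).

(** P and Q are differentiable with the same mixed derivative k: the form
    P dx + Q dy is closed at the point (x, y). *)
Definition closed_at x y := exists p q k, forall e, 0 < e ->
  exists2 dl, 0 < dl & forall x' y', in_rect x' y' ->
    `|x' - x| < dl -> `|y' - y| < dl ->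
    `|P x' y' - P x y - (p * (x' - x) + k * (y' - y))|
      <= e * (`|x' - x| + `|y' - y|) /\
    `|Q x' y' - Q x y - (k * (x' - x) + q * (y' - y))|
      <= e * (`|x' - x| + `|y' - y|).

Lemma nint_diff_le (f g : R -> R) (k e u v : R) : u <= v -> continuous f -> continuous g ->
  (forall t, u <= t <= v -> `|f t - g t - k| <= e) ->
  `|nint f u v - nint g u v - k * (v - u)| <= e * (v - u).
Proof.
move=> uv cf cg h.
have cfg := contB cf cg.
rewrite -(nint_cst e uv).
have -> : nint f u v - nint g u v - k * (v - u) = nint (fun t => f t - g t - k) u v.
  by rewrite !nintB ?nint_cst //; exact: cont_cst.
by apply: nint_norm => //; [apply: contB => //; exact: cont_cst|exact: cont_cst].
Qed.

Lemma circulation_local x y : in_rect x y -> closed_at x y ->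
  forall e, 0 < e -> exists2 dl, 0 < dl & forall x0 y0 w h,
    0 <= w -> 0 <= h -> w < dl -> h < dl -> a <= x0 -> x0 + w <= b -> c <= y0 ->
    y0 + h <= d -> x0 <= x <= x0 + w -> y0 <= y <= y0 + h ->
    `|circulation x0 (x0 + w) y0 (y0 + h)| <= e * (w + h) ^+ 2.
Proof.
move=> xy [p [q [k hk]]] e e0; have [|dl dl0 hd] := hk (e / 2); first lra.
exists dl => // x0 y0 w h w0 h0 wd hd' ax xb cy yd hx hy.
have est x' y' : x0 <= x' <= x0 + w -> y0 <= y' <= y0 + h ->
    `|P x' y' - P x y - (p * (x' - x) + k * (y' - y))| <= e / 2 * (w + h) /\
    `|Q x' y' - Q x y - (k * (x' - x) + q * (y' - y))| <= e / 2 * (w + h).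
  move=> hx' hy'.
  have ex : `|x' - x| <= w by rewrite ler_norml; lra.
  have ey : `|y' - y| <= h by rewrite ler_norml; lra.
  have [|||E1 E2] := hd x' y'; [|lra|lra|].
    by rewrite /in_rect; lra.
  have le : e / 2 * (`|x' - x| + `|y' - y|) <= e / 2 * (w + h).
    by rewrite ler_wpM2l //; lra.
  by split; [exact: le_trans le|exact: le_trans le].
have xw : x0 <= x0 + w by lra.
have yh : y0 <= y0 + h by lra.
have A : `|nint (P^~ y0) x0 (x0 + w) - nint (P^~ (y0 + h)) x0 (x0 + w)
           - - (k * h) * (x0 + w - x0)| <= e * (w + h) * (x0 + w - x0).
  apply: nint_diff_le => // t ht.
  have [|E1 _] := est t y0 ht; first lra.
  have [|E2 _] := est t (y0 + h) ht; first lra.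
  move: E1 E2; rewrite !ler_norml; lra.
have B : `|nint (Q (x0 + w)) y0 (y0 + h) - nint (Q x0) y0 (y0 + h)
           - k * w * (y0 + h - y0)| <= e * (w + h) * (y0 + h - y0).
  apply: nint_diff_le => // t ht.
  have [|_ E1] := est x0 t _ ht; first lra.
  have [|_ E2] := est (x0 + w) t _ ht; first lra.
  move: E1 E2; rewrite !ler_norml; lra.
move: A B; rewrite /circulation.
set A := nint _ _ _ - _; set B := nint _ _ _ - _.
rewrite (_ : x0 + w - x0 = w); last by ring.
rewrite (_ : y0 + h - y0 = h); last by ring.
rewrite !ler_norml => /andP[A1 A2] /andP[B1 B2]; nra.
Qed.

Lemma circulation_quarter x0 y0 w h : 0 <= w -> 0 <= h ->
  exists p : R * R, [/\ p.1 = x0 \/ p.1 = x0 + w / 2,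
    p.2 = y0 \/ p.2 = y0 + h / 2 &
    `|circulation x0 (x0 + w) y0 (y0 + h)| <=
    4 * `|circulation p.1 (p.1 + w / 2) p.2 (p.2 + h / 2)|].
Proof.
move=> w0 h0.
have ex : x0 + w = x0 + w / 2 + w / 2 by field.
have ey : y0 + h = y0 + h / 2 + h / 2 by field.
have add : circulation x0 (x0 + w) y0 (y0 + h) =
  circulation x0 (x0 + w / 2) y0 (y0 + h / 2)
  + circulation (x0 + w / 2) (x0 + w / 2 + w / 2) y0 (y0 + h / 2)
  + circulation x0 (x0 + w / 2) (y0 + h / 2) (y0 + h / 2 + h / 2)
  + circulation (x0 + w / 2) (x0 + w / 2 + w / 2) (y0 + h / 2) (y0 + h / 2 + h / 2).
  have sp (f : R -> R) u k : 0 <= k -> continuous f ->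
      nint f u (u + k / 2 + k / 2) = nint f u (u + k / 2)
        + nint f (u + k / 2) (u + k / 2 + k / 2).
    by move=> k0 cf; apply: nint_cat => //; lra.
  by rewrite /circulation ex ey !sp //; ring.
rewrite add.
set A := circulation _ _ _ _; set B := circulation _ _ _ _.
set C := circulation _ _ _ _; set D := circulation _ _ _ _.
have tri : `|A + B + C + D| <= `|A| + `|B| + `|C| + `|D|.
  by rewrite !(le_trans (ler_normD _ _)) // lerD // (le_trans (ler_normD _ _)) //
    lerD // ler_normD.
case: (lerP `|A + B + C + D| (4 * `|A|)) => [hA|nA].
  by exists (x0, y0); split => //; left.
case: (lerP `|A + B + C + D| (4 * `|B|)) => [hB|nB].
  by exists (x0 + w / 2, y0); split => //=; [right|left].
case: (lerP `|A + B + C + D| (4 * `|C|)) => [hC|nC].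
  by exists (x0, y0 + h / 2); split => //=; [left|right].
case: (lerP `|A + B + C + D| (4 * `|D|)) => [hD|nD].
  by exists (x0 + w / 2, y0 + h / 2); split => //=; right.
lra.
Qed.

(** Goursat's argument: repeated quartering keeps a fixed fraction of the
    circulation, while at the limit point closedness makes the circulation
    negligible with respect to the area. *)
Lemma goursat : (forall x y, in_rect x y -> closed_at x y) ->
  circulation a b c d = 0.
Proof.
move=> cl.
pose w n : R := (b - a) / 2 ^+ n; pose h n : R := (d - c) / 2 ^+ n.
have p2 n : 0 < (2 : R) ^+ n by rewrite exprn_gt0.
have w0 n : 0 <= w n by rewrite divr_ge0 ?subr_ge0 // ltW.
have h0 n : 0 <= h n by rewrite divr_ge0 ?subr_ge0 // ltW.
have wS n : w n.+1 = w n / 2 by rewrite /w exprSr invfM mulrA.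
have hS n : h n.+1 = h n / 2 by rewrite /h exprSr invfM mulrA.
have [next nextP] := choice (fun np : nat * (R * R) =>
  @circulation_quarter np.2.1 np.2.2 _ _ (w0 np.1) (h0 np.1)).
pose fix s n : R * R := if n is k.+1 then next (k, s k) else (a, c).
pose z n := circulation (s n).1 ((s n).1 + w n) (s n).2 ((s n).2 + h n).
have sS n : [/\ (s n.+1).1 = (s n).1 \/ (s n.+1).1 = (s n).1 + w n.+1,
   (s n.+1).2 = (s n).2 \/ (s n.+1).2 = (s n).2 + h n.+1 &
   `|z n| <= 4 * `|z n.+1|].
  by have := nextP (n, s n); rewrite /z /= wS hS.
have [X hX] : exists X, forall n, (s n).1 <= X <= (s n).1 + w n.
  apply: (nested_sup (x := fun n => (s n).1)) => // n.
    by have := w0 n; have [[-> _ _|-> _ _]] := sS n; rewrite ?wS; lra.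
  by have := w0 n; have [[-> _ _|-> _ _]] := sS n; rewrite ?wS; lra.
have [Y hY] : exists Y, forall n, (s n).2 <= Y <= (s n).2 + h n.
  apply: (nested_sup (x := fun n => (s n).2)) => // n.
    by have := h0 n; have [_ [-> _|-> _]] := sS n; rewrite ?hS; lra.
  by have := h0 n; have [_ [-> _|-> _]] := sS n; rewrite ?hS; lra.
have inr n : [/\ a <= (s n).1, (s n).1 + w n <= b, c <= (s n).2 & (s n).2 + h n <= d].
  elim: n => [|n [i1 i2 i3 i4]].
    by rewrite /w /h /= expr0 !divr1; split; lra.
  have [c1 c2 _] := sS n; have := w0 n; have := h0 n; have := wS n; have := hS n.
  by case: c1 => ->; case: c2 => ->; split; lra.
have zn n : `|z 0%N| <= 4 ^+ n * `|z n|.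
  elim: n => [|n ih]; first by rewrite expr0 mul1r.
  have [_ _ hn] := sS n; apply: (le_trans ih); rewrite exprSr -mulrA.
  by rewrite ler_wpM2l // exprn_ge0.
have XY : in_rect X Y.
  have [i1 i2 i3 i4] := inr 0%N; have := hX 0%N; have := hY 0%N.
  by rewrite /in_rect; lra.
have z0 : circulation a b c d = z 0%N.
  by rewrite /z /= /w /h expr0 !divr1; congr circulation; ring.
rewrite z0; apply/eqP; rewrite -normr_le0; apply/ler_addgt0Pl => e e0.
rewrite addr0.
pose S := ((b - a) + (d - c)) ^+ 2.
have S0 : 0 <= S by rewrite sqr_ge0.
have [|dl dl0 loc] := circulation_local XY (cl _ _ XY) (e := e / (1 + S)).
  by rewrite divr_gt0 // ltr_pwDl.
have [n hn] : exists n, w n + h n < dl.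
  have [n hn] : exists n, ((b - a) + (d - c)) / dl < 2 ^+ n.
    exists (Num.bound (((b - a) + (d - c)) / dl)).
    apply: lt_le_trans (archi_boundP _) _.
      by rewrite divr_ge0 ?(ltW dl0) // addr_ge0 ?subr_ge0.
    by rewrite -natrX ler_nat ltnW // ltn_expl.
  exists n; rewrite /w /h -mulrDl ltr_pdivrMr //.
  by rewrite mulrC -ltr_pdivrMr.
have [i1 i2 i3 i4] := inr n.
have := w0 n; have := h0 n => hn0 wn0.
have := loc (s n).1 (s n).2 (w n) (h n) wn0 hn0.
move=> /(_ _ _ i1 i2 i3 i4 (hX n) (hY n)) Z.
have {}Z : `|z n| <= e / (1 + S) * (w n + h n) ^+ 2 by apply: Z; lra.
apply: (le_trans (zn n)); apply: (@le_trans _ _ (4 ^+ n * (e / (1 + S) * (w n + h n) ^+ 2))).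
  by rewrite ler_wpM2l // exprn_ge0.
have -> : 4 ^+ n * (e / (1 + S) * (w n + h n) ^+ 2) = e * (S / (1 + S)).
  rewrite /w /h -mulrDl exprMn -/S exprVn -exprM mulnC exprM.
  rewrite (_ : 2 ^+ 2 = 4 :> R); last by ring.
  have : (4 : R) ^+ n != 0 by rewrite expf_neq0 //; lra.
  by move=> ?; field; lra.
rewrite -[leRHS]mulr1 ler_wpM2l ?(ltW e0) // ler_pdivrMr; lra.
Qed.

End Goursat.


Section Increments.
Variable R : realType.
Implicit Types (f : R -> R) (s t : R).

Definition between s t x := s <= x <= t \/ t <= x <= s.

Lemma between_dist s t x : between s t x -> `|x - t| <= `|s - t|.
Proof. by move=> [] h; [rewrite !ler0_norm|rewrite !ger0_norm]; lra. Qed.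

Lemma mvt_abs f f' (c M : R) s t :
  (forall x, between s t x -> is_derive x 1 f (f' x)) ->
  (forall x, between s t x -> `|f' x - c| <= M) ->
  `|f s - f t - c * (s - t)| <= M * `|s - t|.
Proof.
have key u v : u <= v -> primitive_on f' f u v ->
    (forall x, u <= x <= v -> `|f' x - c| <= M) ->
    `|f v - f u - c * (v - u)| <= M * (v - u).
  move=> uv d h.
  have dc k : primitive_on (fun=> k) (fun x => k * x + 0) u v.
    by move=> x _; exact: daffine.
  have h1 := mean_value_le uv (dc (c - M)) d.
  have h2 := mean_value_le uv d (dc (c + M)).
  have {}h1 : (c - M) * v + 0 - ((c - M) * u + 0) <= f v - f u.
    by apply: h1 => x /h; rewrite ler_norml; lra.
  have {}h2 : f v - f u <= (c + M) * v + 0 - ((c + M) * u + 0).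
    by apply: h2 => x /h; rewrite ler_norml; lra.
  by rewrite ler_norml; lra.
move=> df hM; case: (leP t s) => [ts|/ltW st].
  rewrite (@ger0_norm _ (s - t)) ?subr_ge0 //.
  by apply: key => // x hx; [apply: df|apply: hM]; right.
rewrite -normrN (_ : - (f s - f t - c * (s - t)) = f t - f s - c * (t - s)); last by ring.
rewrite [`|s - t|]distrC (@ger0_norm _ (t - s)) ?subr_ge0 //.
by apply: key => // x hx; [apply: df|apply: hM]; left.
Qed.

Lemma lip_of_derive f f' (M : R) s t :
  (forall x, between s t x -> is_derive x 1 f (f' x)) ->
  (forall x, between s t x -> `|f' x| <= M) -> `|f s - f t| <= M * `|s - t|.
Proof.
move=> df hM; have := @mvt_abs f f' 0 M s t df.
by rewrite mul0r subr0; apply => x /hM; rewrite subr0.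
Qed.

Lemma cos_lip s t : `|cos s - cos t| <= `|s - t|.
Proof.
rewrite -[leRHS]mul1r; apply: (lip_of_derive (f' := fun x => - sin x)) => // x _.
by rewrite normrN sin_max.
Qed.

Lemma sin_lip s t : `|sin s - sin t| <= `|s - t|.
Proof.
by rewrite -[leRHS]mul1r; apply: (lip_of_derive (f' := cos)) => // x _; exact: cos_max.
Qed.

(** The point of the unit circle of argument [t], as a complex number. *)
Definition eit t : R[i] := cos t +i* sin t.

Lemma eitE t : eit t = val (expi t). Proof. by []. Qed.

Lemma cabs_eit t : cabs (eit t) = 1.
Proof. by rewrite eitE cabs_circle. Qed.

Lemma eit_lip s t : cabs (eit s - eit t) <= 2 * `|s - t|.
Proof.
apply: le_trans (cabs_le _) _; rewrite /=.
by have := cos_lip s t; have := sin_lip s t; lra.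
Qed.

Lemma eit_taylor s t :
  cabs (eit s - eit t - 'i%C * eit t * (s - t)%:C) <= 2 * `|s - t| ^+ 2.
Proof.
apply: le_trans (cabs_le _) _; rewrite /=.
rewrite !(mul0r, mulr0, mul1r, subr0, addr0, add0r, sub0r, opprK).
have A : `|sin s - sin t - cos t * (s - t)| <= `|s - t| * `|s - t|.
  by apply: mvt_abs => x /between_dist; apply: le_trans; exact: cos_lip.
have B : `|cos s - cos t - - sin t * (s - t)| <= `|s - t| * `|s - t|.
  by apply: mvt_abs => x /between_dist; apply: le_trans; rewrite -opprD normrN sin_lip.
rewrite expr2; move: A B; lra.
Qed.

Lemma expR_lip s t : s <= 0 -> t <= 0 -> `|expR s - expR t| <= `|s - t|.
Proof.
move=> s0 t0; rewrite -[leRHS]mul1r; apply: (lip_of_derive (f' := @expR R)) => // x.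
by move=> h; rewrite ger0_norm ?expR_ge0 // -expR0 ler_expR; case: h; lra.
Qed.

Lemma expR_taylor s t : s <= 0 -> t <= 0 ->
  `|expR s - expR t - expR t * (s - t)| <= `|s - t| ^+ 2.
Proof.
move=> s0 t0; rewrite expr2; apply: (mvt_abs (f' := @expR R)) => // x h.
by apply: le_trans (between_dist h); apply: expR_lip => //; case: h; lra.
Qed.

End Increments.


Section Holomorphic.
Variable R : realType.
Implicit Types (F G : R[i] -> R[i]) (z w l : R[i]) (x y s t : R).

Definition holo F :=
  {within @closed_disc R, continuous F} /\ forall z, disc z -> derivable F z 1.

Lemma holo_cst l : holo (fun=> l).
Proof.
split; last by move=> z _; exact: (derivable_cst l z 1).
by apply: continuous_subspaceT; exact: cst_continuous.
Qed.

Lemma holoD F G : holo F -> holo G -> holo (fun z => F z + G z).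
Proof.
move=> [cF dF] [cG dG]; split.
  move=> z; have h := continuousD (cF z) (cG z); exact h.
move=> z hz; have h := derivableD (dF z hz) (dG z hz); exact h.
Qed.

Lemma holoM F G : holo F -> holo G -> holo (fun z => F z * G z).
Proof.
move=> [cF dF] [cG dG]; split.
  move=> z; have h := continuousM (cF z) (cG z); exact h.
move=> z hz; have h := derivableM (dF z hz) (dG z hz); exact h.
Qed.

Lemma holoN F : holo F -> holo (fun z => - F z).
Proof.
move=> [cF dF]; split.
  move=> z; have h := continuousN (cF z); exact h.
move=> z hz; have h := derivableN (dF z hz); exact h.
Qed.

Lemma holoB F G : holo F -> holo G -> holo (fun z => F z - G z).
Proof. move=> hF hG; exact (holoD hF (holoN hG)). Qed.

Lemma holoV F : (forall z, closed_disc z -> F z != 0) -> holo F ->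
  holo (fun z => (F z)^-1).
Proof.
move=> F0 [cF dF]; split.
  apply/subspace_continuousP => z hz.
  by apply: cvgV; [exact: F0|move/subspace_continuousP: cF; exact].
move=> z hz; apply: derivableV; last exact: dF.
by apply: F0; move: hz; rewrite discE closed_discE => /ltW.
Qed.

Lemma holo_cdiff F z : holo F -> cabs z < 1 -> exists l, cdiff F z l.
Proof. by move=> [_ dF] hz; apply/derivable_cdiff/dF; rewrite discE. Qed.

Lemma holo_continuous_curve F (g : R -> R[i]) K : holo F ->
  (forall t, cabs (g t) <= 1) ->
  (forall s t, cabs (g s - g t) <= K * `|s - t|) ->
  continuous (fun t => complex.Re (F (g t))) /\
  continuous (fun t => complex.Im (F (g t))).
Proof.
move=> [/continuous_discP cF _] g1 gL.
have key t e : 0 < e -> \forall s \near t, cabs (F (g s) - F (g t)) <= e.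
  move=> e0; have [d d0 h] := cF (g t) (g1 t) e e0.
  have K0 : 0 < 1 + `|K| by rewrite ltr_pwDl.
  apply/nbhs_ballP; exists (d / (1 + `|K|)); first by rewrite /= divr_gt0.
  move=> s; rewrite /ball /= ltr_pdivlMr // => hs; apply: h => //.
  apply: le_lt_trans (gL _ _) _; apply: le_lt_trans hs.
  rewrite distrC mulrC ler_wpM2l //; have := ler_norm K; lra.
split=> t; apply/cvgrPdist_le => e e0; near=> s.
  rewrite -raddfB; apply: le_trans (Re_le_cabs _) _; rewrite cabsC.
  by near: s; exact: key.
rewrite -raddfB; apply: le_trans (Im_le_cabs _) _; rewrite cabsC.
by near: s; exact: key.
Unshelve. all: by end_near. Qed.

(** Logarithmic polar coordinates. *)
Definition lpolar x y : R[i] := (expR x)%:C * eit y.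

Lemma cabs_lpolar x y : cabs (lpolar x y) = expR x.
Proof. by rewrite cabsM cabs_eit mulr1 cabs_real ger0_norm // expR_ge0. Qed.

Lemma lpolar_lip x y x' y' : x <= 0 -> x' <= 0 ->
  cabs (lpolar x' y' - lpolar x y) <= 2 * (`|x' - x| + `|y' - y|).
Proof.
move=> x0 x0'.
have -> : lpolar x' y' - lpolar x y =
   (expR x' - expR x)%:C * eit y' + (expR x)%:C * (eit y' - eit y).
  by rewrite /lpolar rmorphB /=; ring.
apply: le_trans (cabsD _ _) _; rewrite !cabsM !cabs_real cabs_eit mulr1.
have A := expR_lip x0' x0; have B := eit_lip y' y.
have C : `|expR x| * cabs (eit y' - eit y) <= 1 * (2 * `|y' - y|).
  apply: ler_pM => //; first exact: cabs_ge0.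
  by rewrite ger0_norm ?expR_ge0 // -expR0 ler_expR.
have := normr_ge0 (x' - x); lra.
Qed.

Lemma lpolar_taylor x y x' y' : x <= 0 -> x' <= 0 ->
  cabs (lpolar x' y' - lpolar x y - lpolar x y * ((x' - x) +i* (y' - y)))
    <= 2 * (`|x' - x| + `|y' - y|) ^+ 2.
Proof.
move=> x0 x0'.
have -> : (x' - x) +i* (y' - y) = (x' - x)%:C + 'i%C * (y' - y)%:C :> R[i].
  by rewrite [LHS]complexE.
have -> : lpolar x' y' - lpolar x y - lpolar x y * ((x' - x)%:C + 'i%C * (y' - y)%:C) =
   (expR x')%:C * (eit y' - eit y - 'i%C * eit y * (y' - y)%:C)
   + (expR x' - expR x - expR x * (x' - x))%:C * eit y
   + (expR x' - expR x)%:C * ('i%C * eit y * (y' - y)%:C).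
  rewrite /lpolar !rmorphB /= rmorphM rmorphB /=; ring.
apply: le_trans (cabsD _ _) _; apply: le_trans (lerD (cabsD _ _) (lexx _)) _.
rewrite !cabsM !cabs_real cabs_eit !mulr1.
have -> : cabs ('i%C : R[i]) = 1 by rewrite /cabs normc_def /= expr0n expr1n add0r sqrtr1.
rewrite mul1r.
have A := expR_taylor x0' x0; have B := eit_taylor y' y.
have D := expR_lip x0' x0.
have C : `|expR x'| * cabs (eit y' - eit y - 'i%C * eit y * (y' - y)%:C)
   <= 1 * (2 * `|y' - y| ^+ 2).
  apply: ler_pM => //; first exact: cabs_ge0.
  by rewrite ger0_norm ?expR_ge0 // -expR0 ler_expR.
have := normr_ge0 (x' - x); have := normr_ge0 (y' - y); nra.
Qed.

Lemma lpolar_diff F x y l : x <= 0 -> cdiff F (lpolar x y) l ->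
  exists A, forall e, 0 < e -> exists2 d, 0 < d & forall x' y', x' <= 0 ->
    `|x' - x| < d -> `|y' - y| < d ->
    cabs (F (lpolar x' y') - F (lpolar x y) - A * ((x' - x) +i* (y' - y)))
      <= e * (`|x' - x| + `|y' - y|).
Proof.
move=> x0 dF; exists (l * lpolar x y) => e e0.
have [|d d0 h] := dF (e / 4); first lra.
have l0 := cabs_ge0 l.
pose d' := Num.min (d / 4) (e / (8 * (1 + cabs l))).
have d'0 : 0 < d' by rewrite lt_min !divr_gt0 // mulr_gt0 //; lra.
exists d' => // x' y' x0' hx hy.
have L := lpolar_lip y y' x0 x0'; have T := lpolar_taylor y y' x0 x0'.
move: L T; set D := `|_| + _ => L T.
have D0 : 0 <= D by rewrite addr_ge0.
have Dd : D < 2 * d' by rewrite /D; lra.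
have d'1 : d' <= d / 4 by rewrite ge_min lexx.
have d'2 : d' * (8 * (1 + cabs l)) <= e.
  by rewrite -ler_pdivlMr ?mulr_gt0 //; [rewrite ge_min lexx orbT|lra].
have {}h := h (lpolar x' y').
have {h}H : cabs (F (lpolar x' y') - F (lpolar x y) - l * (lpolar x' y' - lpolar x y))
    <= e / 4 * cabs (lpolar x' y' - lpolar x y) by apply: h; lra.
have -> : F (lpolar x' y') - F (lpolar x y) - l * lpolar x y * ((x' - x) +i* (y' - y))
  = (F (lpolar x' y') - F (lpolar x y) - l * (lpolar x' y' - lpolar x y))
  + l * (lpolar x' y' - lpolar x y - lpolar x y * ((x' - x) +i* (y' - y))) by ring.
apply: le_trans (cabsD _ _) _; rewrite (cabsM l).
have A1 : cabs l * cabs (lpolar x' y' - lpolar x y - lpolar x y * ((x' - x) +i* (y' - y)))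
   <= cabs l * (2 * D ^+ 2) by rewrite ler_wpM2l.
have A2 : cabs l * (2 * D ^+ 2) <= e / 2 * D.
  have : D * cabs l <= 2 * d' * cabs l by rewrite ler_wpM2r // ltW.
  nra.
nra.
Qed.

End Holomorphic.


Section MeanValue.
Variable R : realType.
Implicit Types (F G : R[i] -> R[i]) (z w l : R[i]) (x y s t a b : R).

Lemma minr_lip a x y : `|Num.min x a - Num.min y a| <= `|x - y|.
Proof.
by case: (leP x a) => xa; case: (leP y a) => ya //; rewrite ?subrr ?normr0 //;
  rewrite ler_norml; have := ler_norm (x - y); have := ler_norm (y - x);
  rewrite (distrC y); lra.
Qed.

Lemma circle_mean_indep F a b : holo F -> a <= b -> b < 0 ->
  nint (fun y => complex.Re (F (lpolar b y))) 0 (pi *+ 2) =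
  nint (fun y => complex.Re (F (lpolar a y))) 0 (pi *+ 2).
Proof.
move=> hF ab b0.
have mb x : Num.min x b <= b by rewrite ge_min lexx orbT.
have hm x y : cabs (lpolar (Num.min x b) y) <= 1.
  by rewrite cabs_lpolar -expR0 ler_expR (le_trans (mb x)) // ltW.
have lip x y x' y' : cabs (lpolar (Num.min x' b) y' - lpolar (Num.min x b) y)
    <= 2 * (`|x' - x| + `|y' - y|).
  apply: le_trans (lpolar_lip _ _ _ _) _; rewrite ?(le_trans (mb _)) ?(ltW b0) //.
  by rewrite ler_wpM2l // lerD2r minr_lip.
pose P x y := complex.Im (F (lpolar (Num.min x b) y)).
pose Q x y := complex.Re (F (lpolar (Num.min x b) y)).
have cP y : continuous (P^~ y).
  apply: (holo_continuous_curve (K := 2) hF _ _).2 => [x|s t]; first exact: hm.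
  by have := lip t y s y; rewrite subrr normr0 addr0.
have cQ x : continuous (Q x).
  apply: (holo_continuous_curve (K := 2) hF _ _).1 => [y|s t]; first exact: hm.
  by have := lip x t x s; rewrite subrr normr0 add0r.
have p0 : 0 <= pi *+ 2 :> R by rewrite mulrn_wge0 // pi_ge0.
suff : circulation P Q a b 0 (pi *+ 2) = 0.
  rewrite /circulation.
  have -> : P^~ (pi *+ 2) = P^~ 0.
    by apply/funext => x; rewrite /P /lpolar !eitE -[pi *+ 2]add0r expiD2pi.
  have -> : Q b = fun y => complex.Re (F (lpolar b y)).
    by apply/funext => y; rewrite /Q minxx.
  have -> : Q a = fun y => complex.Re (F (lpolar a y)).
    by apply/funext => y; rewrite /Q min_l.
  by rewrite subrr add0r => /eqP; rewrite subr_eq0 => /eqP.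
apply: goursat => // x y /andP[/andP[ax xb] _].
have x0 : x < 0 by lra.
have [|l dl] := @holo_cdiff _ F (lpolar x y) hF; first by rewrite cabs_lpolar expR_lt1.
have [A hA] := lpolar_diff (ltW x0) dl.
exists (complex.Im A), (- complex.Im A), (complex.Re A) => e e0.
have [d d0 hd] := hA e e0; exists d => // x' y' /andP[/andP[ax' xb'] _] hx hy.
have x0' : x' <= 0 by lra.
have := hd x' y' x0' hx hy; set Z := _ - A * _ => hZ.
rewrite /P /Q !min_l //; split.
  apply: le_trans hZ; apply: le_trans (Im_le_cabs _); rewrite /Z !raddfB /=.
  by rewrite le_eqVlt; apply/orP; left; apply/eqP; congr (`|_|); case: (A) => ? ? /=; ring.
apply: le_trans hZ; apply: le_trans (Re_le_cabs _); rewrite /Z !raddfB /=.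
by rewrite le_eqVlt; apply/orP; left; apply/eqP; congr (`|_|); case: (A) => ? ? /=; ring.
Qed.

Lemma nint_close (f g : R -> R) e a b : a <= b -> continuous f -> continuous g ->
  (forall t, a <= t <= b -> `|f t - g t| <= e) ->
  `|nint f a b - nint g a b| <= e * (b - a).
Proof.
move=> ab cf cg h; have := @nint_diff_le _ f g 0 e a b ab cf cg.
by rewrite mul0r subr0; apply => t /h; rewrite subr0.
Qed.

Lemma holo_boundary_unif F e : holo F -> 0 < e -> exists2 x, x < 0 &
  forall y, 0 <= y <= pi *+ 2 -> cabs (F (lpolar x y) - F (eit y)) <= e.
Proof.
move=> [/continuous_discP cF _] e0.
have /compact_near_coveringP nc := @segment_compact R 0 (pi *+ 2).
have := nc R (0^'-) (fun x y => cabs (F (lpolar x y) - F (eit y)) <= e).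
move=> []; last first.
  move=> d /= d0 hd; exists (- (d / 2)); first by lra.
  have b : ball_ Num.norm (0 : R) d (- (d / 2)).
    by rewrite /= sub0r opprK ger0_norm; lra.
  have n0 : - (d / 2) < 0 by lra.
  by move=> y hy; apply: (hd _ b n0); rewrite /= in_itv.
move=> y0 _; have e2 : 0 < e / 2 by lra.
have [|d d0 hd] := cF (eit y0) _ (e / 2) e2; first by rewrite cabs_eit.
exists (ball y0 (d / 8), [set x | x < 0 /\ - (d / 8) < x]) => /=.
  split; first by apply: nbhsx_ballx; lra.
  exists (d / 8) => /=; first by lra.
  by move=> x; rewrite /= sub0r normrN ltr_norml => /andP[h _].
move=> [y x] [/=]; rewrite /ball /= => hy [x0 xd].
have l0 t : lpolar 0 t = eit t by rewrite /lpolar expR0 mul1r.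
have h1 := lpolar_lip y0 y (lexx 0) (ltW x0).
have h2 := lpolar_lip y0 y (lexx (0 : R)) (lexx 0).
rewrite !l0 subr0 in h1; rewrite !l0 subr0 normr0 in h2.
rewrite distrC in hy.
have A : cabs (F (lpolar x y) - F (eit y0)) <= e / 2.
  apply: hd; first by rewrite cabs_lpolar -expR0 ler_expR ltW.
  apply: le_lt_trans h1 _; rewrite (ltr0_norm x0); lra.
have B : cabs (F (eit y) - F (eit y0)) <= e / 2.
  apply: hd; first by rewrite cabs_eit.
  apply: le_lt_trans h2 _; lra.
by apply: le_trans (cabs_dist _ _ (F (eit y0))) _; rewrite (cabsC (F (eit y0))); lra.
Qed.

Lemma holo_mean F : holo F ->
  nint (fun t => complex.Re (F (eit t))) 0 (pi *+ 2) = pi *+ 2 * complex.Re (F 0).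
Proof.
move=> hF.
have p0 : 0 < pi *+ 2 :> R by rewrite mulrn_wgt0 // pi_gt0.
have ce : continuous (fun t => complex.Re (F (eit t))).
  apply: (holo_continuous_curve (K := 2) hF _ _).1 => [y|s t]; first by rewrite cabs_eit.
  exact: eit_lip.
have cl x : x < 0 -> continuous (fun y => complex.Re (F (lpolar x y))).
  move=> x0; apply: (holo_continuous_curve (K := 2) hF _ _).1 => [y|s t].
    by rewrite cabs_lpolar -expR0 ler_expR ltW.
  by have := lpolar_lip t s (ltW x0) (ltW x0); rewrite subrr normr0 add0r.
apply/eqP; rewrite -subr_eq0 -normr_le0; apply/ler_addgt0Pl => e e0; rewrite addr0.
pose e' := e / (2 * (pi *+ 2)).
have e'0 : 0 < e' by rewrite divr_gt0 // mulr_gt0.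
have [x x0 hx] := holo_boundary_unif hF e'0.
have [x1 x1x h1] : exists2 x1, x1 <= x & forall y, cabs (F (lpolar x1 y) - F 0) <= e'.
  have /continuous_discP cF := hF.1.
  have [|d d0 hd] := cF 0 _ e' e'0; first by rewrite cabs0.
  have [n hn] : exists n : nat, d^-1 < expR n%:R.
    exists (Num.bound d^-1); apply: lt_le_trans (archi_boundP _) _.
      by rewrite invr_ge0 ltW.
    by apply: le_trans (expR_ge1Dx _); lra.
  exists (Num.min x (- n%:R)); first by rewrite ge_min lexx.
  move=> y; apply: hd; rewrite ?subr0 cabs_lpolar.
    by rewrite -expR0 ler_expR (le_trans _ (ltW x0)) // ge_min lexx.
  apply: (@le_lt_trans _ _ (expR (- n%:R))).
    by rewrite ler_expR ge_min lexx orbT.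
  by rewrite expRN invf_plt // posrE ?expR_gt0.
have ind := circle_mean_indep hF x1x x0.
have A : `|nint (fun t => complex.Re (F (eit t))) 0 (pi *+ 2)
     - nint (fun y => complex.Re (F (lpolar x y))) 0 (pi *+ 2)| <= e' * (pi *+ 2 - 0).
  apply: nint_close => //; [exact: ltW|exact: cl|].
  move=> t ht; rewrite -raddfB; apply: le_trans (Re_le_cabs _) _.
  by rewrite cabsC hx.
have B : `|nint (fun y => complex.Re (F (lpolar x1 y))) 0 (pi *+ 2)
     - nint (fun _ => complex.Re (F 0)) 0 (pi *+ 2)| <= e' * (pi *+ 2 - 0).
  apply: nint_close => //; [exact: ltW|by apply: cl; lra|exact: cont_cst|].
  by move=> t ht; rewrite -raddfB; apply: le_trans (Re_le_cabs _) _.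
rewrite nint_cst ?(ltW p0) // subr0 -ind in B; rewrite subr0 in A.
have -> : e = e' * (pi *+ 2) + e' * (pi *+ 2).
  rewrite /e'; field; lra.
apply: le_trans (lerD A B); rewrite (mulrC (pi *+ 2)).
exact: ler_distD.
Qed.

Lemma nint_ge0_eq0 (f : R -> R) a b t : continuous f -> (forall x, 0 <= f x) ->
  a < t < b -> nint f a b = 0 -> f t = 0.
Proof.
move=> cf f0 /andP[at_ tb] fi; have ab : a <= b by lra.
have [P hP] := nint_ex a b cf.
have Pc x : a <= x <= b -> P x = P a.
  move=> /andP[ax xb].
  have p0 c d : c <= d -> 0 <= nint f c d.
    move=> cd; rewrite -(mul0r (d - c)) -(@nint_cst _ 0 c d cd).
    by apply: nint_le => //; exact: cont_cst.
  have := p0 a x ax; have := p0 x b xb; move: fi.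
  rewrite (hP a b _ _ _).2 // (hP a x _ _ _).2 // (hP x b _ _ _).2 //; lra.
have [dP _] := hP a b (lexx _) ab (lexx _).
have tab : a <= t <= b by lra.
have d1 := dP t tab.
have d2 : is_derive t 1 P 0.
  have e : \forall x \near t, P a = P x.
    near=> x; rewrite Pc //; apply/andP; split; apply: ltW; near: x.
      exact: lt_nbhsr.
    exact: lt_nbhsl.
  exact: (near_eq_is_derive e (is_derive_cst _ _ _)).
by rewrite -(@derive_val _ _ _ _ _ _ _ d1) (@derive_val _ _ _ _ _ _ _ d2).
Unshelve. all: by end_near. Qed.

(** With c = F(0), the mean of (F - c)^2 over the circle is its value 0 at the
    centre; when F is real on the circle this square is nonnegative there. *)
Lemma holo_real_cst F : holo F -> (forall s : circle R, complex.Im (F (val s)) = 0) ->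
  forall s : circle R, F (val s) = F 0.
Proof.
move=> hF iF.
have p0 : 0 < pi *+ 2 :> R by rewrite mulrn_wgt0 // pi_gt0.
have i0 : complex.Im (F 0) = 0.
  have := holo_mean (holoM (holo_cst (- 'i%C)) hF).
  have -> : (fun t => complex.Re (- 'i%C * F (eit t))) = fun=> 0.
    apply/funext => t; have := iF (expi t); rewrite -eitE.
    by case: (F _) => u v /= ->; ring.
  rewrite nint_cst ?(ltW p0) // mul0r => /esym/eqP; rewrite mulf_eq0 gt_eqF //=.
  by case: (F 0) => u v /= /eqP; lra.
have hG := holoM (holoB hF (holo_cst (F 0))) (holoB hF (holo_cst (F 0))).
have := holo_mean hG; rewrite subrr mulr0 /= mulr0.
set g := fun t => _ => gi.
have cg : continuous g.
  apply: (holo_continuous_curve (K := 2) hG _ _).1 => [y|s t]; first by rewrite cabs_eit.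
  exact: eit_lip.
have gE t : g t = (complex.Re (F (eit t)) - complex.Re (F 0)) ^+ 2.
  have := iF (expi t); rewrite -eitE /g.
  by move: i0; case: (F 0) => u v /= ->; case: (F _) => u' v' /= ->; ring.
move=> s; have [t ->] := expi_surj s.
have gt0 : g t = 0.
  apply: (@nint_ge0_eq0 g (t - pi) (t - pi + pi *+ 2)) => //.
  - by move=> x; rewrite gE sqr_ge0.
  - by have := pi_gt0 R; lra.
  rewrite -gi -[in RHS](add0r (pi *+ 2)); apply: nint_period => //; first exact: ltW.
  by move=> x; rewrite /g !eitE expiD2pi.
move: gt0; rewrite gE => /eqP; rewrite sqrf_eq0 subr_eq0 => /eqP e.
by have := iF (expi t); move: e i0; rewrite eitE; case: (F 0) => ? ?; case: (F _) => ? ? /= -> -> ->.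
Qed.

End MeanValue.


Section ComplexCurves.
Variable R : realType.
Implicit Types (f g : R -> R[i]) (s t a b : R) (v w z : R[i]).

Lemma is_derive_epsP (f : R -> R) t l : is_derive t 1 f l <->
  forall e, 0 < e -> exists2 d, 0 < d & forall s, `|s - t| < d ->
    `|f s - f t - l * (s - t)| <= e * `|s - t|.
Proof.
split=> [[/cvg_ex[l' /= cl] dl] e e0|h].
  have {dl} ll : l' = l by rewrite -dl; exact/esym/cvg_lim.
  move: cl; rewrite {}ll => /cvgrPdist_le /(_ e e0).
  rewrite near_withinE => /nbhs_ballP[d /= d0 h]; exists d => // s st.
  have [->|nst] := eqVneq s t; first by rewrite !subrr mulr0 subrr normr0 mulr0.
  have st0 : s - t != 0 by rewrite subr_eq0.
  have := h (s - t); rewrite /ball /= sub0r normrN => /(_ st st0).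
  rewrite /= [_ *: 1]mulr1 subrK => hw.
  have -> : f s - f t - l * (s - t) = - ((l - (s - t)^-1 * (f s - f t)) * (s - t)).
    by field.
  by rewrite normrN normrM ler_wpM2r.
suff c : h^-1 *: (f (h *: 1 + t) - f t) @[h --> 0^'] --> l.
  by split; [apply/cvg_ex; exists l|exact: cvg_lim].
apply/cvgrPdist_le => e e0; have [d d0 hd] := h e e0.
rewrite near_withinE; apply/nbhs_ballP; exists d => //= s.
rewrite /ball /= sub0r normrN => sd s0; have := hd (s + t).
rewrite addrK [_ *: 1]mulr1 => /(_ sd) hw.
have c0 : 0 < `|s| by rewrite normr_gt0.
rewrite -(ler_pM2r c0) -normrM -normrN.
by have -> : - ((l - s^-1 * (f (s + t) - f t)) * s) = f (s + t) - f t - l * s by field.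
Qed.

(** The complex derivative of a curve in the plane. *)
Definition cder f t v :=
  is_derive t 1 (fun s => complex.Re (f s)) (complex.Re v) /\
  is_derive t 1 (fun s => complex.Im (f s)) (complex.Im v).

Lemma cderP f t v : cder f t v <->
  forall e, 0 < e -> exists2 d, 0 < d & forall s, `|s - t| < d ->
    cabs (f s - f t - v * (s - t)%:C) <= e * `|s - t|.
Proof.
have reE s : complex.Re (f s - f t - v * (s - t)%:C) =
    complex.Re (f s) - complex.Re (f t) - complex.Re v * (s - t).
  by case: v => ? ?; case: (f s) => ? ?; case: (f t) => ? ? /=; ring.
have imE s : complex.Im (f s - f t - v * (s - t)%:C) =
    complex.Im (f s) - complex.Im (f t) - complex.Im v * (s - t).
  by case: v {reE} => ? ?; case: (f s) => ? ?; case: (f t) => ? ? /=; ring.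
split=> [[/is_derive_epsP h1 /is_derive_epsP h2] e e0|h].
  have e2 : 0 < e / 2 by lra.
  have [d1 d10 {}h1] := h1 _ e2; have [d2 d20 {}h2] := h2 _ e2.
  exists (Num.min d1 d2) => [|s]; first by rewrite lt_min d10.
  rewrite lt_min => /andP[/h1 A /h2 B].
  by apply: le_trans (cabs_le _) _; rewrite reE imE; lra.
split; apply/is_derive_epsP => e e0; have [d d0 hd] := h e e0; exists d => // s /hd.
  by rewrite -reE; apply: le_trans; exact: Re_le_cabs.
by rewrite -imE; apply: le_trans; exact: Im_le_cabs.
Qed.

Lemma cder_comp (F : R[i] -> R[i]) f t l v :
  cdiff F (f t) l -> cder f t v -> cder (fun s => F (f s)) t (l * v).
Proof.
move=> dF /cderP df; apply/cderP => e e0.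
have v0 := cabs_ge0 v; have l0 := cabs_ge0 l.
pose e1 := e / (2 * (1 + cabs v)); pose e2 := Num.min 1 (e / (2 * (1 + cabs l))).
have e10 : 0 < e1 by rewrite divr_gt0 // mulr_gt0 //; lra.
have e20 : 0 < e2 by rewrite lt_min ltr01 divr_gt0 // mulr_gt0 //; lra.
have [d d0 hd] := dF e1 e10; have [d' d'0 hd'] := df e2 e20.
have d1 : 0 < d / (1 + cabs v) by rewrite divr_gt0 //; lra.
exists (Num.min d' (d / (1 + cabs v))) => [|s]; first by rewrite lt_min d'0.
rewrite lt_min ltr_pdivlMr ?ltr_wpDr // => /andP[/hd' A B].
have e2l : e2 * (2 * (1 + cabs l)) <= e.
  by rewrite -ler_pdivlMr ?mulr_gt0 //; [rewrite ge_min lexx orbT|lra].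
have e21 : e2 <= 1 by rewrite ge_min lexx.
have e1v : e1 * (2 * (1 + cabs v)) = e by rewrite /e1; field; lra.
have st := normr_ge0 (s - t).
have C : cabs (f s - f t) <= (1 + cabs v) * `|s - t|.
  rewrite -(subrK (v * (s - t)%:C) (f s - f t)); apply: le_trans (cabsD _ _) _.
  rewrite cabsM cabs_real; nra.
have {}hd := hd (f s).
have D : cabs (F (f s) - F (f t) - l * (f s - f t)) <= e1 * cabs (f s - f t).
  by apply: hd; apply: le_lt_trans C _; rewrite mulrC.
have -> : F (f s) - F (f t) - l * v * (s - t)%:C =
  (F (f s) - F (f t) - l * (f s - f t)) + l * (f s - f t - v * (s - t)%:C) by ring.
apply: le_trans (cabsD _ _) _; rewrite (cabsM l).
have E : cabs l * cabs (f s - f t - v * (s - t)%:C) <= cabs l * (e2 * `|s - t|).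
  by rewrite ler_wpM2l.
have G : e1 * cabs (f s - f t) <= e1 * ((1 + cabs v) * `|s - t|).
  by rewrite ler_wpM2l // ltW.
have K : cabs l * e2 <= e / 2 by nra.
have K' : cabs l * e2 * `|s - t| <= e / 2 * `|s - t| by rewrite ler_wpM2r.
nra.
Qed.

Lemma cder_cmean (f f' : R -> R[i]) (g g' : R -> R) a b : a <= b ->
  (forall t, a <= t <= b -> cder f t (f' t)) -> primitive_on g' g a b ->
  (forall t, a <= t <= b -> cabs (f' t) <= g' t) ->
  cabs (f b - f a) <= 2 * (g b - g a).
Proof.
move=> ab df dg h; apply: le_trans (cabs_le _) _; rewrite !raddfB.
have gN : primitive_on (fun t => -1 * g' t) (fun t => -1 * g t) a b.
  by move=> t ht; exact: dZ (dg t ht).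
have key (u : R -> R) u' : primitive_on u' u a b ->
    (forall t, a <= t <= b -> `|u' t| <= g' t) -> `|u b - u a| <= g b - g a.
  move=> du hu; rewrite ler_norml; apply/andP; split; last first.
    by apply: (mean_value_le ab du dg) => t /hu; rewrite ler_norml => /andP[].
  have A := mean_value_le ab gN du.
  have : -1 * g b - -1 * g a <= u b - u a.
    by apply: A => t /hu; rewrite ler_norml mulN1r => /andP[].
  by lra.
have A : `|complex.Re (f b) - complex.Re (f a)| <= g b - g a.
  apply: (key (fun t => complex.Re (f t)) (fun t => complex.Re (f' t))) => t ht.
    exact: (df t ht).1.
  by apply: le_trans (Re_le_cabs _) (h t ht).
have B : `|complex.Im (f b) - complex.Im (f a)| <= g b - g a.
  apply: (key (fun t => complex.Im (f t)) (fun t => complex.Im (f' t))) => t ht.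
    exact: (df t ht).2.
  by apply: le_trans (Im_le_cabs _) (h t ht).
lra.
Qed.

Definition ccts f :=
  continuous (fun t => complex.Re (f t)) /\ continuous (fun t => complex.Im (f t)).

Lemma cctsM f g : ccts f -> ccts g -> ccts (fun t => f t * g t).
Proof.
move=> [f1 f2] [g1 g2]; split.
  rewrite (_ : (fun _ => _) = fun t => complex.Re (f t) * complex.Re (g t)
    - complex.Im (f t) * complex.Im (g t)).
    by apply: contB; exact: contM.
  by apply/funext => t; case: (f t) => ? ?; case: (g t) => ? ?.
rewrite (_ : (fun _ => _) = fun t => complex.Re (f t) * complex.Im (g t)
    + complex.Im (f t) * complex.Re (g t)).
  by apply: contD; exact: contM.
by apply/funext => t; case: (f t) => ? ?; case: (g t) => ? ?.
Qed.

Lemma cctsD f g : ccts f -> ccts g -> ccts (fun t => f t + g t).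
Proof.
move=> [f1 f2] [g1 g2]; split; under eq_fun do rewrite raddfD; exact: contD.
Qed.

Lemma ccts_cst z : ccts (fun=> z).
Proof. by split; exact: cont_cst. Qed.

Lemma ccts_real (h : R -> R) : continuous h -> ccts (fun t => (h t)%:C).
Proof. by move=> ch; split; [exact: ch|exact: cont_cst]. Qed.

Lemma ccts_eit : ccts (@eit R).
Proof. by split; [exact: continuous_cos|exact: continuous_sin]. Qed.

Lemma cctsV f : (forall t, f t != 0) -> ccts f -> ccts (fun t => (f t)^-1).
Proof.
move=> f0 [f1 f2].
have n0 t : complex.Re (f t) ^+ 2 + complex.Im (f t) ^+ 2 != 0.
  by rewrite -cabs_sqr expf_neq0 // cabs_eq0 f0.
have cn : continuous (fun t => (complex.Re (f t) ^+ 2 + complex.Im (f t) ^+ 2)^-1).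
  have cs : continuous (fun t => complex.Re (f t) ^+ 2 + complex.Im (f t) ^+ 2).
    by under eq_fun do rewrite !expr2; apply: contD; exact: contM.
  by move=> t; apply: cvgV => //; exact: cs.
split.
  rewrite (_ : (fun _ => _) = fun t => complex.Re (f t) *
    (complex.Re (f t) ^+ 2 + complex.Im (f t) ^+ 2)^-1); first exact: contM.
  by apply/funext => t; case: (f t).
rewrite (_ : (fun _ => _) = fun t => - (complex.Im (f t) *
    (complex.Re (f t) ^+ 2 + complex.Im (f t) ^+ 2)^-1)).
  by apply: contN; exact: contM.
by apply/funext => t; case: (f t).
Qed.

Definition cint f a b : R[i] :=
  nint (fun t => complex.Re (f t)) a b +i* nint (fun t => complex.Im (f t)) a b.

Lemma cintD f g a b : a <= b -> ccts f -> ccts g ->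
  cint (fun t => f t + g t) a b = cint f a b + cint g a b.
Proof.
move=> ab [f1 f2] [g1 g2]; rewrite /cint; apply/eqP.
rewrite eq_complex /= -!nintD //; apply/andP; split; apply/eqP.
  by congr nint; apply/funext => t; rewrite raddfD.
by congr nint; apply/funext => t; rewrite raddfD.
Qed.

Lemma cintZ f z a b : a <= b -> ccts f ->
  cint (fun t => z * f t) a b = z * cint f a b.
Proof.
move=> ab [f1 f2]; rewrite /cint; case: z => x y; apply/eqP.
rewrite eq_complex /=; apply/andP; split; apply/eqP.
  rewrite -!nintZ // -nintB //; try by apply: contM => //; exact: cont_cst.
  by congr nint; apply/funext => t; case: (f t).
rewrite -!nintZ // -nintD //; try by apply: contM => //; exact: cont_cst.
by congr nint; apply/funext => t; case: (f t).
Qed.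

Lemma cintE f h a b : a <= b -> (forall t, a <= t <= b -> cder h t (f t)) ->
  cint f a b = h b - h a.
Proof.
move=> ab dh; apply/eqP; rewrite eq_complex !raddfB /=.
rewrite (nintE ab (P := fun t => complex.Re (h t))); last by move=> t /dh[].
by rewrite (nintE ab (P := fun t => complex.Im (h t))) ?eqxx //; move=> t /dh[].
Qed.

Lemma cint_le f (g : R -> R) a b : a <= b -> ccts f -> continuous g ->
  (forall t, a <= t <= b -> cabs (f t) <= g t) -> cabs (cint f a b) <= 2 * nint g a b.
Proof.
move=> ab [f1 f2] cg h; apply: le_trans (cabs_le _) _ => /=.
have A : `|nint (fun t => complex.Re (f t)) a b| <= nint g a b.
  by apply: nint_norm => // t /h; apply: le_trans; exact: Re_le_cabs.
have B : `|nint (fun t => complex.Im (f t)) a b| <= nint g a b.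
  by apply: nint_norm => // t /h; apply: le_trans; exact: Im_le_cabs.
lra.
Qed.

Lemma cint_period f p a b : 0 <= p -> ccts f -> (forall t, f (t + p) = f t) ->
  cint f a (a + p) = cint f b (b + p).
Proof.
move=> p0 [f1 f2] fp; rewrite /cint (nint_period a b p0 f1) ?(nint_period a b p0 f2) //.
  by move=> t; rewrite fp.
by move=> t; rewrite fp.
Qed.

Lemma cderM f g t v w : cder f t v -> cder g t w ->
  cder (fun s => f s * g s) t (v * g t + f t * w).
Proof.
move=> [f1 f2] [g1 g2]; split.
  rewrite (_ : (fun _ => _) = fun t => complex.Re (f t) * complex.Re (g t)
    - complex.Im (f t) * complex.Im (g t)).
    apply: dE (dB (dM f1 g1) (dM f2 g2)) _.
    by case: v {f1 f2}; case: w {g1 g2}; case: (f t); case: (g t) => * /=; ring.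
  by apply/funext => u; case: (f u) => ? ?; case: (g u) => ? ?.
rewrite (_ : (fun _ => _) = fun t => complex.Re (f t) * complex.Im (g t)
    + complex.Im (f t) * complex.Re (g t)).
  apply: dE (is_derive_add (dM f1 g2) (dM f2 g1)) _.
  by case: v {f1 f2}; case: w {g1 g2}; case: (f t); case: (g t) => * /=; ring.
by apply/funext => u; case: (f u) => ? ?; case: (g u) => ? ?.
Qed.

Lemma cder_real (h : R -> R) t l : is_derive t 1 h l -> cder (fun s => (h s)%:C) t l%:C.
Proof. by move=> dh; split => //=; exact: is_derive_cst. Qed.

Lemma cder_eit t : cder (@eit R) t ('i%C * eit t).
Proof.
split => /=; first by apply: dE (is_derive_cos t) _; ring.
by apply: dE (is_derive_sin t) _; ring.
Qed.

Lemma cderE f t v w : cder f t v -> v = w -> cder f t w.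
Proof. by move=> + <-. Qed.

Lemma cdiff_inv z : z != 0 -> cdiff (fun w => w^-1) z (- z^-1 ^+ 2).
Proof.
move=> z0 e e0; have c0 : 0 < cabs z by rewrite cabs_gt0.
exists (Num.min (cabs z / 2) (e * cabs z ^+ 3 / 2)).
  by rewrite lt_min !divr_gt0 // mulr_gt0 // exprn_gt0.
move=> w; rewrite lt_min => /andP[h1 h2].
have cw : cabs z / 2 <= cabs w.
  by have := cabsB_ge z w; rewrite cabsC; lra.
have w0 : w != 0 by rewrite -cabs_gt0; lra.
have -> : w^-1 - z^-1 - - z^-1 ^+ 2 * (w - z) = (w - z) ^+ 2 / (z ^+ 2 * w).
  by field; rewrite z0 w0.
rewrite cabsM cabsV cabsM !cabsX ler_pdivrMr ?mulr_gt0 ?exprn_gt0 // ?cabs_gt0 //.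
rewrite expr2 -(mulrA e) mulrCA; apply: ler_wpM2l; first exact: cabs_ge0.
apply: le_trans (ltW h2) _; rewrite -mulrA; apply: ler_wpM2l; first exact: ltW.
have : cabs z ^+ 2 * (cabs z / 2) <= cabs z ^+ 2 * cabs w by rewrite ler_wpM2l ?exprn_ge0 // ltW.
rewrite exprS; nra.
Qed.

Lemma cder_segment z w t : cder (fun s => z + s%:C * w) t w.
Proof.
split.
  rewrite (_ : (fun _ => _) = fun s => complex.Re w * s + complex.Re z).
    exact: daffine.
  by apply/funext => s; rewrite raddfD; case: w => * /=; ring.
rewrite (_ : (fun _ => _) = fun s => complex.Im w * s + complex.Im z).
  exact: daffine.
by apply/funext => s; rewrite raddfD; case: w => * /=; ring.
Qed.

End ComplexCurves.


Section Cauchy.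
Variable R : realType.
Implicit Types (g : R -> R) (s t r x : R) (z w : R[i]).

Lemma eit_sub_neq0 t z : cabs z < 1 -> eit t - z != 0.
Proof.
by move=> z1; rewrite -cabs_gt0; have := cabsB_ge (eit t) z; rewrite cabs_eit; lra.
Qed.

Lemma eit_sub_ge t z : 1 - cabs z <= cabs (eit t - z).
Proof. by have := cabsB_ge (eit t) z; rewrite cabs_eit. Qed.

Lemma eitD2pi t : eit (t + pi *+ 2) = eit t :> R[i].
Proof. by rewrite !eitE expiD2pi. Qed.

Lemma twopi_gt0 : 0 < pi *+ 2 :> R. Proof. by rewrite mulrn_wgt0 // pi_gt0. Qed.

Lemma ccts_eit_sub z : ccts (fun t => eit t - z).
Proof. by apply: cctsD; [exact: ccts_eit|exact: ccts_cst]. Qed.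

Lemma ccts_kernel n z : cabs z < 1 -> ccts (fun t => eit t / (eit t - z) ^+ n).
Proof.
move=> z1; apply: cctsM; first exact: ccts_eit.
apply: cctsV; first by move=> t; rewrite expf_neq0 // eit_sub_neq0.
elim: n => [|n ih]; first by under eq_fun do rewrite expr0; exact: ccts_cst.
by under eq_fun do rewrite exprS; apply: cctsM => //; exact: ccts_eit_sub.
Qed.

(** The n-th Cauchy-type integral of [g]; [n = 1] is the Cauchy integral and
    [n = 2] its derivative. *)
Definition cauchy g n z : R[i] :=
  cint (fun t => (g t)%:C * (eit t / (eit t - z) ^+ n)) 0 (pi *+ 2).

Lemma ccts_cauchy g n z : continuous g -> cabs z < 1 ->
  ccts (fun t => (g t)%:C * (eit t / (eit t - z) ^+ n)).
Proof. by move=> cg z1; apply: cctsM; [exact: ccts_real|exact: ccts_kernel]. Qed.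

Lemma cauchy_diff g z B : continuous g -> (forall t, `|g t| <= B) -> cabs z < 1 ->
  cdiff (cauchy g 1) z (cauchy g 2 z).
Proof.
move=> cg gB z1 e e0; have p0 := ltW twopi_gt0.
pose rho := 1 - cabs z; have r0 : 0 < rho by rewrite /rho; lra.
have B0 : 0 <= B by apply: le_trans (gB 0).
pose M := 2 * (B / (rho ^+ 2 * (rho / 2)) * (pi *+ 2 - 0)).
have M0 : 0 <= M.
  have q0 : 0 < rho ^+ 2 * (rho / 2) by rewrite mulr_gt0 ?exprn_gt0 ?divr_gt0.
  by rewrite /M subr0 !mulr_ge0 // invr_ge0 ltW.
exists (Num.min (rho / 2) (e / (1 + M))).
  by rewrite lt_min !divr_gt0 // ltr_pwDl.
move=> w; rewrite lt_min [X in _ && X]ltr_pdivlMr ?ltr_pwDl // => /andP[wz wz2].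
have w1 : cabs w < 1.
  by have := cabsB_ge w z; move: wz; rewrite /rho; have := cabs_ge0 z; lra.
have wr t : rho / 2 <= cabs (eit t - w).
  have := eit_sub_ge t z; have := cabsB_ge (eit t - z) (w - z).
  rewrite (_ : eit t - z - (w - z) = eit t - w); [rewrite -/rho; lra|ring].
pose k t := (g t)%:C * (eit t / ((eit t - z) ^+ 2 * (eit t - w))).
have ck : ccts k.
  apply: cctsM; first exact: ccts_real.
  apply: cctsM; first exact: ccts_eit.
  apply: cctsV => [t|]; first by rewrite mulf_neq0 ?expf_neq0 ?eit_sub_neq0.
  under eq_fun do rewrite expr2.
  by do 2?apply: cctsM; exact: ccts_eit_sub.
have -> : cauchy g 1 w - cauchy g 1 z - cauchy g 2 z * (w - z)
    = (w - z) ^+ 2 * cint k 0 (pi *+ 2).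
  rewrite {1}/cauchy (_ : (fun t => _) = fun t =>
    (g t)%:C * (eit t / (eit t - z) ^+ 1) +
    ((w - z) * ((g t)%:C * (eit t / (eit t - z) ^+ 2)) + (w - z) ^+ 2 * k t)).
    have cc n := ccts_cauchy n cg z1.
    rewrite !cintD ?cintZ // -/(cauchy g 1 z) -/(cauchy g 2 z); first by ring.
    - by apply: cctsM => //; exact: ccts_cst.
    - by apply: cctsM => //; exact: ccts_cst.
    - by apply: cctsD; apply: cctsM => //; exact: ccts_cst.
  apply/funext => t; rewrite /k; field.
  by rewrite !eit_sub_neq0.
have I : cabs (cint k 0 (pi *+ 2)) <= M.
  rewrite /M -nint_cst //; apply: cint_le => //; first exact: cont_cst.
  move=> t _; rewrite /k !cabsM cabs_real cabs_eit mul1r cabsV cabsM cabsX.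
  apply: ler_pM => //; first by rewrite invr_ge0 mulr_ge0 ?exprn_ge0 ?cabs_ge0.
  rewrite lef_pV2 ?posrE ?mulr_gt0 ?exprn_gt0 ?cabs_gt0 ?eit_sub_neq0 //.
    apply: ler_pM; [by rewrite exprn_ge0 ?ltW|by rewrite divr_ge0 ?ltW| |exact: wr].
    by rewrite ler_pXn2r ?nnegrE ?cabs_ge0 ?(ltW r0) // eit_sub_ge.
  by rewrite invr_gt0.
rewrite cabsM cabsX; have d0 := cabs_ge0 (w - z).
have A : cabs (w - z) ^+ 2 * cabs (cint k 0 (pi *+ 2)) <= cabs (w - z) ^+ 2 * M.
  by rewrite ler_wpM2l ?exprn_ge0.
apply: le_trans A _; nra.
Qed.

Lemma cint_kernel2 z : cabs z < 1 ->
  cint (fun t => eit t / (eit t - z) ^+ 2) 0 (pi *+ 2) = 0.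
Proof.
move=> z1; rewrite (cintE (h := fun t => 'i%C * (eit t - z)^-1) (ltW twopi_gt0)).
  by rewrite -[pi *+ 2]add0r eitD2pi subrr.
move=> t _.
have d1 : cder (fun t => eit t - z) t ('i%C * eit t).
  have [a b] := @cder_eit R t; split.
    under eq_fun do rewrite raddfB.
    by apply: dE (dB a (is_derive_cst _ _ _)) _; rewrite subr0.
  under eq_fun do rewrite raddfB.
  by apply: dE (dB b (is_derive_cst _ _ _)) _; rewrite subr0.
have d2 := cder_comp (cdiff_inv (eit_sub_neq0 t z1)) d1.
have d3 : cder (fun=> 'i%C : R[i]) t 0 by split; exact: is_derive_cst.
apply: cderE (cderM d3 d2) _; rewrite mul0r add0r.
have ii : 'i%C * 'i%C = -1 :> R[i] by rewrite -expr2 sqr_i.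
rewrite -exprVn; set X := (eit t - z)^-1; move: ii; set I := 'i%C => ii.
transitivity (- (I * I) * (eit t * X ^+ 2)); first by ring.
by rewrite ii opprK mul1r.
Qed.

Lemma cint_kernel1 z : cabs z < 1 ->
  cint (fun t => eit t / (eit t - z) ^+ 1) 0 (pi *+ 2) = (pi *+ 2)%:C.
Proof.
have p0 := ltW twopi_gt0.
pose J w := cauchy (fun=> 1) 1 w.
have JE w : J w = cint (fun t => eit t / (eit t - w) ^+ 1) 0 (pi *+ 2).
  by rewrite /J /cauchy; under eq_fun do rewrite mul1r.
have dJ w : cabs w < 1 -> cdiff J w 0.
  move=> w1; rewrite -[0](cint_kernel2 w1).
  have := @cauchy_diff (fun=> 1) w 1 (@cont_cst R R 1) _ w1.
  rewrite {2}/cauchy; under [X in cint X]eq_fun do rewrite mul1r; apply=> t.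
  by rewrite normr1.
move=> z1; rewrite -JE.
have -> : (pi *+ 2)%:C = J 0.
  rewrite JE (_ : (fun _ => _) = fun=> (1 : R)%:C); last first.
    by apply/funext => t; rewrite subr0 expr1 divff // -cabs_eq0 cabs_eit oner_neq0.
  by rewrite /cint /= !nint_cst // mul1r mul0r subr0.
apply/eqP; rewrite -subr_eq0 -cabs_eq0 eq_le cabs_ge0 andbT.
suff : cabs (J (0 + 1%:C * z) - J (0 + 0%:C * z)) <= 2 * (0 - 0).
  by rewrite subr0 mulr0 !add0r [_ * z]mul1r [_ * z]mul0r.
apply: (@cder_cmean R (fun s => J (0 + s%:C * z)) (fun=> 0) (fun=> 0) (fun=> 0) 0 1 ler01).
- move=> t t01; have t1 : cabs (0 + t%:C * z) < 1.
    rewrite add0r cabsM cabs_real ger0_norm; last lra.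
    by have := cabs_ge0 z; nra.
  exact: cderE (cder_comp (dJ _ t1) (cder_segment 0 z t)) (mul0r z).
- by move=> t _; exact: is_derive_cst.
- by move=> t _; rewrite cabs0.
Qed.

Lemma cos_ge x : 0 <= x -> 1 - x ^+ 2 / 2 <= cos x.
Proof.
move=> x0.
have d1 : primitive_on (fun t => - t) (fun t => -1 / 2 * (t * t)) 0 x.
  move=> t _; apply: dE (dZ _ (dM (is_derive_id t 1) (is_derive_id t 1))) _.
  by rewrite mul1r mulr1; field.
have d2 : primitive_on (fun t => - sin t) (@cos R) 0 x by move=> t _; exact: is_derive_cos.
have h := mean_value_le x0 d1 d2; rewrite cos0 in h.
have {}h : -1 / 2 * (x * x) - -1 / 2 * (0 * 0) <= cos x - 1.
  apply: h => t /andP[t0 _]; rewrite lerN2.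
  by have := sin_lip t 0; rewrite sin0 !subr0 (ger0_norm t0); apply: le_trans; exact: ler_norm.
by rewrite expr2; lra.
Qed.

Lemma sin_ge x : 0 <= x <= pi / 2 -> x / 4 <= sin x.
Proof.
move=> /andP[x0 xp].
have dS u v : primitive_on (@cos R) (@sin R) u v by move=> t _; exact: is_derive_sin.
have half (y : R) : 0 <= y <= 1 -> y / 2 <= sin y.
  move=> /andP[y0 y1].
  have d1 : primitive_on (fun=> 1 / 2) (fun t => 1 / 2 * t + 0) 0 y.
    by move=> t _; exact: daffine.
  have h := mean_value_le y0 d1 (dS 0 y).
  have {}h : 1 / 2 * y + 0 - (1 / 2 * 0 + 0) <= sin y - sin 0.
    by apply: h => t ht; have := @cos_ge t; rewrite expr2; nra.
  by rewrite sin0 in h; lra.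
case: (leP x 1) => x1; first by have := half x; lra.
have d1 : primitive_on (fun=> 0) (fun=> 0 : R) 1 x by move=> t _; exact: is_derive_cst.
have h := mean_value_le (ltW x1) d1 (dS 1 x).
have {}h : 0 - 0 <= sin x - sin 1.
  apply: h => t ht; apply: cos_ge0_pihalf; have := pi_gt0 R; lra.
have := half 1; have := pihalf_lt2 R; lra.
Qed.

Lemma eit_sub_chord s t : `|t - s| <= pi -> `|t - s| / 4 <= cabs (eit t - eit s).
Proof.
move=> ts.
have e : cabs (eit t - eit s) ^+ 2 = (2 * sin (`|t - s| / 2)) ^+ 2.
  rewrite cabs_sqr /= exprMn sin2cos2.
  have := cos_mulr2n (`|t - s| / 2); rewrite (_ : (`|t - s| / 2) *+ 2 = `|t - s|).
    rewrite cos_norm cosB => h.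
    have := cos2Dsin2 t; have := cos2Dsin2 s; move: h.
    rewrite !expr2; nra.
  by rewrite mulr2n; field.
have s0 : 0 <= `|t - s| / 2 <= pi / 2 by rewrite divr_ge0 //= ler_pM2r // invr_gt0.
have sg := sin_ge s0.
rewrite -ler_sqr ?nnegrE ?cabs_ge0 ?divr_ge0 // e ler_sqr ?nnegrE; lra.
Qed.

Lemma kernel_ge r s t : 0 <= r < 1 -> `|t - s| <= pi ->
  ((1 - r) + `|t - s|) / 16 <= cabs (eit t - r%:C * eit s).
Proof.
move=> /andP[r0 r1] ts.
have A := eit_sub_ge t (r%:C * eit s).
have B := cabs_dist (eit t) (eit s) (r%:C * eit s).
have C := eit_sub_chord ts; have D : cabs (r%:C * eit s - eit s) = 1 - r.
  rewrite -[X in _ - X]mul1r -mulrBl cabsM cabs_eit mulr1 -(rmorphB (real_complex R) r 1).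
  by rewrite cabs_real ler0_norm; lra.
rewrite cabsM cabs_eit mulr1 cabs_real ger0_norm // in A.
lra.
Qed.

Lemma cont_shift_powR (p rho s : R) : 0 < rho ->
  continuous (fun t => (rho + `|t - s|) `^ p).
Proof.
move=> r0.
have cN : continuous (fun x : R => `|x|) by move=> u; exact: norm_continuous.
have cI : continuous (fun x : R => x) by move=> u; exact: cvg_id.
have c1 : continuous (fun t => rho + `|t - s|).
  apply: contD; first exact: cont_cst.
  by apply: cont_comp => //; apply: contB => //; exact: cont_cst.
move=> t; have d : derivable (fun x : R => x `^ p) (rho + `|t - s|) 1.
  by have [] := is_derive1_powR p (ltr_pwDl r0 (normr_ge0 (t - s))).
have c2 : {for rho + `|t - s|, continuous (fun x : R => x `^ p)}.
  by apply: differentiable_continuous; apply/derivable1_diffP.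
exact: (continuous_comp (c1 t) c2).
Qed.

Lemma nint_shift_powR (d rho s : R) : 0 < d < 1 -> 0 < rho ->
  nint (fun t => (rho + `|t - s|) `^ (d - 2)) (s - pi) (s + pi)
    <= 2 / (1 - d) * rho `^ (d - 1).
Proof.
move=> /andP[d0 d1] r0; have p0 := pi_gt0 R.
have cf := @cont_shift_powR (d - 2) rho s r0.
have dn : d - 1 != 0 by lra.
have dP k c t : 0 < k * t + c ->
  is_derive t 1 (fun t => (d - 1)^-1 * (k * t + c) `^ (d - 1)) (k * (k * t + c) `^ (d - 2)).
  move=> h; have := @dcomp R (fun x => x `^ (d - 1)) (fun t => k * t + c) t _ _
    (is_derive1_powR (d - 1) h) (daffine k c t).
  move=> /(dZ (d - 1)^-1) /dE; apply.
  by rewrite (_ : d - 1 - 1 = d - 2); [field|ring].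
rewrite (@nint_cat _ _ _ s) //; [|lra|lra].
rewrite (@nintE _ _ (fun t => - ((d - 1)^-1 * (-1 * t + (rho + s)) `^ (d - 1)))); last 2 first.
- lra.
- move=> t ht; have h : 0 < -1 * t + (rho + s) by lra.
  have := dZ (-1) (dP (-1) (rho + s) t h).
  under eq_fun do rewrite mulN1r.
  move=> /dE; apply; rewrite mulrA mulrNN !mul1r; congr (_ `^ _).
  by rewrite ler0_norm; lra.
rewrite (@nintE _ _ (fun t => ((d - 1)^-1 * (1 * t + (rho - s)) `^ (d - 1)))); last 2 first.
- lra.
- move=> t ht; have h : 0 < 1 * t + (rho - s) by lra.
  move: (dP 1 (rho - s) t h) => /dE; apply; rewrite mul1r; congr (_ `^ _).
  by rewrite ger0_norm; lra.
rewrite (_ : -1 * s + (rho + s) = rho); last by ring.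
rewrite (_ : 1 * s + (rho - s) = rho); last by ring.
rewrite (_ : (d - 1)^-1 = - (1 - d)^-1); last by rewrite -invrN opprB.
set a := _ `^ _; set b := _ `^ _; set c := _ `^ _.
have i0 : 0 < (1 - d)^-1 by rewrite invr_gt0; lra.
have b0 : 0 <= b by exact: powR_ge0.
have c0 : 0 <= c by exact: powR_ge0.
nra.
Qed.

End Cauchy.


Section PowerLaws.
Variable R : realType.
Implicit Types (x y a b p d : R).

Lemma powR_anti p x y : p <= 0 -> 0 < x -> x <= y -> y `^ p <= x `^ p.
Proof.
move=> p0 x0 xy; have y0 : 0 < y by exact: lt_le_trans xy.
rewrite -(opprK p) !(powRN _ (- p)) lef_pV2 ?posrE ?powR_gt0 //.
by apply: ge0_ler_powR; rewrite ?nnegrE ?(ltW x0) ?(ltW y0) //; lra.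
Qed.

Lemma powR_mono d x y : 0 <= d -> 0 <= x -> x <= y -> x `^ d <= y `^ d.
Proof.
by move=> d0 x0 xy; apply: ge0_ler_powR; rewrite ?nnegrE // (le_trans x0).
Qed.

Lemma powR_subadd d a b : 0 < d < 1 -> 0 <= a -> 0 <= b ->
  (a + b) `^ d <= a `^ d + b `^ d.
Proof.
move=> /andP[d0 d1]; rewrite le_eqVlt => /orP[/eqP <-|a0].
  by rewrite add0r powR0 ?gt_eqF // add0r.
rewrite le_eqVlt => /orP[/eqP <-|b0]; first by rewrite addr0 powR0 ?gt_eqF // addr0.
have ab : 0 < a + b by rewrite addr_gt0.
have split_ x : 0 < x -> x `^ d = x * x `^ (d - 1).
  by move=> x0; rewrite mulr_powRB1 // ltW.
rewrite !split_ // mulrDl; apply: lerD; apply: ler_wpM2l; rewrite ?(ltW a0) ?(ltW b0) //.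
  by apply: powR_anti; lra.
by apply: powR_anti; lra.
Qed.

Lemma powR_small (N d e : R) : 0 < d -> 0 < e -> exists2 r0, 0 < r0 &
  forall r, 0 <= r -> r < r0 -> N * r `^ d <= e.
Proof.
move=> d0 e0; pose q := (e / (1 + `|N|)) `^ d^-1.
have n0 : 0 < 1 + `|N| by rewrite ltr_pwDl.
have q0 : 0 < q by rewrite powR_gt0 // divr_gt0.
exists q => // r r0 rq.
have : r `^ d <= e / (1 + `|N|).
  have -> : e / (1 + `|N|) = q `^ d.
    by rewrite /q -powRrM mulVf ?gt_eqF // powRr1 // ltW // divr_gt0.
  by apply: powR_mono; rewrite // ltW.
rewrite ler_pdivlMr // mulrDr mulr1 => h.
apply: (@le_trans _ _ (`|N| * r `^ d)).
  by rewrite ler_wpM2r ?powR_ge0 // ler_norm.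
by rewrite mulrC; have := powR_ge0 r d; lra.
Qed.

(** McShane's extension: the lower envelope of the cones [u y + w x y]. *)
Lemma mcshane (T : Type) (w : T -> T -> R) (D : set T) (u : T -> R) :
  (forall x : T, w x x = 0) -> (forall x y : T, w x y = w y x) ->
  (forall x y z : T, w x z <= w x y + w y z) -> D !=set0 ->
  (forall x y : T, D x -> D y -> u x - u y <= w x y) ->
  exists v : T -> R, (forall x : T, D x -> v x = u x) /\
    (forall x y : T, `|v x - v y| <= w x y).
Proof.
move=> w0 wC wT [a Da] uw.
pose S (x : T) := [set u y + w x y | y in D].
have lb (x y : T) : D y -> u a - w a x <= u y + w x y.
  by move=> Dy; have := uw a y Da Dy; have := wT a x y; lra.
have hS (x : T) : has_inf (S x).
  split; first by exists (u a + w x a), a.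
  by exists (u a - w a x) => _ [y Dy <-]; exact: lb.
exists (fun x : T => inf (S x)); split=> [x Dx|x y].
  apply/eqP; rewrite eq_le; apply/andP; split.
    by rewrite -[leRHS]addr0 -(w0 x); apply: (ge_inf (hS x).2); exists x.
  by apply: lb_le_inf; [exact: (hS x).1|move=> _ [y Dy <-]; have := uw x y Dx Dy; lra].
have key (x' y' : T) : inf (S x') <= inf (S y') + w x' y'.
  rewrite -lerBlDr; apply: lb_le_inf; first exact: (hS y').1.
  move=> _ [z Dz <-]; have := wT x' y' z.
  have : inf (S x') <= u z + w x' z by apply: (ge_inf (hS x').2); exists z.
  lra.
by rewrite ler_norml; have := key x y; have := key y x; rewrite (wC y x); lra.
Qed.

End PowerLaws.

Section Privalov.
Variables (R : realType) (d : R).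
Hypothesis d01 : 0 < d < 1.
Implicit Types (g : R -> R) (s t r x K : R) (z w : R[i]).

Definition holder K g := forall s t, `|g s - g t| <= K * `|s - t| `^ d.

Let d0 : 0 < d. Proof. by case/andP: d01. Qed.
Let d1 : d < 1. Proof. by case/andP: d01. Qed.

Lemma holder_ext (D : set R[i]) (F : R[i] -> R[i]) L : 0 <= L -> D !=set0 ->
  (forall z w, D z -> D w -> cabs (F z - F w) <= L * cabs (z - w) `^ d) ->
  exists F', (forall z, D z -> F' z = F z) /\
    forall z w, cabs (F' z - F' w) <= 2 * L * cabs (z - w) `^ d.
Proof.
move=> L0 D0 hF; pose om z w := L * cabs (z - w) `^ d.
have om0 z : om z z = 0 by rewrite /om subrr cabs0 powR0 ?gt_eqF // mulr0.
have omC z w : om z w = om w z by rewrite /om cabsC.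
have omT z w y : om z y <= om z w + om w y.
  rewrite /om -mulrDr ler_wpM2l //; apply: le_trans (powR_subadd d01 _ _);
    rewrite ?cabs_ge0 //.
  by apply: powR_mono; [exact: ltW|exact: cabs_ge0|exact: cabs_dist].
have [|u [uE uL]] := @mcshane R R[i] om D (fun z => complex.Re (F z)) om0 omC omT D0.
  move=> z w Dz Dw; rewrite -raddfB; apply: le_trans (hF z w Dz Dw).
  by apply: le_trans (Re_le_cabs _); exact: ler_norm.
have [|v [vE vL]] := @mcshane R R[i] om D (fun z => complex.Im (F z)) om0 omC omT D0.
  move=> z w Dz Dw; rewrite -raddfB; apply: le_trans (hF z w Dz Dw).
  by apply: le_trans (Im_le_cabs _); exact: ler_norm.
exists (fun z => u z +i* v z); split=> [z Dz|z w].
  by rewrite uE // vE //; case: (F z).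
apply: le_trans (cabs_le _) _ => /=.
by have := uL z w; have := vL z w; rewrite /om; lra.
Qed.

Lemma cdiff_mean (F F' : R[i] -> R[i]) z v (G G' : R -> R) h : 0 <= h ->
  (forall t, 0 <= t <= h -> cdiff F (z + t%:C * v) (F' (z + t%:C * v))) ->
  primitive_on G' G 0 h ->
  (forall t, 0 <= t <= h -> cabs (F' (z + t%:C * v) * v) <= G' t) ->
  cabs (F (z + h%:C * v) - F z) <= 2 * (G h - G 0).
Proof.
move=> h0 dF dG hG.
have e0 : z + 0%:C * v = z by rewrite [_ * v]mul0r addr0.
have := @cder_cmean R (fun t => F (z + t%:C * v)) (fun t => F' (z + t%:C * v) * v)
  G G' 0 h h0.
rewrite e0; apply => // t ht.
exact: (cder_comp (dF t ht) (cder_segment z v t)).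
Qed.

(** Hardy and Littlewood: both points are first moved towards the centre by
    about their distance, where the derivative is under control. *)
Lemma hardy_littlewood (F F' : R[i] -> R[i]) A : 0 <= A ->
  (forall z, cabs z < 1 -> cdiff F z (F' z)) ->
  (forall z, cabs z < 1 -> cabs (F' z) <= A * (1 - cabs z) `^ (d - 1)) ->
  forall z w, cabs z < 1 -> cabs w < 1 ->
    cabs (F z - F w) <= 12 / d * A * cabs (z - w) `^ d.
Proof.
move=> A0 dF hF; have dp := d0; have dq := d1.
have radial z h : cabs z < 1 -> 0 < h < 1 ->
    cabs (F (z + h%:C * - z) - F z) <= 4 / d * A * h `^ d.
  move=> z1 /andP[h0 h1]; set rho := 1 - cabs z.
  have r0 : 0 < rho by rewrite /rho; lra.
  have zt t : 0 <= t <= h -> cabs (z + t%:C * - z) = (1 - t) * cabs z.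
    move=> ht; rewrite (_ : z + t%:C * - z = (1 - t)%:C * z).
      by rewrite cabsM cabs_real ger0_norm //; lra.
    by rewrite rmorphB /= mulrBl mul1r mulrN.
  pose q t := 1 / 2 * t + rho / 2.
  have q0 t : 0 <= t -> 0 < q t by rewrite /q; lra.
  have dG : primitive_on (fun t => A * q t `^ (d - 1))
                         (fun t => 2 * A / d * q t `^ d) 0 h.
    move=> t /andP[t0 _].
    have := @dcomp R (fun x => x `^ d) q t _ _
      (is_derive1_powR d (q0 t t0)) (daffine (1 / 2) (rho / 2) t).
    move=> /(dZ (2 * A / d)) /dE; apply; field.
    by rewrite gt_eqF.
  have z0 := cabs_ge0 z.
  have zlt t : 0 <= t <= h -> cabs (z + t%:C * - z) < 1.
    by move=> ht; rewrite zt //; nra.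
  have := cdiff_mean (ltW h0) (fun t ht => dF _ (zlt t ht)) dG.
  move=> H; apply: le_trans (H _) _ => [t ht|].
    rewrite cabsM cabsN.
    apply: (@le_trans _ _ (cabs (F' (z + t%:C * - z)))).
      by rewrite -[leRHS]mulr1 ler_wpM2l ?cabs_ge0 ?ltW.
    apply: le_trans (hF _ (zlt t ht)) _; rewrite ler_wpM2l // zt //.
    have dm : d - 1 <= 0 by rewrite subr_le0 ltW.
    apply: powR_anti; [by []|by apply: q0; lra|].
    rewrite /q /rho; nra.
  have sub : q h `^ d <= (h / 2) `^ d + (rho / 2) `^ d.
    rewrite /q (_ : 1 / 2 * h = h / 2); last by field.
    by apply: powR_subadd; rewrite ?divr_ge0 // ltW.
  have m : (h / 2) `^ d <= h `^ d by apply: powR_mono; lra.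
  have -> : q 0 = rho / 2 by rewrite /q mulr0 add0r.
  have -> : 4 / d * A * h `^ d = 2 * (2 * A / d * h `^ d) by ring.
  rewrite -mulrBr; apply: ler_wpM2l => //; apply: ler_wpM2l; last lra.
  by rewrite divr_ge0 ?mulr_ge0 // ltW.
move=> z w z1 w1.
have [->|zw] := eqVneq z w.
  by rewrite !subrr cabs0 !mulr_ge0 ?powR_ge0 ?invr_ge0 // ltW.
pose D := cabs (z - w); pose h := D / 2.
have D0 : 0 < D by rewrite cabs_gt0 subr_eq0.
have D2 : D < 2 by have := cabsD z (- w); rewrite cabsN -/D; lra.
have h01 : 0 < h < 1 by rewrite /h; lra.
have h0 : 0 < h by case/andP: h01.
pose z' := z + h%:C * - z; pose w' := w + h%:C * - w.
have z'E : z' = (1 - h)%:C * z by rewrite /z' rmorphB /= mulrBl mul1r mulrN.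
have w'E : w' = (1 - h)%:C * w by rewrite /w' rmorphB /= mulrBl mul1r mulrN.
have mid : cabs (F w' - F z') <= 4 / d * A * h `^ d.
  have seg t : 0 <= t <= 1 -> cabs (z' + t%:C * (w' - z')) <= 1 - h.
    move=> ht; rewrite z'E w'E (_ : _ + _ = (1 - h)%:C * ((1 - t)%:C * z + t%:C * w)).
      rewrite cabsM cabs_real ger0_norm; last by rewrite /h; lra.
      rewrite -[leRHS]mulr1 ler_wpM2l //; first by rewrite /h; lra.
      apply: le_trans (cabsD _ _) _; rewrite !cabsM !cabs_real !ger0_norm; try lra.
      nra.
    rewrite !rmorphB /=; ring.
  have seg1 t : 0 <= t <= 1 -> cabs (z' + t%:C * (w' - z')) < 1.
    by move=> /seg; lra.
  have dG : primitive_on (fun=> A * h `^ (d - 1) * D)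
      (fun t => A * h `^ (d - 1) * D * t + 0) 0 1.
    by move=> t _; exact: daffine.
  have := cdiff_mean ler01 (fun t ht => dF _ (seg1 t ht)) dG.
  have -> : z' + 1%:C * (w' - z') = w' by rewrite [_ * _]mul1r addrC subrK.
  move=> H.
  apply: le_trans (H _) _ => [t ht|].
    rewrite cabsM; apply: ler_pM; rewrite ?cabs_ge0 //.
      apply: le_trans (hF _ (seg1 t ht)) _; rewrite ler_wpM2l //.
      by apply: powR_anti; [rewrite subr_le0 ltW|by []|have := seg t ht; lra].
    rewrite z'E w'E -mulrBr cabsM cabs_real cabsC -/D ger0_norm.
      by rewrite /h; nra.
    by rewrite /h; lra.
  have -> : D = 2 * h by rewrite /h; field.
  have -> : A * h `^ (d - 1) * (2 * h) = 2 * A * h `^ d.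
    by rewrite -(mulr_powRB1 (ltW h0) d0); ring.
  rewrite mulr1 mulr0 !addr0 subr0 mulrA.
  have -> : 2 * (2 * A) * h `^ d = 4 * A * h `^ d by ring.
  rewrite ler_wpM2r ?powR_ge0 // ler_wpM2r // ler_pdivlMr //; lra.
have Z := radial z h z1 h01; have W := radial w h w1 h01.
have hD : h `^ d <= D `^ d by apply: powR_mono; rewrite /h; lra.
have c0 : 0 <= 4 / d * A by rewrite !mulr_ge0 // invr_ge0 ltW.
have T : cabs (F z - F w) <= 12 / d * A * h `^ d.
  rewrite (_ : 12 / d * A * h `^ d = 4 / d * A * h `^ d + (4 / d * A * h `^ d + 4 / d * A * h `^ d)).
    apply: le_trans (cabs_dist _ _ (F z')) _; rewrite cabsC lerD //.
    by apply: le_trans (cabs_dist _ _ (F w')) _; rewrite cabsC lerD.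
  ring.
apply: le_trans T _; rewrite ler_wpM2l // !mulr_ge0 // invr_ge0 ltW //.
Qed.

End Privalov.


Section Periodic.
Variable R : realType.

Lemma periodic_shift (g : R -> R) : (forall t, g (t + pi *+ 2) = g t) ->
  forall t, exists2 c, 0 <= t - c <= pi *+ 2 & forall v, g (v - c) = g v.
Proof.
move=> per t; pose n := Num.floor (t / (pi *+ 2)); exists ((pi *+ 2) *~ n).
  have := floor_itv (t / (pi *+ 2)); rewrite -/n.
  rewrite ler_pdivlMr ?twopi_gt0 // ltr_pdivrMr ?twopi_gt0 //.
  rewrite -(mulrzl (pi *+ 2)) intrD mulrDl mul1r.
  by move=> /andP[? ?]; apply/andP; split; lra.
have pern m x : g (x + (pi *+ 2) *+ m) = g x.
  elim: m => [|m ih]; first by rewrite mulr0n addr0.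
  by rewrite mulrSr addrA per.
move=> v; case: n => m; first by rewrite -pmulrn -{2}(subrK ((pi *+ 2) *+ m) v) pern.
by rewrite NegzE mulrNz opprK -pmulrn pern.
Qed.

Lemma periodic_le (g : R -> R) B : (forall t, g (t + pi *+ 2) = g t) ->
  (forall u, 0 <= u <= pi *+ 2 -> `|g u - g 0| <= B) -> forall t, `|g t| <= `|g 0| + B.
Proof.
move=> per hB t; have [c ct gc] := periodic_shift per t.
rewrite -gc -[g (t - c)](subrK (g 0)) addrC; apply: le_trans (ler_normD _ _) _.
by rewrite lerD2l; exact: hB.
Qed.

End Periodic.

Section Herglotz.
Variables (R : realType) (d : R).
Hypothesis d01 : 0 < d < 1.
Implicit Types (s t r x : R) (z w : R[i]).
Variables (g : R -> R) (K : R).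
Hypotheses (cg : continuous g) (per : forall t, g (t + pi *+ 2) = g t).
Hypotheses (K0 : 0 <= K) (hg : holder d K g).

Lemma periodic_bounded : exists B, forall t, `|g t| <= B.
Proof.
exists (`|g 0| + K * (pi *+ 2) `^ d); apply: periodic_le => // u /andP[u0 u1].
apply: le_trans (hg _ _) _; rewrite subr0 ger0_norm //.
apply: ler_wpM2l => //; apply: powR_mono => //.
by case/andP: d01 => /ltW.
Qed.

Lemma kernel_weight r s t : 0 <= r < 1 -> `|t - s| <= pi ->
  `|g t - g s| / cabs (eit t - r%:C * eit s) ^+ 2
    <= 256 * K * (1 - r + `|t - s|) `^ (d - 2).
Proof.
move=> r01 ts; have h := kernel_ge r01 ts; case/andP: r01 => r0 r1.
case/andP: d01 => d0 d1.
pose q := 1 - r + `|t - s|; rewrite -/q in h *.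
have q0 : 0 < q by rewrite /q; have := normr_ge0 (t - s); lra.
have A : `|g t - g s| <= K * q `^ d.
  apply: le_trans (hg _ _) _; rewrite ler_wpM2l //; apply: powR_mono => //; first lra.
  by rewrite /q; lra.
have c0 : 0 < cabs (eit t - r%:C * eit s) by apply: lt_le_trans h; rewrite divr_gt0.
have B : (cabs (eit t - r%:C * eit s) ^+ 2)^-1 <= 256 * q ^- 2.
  rewrite (_ : 256 * q ^- 2 = ((q / 16) ^+ 2)^-1); last by field; lra.
  rewrite lef_pV2 ?posrE ?exprn_gt0 ?divr_gt0 //.
  by rewrite ler_sqr ?nnegrE ?cabs_ge0 // divr_ge0 // ltW.
have -> : 256 * K * q `^ (d - 2) = K * q `^ d * (256 * q ^- 2).
  rewrite powRD; last by rewrite (gt_eqF q0) implybT.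
  by rewrite (powR_invn 2 (ltW q0)); ring.
by apply: ler_pM; rewrite ?invr_ge0 ?exprn_ge0 ?cabs_ge0.
Qed.

Lemma polar z : exists r s, [/\ 0 <= r, r = cabs z & z = r%:C * eit s].
Proof.
exists (cabs z); have [->|z0] := eqVneq z 0.
  by exists 0; rewrite cabs0 mul0r; split.
have c0 : 0 < cabs z by rewrite cabs_gt0.
have h : `|z / (cabs z)%:C| == 1.
  by rewrite cabsE cabsM cabsV cabs_real (ger0_norm (ltW c0)) divff ?(gt_eqF c0) // rmorph1 eqxx.
have [s hs] := expi_surj (exist _ (z / (cabs z)%:C) h : circle R).
exists s; rewrite eitE -hs /=; split; [exact: ltW|by []|].
by rewrite mulrC divfK // -cabs_eq0 cabs_real normr_eq0 gt_eqF.
Qed.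

Lemma shift_interval (f : R -> R[i]) s : ccts f -> (forall t, f (t + pi *+ 2) = f t) ->
  cint f 0 (pi *+ 2) = cint f (s - pi) (s + pi).
Proof.
move=> cf pf; have := cint_period 0 (s - pi) (ltW (twopi_gt0 R)) cf pf.
rewrite add0r => ->; congr cint; rewrite mulr2n; ring.
Qed.

Lemma cauchy2_bound z : cabs z < 1 ->
  cabs (cauchy g 2 z) <= 1024 * K / (1 - d) * (1 - cabs z) `^ (d - 1).
Proof.
move=> z1; have [r [s [r0 rz zE]]] := polar z; have p0 := pi_gt0 R.
have r1 : 0 < 1 - r by lra.
have cg' : continuous (fun t => g t - g s) by apply: contB => //; exact: cont_cst.
have -> : cauchy g 2 z = cint (fun t => (g t - g s)%:C * (eit t / (eit t - z) ^+ 2))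
    (s - pi) (s + pi).
  rewrite -shift_interval; last 2 first.
  - exact: ccts_cauchy cg' z1.
  - by move=> t; rewrite per eitD2pi.
  rewrite (_ : (fun t => _) = fun t => (g t)%:C * (eit t / (eit t - z) ^+ 2)
      + (- g s)%:C * (eit t / (eit t - z) ^+ 2)).
    rewrite cintD ?cintZ ?(ltW (twopi_gt0 R)) ?cint_kernel2 ?mulr0 ?addr0 //.
    - exact: ccts_kernel.
    - exact: ccts_cauchy.
    - by apply: cctsM; [exact: ccts_cst|exact: ccts_kernel].
  by apply/funext => t; rewrite rmorphB rmorphN /=; ring.
have cw : continuous (fun t => 256 * K * (1 - r + `|t - s|) `^ (d - 2)).
  by apply: contM; [exact: cont_cst|exact: cont_shift_powR].
apply: le_trans (@cint_le _ _ (fun t => 256 * K * (1 - r + `|t - s|) `^ (d - 2)) _ _ _ _ _ _) _ => //.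
- lra.
- exact: ccts_cauchy cg' z1.
- move=> t ht; rewrite cabsM cabs_real cabsM cabs_eit mul1r cabsV cabsX zE.
  by apply: kernel_weight; [lra|rewrite ler_norml; lra].
rewrite nintZ; [|lra|exact: cont_shift_powR].
have h := nint_shift_powR s d01 r1; rewrite -rz.
have -> : 1024 * K / (1 - d) * (1 - r) `^ (d - 1)
  = 2 * (256 * K * (2 / (1 - d) * (1 - r) `^ (d - 1))) by ring.
by rewrite ler_wpM2l // ler_wpM2l // mulr_ge0.
Qed.

Definition herglotz z : R[i] :=
  (pi^-1)%:C * cauchy g 1 z - (nint g 0 (pi *+ 2) / (pi *+ 2))%:C.

Lemma herglotz_diff z : cabs z < 1 ->
  cdiff herglotz z ((pi^-1)%:C * cauchy g 2 z).
Proof.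
move=> z1; have [B hB] := periodic_bounded.
have dc := cauchy_diff cg hB z1 => e e0; have p0 := pi_gt0 R.
have [|dl dl0 h] := dc (e * pi); first by rewrite mulr_gt0.
exists dl => // w /h H.
rewrite (_ : _ - _ - _ = (pi^-1)%:C * (cauchy g 1 w - cauchy g 1 z - cauchy g 2 z * (w - z))).
  rewrite cabsM cabs_real ger0_norm ?invr_ge0 ?(ltW p0) // ler_pdivrMl //.
  by rewrite mulrA (mulrC pi).
rewrite /herglotz; ring.
Qed.

Lemma herglotz_re r s : 0 <= r < 1 ->
  `|complex.Re (herglotz (r%:C * eit s)) - g s| <= 1024 * K / (1 - d) * (1 - r) `^ d.
Proof.
move=> r01; have p0 := pi_gt0 R; have p20 := twopi_gt0 R.
pose z := r%:C * eit s; rewrite -/z; case/andP: (r01) => r0 r1; case/andP: d01 => d0 d1.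
have zr : cabs z = r by rewrite cabsM cabs_eit mulr1 cabs_real ger0_norm.
have z1 : cabs z < 1 by rewrite zr.
have q1 : 0 < 1 - r by lra.
have cg' : continuous (fun t => g t - g s) by apply: contB => //; exact: cont_cst.
pose k t := (g t - g s)%:C * (2 * (eit t / (eit t - z) ^+ 1) - 1).
have ck : ccts k.
  apply: cctsM; first exact: ccts_real.
  apply: cctsD; last exact: ccts_cst.
  by apply: cctsM; [exact: ccts_cst|exact: ccts_kernel].
have E : herglotz z - (g s)%:C = ((pi *+ 2)^-1)%:C * cint k (s - pi) (s + pi).
  rewrite -shift_interval //; last by move=> t; rewrite /k per eitD2pi.
  rewrite (_ : k = fun t => 2 * ((g t)%:C * (eit t / (eit t - z) ^+ 1))
      + ((-2 * g s)%:C * (eit t / (eit t - z) ^+ 1) + (g s - g t)%:C)).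
    have c1 : ccts (fun t => 2 * ((g t)%:C * (eit t / (eit t - z) ^+ 1))).
      by apply: cctsM; [exact: ccts_cst|exact: ccts_cauchy].
    have c2 : ccts (fun t => (-2 * g s)%:C * (eit t / (eit t - z) ^+ 1)).
      by apply: cctsM; [exact: ccts_cst|exact: ccts_kernel].
    have c3 : continuous (fun t => g s - g t) by apply: contB => //; exact: cont_cst.
    rewrite cintD ?(ltW p20) //; last by apply: cctsD => //; exact: ccts_real.
    rewrite cintZ ?(ltW p20) //; last exact: ccts_cauchy.
    rewrite cintD ?(ltW p20) //; last exact: ccts_real.
    rewrite cintZ ?(ltW p20) ?cint_kernel1 //; last exact: ccts_kernel.
    rewrite (_ : cint (fun t => (g s - g t)%:C) _ _ = (g s * (pi *+ 2) - nint g 0 (pi *+ 2))%:C).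
      rewrite /herglotz -/(cauchy g 1 z).
      have t2 : 2 = (2 : R)%:C :> R[i] by rewrite rmorph_nat.
      have p2 : pi *+ 2 = 2 * pi :> R by rewrite mulr_natl.
      rewrite t2 p2; case: (cauchy g 1 z) => u v; apply/eqP; rewrite eq_complex /=.
      move: (lt0r_neq0 p0) (nint g _ _); generalize (pi : R) => q q0 I.
      by apply/andP; split; apply/eqP; field.
    rewrite /cint /= nintB ?nint_cst ?(ltW p20) //; last exact: cont_cst.
    by rewrite subr0 mul0r.
  by apply/funext => t; rewrite /k !rmorphB rmorphM rmorphN rmorph_nat /=; ring.
have -> : complex.Re (herglotz z) - g s = (pi *+ 2)^-1 * nint (fun t => complex.Re (k t)) (s - pi) (s + pi).
  have ReZ x w : complex.Re (x%:C * w) = x * complex.Re w.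
    by case: w => u v /=; rewrite mul0r subr0.
  by have := congr1 (@complex.Re R) E; rewrite raddfB ReZ.
have cw : continuous (fun t => 256 * K * (1 - r + `|t - s|) `^ (d - 2)).
  by apply: contM; [exact: cont_cst|exact: cont_shift_powR].
have N : `|nint (fun t => complex.Re (k t)) (s - pi) (s + pi)|
    <= nint (fun t => 2 * (1 - r) * (256 * K * (1 - r + `|t - s|) `^ (d - 2))) (s - pi) (s + pi).
  apply: nint_norm; [lra|exact: ck.1|by apply: contM => //; exact: cont_cst|].
  move=> t ht.
  have zt := eit_sub_neq0 t z1.
  have -> : complex.Re (k t) = (g t - g s) * ((1 - r ^+ 2) / cabs (eit t - z) ^+ 2).
    have -> : complex.Re (k t) = (g t - g s) *
        complex.Re (2 * (eit t / (eit t - z) ^+ 1) - 1).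
      by rewrite /k; case: (_ - 1) => u v /=; ring.
    congr (_ * _).
    have n1 := cabs_sqr (eit t); have n2 := cabs_sqr z; have n3 := cabs_sqr (eit t - z).
    rewrite cabs_eit in n1; rewrite zr in n2.
    have c0 : cabs (eit t - z) ^+ 2 != 0 by rewrite expf_neq0 // cabs_eq0.
    rewrite expr1 (_ : 2 * (eit t / (eit t - z)) - 1 = (eit t + z) / (eit t - z)); last first.
      by field.
    move: n1 n2 n3 c0; case: (z) => a b; case: (eit t) => u v /= n1 n2 n3 c0.
    rewrite -n3; apply/eqP; rewrite eq_sym; apply/eqP.
    have n3' : (u - a) ^+ 2 + (v - b) ^+ 2 != 0 by rewrite -n3.
    rewrite n3 n2 (_ : 1 - (a ^+ 2 + b ^+ 2) = u ^+ 2 + v ^+ 2 - (a ^+ 2 + b ^+ 2)).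
      by field.
    by rewrite -n1 expr1n.
  rewrite normrM (@ger0_norm _ (_ / _)); last first.
    by rewrite divr_ge0 ?exprn_ge0 ?cabs_ge0 // subr_ge0 expr_le1 // ltW.
  have W := @kernel_weight r s t r01; rewrite mulrCA.
  have {}W : `|g t - g s| / cabs (eit t - z) ^+ 2 <= 256 * K * (1 - r + `|t - s|) `^ (d - 2).
    by apply: W; rewrite ler_norml; lra.
  apply: ler_pM => //.
  - by rewrite subr_ge0 expr_le1 // ltW.
  - by rewrite mulr_ge0 // invr_ge0 exprn_ge0 // cabs_ge0.
  - nra.
rewrite nintZ ?nintZ in N; [|lra|exact: cont_shift_powR|lra|by []].
have h := nint_shift_powR s d01 q1.
rewrite normrM ger0_norm ?invr_ge0 ?(ltW p20) //.
apply: (@le_trans _ _ (1 * (2 * (1 - r) * (256 * K * (2 / (1 - d) * (1 - r) `^ (d - 1)))))).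
  apply: ler_pM => //; first by rewrite invr_ge0 ltW.
    by rewrite invf_le1 // mulr2n; have := pi_ge2 R; lra.
  apply: le_trans N _; apply: ler_wpM2l; first lra.
  by apply: ler_wpM2l => //; rewrite mulr_ge0.
rewrite mul1r -(mulr_powRB1 (ltW q1) d0) le_eqVlt; apply/orP; left; apply/eqP.
set X := powR _ _.
by field; lra.
Qed.

End Herglotz.


Section ConjugateFunction.
Variables (R : realType) (d : R).
Hypothesis d01 : 0 < d < 1.
Implicit Types (f g D : R -> R) (s t r x K : R) (z w : R[i]).

(** [f] is of class C^{1,d} with derivative [D] and norm at most [K]. *)
Definition C1b K f D := [/\ forall t, `|f t| <= K, forall t, `|D t| <= K,
  holder d K D & forall t, is_derive t 1 f (D t)].

Let d0 : 0 < d. Proof. by case/andP: d01. Qed.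
Let d1 : d < 1. Proof. by case/andP: d01. Qed.

Lemma holder_cont K g : holder d K g -> continuous g.
Proof.
move=> hg t; apply/cvgrPdist_le => e e0.
have [q q0 hq] := powR_small K d0 e0.
apply/nbhs_ballP; exists q => //= s; rewrite /ball /= => st.
by apply: le_trans (hg t s) _; exact: hq.
Qed.

Lemma is_derive_taylor f x K t :
  (forall s, `|f s - f t - x * (s - t)| <= K * `|s - t| `^ d * `|s - t|) ->
  is_derive t 1 f x.
Proof.
move=> h; apply/is_derive_epsP => e e0; have [q q0 hq] := powR_small K d0 e0.
exists q => // s st; apply: le_trans (h s) _; rewrite ler_wpM2r //.
exact: hq.
Qed.

Lemma taylor_of_holder K f D s t : 0 <= K -> holder d K D ->
  (forall t, is_derive t 1 f (D t)) ->
  `|f s - f t - D t * (s - t)| <= K * `|s - t| `^ d * `|s - t|.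
Proof.
move=> K0 hD df; apply: (mvt_abs (f' := D)) => // x hx.
apply: le_trans (hD _ _) _; rewrite ler_wpM2l //; apply: powR_mono => //; first exact: ltW.
exact: between_dist hx.
Qed.

(** A bound on the remainder of order one passes to pointwise limits, hence so
    does differentiability with a given Hoelder derivative. *)
Lemma is_derive_lim K f D : 0 <= K ->
  (forall s t e, 0 < e -> exists fk Dk, [/\ holder d K Dk,
     forall x, is_derive x 1 fk (Dk x), `|fk s - f s| <= e, `|fk t - f t| <= e &
     `|Dk t - D t| <= e]) ->
  forall t, is_derive t 1 f (D t).
Proof.
move=> K0 h t; apply: (@is_derive_taylor _ _ K) => s.
apply/ler_addgt0Pl => e e0.
have c0 : 0 < 2 + `|s - t| by rewrite ltr_pwDl.
have [|fk [Dk [hk dk A B C]]] := h s t (e / (2 + `|s - t|)); first by rewrite divr_gt0.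
have T := @taylor_of_holder K fk Dk s t K0 hk dk.
have -> : f s - f t - D t * (s - t) = (fk s - fk t - Dk t * (s - t))
  - (fk s - f s) + (fk t - f t) + (Dk t - D t) * (s - t) by ring.
apply: le_trans (ler_normD _ _) _; apply: le_trans (lerD (ler_normD _ _) (lexx _)) _.
apply: le_trans (lerD (lerD (ler_normB _ _) (lexx _)) (lexx _)) _.
rewrite normrM.
have E : `|Dk t - D t| * `|s - t| <= e / (2 + `|s - t|) * `|s - t| by rewrite ler_wpM2r.
have F : e = e / (2 + `|s - t|) * 2 + e / (2 + `|s - t|) * `|s - t|.
  by rewrite -mulrDr divfK // gt_eqF.
by rewrite {1}F; lra.
Qed.

Lemma holder_of_lip K g : 0 <= K -> (forall t, `|g t| <= K) ->
  (forall s t : R, `|g s - g t| <= K * `|s - t|) -> holder d (2 * K) g.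
Proof.
move=> K0 gK gL s t; have p0 := powR_ge0 `|s - t| d.
have [st|st] := leP 1 `|s - t|.
  have : 1 <= `|s - t| `^ d.
    by have := powR_mono (ltW d0) ler01 st; rewrite powR1.
  have := gK s; have := gK t; have := ler_normB (g s) (g t); nra.
apply: le_trans (gL s t) _.
have [->|nst] := eqVneq s t; first by rewrite subrr normr0 powR0 ?gt_eqF // !mulr0.
have : `|s - t| <= `|s - t| `^ d.
  by apply: ger1_powR; rewrite ?(ltW st) ?(ltW d1) // normr_gt0 subr_eq0 nst.
nra.
Qed.

Lemma C1b_lip K f D s t : C1b K f D -> `|f s - f t| <= K * `|s - t|.
Proof. by move=> [_ hD _ df]; apply: (lip_of_derive (f' := D)) => x _. Qed.

Lemma cdiff_ext (F G : R[i] -> R[i]) z l : cabs z < 1 ->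
  (forall w, cabs w < 1 -> F w = G w) -> cdiff G z l -> cdiff F z l.
Proof.
move=> z1 FG dG e e0; have [q q0 h] := dG e e0.
exists (Num.min q (1 - cabs z)) => [|w]; first by rewrite lt_min q0 subr_gt0.
rewrite lt_min => /andP[/h + wz]; rewrite !FG //.
by have := cabsB_ge w z; lra.
Qed.

Lemma privalov_holder : exists2 C, 0 <= C & forall g K, continuous g ->
  (forall t, g (t + pi *+ 2) = g t) -> 0 <= K -> holder d K g -> exists F,
  [/\ forall z w, cabs (F z - F w) <= C * K * cabs (z - w) `^ d,
      forall z, cabs z < 1 -> F z = herglotz g z &
      forall t, complex.Re (F (eit t)) = g t].
Proof.
have dp := d0; have dq := d1.
pose A := 1024 / (1 - d); have A0 : 0 <= A by rewrite divr_ge0 //; lra.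
have L0 : 0 <= 12 / d * A by apply: mulr_ge0 => //; rewrite divr_ge0 // ltW.
exists (2 * (12 / d * A)) => [|g K cg per K0 hg]; first by rewrite mulr_ge0.
have AK : 0 <= A * K by rewrite mulr_ge0.
have hF z : cabs z < 1 ->
    cabs ((pi^-1)%:C * cauchy g 2 z) <= A * K * (1 - cabs z) `^ (d - 1).
  move=> z1; rewrite cabsM cabs_real ger0_norm ?invr_ge0 ?pi_ge0 //.
  have H := cauchy2_bound d01 cg per K0 hg z1.
  rewrite (_ : A * K = 1024 * K / (1 - d)); last by rewrite /A; ring.
  apply: le_trans H; rewrite -[leRHS]mul1r ler_wpM2r ?cabs_ge0 //.
  by rewrite invf_le1 ?pi_gt0 //; have := pi_ge2 R; lra.
have HL := hardy_littlewood d01 AK (fun z => herglotz_diff d01 cg per K0 hg (z := z)) hF.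
have D0 : @disc R !=set0 by exists 0; rewrite discE cabs0.
have [|z w|F [FE FL]] := holder_ext d01 (L := 12 / d * (A * K)) (F := herglotz g) _ D0.
- by rewrite mulr_ge0 // mulr_ge0 // invr_ge0 ltW.
- by rewrite !discE; exact: HL.
have FE' z : cabs z < 1 -> F z = herglotz g z by rewrite -discE => /FE.
have FL' z w : cabs (F z - F w) <= 2 * (12 / d * A) * K * cabs (z - w) `^ d.
  by apply: le_trans (FL z w) _; rewrite !mulrA.
exists F; split=> // t; apply/eqP; rewrite -subr_eq0 -normr_le0.
apply/ler_addgt0Pl => e e0; rewrite addr0.
pose N := 2 * (12 / d * A) * K + 1024 * K / (1 - d).
have [q q0 hq] := powR_small N dp e0.
pose rho := Num.min (q / 2) (1 / 2).
have r0 : 0 < rho by rewrite lt_min !divr_gt0.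
have r1 : rho <= 1 / 2 by rewrite ge_min lexx orbT.
have rq : rho < q by rewrite gt_min; lra.
have r01 : 0 <= 1 - rho < 1 by lra.
have P := @herglotz_re _ _ d01 _ _ cg per K0 hg (1 - rho) t r01.
have E : 1 - (1 - rho) = rho by ring.
have zE : cabs ((1 - rho)%:C * eit t) = 1 - rho.
  by rewrite cabsM cabs_eit mulr1 cabs_real ger0_norm; lra.
have Q := FL' (eit t) ((1 - rho)%:C * eit t).
rewrite (_ : eit t - _ = rho%:C * eit t) in Q; last by rewrite rmorphB /=; ring.
rewrite cabsM cabs_eit mulr1 cabs_real (ger0_norm (ltW r0)) in Q.
rewrite E -FE' in P; last by rewrite zE; lra.
apply: le_trans (hq rho (ltW r0) rq); rewrite mulrDl; apply: le_trans (lerD Q P).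
apply: le_trans (lerD (Re_le_cabs _) (lexx _)); rewrite raddfB.
exact: ler_distD.
Qed.

Lemma periodic_derive g D t : (forall t, g (t + pi *+ 2) = g t) ->
  (forall t, is_derive t 1 g (D t)) -> D (t + pi *+ 2) = D t.
Proof.
move=> per dg.
have h : is_derive t 1 g (D (t + pi *+ 2) * 1).
  rewrite (_ : g = fun u => g (1 * u + pi *+ 2)).
    apply: dcomp; last exact: daffine.
    by rewrite mul1r; exact: dg.
  by apply/funext => u; rewrite mul1r per.
have e1 := @derive_val _ _ _ _ _ _ _ (dg t).
by have := @derive_val _ _ _ _ _ _ _ h; rewrite e1 mulr1.
Qed.

Lemma herglotz_derive g D z : continuous g -> continuous D ->
  (forall t, g (t + pi *+ 2) = g t) -> (forall t, is_derive t 1 g (D t)) ->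
  cabs z < 1 -> herglotz D z = 'i%C * z * ((pi^-1)%:C * cauchy g 2 z).
Proof.
move=> cg cD per dg z1; have p0 := ltW (twopi_gt0 R).
have i0 : nint D 0 (pi *+ 2) = 0.
  rewrite (@nintE _ _ g _ _ p0 (fun t _ => dg t)).
  by have := per 0; rewrite add0r => ->; rewrite subrr.
rewrite /herglotz i0 mul0r subr0.
suff : cauchy D 1 z + (- ('i%C * z)) * cauchy g 2 z = 0.
  by move/eqP; rewrite mulNr subr_eq0 => /eqP ->; ring.
rewrite /cauchy -cintZ // -?cintD //; last 3 first.
- exact: ccts_cauchy.
- by apply: cctsM; [exact: ccts_cst|exact: ccts_cauchy].
- exact: ccts_cauchy.
rewrite (cintE (h := fun t => (g t)%:C * (eit t * (eit t - z)^-1)) p0).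
  by have := per 0; have := @eitD2pi R 0; rewrite !add0r => -> ->; rewrite subrr.
move=> t _; have n0 := eit_sub_neq0 t z1.
have d2 : cder (fun t => eit t - z) t ('i%C * eit t).
  have [a b] := @cder_eit R t; split.
    under eq_fun do rewrite raddfB.
    by apply: dE (dB a (is_derive_cst _ _ _)) _; rewrite subr0.
  under eq_fun do rewrite raddfB.
  by apply: dE (dB b (is_derive_cst _ _ _)) _; rewrite subr0.
have d3 := cder_comp (cdiff_inv n0) d2.
apply: cderE (cderM (cder_real (dg t)) (cderM (cder_eit t) d3)) _.
by rewrite expr1; move: 'i%C => I; field.
Qed.

Lemma privalov : exists2 C, 0 <= C & forall g g' K, 0 <= K ->
  (forall t, g (t + pi *+ 2) = g t) -> C1b K g g' -> exists F D,
  [/\ holo F /\ (forall t, complex.Re (F (eit t)) = g t), complex.Im (F 1) = 0,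
      C1b (C * K) (fun t => complex.Im (F (eit t))) D &
      forall z, cabs z <= 1 -> cabs (F z - F 1) <= C * K].
Proof.
have dp := d0; have dq := d1.
have [C C0 hC] := privalov_holder; exists (4 * C) => [|g g' K K0 per gK].
  by rewrite mulr_ge0.
have [gb g'b hg' dg] := gK.
have cg' := holder_cont hg'.
have hg : holder d (2 * K) g by apply: holder_of_lip => // s t; exact: C1b_lip gK.
have cg := holder_cont hg.
have per' t := periodic_derive t per dg.
have K20 : 0 <= 2 * K by rewrite mulr_ge0.
have [F0 [FL FE FR]] := hC g (2 * K) cg per K20 hg.
have [H [HL HE HR]] := hC g' K cg' per' K0 hg'.
have CK : 0 <= C * K by rewrite mulr_ge0.
pose c := complex.Im (F0 1); pose F z := F0 z - 'i%C * c%:C.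
have FB z w : F z - F w = F0 z - F0 w by rewrite /F; ring.
have pow2 x : 0 <= x -> x <= 2 -> x `^ d <= 2.
  move=> x0 x2; apply: (@le_trans _ _ (2 `^ d)).
    by apply: powR_mono => //; exact: ltW.
  by apply: le_trans (ler1_powR _ _) _ => //; [lra|exact: ltW].
have FB1 z : cabs z <= 1 -> cabs (F z - F 1) <= 4 * C * K.
  move=> z1; rewrite FB; apply: le_trans (FL _ _) _.
  have : cabs (z - 1) <= 2 by have := cabsD z (- 1); rewrite cabsN cabs1; lra.
  move=> /(pow2 _ (cabs_ge0 _)); nra.
have dF z : cabs z < 1 -> cdiff F z ((pi^-1)%:C * cauchy g 2 z).
  move=> z1.
  have : cdiff F0 z ((pi^-1)%:C * cauchy g 2 z).
    have h := herglotz_diff d01 cg per K20 hg z1; exact: (cdiff_ext z1 FE h).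
  by move=> h e /h[q q0 hq]; exists q => // w /hq; rewrite FB.
have hF : holo F.
  split; last by move=> z; rewrite discE => z1; apply/derivable_cdiff; eexists; exact: dF.
  apply/continuous_discP => z z1 e e0; have [q q0 hq] := powR_small (C * (2 * K)) dp e0.
  exists q => // w _ wz; rewrite FB; apply: le_trans (FL _ _) _.
  by apply: hq => //; exact: cabs_ge0.
have H0 : H 0 = 0.
  by rewrite HE ?cabs0 // (herglotz_derive cg cg' per dg) ?cabs0 // mulr0 mul0r.
pose rz r t : R[i] := r%:C * eit t.
have rzB r s t : 0 <= r <= 1 -> cabs (rz r s - rz r t) <= 2 * `|s - t|.
  move=> r01; rewrite /rz -mulrBr cabsM cabs_real ger0_norm; last lra.
  by have := eit_lip s t; have := cabs_ge0 (eit s - eit t); nra.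
have HH r : 0 <= r <= 1 -> holder d (2 * C * K) (fun t => complex.Im (H (rz r t))).
  move=> r01 s t; rewrite -raddfB; apply: le_trans (Im_le_cabs _) _.
  apply: le_trans (HL _ _) _.
  have -> : 2 * C * K * `|s - t| `^ d = C * K * (2 * `|s - t| `^ d) by ring.
  rewrite ler_wpM2l //.
  apply: (@le_trans _ _ ((2 * `|s - t|) `^ d)).
    by apply: powR_mono; [exact: ltW|exact: cabs_ge0|exact: rzB].
  rewrite powRM // ler_wpM2r ?powR_ge0 //.
  by apply: pow2; lra.
have rz1 t : rz 1 t = eit t by rewrite /rz mul1r.
exists F, (fun t => complex.Im (H (eit t))); split=> //.
- split=> // t; have := FR t; rewrite /F raddfB /= => ->.
  by rewrite mul0r mul1r subrr subr0.
- by rewrite /F raddfB /= -/c; ring.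
split=> [t|t||].
- have -> : complex.Im (F (eit t)) = complex.Im (F (eit t) - F 1).
    by rewrite raddfB /= /F !raddfB /= -/c; ring.
  by apply: le_trans (Im_le_cabs _) _; apply: FB1; rewrite cabs_eit.
- apply: le_trans (Im_le_cabs _) _.
  have := HL (eit t) 0; rewrite H0 !subr0 cabs_eit powR1 mulr1; nra.
- move=> s t; have := HH 1 _ s t; rewrite !rz1 lexx ler01 => /(_ isT) h.
  by apply: le_trans h _; rewrite ler_wpM2r ?powR_ge0 //; nra.
apply: (@is_derive_lim (2 * C * K)); first by rewrite -mulrA mulr_ge0.
move=> s t e e0.
pose N := C * (2 * K) + C * K.
have [q q0 hq] := powR_small N dp e0.
pose rho := Num.min (q / 2) (1 / 2).
have r0 : 0 < rho by rewrite lt_min !divr_gt0.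
have r1 : rho <= 1 / 2 by rewrite ge_min lexx orbT.
have rq : rho < q by rewrite gt_min; lra.
have hN := hq rho (ltW r0) rq.
have rzE u : cabs (rz (1 - rho) u - eit u) = rho.
  rewrite /rz rmorphB /= (_ : _ - _ = - (rho%:C * eit u)); last by ring.
  by rewrite cabsN cabsM cabs_eit mulr1 cabs_real ger0_norm // ltW.
have pr := powR_ge0 rho d.
have cF u : `|complex.Im (F (rz (1 - rho) u)) - complex.Im (F (eit u))| <= e.
  rewrite -raddfB FB; apply: le_trans (Im_le_cabs _) _; apply: le_trans (FL _ _) _.
  by rewrite rzE; apply: le_trans hN; rewrite /N; nra.
exists (fun u => complex.Im (F (rz (1 - rho) u))),
  (fun u => complex.Im (H (rz (1 - rho) u))); split=> //.
- by apply: HH; lra.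
- move=> u; have z1 : cabs (rz (1 - rho) u) < 1.
    by rewrite cabsM cabs_eit mulr1 cabs_real ger0_norm; lra.
  have dr : cder (rz (1 - rho)) u ((1 - rho)%:C * ('i%C * eit u)).
    have dc : cder (fun=> (1 - rho)%:C) u (0 : R[i]) by split; exact: is_derive_cst.
    by apply: cderE (cderM dc (cder_eit u)) _; rewrite mul0r add0r.
  have := cder_comp (dF _ z1) dr => /cderE h.
  have := h _ (erefl _) => -[_ {}h]; apply: dE h _; congr complex.Im.
  by rewrite HE // (herglotz_derive cg cg' per dg z1) /rz; ring.
- rewrite -raddfB; apply: le_trans (Im_le_cabs _) _; apply: le_trans (HL _ _) _.
  by rewrite rzE; apply: le_trans hN; rewrite /N; nra.
Qed.

End ConjugateFunction.


Section CircleFunctions.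
Variables (R : realType) (d : R).
Hypothesis d01 : 0 < d < 1.
Implicit Types (f g : circle R -> R) (K C e : R) (s t : R).

(** [f] is of class C^{1,d} on the circle, with norm at most [K]. *)
Definition Bnd K f := exists D, C1b d K (fun t => f (expi t)) D.

Let d0 : 0 < d. Proof. by case/andP: d01. Qed.

Lemma Bnd_ge0 K f : Bnd K f -> 0 <= K.
Proof. by case=> D [h _ _ _]; exact: le_trans (h 0). Qed.

Lemma Bnd_le K f x : Bnd K f -> `|f x| <= K.
Proof. by case=> D [h _ _ _]; have [t ->] := expi_surj x. Qed.

Lemma Bnd_mono K K' f : K <= K' -> Bnd K f -> Bnd K' f.
Proof.
move=> KK [D [h1 h2 h3 h4]]; exists D; split=> [t|t|s t|] //.
- exact: le_trans KK.
- exact: le_trans KK.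
- by apply: le_trans (h3 s t) _; rewrite ler_wpM2r // powR_ge0.
Qed.

Lemma Bnd_cst (k : R) : Bnd `|k| (fun=> k).
Proof.
exists (fun=> 0); split=> [//|t|s t|t]; rewrite ?normr0 //.
  by rewrite subrr normr0 mulr_ge0 // powR_ge0.
exact: is_derive_cst.
Qed.

Lemma Bnd_D K K' f g : Bnd K f -> Bnd K' g -> Bnd (K + K') (fun x => f x + g x).
Proof.
move=> [D [f1 f2 f3 f4]] [D' [g1 g2 g3 g4]].
exists (fun t => D t + D' t); split=> [t|t|s t|t].
- by apply: le_trans (ler_normD _ _) _; rewrite lerD.
- by apply: le_trans (ler_normD _ _) _; rewrite lerD.
- rewrite mulrDl opprD addrACA; apply: le_trans (ler_normD _ _) _.
  by rewrite lerD ?f3 ?g3.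
- exact: is_derive_add.
Qed.

Lemma Bnd_N K f : Bnd K f -> Bnd K (fun x => - f x).
Proof.
move=> [D [f1 f2 f3 f4]]; exists (fun t => - D t); split=> [t|t|s t|t].
- by rewrite normrN.
- by rewrite normrN.
- by rewrite -opprD normrN.
- by have := dZ (-1) (f4 t); rewrite mulN1r; under eq_fun do rewrite mulN1r.
Qed.

Lemma Bnd_M K K' f g : Bnd K f -> Bnd K' g -> Bnd (6 * K * K') (fun x => f x * g x).
Proof.
move=> Bf Bg; have K0 := Bnd_ge0 Bf; have K0' := Bnd_ge0 Bg.
have KK : 0 <= K * K' by rewrite mulr_ge0.
case: Bf => D cf; case: Bg => D' cg.
have [f1 f2 f3 f4] := cf; have [g1 g2 g3 g4] := cg.
have fh : holder d (2 * K) (fun t => f (expi t)).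
  by apply: holder_of_lip => // s t; exact: C1b_lip cf.
have gh : holder d (2 * K') (fun t => g (expi t)).
  by apply: holder_of_lip => // s t; exact: C1b_lip cg.
exists (fun t => D t * g (expi t) + f (expi t) * D' t); split=> [t|t|s t|t].
- by rewrite normrM; apply: le_trans (ler_pM _ _ (f1 t) (g1 t)) _ => //; lra.
- apply: le_trans (ler_normD _ _) _; rewrite !normrM.
  have := ler_pM (normr_ge0 _) (normr_ge0 _) (f2 t) (g1 t).
  have := ler_pM (normr_ge0 _) (normr_ge0 _) (f1 t) (g2 t).
  lra.
- have -> : D s * g (expi s) + f (expi s) * D' s - (D t * g (expi t) + f (expi t) * D' t)
    = ((D s - D t) * g (expi s) + D t * (g (expi s) - g (expi t)))
    + ((f (expi s) - f (expi t)) * D' s + f (expi t) * (D' s - D' t)) by ring.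
  have p0 := powR_ge0 `|s - t| d.
  have A1 := ler_pM (normr_ge0 _) (normr_ge0 _) (f3 s t) (g1 s).
  have A2 := ler_pM (normr_ge0 _) (normr_ge0 _) (f2 t) (gh s t).
  have A3 := ler_pM (normr_ge0 _) (normr_ge0 _) (fh s t) (g2 s).
  have A4 := ler_pM (normr_ge0 _) (normr_ge0 _) (f1 t) (g3 s t).
  rewrite -!normrM in A1 A2 A3 A4.
  apply: le_trans (ler_normD _ _) _.
  apply: le_trans (lerD (ler_normD _ _) (ler_normD _ _)) _.
  lra.
- exact: dM.
Qed.

Lemma Bnd_sum n (f : 'I_n -> circle R -> R) K : 0 <= K -> (forall i, Bnd K (f i)) ->
  Bnd (n%:R * K) (fun x => \sum_(i < n) f i x).
Proof.
move=> K0; elim: n f => [|n ih] f hf.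
  rewrite mul0r; under eq_fun do rewrite big_ord0.
  by have := Bnd_cst 0; rewrite normr0.
under eq_fun do rewrite big_ord_recl.
rewrite (_ : n.+1%:R * K = K + n%:R * K); last by rewrite -natr1 mulrDl mul1r addrC.
by apply: Bnd_D; [exact: hf|apply: ih => i].
Qed.

Lemma Bnd_C1_circle K f : Bnd K f -> C1_circle d f.
Proof.
move=> [D [_ _ h df]]; split=> [t|]; first by have [] := df t.
by exists K => s t; have := h s t; rewrite !derive1E !(@derive_val _ _ _ _ _ _ _ (df _)).
Qed.

Lemma C1_circle_Bnd f : C1_circle d f -> exists K, Bnd K f.
Proof.
move=> [df [K hK]]; pose g t := f (expi t).
have dg t : is_derive t 1 g (derive1 g t).
  by have h := derivableP (df t); rewrite derive1E.
have per t : g (t + pi *+ 2) = g t by rewrite /g expiD2pi.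
have K1 : 0 <= `|K| by [].
have hD : holder d `|K| (derive1 g).
  by move=> s t; apply: le_trans (hK s t) _; rewrite ler_wpM2r ?powR_ge0 // ler_norm.
have [B1 hB1] := @periodic_bounded _ _ d01 _ _ (fun t => periodic_derive t per dg) K1 hD.
have lip s t : `|g s - g t| <= B1 * `|s - t|.
  by apply: (lip_of_derive (f' := derive1 g)).
have B10 : 0 <= B1 by apply: le_trans (hB1 0).
have [B0 hB0] : exists B, forall t, `|g t| <= B.
  exists (`|g 0| + B1 * (pi *+ 2)); apply: periodic_le => // u /andP[u0 u1].
  by apply: le_trans (lip u 0) _; rewrite subr0 ger0_norm // ler_wpM2l.
exists (B0 + B1 + `|K|), (derive1 g); split=> [t|t|s t|//].
- by apply: le_trans (hB0 t) _; have := normr_ge0 K; lra.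
- apply: le_trans (hB1 t) _; have := normr_ge0 K.
  have : 0 <= B0 by apply: le_trans (hB0 0). 
  lra.
- apply: le_trans (hD s t) _; rewrite ler_wpM2r ?powR_ge0 //.
  have : 0 <= B0 by apply: le_trans (hB0 0). 
  lra.
Qed.

Lemma is_T1B f g f' g' : is_T1 f g -> is_T1 f' g' ->
  is_T1 (fun x => f x - f' x) (fun x => g x - g' x).
Proof.
move=> [g1 [F [cF dF hF]]] [g1' [F' [cF' dF' hF']]].
split; first by rewrite g1 g1' subr0.
have [cB dB] := holoB (conj cF dF) (conj cF' dF').
exists (fun z => F z - F' z); split => //.
by move=> x; rewrite hF hF'; apply/eqP; rewrite eq_complex /= !eqxx.
Qed.

Lemma is_T1_uniq f g g' : is_T1 f g -> is_T1 f g' -> g = g'.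
Proof.
move=> h h'; have [e0 [F [cF dF hF]]] := is_T1B h h'; apply/funext => x.
have hi := holoM (holo_cst (- 'i%C)) (conj cF dF).
have re y : - 'i%C * F (val y) = (g y - g' y)%:C.
  by rewrite hF subrr; apply/eqP; rewrite eq_complex /=; apply/andP; split; apply/eqP; ring.
have := holo_real_cst hi; move=> /(_ (fun y => congr1 (@complex.Im R) (re y))) c.
have := c x; rewrite -(c (circle_one R)) !re e0 => /complexI /eqP.
by rewrite subr_eq0 => /eqP.
Qed.

(** The operator T_1, with the bound given by Privalov's theorem. *)
Definition T1 f : circle R -> R := xget (fun=> 0) [set g | is_T1 f g].

Lemma T1_bounded : exists2 C, 0 <= C & forall K f, Bnd K f ->
  [/\ is_T1 f (T1 f), Bnd (C * K) (T1 f) &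
    exists2 F : R[i] -> R[i], extension (fun x => f x +i* T1 f x) F &
      forall z : R[i], closed_disc z -> cabs (F z - F 1) <= C * K].
Proof.
have [C C0 hC] := @privalov R d d01; exists C => // K f Bf.
have K0 := Bnd_ge0 Bf; have [D cf] := Bf.
have per t : f (expi (t + pi *+ 2)) = f (expi t) by rewrite expiD2pi.
have [F [D' [[hF reF] i1 cD' bF]]] := hC _ _ K K0 per cf.
pose g (x : circle R) := complex.Im (F (val x)).
have hext : extension (fun x => f x +i* g x) F.
  have [cF dF] := hF; split => // x; have [t ->] := expi_surj x.
  by rewrite -reF /g -eitE; case: (F _).
have hg : is_T1 f g by split; [|exists F].
have TE : T1 f = g.
  by rewrite /T1; case: xgetP => [g' _ /= hg'|/(_ g)//]; exact: is_T1_uniq hg' hg.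
rewrite TE; split=> //; first by exists D'.
by exists F => // z; rewrite closed_discE; exact: bF.
Qed.

Lemma dyadic_lim (u : nat -> R) : (forall n, `|u n.+1 - u n| <= 2 ^- n) ->
  exists l, forall n, `|l - u n| <= 2 * 2 ^- n.
Proof.
move=> h.
have p n : 0 < (2 : R) ^- n by rewrite invr_gt0 exprn_gt0.
have pS n : (2 : R) ^- n = 2 * 2 ^- n.+1 by rewrite exprS invfM mulrA divff ?mul1r ?pnatr_eq0.
have [||n|l hl] := @nested_sup R (fun n => u n - 2 * 2 ^- n) (fun n => 4 * 2 ^- n).
- move=> n; have := h n; have := p n.+1; rewrite (pS n) ler_norml; lra.
- move=> n; have := h n; have := p n.+1; rewrite (pS n) ler_norml; lra.
- by rewrite mulr_ge0 // ltW.
- by exists l => n; have := hl n; rewrite ler_norml; lra.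
Qed.

Lemma dyadic_small e : 0 < e -> exists n, (2 : R) ^- n <= e.
Proof.
move=> e0; exists (Num.bound e^-1).
rewrite -[leRHS]invrK lef_pV2 ?posrE ?exprn_gt0 ?invr_gt0 //.
apply/ltW/(lt_le_trans (archi_boundP _)); first by rewrite invr_ge0 ltW.
by rewrite -natrX ler_nat ltnW // ltn_expl.
Qed.

Lemma ler_dyadic (a b c : R) : (forall n, a <= b + c * 2 ^- n) -> a <= b.
Proof.
move=> h; apply/ler_addgt0Pl => e e0.
have c0 : 0 < 1 + `|c| by rewrite ltr_pwDl.
have [|n hn] := @dyadic_small (e / (1 + `|c|)); first by rewrite divr_gt0.
apply: le_trans (h n) _; rewrite addrC lerD2r.
apply: (@le_trans _ _ (`|c| * 2 ^- n)).
  by rewrite ler_wpM2r ?ler_norm // invr_ge0 exprn_ge0.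
have e' : e = `|c| * (e / (1 + `|c|)) + e / (1 + `|c|) by field; rewrite gt_eqF.
rewrite [leRHS]e'; have : `|c| * 2 ^- n <= `|c| * (e / (1 + `|c|)) by rewrite ler_wpM2l.
have : 0 < e / (1 + `|c|) by rewrite divr_gt0.
lra.
Qed.

(** Completeness of C^{1,d}, for geometric series. *)
Lemma Bnd_series (e : nat -> circle R -> R) : (forall n, Bnd (2 ^- n) (e n)) ->
  exists g, forall n, Bnd (2 * 2 ^- n) (fun x => g x - \sum_(k < n) e k x).
Proof.
move=> he; have [De hDe] := choice he.
pose S n x := \sum_(k < n) e k x; pose DS n t := \sum_(k < n) De k t.
have SS n x : S n.+1 x - S n x = e n x by rewrite /S big_ord_recr /= [X in X - _]addrC addrK.
have DSS n t : DS n.+1 t - DS n t = De n t by rewrite /DS big_ord_recr /= [X in X - _]addrC addrK.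
have /choice[g hg] : forall x, exists l, forall n, `|l - S n x| <= 2 * 2 ^- n .
  move=> x; apply: dyadic_lim => n; rewrite SS; exact: Bnd_le (he n).
have /choice[Dg hDg] : forall t, exists l, forall n, `|l - DS n t| <= 2 * 2 ^- n .
  by move=> t; apply: dyadic_lim => n; rewrite DSS; have [_ h _ _] := hDe n.
have p n : 0 < (2 : R) ^- n by rewrite invr_gt0 exprn_gt0.
have pS n : (2 : R) ^- n = 2 * 2 ^- n.+1 by rewrite exprS invfM mulrA divff ?mul1r ?pnatr_eq0.
have dS n t : is_derive t 1 (fun t => S n (expi t)) (DS n t).
  rewrite /S /DS; elim: n => [|n ih].
    under eq_fun do rewrite big_ord0; rewrite big_ord0; exact: is_derive_cst.
  under eq_fun do rewrite big_ord_recr /=; rewrite big_ord_recr /=.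
  by apply: is_derive_add => //; have [_ _ _ h] := hDe n.
have hol n k : holder d (2 * 2 ^- n - 2 * 2 ^- (n + k)) (fun t => DS (n + k)%N t - DS n t).
  elim: k => [|k ih] s t; first by rewrite addn0 !subrr mul0r normr0.
  have [_ _ h _] := hDe (n + k)%N; have := h s t; have := ih s t.
  rewrite addnS -(DSS (n + k)%N s) -(DSS (n + k)%N t) (pS (n + k)%N).
  have := powR_ge0 `|s - t| d; rewrite !ler_norml; lra.
have holg n : holder d (2 * 2 ^- n) (fun t => Dg t - DS n t).
  move=> s t; have p0 := powR_ge0 `|s - t| d; apply: (@ler_dyadic _ _ 4) => k.
  have A := hol n k s t; have B := hDg s (n + k)%N; have C := hDg t (n + k)%N.
  have E : (2 : R) ^- (n + k) <= 2 ^- k.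
    rewrite lef_pV2 ?posrE ?exprn_gt0 // exprD ler_peMl ?exprn_ge0 //.
    by rewrite exprn_ege1 // ler1n.
  have := mulr_ge0 p0 (ltW (p (n + k)%N)).
  by move: A B C; rewrite !ler_norml; lra.
exists g => n; exists (fun t => Dg t - DS n t); split=> [t|t||t].
- exact: hg.
- exact: hDg.
- exact: holg.
apply: dB (dS n t); apply: (@is_derive_lim _ _ d01 2) => // s {}t eps e0.
have [|k hk] := @dyadic_small (eps / 2); first lra.
exists (fun t => S k (expi t)), (DS k); split => //.
- have := hol 0%N k; rewrite add0n expr0 invr1 mulr1 => h u v.
  have DS0 x : DS 0%N x = 0 by rewrite /DS big_ord0.
  have := h u v; rewrite !DS0 !subr0 => h'; apply: le_trans h' _.
  by rewrite ler_wpM2r ?powR_ge0 //; have := p k; lra.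
- by have := hg (expi s) k; rewrite distrC; lra.
- by have := hg (expi t) k; rewrite distrC; lra.
- by have := hDg t k; rewrite distrC; lra.
Qed.

End CircleFunctions.


Section SmallMatrices.
Variable R : realType.

Lemma small_perturbation_unit m (A : 'M[R[i]]_m) e :
  (forall i j, cabs (A i j) <= e) -> m%:R * e < 1 -> 1%:M + A \in unitmx.
Proof.
move=> hA me; rewrite -row_free_unit -kermx_eq0; apply/eqP/row_matrixP => i.
set v := row i _; have : v *m (1%:M + A) = 0.
  by apply/sub_kermxP; exact: row_sub.
rewrite mulmxDr mulmx1 row0 => /eqP; rewrite addr_eq0 => /eqP vA.
pose S := \sum_j cabs (v 0 j).
have S0 : 0 <= S by apply: sumr_ge0 => j _; exact: cabs_ge0.
have : S <= m%:R * e * S.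
  have h j : cabs (v 0 j) <= \sum_k cabs (v 0 k) * e.
    rewrite {1}vA !mxE cabsN.
    apply: (@le_trans _ _ (\sum_k cabs (v 0 k * A k j))).
      elim/big_ind2: _ => [|x a y b hx hy|k _] //; first by rewrite cabs0.
      by apply: le_trans (cabsD _ _) _; rewrite lerD.
    by apply: ler_sum => k _; rewrite cabsM ler_wpM2l ?cabs_ge0.
  apply: (@le_trans _ _ (\sum_(j < m) \sum_k cabs (v 0 k) * e)).
    by apply: ler_sum => j _; exact: h.
  rewrite sumr_const card_ord -mulr_suml -/S -mulr_natl.
  by rewrite le_eqVlt; apply/orP; left; apply/eqP; ring.
move=> hS; have {hS} : S = 0 by nra.
move/eqP; rewrite psumr_eq0 => [|j _]; last exact: cabs_ge0.
move=> /allP hv; apply/rowP => j; rewrite [RHS]mxE; apply/eqP; rewrite -cabs_eq0.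
by apply: hv; rewrite mem_index_enum.
Qed.

Lemma small_perturbation_unitR m (A : 'M[R]_m) e :
  (forall i j, `|A i j| <= e) -> m%:R * e < 1 -> 1%:M + A \in unitmx.
Proof.
move=> hA me; rewrite -(map_unitmx (real_complex R)) raddfD /= map_mx1.
apply: (@small_perturbation_unit _ _ e) => // i j.
by rewrite mxE cabs_real.
Qed.

End SmallMatrices.

Section FixedPoint.
Variables (R : realType) (d : R).
Hypothesis d01 : 0 < d < 1.
Variable m : nat.
Implicit Types (A B G : circle R -> 'M[R]_m) (K e : R).

Definition MB K A := forall i j, Bnd d K (fun s => A s i j).

Lemma MB_mulmx K K' A B : 0 <= K -> 0 <= K' -> MB K A -> MB K' B ->
  MB (m%:R * (6 * K * K')) (fun s => A s *m B s).
Proof.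
move=> K0 K0' hA hB i j; under eq_fun do rewrite mxE.
by apply: Bnd_sum => [|k]; [rewrite !mulr_ge0|apply: Bnd_M].
Qed.

Definition T1mx A : circle R -> 'M[R]_m :=
  fun s => \matrix_(i, j) T1 (fun s => A s i j) s.

Lemma T1mx_B C A B : 
  (forall K f, Bnd d K f -> [/\ is_T1 f (T1 f), Bnd d (C * K) (T1 f) &
    exists2 F : R[i] -> R[i], extension (fun x => f x +i* T1 f x) F &
      forall z : R[i], closed_disc z -> cabs (F z - F 1) <= C * K]) ->
  (exists K, MB K A) -> (exists K, MB K B) ->
  forall s, T1mx (fun s => A s - B s) s = T1mx A s - T1mx B s.
Proof.
move=> hC [K hA] [K' hB] s; apply/matrixP => i j; rewrite !mxE.
have [hA1 _ _] := hC _ _ (hA i j); have [hB1 _ _] := hC _ _ (hB i j).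
have Bd := Bnd_D (hA i j) (Bnd_N (hB i j)).
have [hD1 _ _] := hC _ _ Bd.
have -> : (fun s => (A s - B s) i j) = (fun s => A s i j - B s i j).
  by apply/funext => x; rewrite !mxE.
by rewrite (is_T1_uniq hD1 (is_T1B hA1 hB1)).
Qed.

(** The equation G + G a + T_1 (G b) = 1 for small a and b, by Neumann series. *)
Lemma neumann_solution e : 0 < e -> exists2 k, 0 < k & forall a b,
  MB k a -> MB k b -> exists G,
  [/\ MB 4 G, forall s, G s + G s *m a s + T1mx (fun s => G s *m b s) s = 1%:M,
      forall i j, is_T1 (fun s => (G s *m b s) i j) (fun s => T1mx (fun s => G s *m b s) s i j),
      MB e (fun s => T1mx (fun s => G s *m b s) s) &
      forall i j, exists2 F : R[i] -> R[i],
        extension (fun s => (G s *m b s) i j +i* T1mx (fun s => G s *m b s) s i j) F &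
        forall z : R[i], closed_disc z -> cabs (F z) <= e].
Proof.
move=> e0; have [C C0 hC] := @T1_bounded R d d01.
pose c := (m%:R + 1) * 24 * (C + 1).
have m0 : 0 <= m%:R :> R by [].
have c0 : 0 < c by rewrite /c !mulr_gt0 //; lra.
pose k := Num.min 1 e / (2 * c).
have me0 : 0 < Num.min 1 e by rewrite lt_min ltr01.
have k0 : 0 < k by rewrite divr_gt0 // mulr_gt0.
exists k => // a b ha hb.
have me1 : Num.min 1 e <= 1 by rewrite ge_min lexx.
have mee : Num.min 1 e <= e by rewrite ge_min lexx orbT.
have ck : c * k = Num.min 1 e / 2 by rewrite /k; field; rewrite gt_eqF.
have small K : 0 <= K -> m%:R * (6 * K * k) * (C + 1) <= K * Num.min 1 e / 8.
  move=> K0; have -> : K * Num.min 1 e / 8 = K * (c * k) / 4 by rewrite ck; field.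
  have := mulr_ge0 (mulr_ge0 K0 (ltW k0)) C0; have := mulr_ge0 K0 (ltW k0).
  have := mulr_ge0 m0 (mulr_ge0 (mulr_ge0 K0 (ltW k0)) C0).
  have := mulr_ge0 m0 (mulr_ge0 K0 (ltW k0)).
  rewrite /c; lra.
pose L G s := G s *m a s + T1mx (fun s => G s *m b s) s.
have TB K G : 0 <= K -> MB K G -> MB (C * (m%:R * (6 * K * k))) (T1mx (fun s => G s *m b s)).
  move=> K0 hG i j; rewrite /T1mx; under eq_fun do rewrite mxE.
  by have [_ h _] := hC _ _ (MB_mulmx K0 (ltW k0) hG hb i j).
have LB K G : 0 <= K -> MB K G -> MB (K / 2) (L G).
  move=> K0 hG i j; rewrite /L; under eq_fun do rewrite mxE.
  apply: Bnd_mono (Bnd_D (MB_mulmx K0 (ltW k0) hG ha i j) (TB K G K0 hG i j)).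
  have := small K K0; have : K * Num.min 1 e <= K * 1 by rewrite ler_wpM2l.
  lra.
have MBD K K' A B : MB K A -> MB K' B -> MB (K + K') (fun s => A s - B s).
  by move=> hA hB i j; under eq_fun do rewrite !mxE; apply: Bnd_D => //; exact: Bnd_N.
have LD K K' A B : 0 <= K -> 0 <= K' -> MB K A -> MB K' B ->
    forall s, L A s - L B s = L (fun s => A s - B s) s.
  move=> K0 K0' hA hB s; rewrite /L.
  have -> : (fun s => (A s - B s) *m b s) = fun s => A s *m b s - B s *m b s.
    by apply/funext => x; rewrite mulmxBl.
  rewrite (T1mx_B hC) ?mulmxBl; first by rewrite opprD addrACA.
    by eexists; exact: (MB_mulmx K0 (ltW k0) hA hb).
  by eexists; exact: (MB_mulmx K0' (ltW k0) hB hb).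
have MBN K A : MB K A -> MB K (fun s => - A s).
  by move=> hA i j; under eq_fun do rewrite mxE; exact: Bnd_N.
pose E := fix E n := if n is n'.+1 then (fun s => - L (E n') s) else (fun=> 1%:M).
have EB n : MB (2 ^- n) (E n).
  elim: n => [|n ih] /=.
    move=> i j; under eq_fun do rewrite mxE.
    apply: Bnd_mono (Bnd_cst d (i == j)%:R); rewrite expr0 invr1.
    by case: (i == j); rewrite ?normr1 ?normr0.
  rewrite exprSr invfM; apply: MBN.
  by apply: LB => //; rewrite invr_ge0 exprn_ge0.
have gex (ij : 'I_m * 'I_m) : exists g, forall n,
    Bnd d (2 * 2 ^- n) (fun x => g x - \sum_(l < n) E l x ij.1 ij.2).
  by apply: (Bnd_series d01 (e := fun n x => E n x ij.1 ij.2)) => n; exact: EB.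
have /choice[g hg] := gex.
pose G (s : circle R) : 'M[R]_m := \matrix_(i, j) g (i, j) s.
pose S n (s : circle R) : 'M[R]_m := \sum_(l < n) E l s.
have GS n : MB (2 * 2 ^- n) (fun s => G s - S n s).
  move=> i j; have := hg (i, j) n.
  rewrite (_ : (fun x => _) = fun s => (G s - S n s) i j) //.
  by apply/funext => s; rewrite !mxE /= summxE.
have SB n : MB 4 (S n).
  move=> i j; have := Bnd_D (GS 0%N i j) (Bnd_N (GS n i j)).
  rewrite expr0 invr1 mulr1.
  rewrite (_ : (fun x => _) = fun s => S n s i j); last first.
    by apply/funext => s; rewrite !mxE /S big_ord0 !mxE summxE; ring.
  apply: Bnd_mono; have : (2 : R) ^- n <= 1.
    by rewrite invf_le1 ?exprn_gt0 // exprn_ege1 // ler1n.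
  lra.
have GB : MB 4 G.
  move=> i j; have := GS 0%N i j; rewrite expr0 invr1 mulr1.
  rewrite (_ : (fun x => _) = fun s => G s i j); last first.
    by apply/funext => s; rewrite !mxE /S big_ord0 !mxE subr0.
  by apply: Bnd_mono; lra.
have S_rec n s : S n.+1 s = 1%:M - L (S n) s.
  elim: n s => [|n ih] s.
    rewrite /S big_ord1 /=.
    have -> : L (fun s => \sum_(l < 0) E l s) s = 0.
      have -> : (fun s : circle R => \sum_(l < 0) E l s) = fun s => E 0%N s - E 0%N s.
        by apply/funext => x; rewrite big_ord0 subrr.
      by rewrite -(LD _ _ _ _ _ _ (EB 0%N) (EB 0%N)) ?subrr // invr_ge0 exprn_ge0.
    by rewrite subr0.
  have SE x : S n.+1 x = S n x + E n x by rewrite /S big_ord_recr.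
  have e1 : S n.+2 s = S n.+1 s + E n.+1 s by rewrite /S big_ord_recr.
  rewrite e1 ih /= -addrA -opprD; congr (_ - _).
  have -> : L (E n) s = L (fun x => S n.+1 x - S n x) s.
    by congr (L _ s); apply/funext => x; rewrite SE [S n x + _]addrC addrK.
  by rewrite -(LD _ _ _ _ _ _ (SB n.+1) (SB n)) // addrC subrK.
have fixG s : G s + L G s = 1%:M.
  apply/matrixP => i j; apply/eqP; rewrite -subr_eq0 -normr_le0.
  apply: (ler_dyadic (c := 2)) => n; rewrite add0r.
  have A1 := Bnd_le s (GS n.+1 i j).
  have A2 := Bnd_le s (LB _ _ _ (GS n) i j).
  have {}A2 : `|L (fun s => G s - S n s) s i j| <= 2 * 2 ^- n / 2.
    by apply: A2; rewrite mulr_ge0 // invr_ge0 exprn_ge0.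
  rewrite -(LD _ _ _ _ _ _ GB (SB n)) // in A2.
  have E1 : (G s + L G s) i j - (1%:M : 'M[R]_m) i j
     = (G s - S n.+1 s) i j + (L G s - L (S n) s) i j.
    by rewrite S_rec !mxE; ring.
  rewrite E1; apply: le_trans (ler_normD _ _) _; apply: le_trans (lerD A1 A2) _.
  have p : 0 < (2 : R) ^- n by rewrite invr_gt0 exprn_gt0.
  by rewrite exprS invfM; lra.
have s4 : m%:R * (6 * 4 * k) * (C + 1) <= e.
  have := small 4; lra.
have q0 : 0 <= m%:R * (6 * 4 * k) by have k0' := ltW k0; apply: mulr_ge0 => //; lra.
exists G; split=> //.
- by move=> s; rewrite -addrA; exact: fixG.
- move=> i j; have [h _ _] := hC _ _ (MB_mulmx (ler0n _ 4) (ltW k0) GB hb i j).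
  by rewrite /T1mx; under [X in is_T1 _ X]eq_fun do rewrite mxE.
- move=> i j; apply: Bnd_mono (TB 4 G _ GB i j) => //; lra.
move=> i j; have Bf := MB_mulmx (ler0n _ 4) (ltW k0) GB hb i j.
have [[T0 _] _ [F hF bF]] := hC _ _ Bf.
exists F; first by rewrite /T1mx; under [X in extension X]eq_fun do rewrite mxE.
move=> z /bF h; rewrite -(subrK (F 1) (F z)); apply: le_trans (cabsD _ _) _.
have [_ _ /(_ (circle_one R)) F1] := hF.
have c1 : cabs (F 1) <= m%:R * (6 * 4 * k).
  have -> : F 1 = ((G (circle_one R) *m b (circle_one R)) i j)%:C.
    by rewrite [F 1]F1 T0.
  by rewrite cabs_real; exact: Bnd_le Bf.
lra.
Qed.

End FixedPoint.


Section RowVectors.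
Variable R : realType.

Lemma rv_norm_le n (v : 'rV[R]_n) (c : R) : 0 <= c -> (forall i, `|v 0 i| <= c) -> `|v| <= c.
Proof.
move=> c0 h; rewrite /Num.Def.normr /= mx_normrE (bigmax_le _ c0) //= => -[i j] _.
by rewrite /= (ord1 i).
Qed.

Lemma rv_coord_le n (v : 'rV[R]_n) i : `|v 0 i| <= `|v|.
Proof.
rewrite [leRHS]/Num.Def.normr /= mx_normrE.
exact: (le_bigmax _ (fun x : 'I_1 * 'I_n => `|v x.1 x.2|) (0, i)).
Qed.

Lemma rv_sum n (v : 'rV[R]_n) : v = \sum_i v 0 i *: delta_mx 0 i.
Proof. exact: row_sum_delta. Qed.

(** [c] is the gradient of [f] at [x]. *)
Definition grad_at n (f : 'rV[R]_n -> R) x (c : 'I_n -> R) := forall e, 0 < e ->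
  exists2 d, 0 < d & forall y, `|y - x| < d ->
    `|f y - f x - \sum_i c i * (y - x) 0 i| <= e * `|y - x|.

Definition partial n (i : 'I_n) (f : 'rV[R]_n -> R) x : R := 'D_(delta_mx 0 i) f x.

Lemma grad_atP n (f : 'rV[R]_n -> R) x : differentiable f x ->
  grad_at f x (fun i => partial i f x).
Proof.
move=> df e e0; have := (diff_locallyP x f).1 df => -[_ /eqaddoP /(_ e e0)].
move=> /nbhs_ballP[d /= d0 h]; exists d => // y yx.
have := h (y - x); rewrite -ball_normE /= sub0r normrN => /(_ yx).
rewrite /GRing.sub_fun /= => H.
have E : \sum_i partial i f x * (y - x) 0 i = 'd f x (y - x).
  rewrite {2}(rv_sum (y - x)) linear_sum; apply: eq_bigr => i _.
  by rewrite linearZ /= /partial deriveE // [RHS]mulrC.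
rewrite E; apply: le_trans H; rewrite le_eqVlt; apply/orP; left; apply/eqP.
congr (`|_|); rewrite /= !fctE /=.
by rewrite subrK opprD addrA.
Qed.

Lemma sum_coord_le n (c : 'I_n -> R) (v : 'rV[R]_n) B : 0 <= B -> (forall i, `|c i| <= B) ->
  `|\sum_i c i * v 0 i| <= n%:R * B * `|v|.
Proof.
move=> B0 hc; apply: le_trans (ler_norm_sum _ _ _) _.
apply: (@le_trans _ _ (\sum_(i < n) B * `|v|)).
  by apply: ler_sum => i _; rewrite normrM ler_pM ?rv_coord_le.
by rewrite sumr_const card_ord -mulrA mulr_natl.
Qed.

Lemma grad_at_differentiable n (f : 'rV[R]_n -> R) x c : grad_at f x c ->
  differentiable f x /\ forall i, partial i f x = c i.
Proof.
move=> h; pose L (v : 'rV[R]_n) := \sum_i c i * v 0 i.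
have Llin : linear L.
  move=> a u v; rewrite /L scaler_sumr -big_split; apply: eq_bigr => i _ /=.
  by rewrite !mxE /GRing.scale /=; ring.
pose LM := GRing.isLinear.Build _ _ _ _ _ Llin.
pose Lf : {linear 'rV[R]_n -> R} := HB.pack L LM.
pose B := \sum_i `|c i|.
have B0 : 0 <= B by apply: sumr_ge0.
have LB v : `|Lf v| <= n%:R * B * `|v|.
  apply: sum_coord_le => // i; rewrite /B (bigD1 i) //= lerDl.
  by apply: sumr_ge0.
have Lc : continuous (Lf : 'rV[R]_n -> R).
  move=> v; have FF := nbhs_filter (v : 'rV[R]_n).
  apply/(@cvgrPdist_le _ R^o _ (nbhs (v : 'rV[R]_n)) FF Lf (Lf v)) => e e0.
  have q0 : 0 < 1 + n%:R * B by rewrite ltr_pwDl // mulr_ge0.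
  apply/nbhs_ballP; exists (e / (1 + n%:R * B)); first by rewrite /= divr_gt0.
  move=> u; rewrite -ball_normE /= ltr_pdivlMr // => hu.
  have E : Lf (v - u) = Lf v - Lf u by exact: linearB.
  rewrite -[_ - _]E; apply: le_trans (LB _) _; apply: le_trans (ltW hu).
  by rewrite mulrC ler_wpM2l //; lra.
have e : f \o shift x = cst (f x) + Lf +o_ (0 : 'rV[R]_n) id.
  apply/eqaddoP => e e0; have [d d0 hd] := h e e0.
  apply/nbhs_ballP; exists d => // v; rewrite -ball_normE /= sub0r normrN => vd.
  have := hd (v + x); rewrite addrK => /(_ vd) H; apply: le_trans H.
  by rewrite le_eqVlt; apply/orP; left; apply/eqP; congr (`|_|); rewrite !fctE /= opprD addrA.
have dE := diff_unique Lc e.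
have df : differentiable f x by apply/diff_locallyP; rewrite dE.
split=> // i; rewrite /partial deriveE // dE /= /L (bigD1 i) //= big1 ?addr0.
  by rewrite mxE !eqxx mulr1.
by move=> j ji; rewrite mxE eqxx /= (negbTE ji) mulr0.
Qed.

Lemma differentiable_rvP (V : normedModType R) n (q : V -> 'rV[R]_n) x :
  differentiable q x <-> forall i, differentiable (fun y => q y 0 i) x.
Proof.
split=> [dq i|h].
  have dc := @differentiable_coord R 1 n (q x) 0 i.
  exact: (differentiable_comp dq dc).
rewrite (_ : q = \sum_i (fun y => q y 0 i *: (delta_mx 0 i : 'rV[R]_n))).
  by apply: differentiable_sum => i; apply: differentiableZl.
by apply/funext => y; rewrite fct_sumE; exact: rv_sum.
Qed.

Lemma derive_coord (V : normedModType R) n (q : V -> 'rV[R]_n) x v i :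
  differentiable q x -> ('D_v q x) 0 i = 'D_v (fun y => q y 0 i) x.
Proof. by move=> dq; rewrite derive_mx ?mxE //; exact: diff_derivable. Qed.

Lemma derive_chain (V : normedModType R) n (f : 'rV[R]_n -> R) (q : V -> 'rV[R]_n) x v :
  differentiable q x -> differentiable f (q x) ->
  'D_v (fun y => f (q y)) x = \sum_i partial i f (q x) * ('D_v q x) 0 i.
Proof.
move=> dq df; have dfq : differentiable (f \o q) x by exact: differentiable_comp.
rewrite (deriveE _ dfq) diff_comp //= -(deriveE v dq) {1}(rv_sum ('D_v q x)) linear_sum.
by apply: eq_bigr => i _; rewrite linearZ /= /partial (deriveE _ df) [RHS]mulrC.
Qed.

Lemma is_derive_chain n (f : 'rV[R]_n -> R) (q : R -> 'rV[R]_n) (t : R) (w : 'I_n -> R) :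
  (forall i, is_derive t 1 (fun y => q y 0 i) (w i)) -> differentiable f (q t) ->
  is_derive t 1 (fun y => f (q y)) (\sum_i partial i f (q t) * w i).
Proof.
move=> dq df.
have dqt : differentiable q t.
  by apply/differentiable_rvP => i; apply/derivable1_diffP; have [] := dq i.
have dfq : differentiable (fun y => f (q y)) t by exact: (differentiable_comp dqt df).
apply: DeriveDef; first exact/derivable1_diffP.
rewrite derive_chain //; apply: eq_bigr => i _; congr (_ * _).
by rewrite derive_coord //; exact: (@derive_val _ _ _ _ _ _ _ (dq i)).
Qed.

Lemma segment_ball n (p x y : 'rV[R]_n) (r t : R) : `|x - p| < r -> `|y - p| < r ->
  0 <= t <= 1 -> `|y + t *: (x - y) - p| < r.
Proof.
move=> hx hy /andP[t0 t1].
have -> : y + t *: (x - y) - p = t *: (x - p) + (1 - t) *: (y - p).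
  by apply/rowP => i; rewrite !mxE; ring.
apply: le_lt_trans (ler_normD _ _) _; rewrite !normrZ !ger0_norm ?subr_ge0 //.
have [->|tn] := eqVneq t 0; first by rewrite mul0r subr0 mul1r add0r.
have : 0 < t by rewrite lt_neqAle eq_sym tn.
nra.
Qed.

(** On a ball where the gradient of [f] is close to [c], [f] is close to an
    affine map of gradient [c]. *)
Lemma mvt_ball n (f : 'rV[R]_n -> R) (p x y : 'rV[R]_n) r (c : 'I_n -> R) (eta : R) : 0 <= eta ->
  (forall z : 'rV[R]_n, `|z - p| < r -> differentiable f z) ->
  (forall z : 'rV[R]_n, `|z - p| < r -> forall i, `|partial i f z - c i| <= eta) ->
  `|x - p| < r -> `|y - p| < r ->
  `|f x - f y - \sum_i c i * (x - y) 0 i| <= n%:R * eta * `|x - y|.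
Proof.
move=> e0 df hc hx hy; pose q (t : R) := y + t *: (x - y).
have dq (t : R) i : is_derive t 1 (fun u => q u 0 i) ((x - y) 0 i).
  rewrite (_ : (fun u => _) = fun u => (x - y) 0 i * u + y 0 i).
    exact: daffine.
  by apply/funext => u; rewrite !mxE; ring.
pose S := \sum_i c i * (x - y) 0 i.
have := @mvt_abs R (fun t => f (q t)) (fun t => \sum_i partial i f (q t) * (x - y) 0 i) S
  (n%:R * eta * `|x - y|) 1 0.
have -> : q 1 = x by rewrite /q scale1r addrC subrK.
have -> : q 0 = y by rewrite /q scale0r addr0.
rewrite subr0 normr1 !mulr1; apply.
  move=> t ht; apply: (@is_derive_chain n f q t (fun i => (x - y) 0 i)).
  by apply: df; apply: segment_ball => //; case: ht; lra.
move=> t ht; rewrite /S -sumrB; under eq_bigr do rewrite -mulrBl.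
apply: sum_coord_le => // i; apply: hc; apply: segment_ball => //.
by case: ht; lra.
Qed.

End RowVectors.

Lemma common_radius (R : realType) n (P : 'I_n -> R -> Prop) :
  (forall i (e e' : R), 0 < e' -> e' <= e -> P i e -> P i e') ->
  (forall i, exists2 e, 0 < e & P i e) -> exists2 e, 0 < e & forall i, P i e.
Proof.
elim: n P => [|n ih] P hP h; first by exists 1 => // -[].
have [|i|e e0 he] := ih (fun i => P (lift ord0 i)); [by move=> ? ?; exact: hP|exact: h|].
have [e' e'0 he'] := h ord0; exists (Num.min e e') => [|i]; first by rewrite lt_min e0.
have m0 : 0 < Num.min e e' by rewrite lt_min e0.
have [j ->|->] := unliftP ord0 i.
  by apply: hP (he j) => //; rewrite ge_min lexx.
by apply: hP he' => //; rewrite ge_min lexx orbT.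
Qed.

(** Matrix operations preserve any class of functions that is stable under the
    field operations; they are applied to Hoelder functions and to functions of
    class C^{1,a}. *)
Section FunctionAlgebra.
Variables (R : fieldType) (T : Type) (U : set T) (P : (T -> R) -> Prop).
Hypotheses (Pext : forall f g : T -> R, (forall x, U x -> f x = g x) -> P f -> P g)
  (Pcst : forall k, P (fun=> k))
  (PD : forall f g, P f -> P g -> P (fun x => f x + g x))
  (PM : forall f g, P f -> P g -> P (fun x => f x * g x))
  (PV : forall f, (forall x, U x -> f x != 0) -> P f -> P (fun x => (f x)^-1)).

Lemma alg_sum (I : Type) (r : seq I) (f : I -> T -> R) : (forall i, P (f i)) ->
  P (fun x => \sum_(i <- r) f i x).
Proof.
move=> hf; elim: r => [|i r ih]; first by under eq_fun do rewrite big_nil; exact: Pcst.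
by under eq_fun do rewrite big_cons; exact: PD.
Qed.

Lemma alg_prod (I : Type) (r : seq I) (f : I -> T -> R) : (forall i, P (f i)) ->
  P (fun x => \prod_(i <- r) f i x).
Proof.
move=> hf; elim: r => [|i r ih]; first by under eq_fun do rewrite big_nil; exact: Pcst.
by under eq_fun do rewrite big_cons; exact: PM.
Qed.

Lemma alg_mulmx k l n (A : T -> 'M[R]_(k, l)) (B : T -> 'M[R]_(l, n)) :
  (forall i j, P (fun x => A x i j)) -> (forall i j, P (fun x => B x i j)) ->
  forall i j, P (fun x => (A x *m B x) i j).
Proof.
move=> hA hB i j; under eq_fun do rewrite mxE.
by apply: alg_sum => l'; apply: PM.
Qed.

Lemma alg_det m (A : T -> 'M[R]_m) : (forall i j, P (fun x => A x i j)) ->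
  P (fun x => \det (A x)).
Proof.
move=> hA; rewrite /determinant; apply: alg_sum => s; apply: PM; first exact: Pcst.
by apply: alg_prod.
Qed.

Lemma alg_invmx m (A : T -> 'M[R]_m) : (forall x, U x -> A x \in unitmx) ->
  (forall i j, P (fun x => A x i j)) -> forall i j, P (fun x => invmx (A x) i j).
Proof.
move=> uA hA i j.
have cof : P (fun x => cofactor (A x) j i).
  rewrite /cofactor; apply: PM; first exact: Pcst.
  by apply: alg_det => k l; under eq_fun do rewrite !mxE; exact: hA.
have dV : P (fun x => (\det (A x))^-1).
  by apply: PV; [move=> x Ux; have := uA x Ux; rewrite unitmxE unitfE|exact: alg_det].
apply: Pext (PM dV cof) => x Ux.
by rewrite /invmx uA // !mxE.
Qed.

End FunctionAlgebra.

Section HolderAlgebra.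
Variables (R : realType) (a : R).
Hypothesis a01 : 0 < a < 1.
Let a0 : 0 < a. Proof. by case/andP: a01. Qed.
Let a1 : a < 1. Proof. by case/andP: a01. Qed.

Section Normed.
Variables (V : normedModType R) (U : set V).
Implicit Types (f g : V -> R) (p x y : V).

Let LH f := locally_holder a U f.

Lemma LH_near f p eta : LH f -> U p -> 0 < eta ->
  exists e K, [/\ 0 < e, 0 <= K, forall x y, U x -> U y -> `|x - p| < e -> `|y - p| < e ->
    `|f x - f y| <= K * `|x - y| `^ a & forall x, U x -> `|x - p| < e -> `|f x - f p| <= eta].
Proof.
move=> hf Up eta0; have [e [K [e0 h]]] := hf p Up.
have [r r0 hr] := powR_small `|K| a0 eta0.
have h' x y : U x -> U y -> `|x - p| < e -> `|y - p| < e ->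
    `|f x - f y| <= `|K| * `|x - y| `^ a.
  move=> Ux Uy xp yp; apply: le_trans (h x y Ux Uy _ _) _.
  - by rewrite -ball_normE /= distrC.
  - by rewrite -ball_normE /= distrC.
  by rewrite ler_wpM2r ?powR_ge0 // ler_norm.
exists (Num.min e r), `|K|; split=> [||x y Ux Uy|x Ux]; rewrite ?lt_min ?e0 ?r0 //.
  by move=> /andP[? _] /andP[? _]; apply: h'.
move=> /andP[xe xr]; apply: le_trans (h' x p Ux Up xe _) _; first by rewrite subrr normr0.
exact: hr.
Qed.

Lemma LH_intro f : (forall p, U p -> exists e K, 0 < e /\
   forall x y, U x -> U y -> `|x - p| < e -> `|y - p| < e ->
     `|f x - f y| <= K * `|x - y| `^ a) -> LH f.
Proof.
move=> h p Up; have [e [K [e0 hK]]] := h p Up; exists e, K; split=> // x y Ux Uy.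
by rewrite -ball_normE /= ![`|p - _|]distrC; exact: hK.
Qed.

Lemma LH_ext f g : (forall x, U x -> f x = g x) -> LH f -> LH g.
Proof.
move=> fg hf p Up; have [e [K [e0 h]]] := hf p Up; exists e, K; split=> // x y Ux Uy.
by rewrite -!fg //; exact: h.
Qed.

Lemma LH_cst k : LH (fun=> k).
Proof.
move=> p _; exists 1, 0; split=> // x y _ _ _ _.
by rewrite subrr normr0 mul0r.
Qed.

Lemma LH_D f g : LH f -> LH g -> LH (fun x => f x + g x).
Proof.
move=> hf hg; apply: LH_intro => p Up.
have [e [K [e0 K0 h _]]] := LH_near hf Up ltr01.
have [e' [K' [e0' K0' h' _]]] := LH_near hg Up ltr01.
exists (Num.min e e'), (K + K'); rewrite lt_min e0 e0'; split=> // x y Ux Uy.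
rewrite !lt_min => /andP[x1 x2] /andP[y1 y2].
rewrite opprD addrACA; apply: le_trans (ler_normD _ _) _.
by rewrite mulrDl lerD ?h ?h'.
Qed.

Lemma LH_M f g : LH f -> LH g -> LH (fun x => f x * g x).
Proof.
move=> hf hg; apply: LH_intro => p Up.
have [e [K [e0 K0 h b]]] := LH_near hf Up ltr01.
have [e' [K' [e0' K0' h' b']]] := LH_near hg Up ltr01.
exists (Num.min e e'), (K * (`|g p| + 1) + (`|f p| + 1) * K').
rewrite lt_min e0 e0'; split=> // x y Ux Uy.
rewrite !lt_min => /andP[x1 x2] /andP[y1 y2].
have -> : f x * g x - f y * g y = (f x - f y) * g x + f y * (g x - g y) by ring.
have gx : `|g x| <= `|g p| + 1.
  by rewrite -[g x](subrK (g p)) addrC; apply: le_trans (ler_normD _ _) _; rewrite lerD2l b'.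
have fy : `|f y| <= `|f p| + 1.
  by rewrite -[f y](subrK (f p)) addrC; apply: le_trans (ler_normD _ _) _; rewrite lerD2l b.
apply: le_trans (ler_normD _ _) _; rewrite !normrM.
have A := ler_pM (normr_ge0 _) (normr_ge0 _) (h x y Ux Uy x1 y1) gx.
have B := ler_pM (normr_ge0 _) (normr_ge0 _) fy (h' x y Ux Uy x2 y2).
lra.
Qed.

Lemma LH_V f : (forall x, U x -> f x != 0) -> LH f -> LH (fun x => (f x)^-1).
Proof.
move=> f0 hf; apply: LH_intro => p Up.
have c0 : 0 < `|f p| by rewrite normr_gt0 f0.
have c2 : 0 < `|f p| / 2 by rewrite divr_gt0.
have [e [K [e0 K0 h b]]] := LH_near hf Up c2.
exists e, (K * (`|f p| / 2) ^- 2); split=> // x y Ux Uy xp yp.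
have low z : U z -> `|z - p| < e -> `|f p| / 2 <= `|f z|.
  move=> Uz zp; have := b z Uz zp; have := ler_distD (f z) (f p) 0.
  by rewrite !subr0 (distrC (f p)); lra.
have -> : (f x)^-1 - (f y)^-1 = - (f x - f y) / (f x * f y) by field; rewrite !f0.
have lx := low x Ux xp; have ly := low y Uy yp.
have B : (`|f x| * `|f y|)^-1 <= (`|f p| / 2) ^- 2.
  rewrite lef_pV2 ?posrE ?exprn_gt0 ?mulr_gt0 ?normr_gt0 ?f0 ?invr_gt0 //.
  by rewrite expr2; apply: ler_pM => //; exact: ltW.
rewrite normrM normrN normfV normrM (mulrAC K).
by apply: ler_pM => //; [rewrite invr_ge0 mulr_ge0|exact: h].
Qed.

Lemma LH_sum n (f : 'I_n -> V -> R) : (forall i, LH (f i)) -> LH (fun x => \sum_i f i x).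
Proof.
elim: n f => [|n ih] f hf; first by under eq_fun do rewrite big_ord0; exact: LH_cst.
by under eq_fun do rewrite big_ord_recl; apply: LH_D => //; apply: ih.
Qed.

Lemma LH_lip f : (forall p, U p -> exists e L, 0 < e /\
   forall x y, U x -> U y -> `|x - p| < e -> `|y - p| < e -> `|f x - f y| <= L * `|x - y|) ->
  LH f.
Proof.
move=> h; apply: LH_intro => p Up; have [e [L [e0 hL]]] := h p Up.
exists (Num.min e (1 / 2)), `|L|; split=> [|x y Ux Uy]; first by rewrite lt_min e0 divr_gt0.
rewrite !lt_min => /andP[x1 x2] /andP[y1 y2].
apply: le_trans (hL x y Ux Uy x1 y1) _.
have xy : `|x - y| < 1 by have := ler_distD p x y; rewrite (distrC p y); lra.
apply: (@le_trans _ _ (`|L| * `|x - y|)); first by rewrite ler_wpM2r // ler_norm.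
rewrite ler_wpM2l //; have [->|xn] := eqVneq x y; first by rewrite subrr normr0 powR_ge0.
by apply: ger1_powR; rewrite ?(ltW xy) ?(ltW a1) // normr_gt0 subr_eq0 xn.
Qed.

Lemma LH_comp (W : normedModType R) (U' : set W) (f : W -> R) (q : V -> W) L :
  locally_holder a U' f -> (forall x, U x -> U' (q x)) ->
  (forall x y, U x -> U y -> `|q x - q y| <= L * `|x - y|) -> LH (fun x => f (q x)).
Proof.
move=> hf qU qL; apply: LH_intro => p Up; have [e [K [e0 h]]] := hf _ (qU p Up).
pose M := 1 + `|L|; have M0 : 0 < M by rewrite ltr_pwDl.
have qM x y : U x -> U y -> `|q x - q y| <= M * `|x - y|.
  move=> Ux Uy; apply: le_trans (qL x y Ux Uy) _; rewrite ler_wpM2r //.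
  by have := ler_norm L; rewrite /M; lra.
exists (e / M), (`|K| * M `^ a); rewrite divr_gt0 //; split=> // x y Ux Uy.
rewrite !ltr_pdivlMr // => xp yp.
have qb z : U z -> `|z - p| * M < e -> ball (q p) e (q z).
  move=> Uz zp; rewrite -ball_normE /= distrC; apply: le_lt_trans (qM z p Uz Up) _.
  by rewrite mulrC.
apply: le_trans (h _ _ (qU x Ux) (qU y Uy) (qb x Ux xp) (qb y Uy yp)) _.
apply: (@le_trans _ _ (`|K| * `|q x - q y| `^ a)).
  by rewrite ler_wpM2r ?powR_ge0 // ler_norm.
rewrite -mulrA ler_wpM2l // -powRM // ?(ltW M0) //.
by apply: powR_mono; rewrite ?(ltW a0) // qM.
Qed.

End Normed.

Section C1.
Variables (n : nat) (U : set 'rV[R]_n).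
Hypothesis oU : open U.
Implicit Types (f g : 'rV[R]_n -> R).

(** Scalar functions of class C^{1,a}. *)
Definition sC1 f := (forall x, U x -> differentiable f x) /\
  forall i, locally_holder a U (partial i f).

Lemma open_ball_sub p : U p -> exists2 e, 0 < e & forall x, `|x - p| < e -> U x.
Proof.
move=> Up; have /nbhs_ballP[e /= e0 h] := open_nbhs_nbhs (conj oU Up); exists e => // x xp.
by apply: h; rewrite -ball_normE /= distrC.
Qed.

Lemma sC1_LH f : sC1 f -> locally_holder a U f.
Proof.
move=> [df hf]; apply: LH_lip => p Up.
have [r r0 hr] := open_ball_sub Up.
have [|i|e e0 he] := @common_radius R n (fun i e => forall x : 'rV[R]_n, `|x - p| < e ->
    U x -> `|partial i f x - partial i f p| <= 1).
- by move=> i e e' _ ee h x xp; apply: h; exact: lt_le_trans ee.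
- have [e [K [e0 _ _ h]]] := LH_near (hf i) Up ltr01.
  by exists e => // x xp Ux; exact: h.
pose B := \sum_i `|partial i f p|.
have r'0 : 0 < Num.min r e by rewrite lt_min r0.
exists (Num.min r e), (n%:R * (B + 1)); split=> // x y _ _ xp yp.
have B0 : 0 <= B by apply: sumr_ge0.
have := @mvt_ball R n f p x y (Num.min r e) (fun=> 0) (B + 1).
rewrite big1 ?subr0 => [|i _]; last by rewrite mul0r.
apply => //; first by lra.
  by move=> z; rewrite lt_min => /andP[zr _]; apply/df/hr.
move=> z; rewrite lt_min => /andP[zr ze] i; rewrite subr0.
have h := he i z ze (hr z zr); have : `|partial i f p| <= B.
  by rewrite /B (bigD1 i) //= lerDl; apply: sumr_ge0.
have := ler_distD (partial i f p) (partial i f z) 0; rewrite !subr0; lra.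
Qed.

Lemma sC1_ext f g : (forall x, U x -> f x = g x) -> sC1 f -> sC1 g.
Proof.
move=> fg [df hf].
have near_eq x : U x -> {near x, f =1 g}.
  move=> Ux; have [e e0 h] := open_ball_sub Ux; apply/nbhs_ballP; exists e => // y.
  by rewrite -ball_normE /= distrC => /h; exact: fg.
split=> [x Ux|i].
  have gr := grad_atP (df x Ux).
  suff : grad_at g x (fun i => partial i f x) by move=> /grad_at_differentiable[].
  move=> e e0; have [d d0 hd] := gr e e0; have [r r0 hr] := open_ball_sub Ux.
  exists (Num.min d r); rewrite ?lt_min ?d0 // => y; rewrite lt_min => /andP[yd yr].
  by rewrite -!fg //; [exact: hd|exact: hr].
apply: LH_ext (hf i) => x Ux; apply: near_eq_derive; exact: near_eq.
Qed.

Lemma sC1_cst k : sC1 (fun=> k).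
Proof.
split=> [x _|i]; first exact: differentiable_cst.
apply: LH_ext (LH_cst 0) => x _; rewrite /partial; exact/esym/derive_cst.
Qed.

Lemma sC1_D f g : sC1 f -> sC1 g -> sC1 (fun x => f x + g x).
Proof.
move=> [df hf] [dg hg]; split=> [x Ux|i].
  exact: (differentiableD (df x Ux) (dg x Ux)).
apply: LH_ext (LH_D (hf i) (hg i)) => x Ux; apply/esym.
by apply: deriveD; apply: diff_derivable; [exact: df|exact: dg].
Qed.

Lemma sC1_M f g : sC1 f -> sC1 g -> sC1 (fun x => f x * g x).
Proof.
move=> sf sg; have [df hf] := sf; have [dg hg] := sg; split=> [x Ux|i].
  exact: (differentiableM (df x Ux) (dg x Ux)).
apply: LH_ext (LH_D (LH_M (sC1_LH sf) (hg i)) (LH_M (sC1_LH sg) (hf i))) => x Ux.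
apply/esym.
by apply: deriveM; apply: diff_derivable; [exact: df|exact: dg].
Qed.

Lemma sC1_V f : (forall x, U x -> f x != 0) -> sC1 f -> sC1 (fun x => (f x)^-1).
Proof.
move=> f0 sf; have [df hf] := sf; split=> [x Ux|i].
  exact: (differentiableV (df x Ux) (f0 x Ux)).
have hV := LH_V f0 (sC1_LH sf).
apply: LH_ext (LH_M (LH_M (LH_cst (-1)) (LH_M hV hV)) (hf i)) => x Ux; apply/esym.
rewrite /partial deriveV ?f0 //; last by apply: diff_derivable; exact: df.
by rewrite /GRing.scale /= mulN1r -invfM -expr2.
Qed.

End C1.

Lemma sC1_comp n k (U : set 'rV[R]_n) (W : set 'rV[R]_k) (f : 'rV[R]_n -> R)
    (q : 'rV[R]_k -> 'rV[R]_n) L : open W ->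
  sC1 U f -> (forall i, sC1 W (fun x => q x 0 i)) -> (forall x, W x -> U (q x)) ->
  (forall x y, W x -> W y -> `|q x - q y| <= L * `|x - y|) ->
  sC1 W (fun x => f (q x)).
Proof.
move=> oW [df hf] hq qU qL.
have dq x : W x -> differentiable q x.
  by move=> Wx; apply/differentiable_rvP => i; exact: (hq i).1.
split=> [x Wx|i].
  exact: (differentiable_comp (dq x Wx) (df _ (qU x Wx))).
have := @LH_sum _ W n (fun j x => partial j f (q x) * partial i (fun y => q y 0 j) x).
move=> /(_ (fun j => LH_M (LH_comp (hf j) qU qL) ((hq j).2 i))).
apply: LH_ext => x Wx; rewrite [RHS]/partial derive_chain; [|exact: dq|exact/df/qU].
by apply: eq_bigr => j _; rewrite derive_coord //; exact: dq.
Qed.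

End HolderAlgebra.


Section ClassC2.
Variables (R : realType) (a : R).
Hypothesis a01 : 0 < a < 1.

Lemma dist_le2 (x y z e : R) : `|x - z| <= e -> `|y - z| <= e -> `|x - y| <= 2 * e.
Proof. by rewrite !ler_norml; lra. Qed.

Lemma rv_subE n (u v : 'rV[R]_n) j : (u - v) 0 j = u 0 j - v 0 j.
Proof. by rewrite !mxE. Qed.

Lemma jacobianE n m (rho : 'rV[R]_n -> 'rV[R]_m) x i j : differentiable rho x ->
  'J rho x i j = partial i (fun y => rho y 0 j) x.
Proof.
move=> dr; rewrite /partial -derive_coord // deriveEjacobian //.
by rewrite -rowE [RHS]mxE.
Qed.

Lemma class_Ck2_jacobian n m (U : set 'rV[R]_n) (rho : 'rV[R]_n -> 'rV[R]_m) :
  open U -> class_Ck 2 a U rho ->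
  (forall x, U x -> differentiable rho x) /\
  forall i j, sC1 a U (fun x => 'J rho x i j).
Proof.
move=> oU [dr h]; split=> // i j; have [d2 h2] := h i.
apply: (sC1_ext oU (f := fun x => ('D_(delta_mx 0 i) rho x) 0 j)).
  by move=> x Ux; have dx := dr x Ux; rewrite jacobianE // derive_coord.
split=> [x Ux|k]; first exact: ((differentiable_rvP _ _).1 (d2 x Ux) j).
apply: (LH_ext (f := fun x => ('D_(delta_mx 0 k) (fun y => 'D_(delta_mx 0 i) rho y) x) 0 j)).
  by move=> x Ux; rewrite /partial -derive_coord //; exact: d2.
move=> p Up; have [e [K [e0 hK]]] := h2 k p Up; exists e, K; split=> // x y Ux Uy xp yp.
apply: le_trans (hK x y Ux Uy xp yp).
by apply: le_trans (rv_coord_le _ j); rewrite rv_subE.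
Qed.

Lemma class_Ck2_intro n m (U : set 'rV[R]_n) (h : 'rV[R]_n -> 'rV[R]_m) :
  open U -> (forall x, U x -> differentiable h x) ->
  (forall i j, sC1 a U (partial i (fun y => h y 0 j))) -> class_Ck 2 a U h.
Proof.
move=> oU dh hh; split=> // i.
have E x j : U x -> ('D_(delta_mx 0 i) h x) 0 j = partial i (fun y => h y 0 j) x.
  by move=> Ux; rewrite derive_coord //; exact: dh.
have sD j : sC1 a U (fun x => ('D_(delta_mx 0 i) h x) 0 j).
  by apply: (sC1_ext oU _ (hh i j)) => x Ux; rewrite E.
have dD x : U x -> differentiable (fun y => 'D_(delta_mx 0 i) h y) x.
  by move=> Ux; apply/differentiable_rvP => j; exact: (sD j).1.
split=> // k p Up.
have [||e e0 he] := @common_radius R m (fun j e => exists2 K : R, 0 <= K &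
    forall x y : 'rV[R]_n, U x -> U y -> `|x - p| < e -> `|y - p| < e ->
    `|partial k (fun x => ('D_(delta_mx 0 i) h x) 0 j) x
      - partial k (fun x => ('D_(delta_mx 0 i) h x) 0 j) y| <= K * `|x - y| `^ a).
- move=> j e e' _ ee [K K0 hK]; exists K => // x y Ux Uy xp yp.
  by apply: hK => //; exact: lt_le_trans ee.
- move=> j; have [e [K [e0 K0 hK _]]] := LH_near a01 ((sD j).2 k) Up ltr01.
  by exists e => //; exists K.
have /choice[K hK] : forall j, exists K : R, 0 <= K /\
    forall x y : 'rV[R]_n, U x -> U y -> `|x - p| < e -> `|y - p| < e ->
    `|partial k (fun x => ('D_(delta_mx 0 i) h x) 0 j) x
      - partial k (fun x => ('D_(delta_mx 0 i) h x) 0 j) y| <= K * `|x - y| `^ a.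
  by move=> j; have [K K0 hK] := he j; exists K.
have K0 : 0 <= \sum_j K j by apply: sumr_ge0 => j _; have [] := hK j.
exists e, (\sum_j K j); split=> // x y Ux Uy.
rewrite -!ball_normE /= ![`|p - _|]distrC => xp yp.
apply: rv_norm_le => [|j]; first by rewrite mulr_ge0 ?powR_ge0.
have Ec z : U z -> ('D_(delta_mx 0 k) (fun y => 'D_(delta_mx 0 i) h y) z) 0 j
    = partial k (fun x => ('D_(delta_mx 0 i) h x) 0 j) z.
  by move=> Uz; exact: derive_coord (dD z Uz).
have [_ h'] := hK j; have {}h' := h' x y Ux Uy xp yp.
move: (Ec x Ux) (Ec y Uy) h'.
move: ('D__ _ x) ('D__ _ y) => Ax Ay; rewrite rv_subE => <- <- h'.
apply: le_trans h' _.
rewrite ler_wpM2r ?powR_ge0 // (bigD1 j) //= lerDl.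
by apply: sumr_ge0 => l _; have [] := hK l.
Qed.

End ClassC2.

Section ImplicitFunction.
Variables (R : realType) (a : R).
Hypothesis a01 : 0 < a < 1.
Variables (N m k : nat) (U : set 'rV[R]_N) (rho : 'rV[R]_N -> 'rV[R]_m).
Hypotheses (oU : open U) (hrho : class_Ck 2 a U rho).

Lemma mulmx_norm n l (v : 'rV[R]_n) (A : 'M[R]_(n, l)) B : 0 <= B ->
  (forall i j, `|A i j| <= B) -> `|v *m A| <= n%:R * B * `|v|.
Proof.
move=> B0 hA; apply: rv_norm_le => [|j]; first by rewrite !mulr_ge0.
rewrite mxE; under eq_bigr do rewrite mulrC.
exact: (@sum_coord_le R n (fun i => A i j)).
Qed.

(** Coordinates in which the zero set is to be a graph: x along X, v along V. *)
Definition frame (p : 'rV[R]_N) (X : 'M[R]_(m, N)) (V : 'M[R]_(k, N)) x v :=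
  p + x *m X + v *m V.

Lemma jacobian_close p0 (eta : R) : U p0 -> 0 < eta -> exists2 r, 0 < r &
  forall x : 'rV[R]_N, `|x - p0| < r -> U x /\ forall i j, `|'J rho x i j - 'J rho p0 i j| <= eta.
Proof.
move=> Up eta0; have [dr sJ] := class_Ck2_jacobian oU hrho.
have [r r0 hr] := open_ball_sub oU Up.
have [||e e0 he] := @common_radius R N (fun i e => forall j (x : 'rV[R]_N), `|x - p0| < e -> U x ->
    `|'J rho x i j - 'J rho p0 i j| <= eta).
- by move=> i e e' _ ee h j x xp; apply: h; exact: lt_le_trans ee.
- move=> i.
  have [||e e0 he] := @common_radius R m (fun j e => forall x : 'rV[R]_N, `|x - p0| < e -> U x ->
    `|'J rho x i j - 'J rho p0 i j| <= eta).
  + by move=> j e e' _ ee h x xp; apply: h; exact: lt_le_trans ee.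
  + move=> j; have [e [K [e0 _ _ h]]] := LH_near a01 (sC1_LH a01 oU (sJ i j)) Up eta0.
    by exists e => // x xp Ux; exact: h.
  by exists e => // j; exact: he.
exists (Num.min r e); first by rewrite lt_min r0.
by move=> x; rewrite lt_min => /andP[/hr Ux xe]; split=> // i j; exact: he.
Qed.

Lemma implicit_contraction p0 (kap : R) : U p0 -> 0 <= kap -> exists2 r, 0 < r &
  forall p (X : 'M[R]_(m, N)) (V : 'M[R]_(k, N)), `|p - p0| < r -> (forall i j, `|X i j| <= kap) ->
    (forall i j, `|V i j| <= kap) -> X *m 'J rho p = 1%:M -> V *m 'J rho p = 0 ->
  (forall x v, `|x| < r -> `|v| < r ->
     U (frame p X V x v) /\ X *m 'J rho (frame p X V x v) \in unitmx) /\
  forall x v x' v', `|x| < r -> `|v| < r -> `|x'| < r -> `|v'| < r ->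
    `|rho (frame p X V x v) - rho (frame p X V x' v') - (x - x')|
       <= 1 / 4 * (`|x - x'| + `|v - v'|).
Proof.
move=> Up kap0; pose A : R := (m%:R + k%:R) * kap.
have N0 : 0 <= N%:R :> R by []. have m0 : 0 <= m%:R :> R by [].
have k0 : 0 <= k%:R :> R by [].
have A0 : 0 <= A by rewrite mulr_ge0 // addr_ge0.
pose D := (N%:R + 1) * (A + 1) * ((m%:R + 1) * (kap + 1)).
have D0 : 0 < D by rewrite !mulr_gt0 //; lra.
have mk0 : 0 <= m%:R * kap by rewrite mulr_ge0.
have NA0 : 0 <= N%:R * A by rewrite mulr_ge0.
have D3 : 1 <= (m%:R + 1) * (kap + 1) by lra.
have D4 : N%:R * A <= (N%:R + 1) * (A + 1) by lra.
have D5 : N%:R * 1 <= (N%:R + 1) * (A + 1) by lra.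
have D6 : m%:R * kap <= (m%:R + 1) * (kap + 1) by lra.
have D1 : N%:R * A <= D by rewrite /D; nra.
have D2 : N%:R * 1 * (m%:R * kap) <= D.
  by apply: ler_pM => //; rewrite mulr1.
pose eta := (16 * D)^-1.
have eta0 : 0 < eta by rewrite invr_gt0 mulr_gt0.
have etaE : eta * (16 * D) = 1 by rewrite mulVf // gt_eqF // mulr_gt0.
have e1 : eta * (N%:R * A) <= eta * D by rewrite ler_wpM2l // ltW.
have e2 : eta * (N%:R * 1 * (m%:R * kap)) <= eta * D by rewrite ler_wpM2l // ltW.
have [r0 r00 hr0] := jacobian_close Up eta0.
pose r := r0 / (2 * (A + 1)).
have q0 : 0 < 2 * (A + 1) by rewrite mulr_gt0 //; lra.
have r_gt0 : 0 < r by rewrite divr_gt0.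
have rE : r * (2 * (A + 1)) = r0 by rewrite /r divfK // gt_eqF.
have Ar : 0 <= A * r by rewrite mulr_ge0 // ltW.
exists r => // p X V pp hX hV XJ VJ.
have inb x v : `|x| < r -> `|v| < r -> `|frame p X V x v - p0| < r0.
  move=> xr vr; rewrite /frame.
  have -> : p + x *m X + v *m V - p0 = (p - p0) + (x *m X + v *m V).
    by rewrite -!addrA (addrC (- p0)) -!addrA.
  apply: le_lt_trans (ler_normD _ _) _.
  have B1 := mulmx_norm x kap0 hX; have B2 := mulmx_norm v kap0 hV.
  have B3 := ler_normD (x *m X) (v *m V).
  have B4 : m%:R * kap * `|x| <= m%:R * kap * r by rewrite ler_wpM2l ?mulr_ge0 // ltW.
  have B5 : k%:R * kap * `|v| <= k%:R * kap * r by rewrite ler_wpM2l ?mulr_ge0 // ltW.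
  have B6 : A * r = m%:R * kap * r + k%:R * kap * r by rewrite /A; ring.
  lra.
have pin : `|p - p0| < r0 by lra.
have [Upp Jp] := hr0 p pin.
have [dr _] := class_Ck2_jacobian oU hrho.
have Jc z : `|z - p0| < r0 -> forall i j, `|'J rho z i j - 'J rho p i j| <= 2 * eta.
  move=> zr i j; have [_ /(_ i j) Jz] := hr0 z zr.
  exact: dist_le2 Jz (Jp i j).
have e20 : 0 <= 2 * eta by lra.
split=> [x v xr vr|x v x' v' xr vr xr' vr'].
  have zr := inb x v xr vr; split; first by have [] := hr0 _ zr.
  move: (Jc _ zr) XJ; move: ('J rho (frame p X V x v)) ('J rho p) => Jq Jr hJ XJr.
  rewrite (_ : X *m Jq = 1%:M + X *m (Jq - Jr)); last first.
    by rewrite mulmxBr XJr addrC subrK.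
  apply: (@small_perturbation_unitR _ _ _ (N%:R * (kap * (2 * eta)))).
    move=> i j; rewrite mxE; apply: le_trans (ler_norm_sum _ _ _) _.
    apply: (@le_trans _ _ (\sum_(l < N) kap * (2 * eta))).
      by apply: ler_sum => l _; rewrite normrM ler_pM // !mxE hJ.
    by rewrite sumr_const card_ord -[leLHS]mulr_natl.
  lra.
set q := frame p X V x v; set q' := frame p X V x' v'.
have qq : q - q' = (x - x') *m X + (v - v') *m V.
  rewrite /q /q' /frame !mulmxBl.
  move: (x *m X) (x' *m X) (v *m V) (v' *m V) => A1 A2 A3 A4.
  by apply/rowP => i; rewrite !mxE; ring.
have nq : `|q - q'| <= A * (`|x - x'| + `|v - v'|).
  rewrite qq; apply: le_trans (ler_normD _ _) _.
  have B1 := mulmx_norm (x - x') kap0 hX; have B2 := mulmx_norm (v - v') kap0 hV.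
  have := mulr_ge0 (mulr_ge0 m0 kap0) (normr_ge0 (v - v')).
  have := mulr_ge0 (mulr_ge0 k0 kap0) (normr_ge0 (x - x')).
  by rewrite /A; lra.
have s0 : 0 <= `|x - x'| + `|v - v'| by rewrite addr_ge0.
apply: rv_norm_le => [|b]; first by apply: mulr_ge0 => //; lra.
have dz z : `|z - p0| < r0 -> differentiable rho z by move=> /hr0[/dr].
have := @mvt_ball R N (fun y => rho y 0 b) p0 q q' r0 (fun i => 'J rho p i b) (2 * eta) e20.
move=> /(_ (fun z zr => (differentiable_rvP _ _).1 (dz z zr) b)) M.
have {M} : `|rho q 0 b - rho q' 0 b - \sum_i 'J rho p i b * (q - q') 0 i|
    <= N%:R * (2 * eta) * `|q - q'|.
  apply: M; [|exact: inb|exact: inb].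
  by move=> z zr i; rewrite -jacobianE; [exact: Jc|exact: dz].
have -> : \sum_i 'J rho p i b * (q - q') 0 i = (x - x') 0 b.
  move: XJ VJ; move: ('J rho p) => Jr XJ VJ.
  have -> : x - x' = (q - q') *m Jr.
    by rewrite qq mulmxDl -!mulmxA XJ VJ mulmx1 mulmx0 addr0.
  by rewrite mxE; apply: eq_bigr => i _; rewrite mulrC.
move=> M; rewrite !rv_subE; move: M; rewrite rv_subE => M.
apply: le_trans M _.
have B : N%:R * (2 * eta) * `|q - q'| <= N%:R * (2 * eta) * (A * (`|x - x'| + `|v - v'|)).
  by rewrite ler_wpM2l // mulr_ge0.
apply: le_trans B _.
have -> : N%:R * (2 * eta) * (A * (`|x - x'| + `|v - v'|))
  = 2 * (eta * (N%:R * A)) * (`|x - x'| + `|v - v'|) by ring.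
rewrite ler_wpM2r //; lra.
Qed.

End ImplicitFunction.


Section ImplicitFunctionTheorem.
Variables (R : realType) (a : R).
Hypothesis a01 : 0 < a < 1.
Variables (N m k : nat) (U : set 'rV[R]_N) (rho : 'rV[R]_N -> 'rV[R]_m).
Hypotheses (oU : open U) (hrho : class_Ck 2 a U rho).

Section Graph.
Variables (p : 'rV[R]_N) (X : 'M[R]_(m, N)) (V : 'M[R]_(k, N)) (r : R).
Hypotheses (r0 : 0 < r) (rp : rho p = 0).
Let q x v := frame p X V x v.
Hypothesis hU : forall x v, `|x| < r -> `|v| < r -> U (q x v) /\ X *m 'J rho (q x v) \in unitmx.
Hypothesis hC : forall (x : 'rV[R]_m) (v : 'rV[R]_k) x' v',
  `|x| < r -> `|v| < r -> `|x'| < r -> `|v'| < r ->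
  `|rho (q x v) - rho (q x' v') - (x - x')| <= 1 / 4 * (`|x - x'| + `|v - v'|).

Lemma graph_point v : `|v| < r -> exists2 x, `|x| <= `|v| & rho (q x v) = 0.
Proof.
move=> vr; pose Phi x := x - rho (q x v).
have v0 := normr_ge0 v.
have n0 : `|0 : 'rV[R]_m| < r by rewrite normr0.
have n0' : `|0 : 'rV[R]_k| < r by rewrite normr0.
have q00 : q 0 0 = p by rewrite /q /frame !mul0mx !addr0.
have step x x' : `|x| < r -> `|x'| < r -> `|Phi x - Phi x'| <= 1 / 4 * `|x - x'|.
  move=> xr xr'; have := hC xr vr xr' vr; rewrite subrr normr0 addr0 /Phi.
  move: (rho (q x v)) (rho (q x' v)) => A B.
  rewrite (_ : A - B - (x - x') = - (x - A - (x' - B))) ?normrN //.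
  by apply/rowP => i; rewrite !mxE; ring.
have self x : `|x| <= `|v| -> `|Phi x| <= `|v|.
  move=> xv; have xr : `|x| < r by exact: le_lt_trans xv vr.
  have := hC xr vr n0 n0'; rewrite q00 rp !subr0 -normrN opprB -/(Phi x); lra.
pose u := fix u n := if n is n'.+1 then Phi (u n') else (0 : 'rV[R]_m).
have uv n : `|u n| <= `|v| by elim: n => [|n ih] /=; [rewrite normr0|exact: self].
have ur n : `|u n| < r by exact: le_lt_trans (uv n) vr.
have us n : `|u n.+1 - u n| <= r * 2 ^- n.
  elim: n => [|n ih].
    by rewrite /= subr0 expr0 invr1 mulr1; exact: le_trans (uv 1%N) (ltW vr).
  have := step _ _ (ur n.+1) (ur n); rewrite /= => h.
  apply: le_trans h _; rewrite exprS invfM.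
  have p2 : 0 < r * (2 : R) ^- n by rewrite mulr_gt0 // invr_gt0 exprn_gt0.
  by move: ih; rewrite /= => ih; lra.
have lim i : exists l, forall n, `|l - u n 0 i| <= r * 2 * 2 ^- n.
  have [n|l hl] := @dyadic_lim R (fun n => u n 0 i / r).
    rewrite -mulrBl normrM normfV (gtr0_norm r0) ler_pdivrMr // [leRHS]mulrC.
    by apply: le_trans (us n); rewrite -rv_subE; exact: rv_coord_le.
  exists (r * l) => n; have := hl n.
  rewrite -(ler_pM2l r0) mulrA -{1}(gtr0_norm r0) -normrM mulrBr.
  by rewrite (mulrC r (_ / r)) divfK ?gt_eqF.
have [l hl] := choice lim.
pose x : 'rV[R]_m := \row_i l i.
have xu n : `|x - u n| <= r * 2 * 2 ^- n.
  apply: rv_norm_le => [|i]; first by rewrite !mulr_ge0 ?(ltW r0) // invr_ge0 exprn_ge0.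
  by rewrite rv_subE mxE.
have xv : `|x| <= `|v|.
  apply: (ler_dyadic (c := r * 2)) => n; rewrite -(subrK (u n) x) addrC.
  by apply: le_trans (ler_normD _ _) _; rewrite lerD // uv.
have xr : `|x| < r by exact: le_lt_trans xv vr.
exists x => //; apply/eqP; rewrite -normr_le0.
apply: (ler_dyadic (c := r * 4)) => n; rewrite add0r.
have -> : rho (q x v) = (x - u n.+1) + (Phi (u n) - Phi x).
  rewrite (_ : u n.+1 = Phi (u n)) // {3}/Phi; move: (Phi (u n)) (rho (q x v)) => A B.
  by apply/rowP => i; rewrite !mxE; ring.
apply: le_trans (ler_normD _ _) _.
have h1 := xu n.+1; have h2 := step _ _ (ur n) xr; have h3 := xu n.
rewrite (distrC (u n)) in h2; rewrite exprS invfM in h1.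
have p2 : 0 < r * (2 : R) ^- n by rewrite mulr_gt0 // invr_gt0 exprn_gt0.
lra.
Qed.

Definition graph_fun v : 'rV[R]_m := xget 0 [set x | `|x| <= `|v| /\ rho (q x v) = 0].

Lemma graph_funP v : `|v| < r -> `|graph_fun v| <= `|v| /\ rho (q (graph_fun v) v) = 0.
Proof.
move=> vr; rewrite /graph_fun; case: xgetP => [x _ //|].
by have [x xv xq] := graph_point vr; move=> /(_ x); case.
Qed.

Lemma graph_fun_lt v : `|v| < r -> `|graph_fun v| < r.
Proof. by move=> vr; have [h _] := graph_funP vr; exact: le_lt_trans vr. Qed.

Lemma graph_fun_uniq v x : `|v| < r -> `|x| < r -> rho (q x v) = 0 -> x = graph_fun v.
Proof.
move=> vr xr qx; have [_ qg] := graph_funP vr.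
have := hC xr vr (graph_fun_lt vr) vr; rewrite qx qg !subrr normr0 addr0 sub0r normrN.
move=> h; apply/eqP; rewrite -subr_eq0 -normr_le0.
by have := normr_ge0 (x - graph_fun v); lra.
Qed.

Lemma graph_fun_lip v w : `|v| < r -> `|w| < r -> `|graph_fun v - graph_fun w| <= `|v - w|.
Proof.
move=> vr wr; have [_ qv] := graph_funP vr; have [_ qw] := graph_funP wr.
have := hC (graph_fun_lt vr) vr (graph_fun_lt wr) wr.
rewrite qv qw subrr sub0r normrN.
by have := normr_ge0 (graph_fun v - graph_fun w); have := normr_ge0 (v - w); lra.
Qed.

Lemma graph_fun0 : graph_fun 0 = 0.
Proof.
apply/esym/graph_fun_uniq; rewrite ?normr0 //.
by rewrite /q /frame !mul0mx !addr0.
Qed.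

Let W : set 'rV[R]_k := [set v | `|v| < r].

Let oW : open W.
Proof.
have := ball_open (0 : 'rV[R]_k) r.
by rewrite -ball_normE (_ : ball_ _ _ _ = W) //; apply/seteqP; split=> v; rewrite /W /= sub0r normrN.
Qed.

Let Q v := q (graph_fun v) v.

Let bnd (n l : nat) (A : 'M[R]_(n, l)) : R := \sum_i \sum_j `|A i j|.

Let bndP (n l : nat) (A : 'M[R]_(n, l)) : 0 <= bnd A /\ forall i j, `|A i j| <= bnd A.
Proof.
have h i : 0 <= \sum_j `|A i j| by apply: sumr_ge0.
split; first exact: sumr_ge0.
move=> i j; apply: (@le_trans _ _ (\sum_j `|A i j|)).
  by rewrite (bigD1 j) //= lerDl; apply: sumr_ge0.
by rewrite /bnd (bigD1 i) //= lerDl; apply: sumr_ge0.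
Qed.

Let Q_lip : exists2 L, 0 <= L & forall v w, W v -> W w -> `|Q v - Q w| <= L * `|v - w|.
Proof.
have [X0 hX] := bndP X; have [V0 hV] := bndP V.
exists (m%:R * bnd X + k%:R * bnd V) => [|v w Wv Ww].
  by apply: addr_ge0; apply: mulr_ge0.
have -> : Q v - Q w = (graph_fun v - graph_fun w) *m X + (v - w) *m V.
  rewrite /Q /q /frame !mulmxBl.
  move: (graph_fun v *m X) (graph_fun w *m X) (v *m V) (w *m V) => A1 A2 A3 A4.
  by apply/rowP => i; rewrite !mxE; ring.
apply: le_trans (ler_normD _ _) _; rewrite mulrDl; apply: lerD; last exact: mulmx_norm.
apply: le_trans (mulmx_norm _ X0 hX) _; apply: ler_wpM2l; first exact: mulr_ge0.
exact: graph_fun_lip.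
Qed.

Definition graph_slope v : 'M[R]_(k, m) := - (V *m 'J rho (Q v) *m invmx (X *m 'J rho (Q v))).

Lemma graph_fun_grad v j : `|v| < r ->
  grad_at (fun w => graph_fun w 0 j) v (fun i => graph_slope v i j).
Proof.
move=> vr e e0; have [dr _] := class_Ck2_jacobian oU hrho.
have [UQ uX] := hU (graph_fun_lt vr) vr; rewrite -/(Q v) in UQ uX.
have dQ := dr _ UQ; have [L L0 QL] := Q_lip.
rewrite /graph_slope; move: uX; set J := 'J rho (Q v); set Ai := invmx _ => uX.
have [B0 hB] := bndP Ai; set B := bnd Ai in B0 hB.
pose e1 := e / ((L + 1) * (m%:R * B + 1)).
have mB : 0 <= m%:R * B by rewrite mulr_ge0.
have q0 : 0 < (L + 1) * (m%:R * B + 1) by rewrite mulr_gt0 //; lra.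
have e10 : 0 < e1 by rewrite divr_gt0.
have e1E : e1 * ((L + 1) * (m%:R * B + 1)) = e by rewrite /e1 divfK // gt_eqF.
have gr b := grad_atP ((differentiable_rvP _ _).1 dQ b) e10.
have [||d d0 hd] := @common_radius R m (fun b d => forall y : 'rV[R]_N, `|y - Q v| < d ->
   `|rho y 0 b - rho (Q v) 0 b - \sum_i J i b * (y - Q v) 0 i| <= e1 * `|y - Q v|).
- by move=> b d d' _ dd h y yd; apply: h; exact: lt_le_trans dd.
- move=> b; have [d d0 hd] := gr b; exists d => // y /hd.
  by under eq_bigr do rewrite -(jacobianE _ _ dQ).
exists (Num.min (d / (L + 1)) (r - `|v|)).
  by rewrite lt_min subr_gt0 vr andbT divr_gt0 //; lra.
move=> w; rewrite lt_min ltr_pdivlMr; last lra.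
move=> /andP[wd wr'].
have wr : `|w| < r.
  by rewrite -(subrK v w); apply: le_lt_trans (ler_normD _ _) _; lra.
have Qwv := QL w v wr vr.
have wv0 := normr_ge0 (w - v).
have [_ rw] := graph_funP wr; have [_ rv] := graph_funP vr.
rewrite -/(q _ _) -/(Q _) in rw rv.
have hb b : `|((Q w - Q v) *m J) 0 b| <= e1 * (L * `|w - v|).
  have := hd b (Q w); rewrite rw rv !mxE subrr sub0r normrN => h.
  under eq_bigr do rewrite mulrC.
  apply: le_trans (h _) _; first by lra.
  by rewrite ler_wpM2l // ltW.
have QE : (Q w - Q v) *m J *m Ai
    = (graph_fun w - graph_fun v) + (w - v) *m (V *m J *m Ai).
  have -> : Q w - Q v = (graph_fun w - graph_fun v) *m X + (w - v) *m V.
    rewrite /Q /q /frame !mulmxBl.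
    move: (graph_fun v *m X) (graph_fun w *m X) (v *m V) (w *m V) => A1 A2 A3 A4.
    by apply/rowP => i; rewrite !mxE; ring.
  have XA : X *m (J *m Ai) = 1%:M by rewrite mulmxA; exact: mulmxV.
  by rewrite !mulmxDl -!mulmxA XA !mulmx1.
have -> : graph_fun w 0 j - graph_fun v 0 j
    - \sum_i (- (V *m J *m Ai)) i j * (w - v) 0 i = ((Q w - Q v) *m J *m Ai) 0 j.
  rewrite QE !mxE -sumrN; congr (_ + _); apply: eq_bigr => i _.
  by rewrite [in LHS]mxE mulNr opprK mulrC.
rewrite mxE; under eq_bigr do rewrite mulrC.
have := @sum_coord_le R m (fun b => Ai b j) ((Q w - Q v) *m J) B B0 (fun b => hB b j).
move=> h; apply: le_trans h _.
have nb : `|(Q w - Q v) *m J| <= e1 * (L * `|w - v|).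
  by apply: rv_norm_le => //; exact: mulr_ge0 (ltW e10) (mulr_ge0 L0 wv0).
apply: le_trans (ler_wpM2l mB nb) _; rewrite -e1E.
have h1 := mulr_ge0 (mulr_ge0 mB (ltW e10)) wv0.
have h2 := mulr_ge0 (mulr_ge0 L0 (ltW e10)) wv0; have h3 := mulr_ge0 (ltW e10) wv0.
lra.
Qed.

Lemma graph_fun_diff v : `|v| < r -> differentiable graph_fun v /\ 'J graph_fun v = graph_slope v.
Proof.
move=> vr.
have dg : differentiable graph_fun v.
  by apply/differentiable_rvP => j; exact: (grad_at_differentiable (graph_fun_grad j vr)).1.
split=> //; apply/matrixP => i j; rewrite jacobianE //.
exact: (grad_at_differentiable (graph_fun_grad j vr)).2.
Qed.

Lemma graph_fun_class : class_Ck 2 a W graph_fun.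
Proof.
have [dr sJ] := class_Ck2_jacobian oU hrho; have [L L0 QL] := Q_lip.
have QU v : W v -> U (Q v) by move=> Wv; have [] := hU (graph_fun_lt Wv) Wv.
have uXQ v : W v -> X *m 'J rho (Q v) \in unitmx.
  by move=> Wv; have [] := hU (graph_fun_lt Wv) Wv.
(* the entries of the slope belong to every class closed under field operations
   that contains the entries of the Jacobian along the graph *)
have alg (P : ('rV[R]_k -> R) -> Prop) :
    (forall f g : 'rV[R]_k -> R, (forall x, W x -> f x = g x) -> P f -> P g) ->
    (forall c, P (fun=> c)) ->
    (forall f g, P f -> P g -> P (fun x => f x + g x)) ->
    (forall f g, P f -> P g -> P (fun x => f x * g x)) ->
    (forall f, (forall x, W x -> f x != 0) -> P f -> P (fun x => (f x)^-1)) ->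
    (forall i j, P (fun v => 'J rho (Q v) i j)) ->
    forall i j, P (fun v => graph_slope v i j).
  move=> Pe Pc PD PM PV PJ i j; rewrite /graph_slope.
  under eq_fun do rewrite mxE -mulN1r.
  apply: (PM); first exact: Pc.
  apply: (alg_mulmx Pc PD PM).
    by apply: (alg_mulmx Pc PD PM) => // *; exact: Pc.
  apply: (alg_invmx Pe Pc PD PM PV) => //.
  by apply: (alg_mulmx Pc PD PM) => // *; exact: Pc.
have dE i j v : W v -> partial i (fun w => graph_fun w 0 j) v = graph_slope v i j.
  by move=> Wv; exact: (grad_at_differentiable (graph_fun_grad j Wv)).2.
have dg v : W v -> differentiable graph_fun v by move=> /graph_fun_diff[].
have h1 i j : locally_holder a W (fun v => graph_slope v i j).
  apply: (alg (fun f => locally_holder a W f)).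
  - by move=> f g; exact: LH_ext.
  - by move=> c; exact: LH_cst.
  - by move=> f g; exact: LH_D.
  - by move=> f g; exact: LH_M.
  - by move=> f; exact: LH_V.
  - by move=> i' j'; apply: (LH_comp a01 (sC1_LH a01 oU (sJ i' j')) QU QL).
have sg j : sC1 a W (fun v => graph_fun v 0 j).
  split=> [v Wv|i]; first exact: ((differentiable_rvP _ _).1 (dg v Wv) j).
  by apply: LH_ext (h1 i j) => v Wv; rewrite dE.
have saff (n : nat) (c : 'rV[R]_n) (A : 'M[R]_(k, n)) j : sC1 a W (fun v => (c + v *m A) 0 j).
  have gr v : grad_at (fun v => (c + v *m A) 0 j) v (fun i => A i j).
    move=> e e0; exists 1 => // w _.
    have -> : (c + w *m A) 0 j - (c + v *m A) 0 j = \sum_i A i j * (w - v) 0 i.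
      rewrite !mxE opprD addrACA subrr add0r -sumrB; apply: eq_bigr => i _.
      by rewrite !mxE; ring.
    by rewrite subrr normr0; exact: mulr_ge0 (ltW e0) _.
  split=> [v _|i]; first exact: (grad_at_differentiable (gr v)).1.
  apply: LH_ext (LH_cst a (A i j)) => v _.
  by rewrite (grad_at_differentiable (gr v)).2.
have sQ j : sC1 a W (fun v => Q v 0 j).
  apply: (sC1_ext oW (f := fun v => (p + v *m V) 0 j + \sum_l graph_fun v 0 l * X l j)).
    by move=> v _; rewrite /Q /q /frame !mxE; ring.
  apply: (sC1_D a01); first exact: saff.
  apply: (alg_sum (P := sC1 a W) (sC1_cst a W) (@sC1_D _ _ a01 _ W)) => l.
  by apply: (sC1_M a01 oW); [exact: sg|exact: sC1_cst].
apply: class_Ck2_intro => // i j.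
have h2 : sC1 a W (fun v => graph_slope v i j).
  apply: (alg (fun f => sC1 a W f)).
  - by move=> f g; exact: (sC1_ext oW).
  - by move=> c; exact: sC1_cst.
  - by move=> f g; exact: (sC1_D a01).
  - by move=> f g; exact: (sC1_M a01 oW).
  - by move=> f; exact: (sC1_V a01 oW).
  - by move=> i' j'; apply: (sC1_comp a01 oW (sJ i' j') sQ QU QL).
by apply: (sC1_ext oW _ h2) => v Wv; rewrite dE.
Qed.

End Graph.

End ImplicitFunctionTheorem.



Section BoundaryOfDiscs.
Variables (R : realType) (d : R).
Hypothesis d01 : 0 < d < 1.
Let d0 : 0 < d. Proof. by case/andP: d01. Qed.
Let d1 : d < 1. Proof. by case/andP: d01. Qed.

Lemma holder_mul K L A B (f g : R -> R) : (forall t, `|f t| <= A) -> (forall t, `|g t| <= B) ->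
  holder d K f -> holder d L g -> holder d (A * L + K * B) (fun t => f t * g t).
Proof.
move=> fA gB fK gL s t.
have -> : f s * g s - f t * g t = f s * (g s - g t) + (f s - f t) * g t by ring.
apply: le_trans (ler_normD _ _) _; rewrite !normrM mulrDl -!mulrA lerD //.
  by apply: ler_pM => //; exact: gL.
by rewrite mulrA mulrAC; apply: ler_pM => //; exact: fK.
Qed.

Lemma holder_add K L (f g : R -> R) : holder d K f -> holder d L g ->
  holder d (K + L) (fun t => f t + g t).
Proof.
move=> fK gL s t; rewrite opprD addrACA mulrDl.
by apply: le_trans (ler_normD _ _) _; exact: lerD.
Qed.

Definition circ (r t : R) : 'rV[R]_2 := \row_i (if i == 0 then r * cos t else r * sin t).

Lemma circ0 r t : circ r t 0 0 = r * cos t. Proof. by rewrite mxE. Qed.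
Lemma circ1 r t : circ r t 0 1 = r * sin t. Proof. by rewrite mxE. Qed.

Lemma circ_lip r s t : 0 <= r -> r <= 1 -> `|circ r s - circ r t| <= `|s - t|.
Proof.
move=> r0 r1; apply: rv_norm_le => // i; rewrite !mxE.
have h x : `|x| <= `|s - t| -> `|r * x| <= `|s - t|.
  by move=> hx; rewrite normrM ger0_norm //; apply: le_trans (ler_piMl _ r1) hx.
by case: ifP => _; rewrite -mulrBr; apply: h; [exact: cos_lip|exact: sin_lip].
Qed.

Lemma circ_radial r t : r <= 1 -> `|circ r t - circ 1 t| <= 1 - r.
Proof.
move=> r1; have p : 0 <= 1 - r by rewrite subr_ge0.
apply: rv_norm_le => // i; rewrite !mxE.
have h x : `|x| <= 1 -> `|r * x - 1 * x| <= 1 - r.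
  move=> hx; rewrite -mulrBl normrM distrC (ger0_norm p).
  exact: (ler_piMr p hx).
by case: ifP => _; apply: h; [exact: cos_max|exact: sin_max].
Qed.

Lemma circ_norm r t : 0 <= r -> r <= 1 -> `|circ r t| <= 1.
Proof.
move=> r0 r1; apply: rv_norm_le => // i; rewrite mxE.
have h x : `|x| <= 1 -> `|r * x| <= 1.
  by move=> hx; rewrite normrM ger0_norm //; exact: mulr_ile1.
by case: ifP => _; apply: h; [exact: cos_max|exact: sin_max].
Qed.

Lemma circ_C r t : plane_to_C (circ r t) = r%:C * val (expi t).
Proof. by rewrite /plane_to_C circ0 circ1 /=; simpc. Qed.

Lemma circ_disc2 r t : 0 <= r -> r < 1 -> disc2 (circ r t).
Proof.
move=> r0 r1; rewrite /disc2 /= discE circ_C cabsM cabs_circle mulr1 cabs_real.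
by rewrite ger0_norm.
Qed.

Lemma disc2_norm (x : 'rV[R]_2) : disc2 x -> `|x| <= 1.
Proof.
rewrite /disc2 /= discE => /ltW h; apply: rv_norm_le => // i.
have /orP[/eqP ->|/eqP ->] : (i == 0) || (i == 1) by case: i => -[|[|]].
  exact: le_trans (Re_le_cabs _) h.
exact: le_trans (Im_le_cabs _) h.
Qed.

Lemma is_derive_circ (r t : R) (i : 'I_2) : is_derive t 1 (fun s => circ r s 0 i)
  (if i == 0 then r * - sin t else r * cos t).
Proof.
case: ifP => hi.
  have -> : (fun s => circ r s 0 i) = (fun s => r * cos s).
    by apply/funext => s; rewrite mxE hi.
  exact: dZ (is_derive_cos t).
have -> : (fun s => circ r s 0 i) = (fun s => r * sin s).
  by apply/funext => s; rewrite mxE hi.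
exact: dZ (is_derive_sin t).
Qed.

Lemma boundary_derivative (u : 'rV[R]_2 -> R) K : 0 <= K ->
  (forall x, disc2 x -> differentiable u x) ->
  (forall i x, disc2 x -> `|partial i u x| <= K) ->
  (forall i x y, disc2 x -> disc2 y -> `|partial i u x - partial i u y| <= K * `|x - y| `^ d) ->
  (forall t e, 0 < e -> exists2 r0, r0 < 1 & forall r, r0 < r -> r < 1 ->
     `|u (circ r t) - u (circ 1 t)| <= e) ->
  exists D : R -> R, [/\ forall t : R, is_derive t 1 (fun t => u (circ 1 t)) (D t),
    forall t, `|D t| <= 4 * K & holder d (10 * K) D].
Proof.
move=> K0 du uK uH urad.
have ext i : exists v : 'rV[R]_2 -> R, (forall x, disc2 x -> v x = partial i u x) /\
    forall x y, `|v x - v y| <= K * `|x - y| `^ d.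
  apply: mcshane => [x|x y|x y z||x y Dx Dy].
  - by rewrite subrr normr0 powR0 ?gt_eqF // mulr0.
  - by rewrite distrC.
  - rewrite -mulrDr ler_wpM2l //; apply: le_trans (powR_subadd d01 _ _) => //.
    apply: powR_mono => //; first exact: ltW.
    by rewrite (_ : x - z = (x - y) + (y - z)) ?ler_normD // addrA subrK.
  - by exists (circ 0 0); apply: circ_disc2.
  - by apply: le_trans (uH i _ _ Dx Dy); exact: ler_norm.
have [v hv] := choice ext.
have vE i x : disc2 x -> v i x = partial i u x by have [h _] := hv i; exact: h.
have vH i x y : `|v i x - v i y| <= K * `|x - y| `^ d by have [_ h] := hv i.
have D0 : disc2 (circ 0 0) by apply: circ_disc2.
have c00 : circ 0 0 = 0 by apply/rowP => i; rewrite !mxE !mul0r; case: ifP.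
have v2 i r t : 0 <= r -> r <= 1 -> `|v i (circ r t)| <= 2 * K.
  move=> r0 r1; have h1 := vH i (circ r t) (circ 0 0).
  have h2 := uK i _ D0; rewrite -vE // in h2.
  have h3 : `|circ r t - circ 0 0| `^ d <= 1.
    have := powR_mono (ltW d0) (normr_ge0 _) (circ_norm t r0 r1).
    by rewrite powR1 c00 subr0.
  have h4 : K * `|circ r t - circ 0 0| `^ d <= K by exact: ler_piMr.
  have h5 := ler_normB (v i (circ r t) - v i (circ 0 0)) (- v i (circ 0 0)).
  by rewrite opprK subrK normrN in h5; lra.
pose D r t := v 0 (circ r t) * (r * - sin t) + v 1 (circ r t) * (r * cos t).
have Hv i r : 0 <= r -> r <= 1 -> holder d K (fun t => v i (circ r t)).
  move=> r0 r1 s t; apply: le_trans (vH _ _ _) _; rewrite ler_wpM2l //.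
  by apply: powR_mono => //; [exact: ltW|exact: circ_lip].
have Hc r (f : R -> R) : 0 <= r -> r <= 1 -> (forall t, `|f t| <= 1) ->
    (forall s t, `|f s - f t| <= `|s - t|) ->
    (forall t, `|r * f t| <= 1) /\ holder d 2 (fun t => r * f t).
  move=> r0 r1 f1 fl.
  have b t : `|r * f t| <= 1 by rewrite normrM ger0_norm //; exact: mulr_ile1.
  split=> //; rewrite -[X in holder d X](mulr1 2).
  apply: (holder_of_lip d01 ler01 b) => s t; rewrite mul1r -mulrBr normrM ger0_norm //.
  by apply: le_trans (ler_piMl _ r1) (fl s t).
have sinN (s t : R) : `|- sin s - - sin t| <= `|s - t| by rewrite -opprD normrN; exact: sin_lip.
have sinN1 (t : R) : `|- sin t| <= 1 by rewrite normrN; exact: sin_max.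
have DH r : 0 <= r -> r <= 1 -> holder d (10 * K) (D r).
  move=> r0 r1; have [s1 sH] := Hc r _ r0 r1 sinN1 sinN.
  have [c1 cH] := Hc r _ r0 r1 (@cos_max R) (@cos_lip R).
  have -> : 10 * K = (2 * K * 2 + K * 1) + (2 * K * 2 + K * 1) by ring.
  by apply: holder_add; apply: holder_mul => //; try exact: Hv; move=> t; exact: v2.
exists (D 1); split=> [t|t|]; last exact: DH.
  apply: (@is_derive_lim _ _ d01 (10 * K)) => [|s' s e e0]; first by rewrite mulr_ge0.
  have [r1 r11 h1] := urad s' e e0; have [r2 r21 h2] := urad s e e0.
  have [q q0 hq] := powR_small (2 * K) d0 (divr_gt0 e0 (ltr0n R 2)).
  have e4 : 0 < e / (8 * K + 1) by rewrite divr_gt0 //; lra.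
  pose r := Num.max (Num.max r1 r2) (Num.max (1 - q / 2) (Num.max (1 - e / (8 * K + 1)) 0)).
  pose r' := (1 + r) / 2.
  have r1' : r < 1 by rewrite /r !gt_max r11 r21 ltr01 /=; lra.
  have rr : r < r' by rewrite /r'; lra.
  have r'1 : r' < 1 by rewrite /r'; lra.
  have : r <= r by [].
  rewrite {1}/r !ge_max => /andP[/andP[ra rb] /andP[rc /andP[rd re]]].
  have r'0 : 0 <= r' by rewrite /r'; lra.
  exists (fun t => u (circ r' t)), (D r'); split.
  - by apply: DH => //; exact: ltW.
  - move=> x; have Dx := circ_disc2 x r'0 r'1.
    apply: dE (is_derive_chain (is_derive_circ r' x) (du _ Dx)) _.
    rewrite /D !vE // big_ord_recl big_ord1 /=.
    by rewrite (_ : lift ord0 ord0 = 1) //; exact: val_inj.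
  - by apply: h1 => //; lra.
  - by apply: h2 => //; lra.
  - rewrite /D !mul1r.
    have h3 i : `|v i (circ r' s) - v i (circ 1 s)| <= e / 2 / 2.
      apply: le_trans (vH _ _ _) _.
      have := hq _ (normr_ge0 (circ r' s - circ 1 s)).
      have := circ_radial s (ltW r'1) => h /(_ (le_lt_trans h _)); rewrite -mulrA.
      by move=> /(_ ltac:(lra)); lra.
    have term i (f : R) : `|f| <= 1 -> `|v i (circ r' s) * (r' * f) - v i (circ 1 s) * f| <= e / 2.
      move=> f1.
      have -> : v i (circ r' s) * (r' * f) - v i (circ 1 s) * f
        = ((v i (circ r' s) - v i (circ 1 s)) - (1 - r') * v i (circ r' s)) * f by ring.
      rewrite normrM; apply: le_trans (ler_piMr _ f1) _ => //.
      apply: le_trans (ler_normB _ _) _; rewrite normrM (ger0_norm (x := 1 - r')); last lra.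
      have v3 := v2 i r' s r'0 (ltW r'1).
      have h4 : (1 - r') * `|v i (circ r' s)| <= e / (8 * K + 1) * (2 * K).
        by apply: ler_pM => //; lra.
      have h5 : e / (8 * K + 1) * (8 * K + 1) = e by rewrite divfK // gt_eqF //; lra.
      by have := h3 i; lra.
    rewrite opprD addrACA; apply: le_trans (ler_normD _ _) _.
    by have := term 0 _ (sinN1 s); have := term 1 _ (cos_max s); lra.
rewrite /D !mul1r; apply: le_trans (ler_normD _ _) _; rewrite !normrM.
have a i (f : R) : `|f| <= 1 -> `|v i (circ 1 t)| * `|f| <= 2 * K.
  by move=> f1; apply: le_trans (ler_piMr _ f1) _ => //; exact: v2.
by have := a 0 _ (sinN1 t); have := a 1 _ (cos_max t); lra.
Qed.

End BoundaryOfDiscs.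



Section Realification.
Variables (R : realType) (n : nat).
Implicit Types u v : 'rV[R[i]]_n.

Lemma realify0 : realify (0 : 'rV[R[i]]_n) = 0.
Proof. by rewrite /realify !map_mx0 row_mx0. Qed.

Lemma realifyD u v : realify (u + v) = realify u + realify v.
Proof. by rewrite /realify !map_mxD -add_row_mx. Qed.

Lemma realifyB u v : realify (u - v) = realify u - realify v.
Proof. by rewrite /realify !map_mxB opp_row_mx add_row_mx. Qed.

End Realification.

Section DiscSize.
Variables (R : realType) (d : R).
Hypothesis d01 : 0 < d < 1.
Let d0 : 0 < d. Proof. by case/andP: d01. Qed.
Variables (n : nat) (phi : R[i] -> 'rV[R[i]]_n).
Hypothesis hphi : C1_disc d phi.

Let F := real_form phi.

Lemma real_form_translate z0 x : real_form (fun z => phi z + z0) x = F x + realify z0.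
Proof. exact: realifyD. Qed.

Lemma derive_translate (V W : normedModType R) (f : V -> W) c x v :
  'D_v (fun y => f y + c) x = 'D_v f x.
Proof.
have E : (fun h : R => h^-1 *: (((fun y => f y + c) \o shift x) (h *: v) - (f x + c)))
    = (fun h : R => h^-1 *: ((f \o shift x) (h *: v) - f x)).
  by apply/funext => h /=; rewrite opprD addrACA subrr addr0.
by rewrite /derive E.
Qed.

Lemma sup_ge0 (A : set R) : (forall x, A x -> 0 <= x) -> 0 <= sup A.
Proof.
move=> hA; have [[[x Ax] ub]|/sup_out ->//] := pselect (has_sup A).
by apply: le_trans (hA x Ax) _; exact: ub_le_sup.
Qed.

Lemma disc_size_bounds R0 : disc_size d phi < R0 ->
  (forall (i : 'I_2) x, disc2 x -> `|'D_(delta_mx 0 i) F x| <= R0) /\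
  forall (i : 'I_2) x y, disc2 x -> disc2 y ->
    `|'D_(delta_mx 0 i) F x - 'D_(delta_mx 0 i) F y| <= R0 * `|x - y| `^ d.
Proof.
move=> hR; have [_ _ [K hK]] := hphi.
have [|_ [z0 _ <-] hz] := inf_lt _ hR; first by exists (C1_norm d (fun z => phi z + 0)), 0.
have D_tr (i : 'I_2) x : 'D_(delta_mx 0 i) (real_form (fun z => phi z + z0)) x
    = 'D_(delta_mx 0 i) F x.
  have -> : real_form (fun z => phi z + z0) = (fun y => F y + realify z0).
    by apply/funext => y; exact: real_form_translate.
  exact: derive_translate.
have K0 : 0 <= `|K| by [].
have hK' (i : 'I_2) x y : disc2 x -> disc2 y ->
    `|'D_(delta_mx 0 i) F x - 'D_(delta_mx 0 i) F y| <= `|K| * `|x - y| `^ d.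
  move=> Dx Dy; apply: le_trans (hK i x y Dx Dy) _.
  by rewrite ler_wpM2r ?powR_ge0 // ler_norm.
have D00 : disc2 (0 : 'rV[R]_2).
  have := @circ_disc2 R 0 0 (lexx _) ltr01; congr disc2.
  by apply/rowP => i; rewrite !mxE !mul0r; case: ifP.
move: hz; rewrite /C1_norm; set S0 := sup _; set S1 := \sum_(i < 2) _; set S2 := \sum_(i < 2) _.
move=> hz.
have s0 : 0 <= S0 by apply: sup_ge0 => _ [x _ <-].
have t1 (i : 'I_2) : 0 <= sup [set `|'D_(delta_mx 0 i) (real_form (fun z => phi z + z0)) x| | x in @disc2 R].
  by apply: sup_ge0 => _ [x _ <-].
have t2 (i : 'I_2) : 0 <= sup [set q | exists x y, [/\ disc2 x, disc2 y, x <> y &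
      q = `|'D_(delta_mx 0 i) (real_form (fun z => phi z + z0)) x
         - 'D_(delta_mx 0 i) (real_form (fun z => phi z + z0)) y| / `|x - y| `^ d]].
  apply: sup_ge0 => _ [x [y [_ _ _ ->]]].
  by rewrite divr_ge0 // powR_ge0.
have s1 : 0 <= S1 by apply: sumr_ge0 => i _; exact: t1.
have s2 : 0 <= S2 by apply: sumr_ge0 => i _; exact: t2.
have le_sum (G : 'I_2 -> R) i : (forall i, 0 <= G i) -> G i <= \sum_(i < 2) G i.
  by move=> G0; rewrite (bigD1 i) //= lerDl sumr_ge0.
split=> [i x Dx|i x y Dx Dy].
  apply: (@le_trans _ _ S1); last by lra.
  apply: le_trans (le_sum _ i t1); apply: ub_le_sup; last by exists x; rewrite ?D_tr.
  exists (`|'D_(delta_mx 0 i) F 0| + `|K|) => _ [y Dy <-]; rewrite D_tr.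
  rewrite -(subrK ('D_(delta_mx 0 i) F 0) ('D_(delta_mx 0 i) F y)) addrC.
  apply: le_trans (ler_normD _ _) _; rewrite lerD2l; apply: le_trans (hK' i _ _ Dy D00) _.
  rewrite subr0; apply: ler_piMr => //.
  by have := powR_mono (ltW d0) (normr_ge0 _) (disc2_norm Dy); rewrite powR1.
have [->|/eqP xy] := pselect (x = y).
  by rewrite !subrr !normr0 mulr_ge0 ?powR_ge0 //; lra.
have p : 0 < `|x - y| `^ d by rewrite powR_gt0 // normr_gt0 subr_eq0.
rewrite -ler_pdivrMr //; apply: (@le_trans _ _ S2); last by lra.
apply: le_trans (le_sum _ i t2); apply: ub_le_sup; last first.
  by exists x, y; rewrite !D_tr; split=> //; exact/eqP.
exists `|K| => _ [x' [y' [Dx' Dy' xy' ->]]]; rewrite !D_tr.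
rewrite ler_pdivrMr; first exact: hK'.
by rewrite powR_gt0 // normr_gt0 subr_eq0; exact/eqP.
Qed.

Lemma disc_radial j t e : 0 < e -> exists2 r0, r0 < 1 & forall r, r0 < r -> r < 1 ->
  `|F (circ r t) 0 j - F (circ 1 t) 0 j| <= e.
Proof.
move=> e0; have [cphi _ _] := hphi.
have coordP (k : 'I_n) : exists2 r0, r0 < 1 & forall r, r0 < r -> r < 1 ->
    cabs (phi (r%:C * val (expi t)) 0 k - phi (val (expi t)) 0 k) <= e.
  have ck : {within @closed_disc R, continuous (fun z => phi z 0 k)}.
    move=> z; have h := @continuous_comp _ _ _ _ (fun v : 'rV[R[i]]_n => v 0 k) z (cphi z).
    have h2 := h (@coord_continuous _ _ _ 0 k _); exact h2.
  have [|q q0 h] := (continuous_discP _).1 ck (val (expi t)) _ e e0.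
    by rewrite cabs_circle.
  exists (Num.max 0 (1 - q)) => [|r]; first by rewrite gt_max ltr01 /=; lra.
  rewrite gt_max => /andP[r0 rq] r1; apply: h.
    by rewrite cabsM cabs_circle mulr1 cabs_real ger0_norm ?ltW.
  rewrite -[X in _ - X]mul1r -mulrBl cabsM cabs_circle mulr1 -raddfB cabs_real distrC.
  by rewrite ger0_norm; lra.
have e1 : val (expi t) = plane_to_C (circ 1 t) by rewrite circ_C mul1r.
case: (split_ordP j) => k ->; have [r0 r01 h] := coordP k; exists r0 => // r rr r1.
  rewrite /F /real_form /realify !row_mxEl !mxE -raddfB circ_C -e1.
  by apply: le_trans (Re_le_cabs _) _; exact: h.
rewrite /F /real_form /realify !row_mxEr !mxE -raddfB circ_C -e1.
by apply: le_trans (Im_le_cabs _) _; exact: h.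
Qed.

Lemma disc_boundary R0 : disc_size d phi < R0 ->
  forall j, Bnd d (32 * R0) (fun s => realify (phi (val s) - phi 1) 0 j).
Proof.
move=> hR j; have [hD hH] := disc_size_bounds hR; have [_ dF _] := hphi.
have R00 : 0 <= R0.
  have D00 := @circ_disc2 R 0 0 (lexx _) ltr01.
  by apply: le_trans (hD 0 _ D00).
have E i x : disc2 x -> partial i (fun y => F y 0 j) x = ('D_(delta_mx 0 i) F x) 0 j.
  by move=> Dx; rewrite /partial -derive_coord //; exact: dF.
have [//|x Dx|i x Dx|i x y Dx Dy|t e e0|D [dD D4 D10]] :=
  @boundary_derivative R d d01 (fun x => F x 0 j) R0.
- exact: ((differentiable_rvP F x).1 (dF x Dx) j).
- by rewrite E //; apply: le_trans (rv_coord_le _ j) _; exact: hD.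
- by rewrite !E // -rv_subE; apply: le_trans (rv_coord_le _ j) _; exact: hH.
- exact: disc_radial.
have val1 t : F (circ 1 t) = realify (phi (val (expi t))).
  by rewrite /F /real_form circ_C mul1r.
have e1 : val (expi 0) = 1 :> R[i] by rewrite /= cos0 sin0.
have gE t : realify (phi (val (expi t)) - phi 1) 0 j = F (circ 1 t) 0 j + - F (circ 1 0) 0 j.
  by rewrite !val1 e1 -rv_subE realifyB.
have R4 : 0 <= 4 * R0 by rewrite mulr_ge0.
exists D; split=> [t|t|s t|t].
- have per u : realify (phi (val (expi (u + pi *+ 2))) - phi 1) 0 j
      = realify (phi (val (expi u)) - phi 1) 0 j by rewrite expiD2pi.
  have := @periodic_le R (fun t => realify (phi (val (expi t)) - phi 1) 0 j) (32 * R0) per.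
  rewrite e1 subrr realify0 mxE normr0 add0r; apply=> u /andP[u0 u1].
  rewrite subr0 gE; have := lip_of_derive (fun x _ => dD x) (fun x _ => D4 x) (s := u) (t := 0).
  rewrite subr0 (ger0_norm u0) => h; apply: le_trans h _.
  have pi4 := pihalf_lt2 R.
  have : 4 * R0 * u <= 4 * R0 * 8 by rewrite ler_wpM2l //; lra.
  by lra.
- by apply: le_trans (D4 t) _; lra.
- by apply: le_trans (D10 s t) _; rewrite ler_wpM2r ?powR_ge0 //; lra.
- under eq_fun do rewrite gE.
  by apply: dE (is_derive_add (dD t) (is_derive_cst _ t 1)) _; rewrite addr0.
Qed.

End DiscSize.



Section CompositionOnCircle.
Variables (R : realType) (d e : R).
Hypotheses (d01 : 0 < d < 1) (e01 : 0 < e < 1) (de : d <= e).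
Let d0 : 0 < d. Proof. by case/andP: d01. Qed.
Let d1 : d < 1. Proof. by case/andP: d01. Qed.

Lemma powR_exp_anti (x : R) : 0 <= x -> x <= 1 -> x `^ e <= x `^ d.
Proof.
rewrite le_eqVlt => /orP[/eqP <- _|x0 x1].
  by rewrite !powR0 ?gt_eqF // (lt_le_trans d0).
by apply: ger_powR => //; rewrite x0.
Qed.

Lemma LH_exponent (V : normedModType R) (U : set V) (f : V -> R) :
  locally_holder e U f -> locally_holder d U f.
Proof.
move=> hf; apply: LH_intro => p Up; have [r [K [r0 hr]]] := hf p Up.
exists (Num.min r (1 / 2)), `|K|; split=> [|x y Ux Uy]; first by rewrite lt_min r0 divr_gt0.
rewrite !lt_min => /andP[x1 x2] /andP[y1 y2].
apply: (@le_trans _ _ (`|K| * `|x - y| `^ e)).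
  apply: (@le_trans _ _ (K * `|x - y| `^ e)); last by rewrite ler_wpM2r ?powR_ge0 // ler_norm.
  by apply: hr => //; rewrite -ball_normE /= distrC.
rewrite ler_wpM2l //; apply: powR_exp_anti => //.
rewrite (_ : x - y = (x - p) - (y - p)); last by rewrite opprB addrA subrK.
by apply: le_trans (ler_normB _ _) _; lra.
Qed.

Lemma holder_local_global (D : R -> R) : (forall t, D (t + pi *+ 2) = D t) ->
  locally_holder d setT D -> exists K, [/\ 0 <= K, holder d K D & forall t, `|D t| <= K].
Proof.
move=> per loc.
pose P (k x : R) := forall s s' : R, `|s - x| < 1 / k -> `|s' - x| < 1 / k ->
  `|D s - D s'| <= k * `|s - s'| `^ d /\ `|D s| <= k.
have cpt := @segment_compact R 0 (pi *+ 2).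
have [k k0 hk] : exists2 k, 0 < k & forall t, 0 <= t <= pi *+ 2 -> P k t.
  have /(_ _ +oo%R P) := (compact_near_coveringP _).1 cpt.
  case.
    move=> t _; have [r [K [r0 K0 h b1]]] := LH_near d01 loc (I : setT t) ltr01.
    pose M := 2 / r + `|K| + (`|D t| + 1).
    exists (ball t (r / 2), [set k | M < k]).
      split; first by apply: nbhsx_ballx; rewrite divr_gt0.
      by exists M; split=> //; exact: num_real.
    case=> x k /= [tx Mk] s s' sx s'x; rewrite -ball_normE /= distrC in tx.
    have r2 : 0 < 2 / r by rewrite divr_gt0.
    have k0 : 0 < k by have := normr_ge0 (D t); have := normr_ge0 K; rewrite /M in Mk; lra.
    have rk : 1 / k < r / 2.
      by rewrite ltr_pdivrMr // mulrC -ltr_pdivrMr ?divr_gt0 // invf_div mul1r;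
        have := normr_ge0 (D t); have := normr_ge0 K; rewrite /M in Mk; lra.
    have near y : `|y - x| < 1 / k -> `|y - t| < r.
      move=> yx; rewrite -(subrK x y) -addrA; apply: le_lt_trans (ler_normD _ _) _; lra.
    split.
      apply: le_trans (h s s' I I (near _ sx) (near _ s'x)) _.
      rewrite ler_wpM2r ?powR_ge0 //; apply: le_trans (ler_norm _) _.
      by have := normr_ge0 (D t); rewrite /M in Mk; lra.
    rewrite -(subrK (D t) (D s)) addrC; apply: le_trans (ler_normD _ _) _.
    by have := b1 s I (near _ sx); have := normr_ge0 K; rewrite /M in Mk; lra.
  move=> N [_ hN]; exists (Num.max N 0 + 1); first by rewrite ltr_pwDr // le_max lexx orbT.
  by move=> t ht; apply: hN; rewrite /= ?in_itv //= ltr_pwDr // le_max lexx.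
have glob s s' : `|s - s'| < 1 / k -> `|D s - D s'| <= k * `|s - s'| `^ d /\ `|D s| <= k.
  move=> ss; have [c hc Dc] := periodic_shift per s.
  have k1 : 0 < 1 / k by rewrite divr_gt0.
  have := hk _ hc (s - c) (s' - c); rewrite !Dc subrr normr0 => /(_ k1).
  by rewrite !opprB !addrA !subrK -(distrC s) => /(_ ss).
have bd s : `|D s| <= k.
  by have := glob s s; rewrite subrr normr0; case=> //; rewrite divr_gt0.
pose Q := 1 + k `^ d; have kd := powR_ge0 k d.
have kQ : 0 <= 2 * k * Q by rewrite !mulr_ge0 //; rewrite /Q; lra.
exists (2 * k * Q); split=> // [s s'|t].
  have p := powR_ge0 `|s - s'| d.
  have [ss|ss] := ltP `|s - s'| (1 / k).
    have [h _] := glob _ _ ss; apply: le_trans h _; rewrite ler_wpM2r // /Q.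
    by have := mulr_ge0 (ltW k0) kd; lra.
  have h1 : 1 <= k `^ d * `|s - s'| `^ d.
    have h : 1 <= k * `|s - s'| by rewrite mulrC -ler_pdivrMr.
    by have := powR_mono (ltW d0) ler01 h; rewrite powR1 powRM // ltW.
  have h2 : `|D s - D s'| <= 2 * k.
    by apply: le_trans (ler_normB _ _) _; have := bd s; have := bd s'; lra.
  apply: le_trans h2 _; rewrite -[leRHS]mulrA -[leLHS]mulr1.
  by rewrite ler_wpM2l ?(mulr_ge0 _ (ltW k0)) // /Q; lra.
by apply: le_trans (bd t) _; rewrite /Q; have := mulr_ge0 (ltW k0) kd; lra.
Qed.

Section Curve.
Variables (N : nat) (q : circle R -> 'rV[R]_N).

Lemma curve_velocity k : (forall j, Bnd d k (fun s => q s 0 j - q (circle_one R) 0 j)) ->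
  exists w : 'I_N -> R -> R, forall j, [/\ forall t, `|w j t| <= k, holder d k (w j) &
    forall t : R, is_derive t 1 (fun t => q (expi t) 0 j) (w j t)].
Proof.
move=> hq; have [w hw] := choice hq; exists w => j; have [_ h1 h2 h3] := hw j.
split=> // t; have := is_derive_add (h3 t) (is_derive_cst (q (circle_one R) 0 j) t 1).
by under eq_fun do rewrite subrK; rewrite addr0.
Qed.

Lemma composition_bound (f : 'rV[R]_N -> R) (K k r : R) p : 0 <= K -> 0 <= k <= 1 ->
  (forall x : 'rV[R]_N, `|x - p| < r -> differentiable f x) ->
  (forall i (x : 'rV[R]_N), `|x - p| < r -> `|partial i f x| <= K) ->
  (forall i (x y : 'rV[R]_N), `|x - p| < r -> `|y - p| < r ->
     `|partial i f x - partial i f y| <= K * `|x - y| `^ e) ->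
  (forall j, Bnd d k (fun s => q s 0 j - q (circle_one R) 0 j)) -> (forall s, `|q s - p| < r) ->
  Bnd d (8 * (N%:R * (K * k))) (fun s => f (q s) - f (q (circle_one R))).
Proof.
move=> K0 /andP[k0 k1] df fK fH hq qp; have [w hw] := curve_velocity hq.
have wk j t : `|w j t| <= k by have [] := hw j.
have Kk : 0 <= K * k by rewrite mulr_ge0.
have NKk : 0 <= N%:R * (K * k) by rewrite mulr_ge0.
pose D t := \sum_i partial i f (q (expi t)) * w i t.
have dD (t : R) : is_derive t 1 (fun t => f (q (expi t))) (D t).
  by apply: is_derive_chain => [i|]; [have [_ _] := hw i; exact|exact: df].
have sumK (c : 'I_N -> R) B : 0 <= B -> (forall i, `|c i| <= B) -> `|\sum_i c i| <= N%:R * B.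
  move=> B0 hc; apply: le_trans (ler_norm_sum _ _ _) _.
  by apply: le_trans (ler_sum _ (fun i _ => hc i)) _; rewrite sumr_const card_ord mulr_natl.
have Db t : `|D t| <= N%:R * (K * k).
  by apply: sumK => // i; rewrite normrM ler_pM // fK.
have qlip s t : `|q (expi s) - q (expi t)| <= `|s - t| /\ `|q (expi s) - q (expi t)| <= 2.
  split; apply: rv_norm_le => // i; rewrite rv_subE.
    have [w1 _ dw] := hw i.
    apply: le_trans (lip_of_derive (fun x _ => dw x) (fun x _ => w1 x)) _.
    exact: ler_piMl.
  have b1 := Bnd_le (expi s) (hq i); have b2 := Bnd_le (expi t) (hq i).
  rewrite (_ : _ - _ = (q (expi s) 0 i - q (circle_one R) 0 i) - (q (expi t) 0 i - q (circle_one R) 0 i)).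
    by apply: le_trans (ler_normB _ _) _; lra.
  by ring.
have qH i s t : `|partial i f (q (expi s)) - partial i f (q (expi t))| <= 2 * K * `|s - t| `^ d.
  apply: le_trans (fH i _ _ (qp _) (qp _)) _; rewrite -mulrA mulrCA ler_wpM2l //.
  have [l1 l2] := qlip s t; have [e0 e1] := andP e01.
  have [st|st] := leP `|s - t| 1.
    have h1 := powR_mono (ltW e0) (normr_ge0 _) l1.
    by have := powR_exp_anti (normr_ge0 _) st; have := powR_ge0 `|s - t| d; lra.
  have h1 := powR_mono (ltW e0) (normr_ge0 _) l2.
  have h2 := powR_mono (ltW d0) ler01 (ltW st); rewrite powR1 in h2.
  have h3 : (2 : R) `^ e <= 2 `^ 1 by apply: ler_powR; [rewrite ler1n|exact: ltW].
  by rewrite powRr1 // in h3; lra.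
have per u : f (q (expi (u + pi *+ 2))) - f (q (circle_one R)) = f (q (expi u)) - f (q (circle_one R)).
  by rewrite expiD2pi.
have exp0 : expi 0 = circle_one R by apply: val_inj; rewrite /= cos0 sin0.
exists D; split=> [t|t|s t|t].
- have := @periodic_le R (fun t => f (q (expi t)) - f (q (circle_one R))) (8 * (N%:R * (K * k))) per.
  rewrite exp0 subrr normr0 add0r; apply=> u /andP[u0 u1]; rewrite subr0 -exp0.
  apply: le_trans (lip_of_derive (fun x _ => dD x) (fun x _ => Db x)) _.
  rewrite subr0 (ger0_norm u0); have pi4 := pihalf_lt2 R.
  by rewrite mulrC ler_wpM2r //; lra.
- by apply: le_trans (Db t) _; lra.
- rewrite /D -sumrB; have pw := powR_ge0 `|s - t| d.
  have -> : 8 * (N%:R * (K * k)) * `|s - t| `^ d = N%:R * (8 * (K * k) * `|s - t| `^ d) by ring.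
  have Kkp : 0 <= K * k * `|s - t| `^ d by rewrite mulr_ge0.
  apply: sumK => [|i]; first by lra.
  have -> : partial i f (q (expi s)) * w i s - partial i f (q (expi t)) * w i t
    = (partial i f (q (expi s)) - partial i f (q (expi t))) * w i s
      + partial i f (q (expi t)) * (w i s - w i t) by ring.
  apply: le_trans (ler_normD _ _) _; rewrite !normrM.
  have h1 := ler_pM (normr_ge0 _) (normr_ge0 _) (qH i s t) (wk i s).
  have [_ wH _] := hw i.
  have h2 := ler_pM (normr_ge0 _) (normr_ge0 _) (fK i _ (qp (expi t))) (wH s t).
  by lra.
- have := is_derive_add (dD t) (is_derive_cst (- f (q (circle_one R))) t 1).
  by rewrite addr0.
Qed.

Lemma composition_C1 (W : set 'rV[R]_N) (f : 'rV[R]_N -> R) : open W -> sC1 e W f ->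
  (forall s, W (q s)) -> (forall j, exists K, Bnd d K (fun s => q s 0 j)) ->
  exists K, Bnd d K (fun s => f (q s)).
Proof.
move=> oW [df hf] qW hq.
have [K0 [k hk]] : exists K0, exists k : 'I_N -> R, 0 <= K0 /\ forall j, k j <= K0 /\ Bnd d (k j) (fun s => q s 0 j).
  have [k hk] := choice hq; have k0 j := Bnd_ge0 (hk j).
  exists (\sum_j k j), k; split=> [|j]; first exact: sumr_ge0.
  by split=> //; rewrite (bigD1 j) //= lerDl sumr_ge0.
have [K00 {}hk] := hk.
have /choice[w hw] : forall j, exists w, C1b d K0 (fun t => q (expi t) 0 j) w.
  by move=> j; have [kK kB] := hk j; exact: Bnd_mono kK kB.
pose D t := \sum_i partial i f (q (expi t)) * w i t.
have dD (t : R) : is_derive t 1 (fun t => f (q (expi t))) (D t).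
  by apply: is_derive_chain => [i|]; [have [_ _ _] := hw i; exact|exact: df].
have per u : f (q (expi (u + pi *+ 2))) = f (q (expi u)) by rewrite expiD2pi.
have perD t : D (t + pi *+ 2) = D t by exact: (@periodic_derive R (fun t => f (q (expi t))) D t per dD).
have qlip s t : setT s -> setT t -> `|q (expi s) - q (expi t)| <= K0 * `|s - t|.
  move=> _ _; apply: rv_norm_le => [|i]; first by rewrite mulr_ge0.
  by rewrite rv_subE; exact: C1b_lip (hw i).
have locD : locally_holder d setT D.
  rewrite /D; apply: (alg_sum (P := fun f : R -> R => locally_holder d setT f)).
  - by move=> k0; exact: LH_cst.
  - by move=> f0 g0; exact: (LH_D d01).
  move=> i.
  apply: (LH_M d01).
    apply: LH_exponent; apply: (LH_comp e01 (hf i) (q := fun t => q (expi t))); last exact: qlip.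
    by move=> t _; exact: qW.
  have [_ _ wH _] := hw i; move=> t _; exists 1, K0; split=> // x y _ _ _ _; exact: wH.
have [B [B0 hB bB]] := holder_local_global perD locD.
have exp0 : expi 0 = circle_one R by apply: val_inj; rewrite /= cos0 sin0.
exists (`|f (q (circle_one R))| + 8 * B), D; split=> [t|t|s t|//].
- have := @periodic_le R (fun t => f (q (expi t))) (8 * B) per.
  rewrite exp0; apply=> u /andP[u0 u1]; rewrite -exp0.
  apply: le_trans (lip_of_derive (fun x _ => dD x) (fun x _ => bB x)) _.
  rewrite subr0 (ger0_norm u0); have pi4 := pihalf_lt2 R.
  by rewrite mulrC ler_wpM2r //; lra.
- by apply: le_trans (bB t) _; have := normr_ge0 (f (q (circle_one R))); lra.
- apply: le_trans (hB s t) _; rewrite ler_wpM2r ?powR_ge0 //.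
  by have := normr_ge0 (f (q (circle_one R))); lra.
Qed.

End Curve.

End CompositionOnCircle.



Section ComplexGradient.
Variables (R : realType).
Local Notation C := R[i].

Definition cgrad n m (J : 'M[R]_(n + n, m)) : 'M[C]_(n, m) :=
  \matrix_(j, b) (J (lshift n j) b -i* J (rshift n j) b).

Definition realmx k n (A : 'M[C]_(k, n)) : 'M[R]_(k, n + n) :=
  row_mx (map_mx (@complex.Re R) A) (map_mx (@complex.Im R) A).

Local Notation toC := (map_mx (real_complex R)).

Lemma Re_sum (I : Type) (r : seq I) (F : I -> C) :
  complex.Re (\sum_(i <- r) F i) = \sum_(i <- r) complex.Re (F i).
Proof. exact: raddf_sum. Qed.

Lemma Im_sum (I : Type) (r : seq I) (F : I -> C) :
  complex.Im (\sum_(i <- r) F i) = \sum_(i <- r) complex.Im (F i).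
Proof. exact: raddf_sum. Qed.

Lemma realmx_mul_J k n m (A : 'M[C]_(k, n)) (J : 'M[R]_(n + n, m)) :
  realmx A *m J = map_mx (@complex.Re R) (A *m cgrad J).
Proof.
apply/matrixP => i b; rewrite [LHS]mxE [RHS]mxE [X in complex.Re X]mxE Re_sum big_split_ord /= -big_split /=.
apply: eq_bigr => j _; rewrite row_mxEl row_mxEr !mxE.
by case: (A i j) => x y /=; ring.
Qed.

Lemma realify_mul_J n m (v : 'rV[C]_n) (J : 'M[R]_(n + n, m)) :
  realify v *m J = map_mx (@complex.Re R) (v *m cgrad J).
Proof. exact: realmx_mul_J. Qed.

Lemma mul_realmx k n (x : 'rV[R]_k) (A : 'M[C]_(k, n)) :
  x *m realmx A = realify (toC x *m A).
Proof.
rewrite /realmx mul_mx_row /realify; congr row_mx; apply/rowP => j; rewrite !mxE.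
  by rewrite Re_sum; apply: eq_bigr => i _; rewrite !mxE; case: (A i j) => a b /=; ring.
by rewrite Im_sum; apply: eq_bigr => i _; rewrite !mxE; case: (A i j) => a b /=; ring.
Qed.

Lemma complexifyK n : cancel (@complexify R n) (@realify R n).
Proof.
move=> v; rewrite -[RHS]hsubmxK /realify; congr row_mx; apply/rowP => j; rewrite !mxE /=; ring.
Qed.

Lemma rvC_norm_lt n (w : 'rV[C]_n) (r : R) : 0 < r ->
  (`|w| < r%:C) <-> (forall j, cabs (w 0 j) < r).
Proof.
move=> r0.
have E : (`|w| < r%:C) = (ball (0 : 'rV[C]_n) r%:C w) :> Prop.
  by rewrite -ball_normE /= sub0r normrN.
rewrite E; split=> [[_ h] j|h].
  have := h 0 j; rewrite -ball_normE /= mxE sub0r normrN cabsE ltcR //.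
split; first by rewrite ltcR.
by move=> i j; rewrite (ord1 i) -ball_normE /= mxE sub0r normrN cabsE ltcR.
Qed.

Lemma inverse_bound k (A B : 'M[C]_k) f : (forall i j, cabs (A i j) <= f) -> k%:R * f <= 1 / 2 ->
  B *m (1%:M + A) = 1%:M -> forall i j, cabs (B i j) <= 2.
Proof.
move=> hA kf BA i j.
have BE l : B i l = (i == l)%:R - \sum_h B i h * A h l.
  have := congr1 (fun M : 'M_k => M i l) BA; rewrite mulmxDr mulmx1 !mxE => <-.
  by rewrite addrK.
pose S := \sum_l cabs (B i l).
have S0 : 0 <= S by apply: sumr_ge0 => l _; exact: cabs_ge0.
have sumC (I : Type) (r : seq I) (F : I -> C) : cabs (\sum_(l <- r) F l) <= \sum_(l <- r) cabs (F l).
  elim: r => [|x r ih]; first by rewrite !big_nil cabs0.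
  by rewrite !big_cons; apply: le_trans (cabsD _ _) _; rewrite lerD2l.
have f0 l : \sum_h cabs (B i h * A h l) <= S * f.
  by rewrite mulr_suml; apply: ler_sum => h _; rewrite cabsM ler_wpM2l ?cabs_ge0.
have S1 : S <= 1 + S * (k%:R * f).
  have -> : 1 + S * (k%:R * f) = \sum_l ((i == l)%:R + S * f).
    rewrite big_split /= sumr_const card_ord -(mulr_natl (S * f)) mulrCA; congr (_ + _).
    rewrite (bigD1 i) //= eqxx big1 ?addr0 // => l; rewrite eq_sym => /negbTE ->; exact: mulr0n.
  apply: ler_sum => l _; rewrite BE; apply: le_trans (cabsD _ _) _; rewrite cabsN lerD //.
    by case: (i == l); rewrite ?cabs0 ?cabs1.
  by apply: le_trans (sumC _ _ _) _; exact: f0.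
have Sij : cabs (B i j) <= S.
  by rewrite /S (bigD1 j) //= lerDl; apply: sumr_ge0 => l _; exact: cabs_ge0.
have : S * (k%:R * f) <= S * (1 / 2) by rewrite ler_wpM2l.
lra.
Qed.

Lemma tangent_kernel N m (S U : set 'rV[R]_N) (rho : 'rV[R]_N -> 'rV[R]_m) p v :
  open U -> U p -> differentiable rho p -> (forall q, U q -> S q -> rho q = 0) ->
  tangent S p v -> v *m 'J rho p = 0.
Proof.
move=> oU Up dr hS [g [gp Sg dg]].
have gU : \forall t \near (0 : R), U (g t).
  have cg : {for 0, continuous g}.
    by apply: differentiable_continuous; apply/derivable1_diffP; case: dg.
  by apply: cg; rewrite gp; apply: open_nbhs_nbhs.
apply/rowP => b; rewrite [RHS]mxE.
have dgi i : is_derive (0 : R) 1 (fun t => g t 0 i) (v 0 i).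
  have dgd : differentiable g 0 by apply/derivable1_diffP; case: dg.
  have h := derive_coord (1 : R) i dgd.
  have dgv : 'D_1 g 0 = v by exact: (@derive_val _ _ _ _ _ _ _ dg).
  apply: DeriveDef; last by rewrite -h dgv.
  by apply/derivable1_diffP; exact: ((differentiable_rvP g 0).1 dgd i).
have dr0 : differentiable (fun q => rho q 0 b) (g 0).
  by rewrite gp; exact: ((differentiable_rvP rho p).1 dr b).
have dE := is_derive_chain dgi dr0.
have -> : (v *m 'J rho p) 0 b = \sum_i partial i (fun y => rho y 0 b) (g 0) * v 0 i.
  rewrite mxE; apply: eq_bigr => i _; rewrite gp -jacobianE //; exact: mulrC.
move: dE; move: (\sum_i _) => a /is_derive_epsP h.
apply/eqP; rewrite -normr_le0; apply/ler_addgt0Pl => e e0; rewrite addr0.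
have [q q0 hq] := h e e0.
have /nbhs_ballP[r /= r0 hr] : \forall t \near (0 : R), S (g t) /\ U (g t) by apply: filterI.
have r00 : rho (g 0) 0 b = 0 by have [a1 a2] := hr 0 (ballxx _ r0); rewrite (hS _ a2 a1) mxE.
have m0 : 0 < Num.min q r by rewrite lt_min q0 r0.
have [s s0 sm] : exists2 s, 0 < s & s < Num.min q r.
  by exists (Num.min q r / 2); [rewrite divr_gt0|lra].
move: sm; rewrite lt_min => /andP[sq sr].
have [a1 a2] : S (g s) /\ U (g s).
  by apply: hr; rewrite /ball /= sub0r normrN gtr0_norm.
have := hq s; rewrite !subr0 r00 (hS _ a2 a1) mxE subr0 sub0r normrN normrM (gtr0_norm s0).
by rewrite ler_pM2r //; apply.
Qed.

Lemma generic_rank n m (T : set 'rV[C]_n) (J : 'M[R]_(n + n, m)) : \rank J = m ->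
  (forall v, T v -> realify v *m J = 0) ->
  (forall u : 'rV[C]_n, exists (k : nat) (c : 'I_k -> C) (v : 'I_k -> 'rV[C]_n),
    (forall i, T (v i)) /\ u = \sum_(i < k) c i *: v i) ->
  row_free (cgrad J)^T.
Proof.
move=> rJ TJ span.
have real (c : 'rV[R]_m) : (forall v, T v -> v *m cgrad J *m (toC c)^T = 0) -> c = 0.
  move=> hc; have PC : cgrad J *m (toC c)^T = 0.
    apply/row_matrixP => i; rewrite row0 rowE mulmxA.
    have [k [a [v [Tv ->]]]] := span (delta_mx 0 i).
    rewrite !mulmx_suml big1 // => l _.
    by rewrite -!scalemxAl hc // scaler0.
  have JC : J *m c^T = 0.
    apply/matrixP => i b; rewrite (ord1 b).
    case: (split_ordP i) => j ->; have := congr1 (fun M : 'cV_n => M j 0) PC; rewrite !mxE.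
      move=> /(congr1 (@complex.Re R)); rewrite Re_sum /= => h; rewrite -[RHS]h.
      by apply: eq_bigr => l _; rewrite !mxE /=; ring.
    move=> /(congr1 (@complex.Im R)); rewrite Im_sum /= => h; apply: oppr_inj; rewrite oppr0 -[RHS]h.
    rewrite -sumrN; apply: eq_bigr => l _; rewrite !mxE /=; ring.
  have fJ : row_free J^T by rewrite /row_free mxrank_tr rJ.
  apply: (row_free_inj fJ); rewrite mul0mx; apply: trmx_inj.
  by rewrite trmx_mul trmxK JC trmx0.
rewrite -kermx_eq0; apply/rowV0P => c /sub_kermxP hc.
have Pc : cgrad J *m c^T = 0 by apply: trmx_inj; rewrite trmx_mul trmxK hc trmx0.
pose c1 := map_mx (@complex.Re R) c; pose c2 := map_mx (@complex.Im R) c.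
have key v : T v -> v *m cgrad J *m (toC c1)^T = 0 /\ v *m cgrad J *m (toC c2)^T = 0.
  move=> Tv; have := TJ v Tv; rewrite realify_mul_J => h.
  have h0 : v *m cgrad J *m c^T = 0 by rewrite -mulmxA Pc mulmx0.
  move: (v *m cgrad J) h h0 => y hy h0.
  have yr l : complex.Re (y 0 l) = 0 by have := congr1 (fun M : 'rV_m => M 0 l) hy; rewrite !mxE.
  have := congr1 (fun M : 'M_1 => M 0 0) h0; rewrite !mxE => hs.
  split; apply/matrixP => i b; rewrite (ord1 i) (ord1 b) !mxE.
    have := congr1 (@complex.Im R) hs; rewrite Im_sum /= => him.
    apply/eqP; rewrite eq_complex Re_sum Im_sum /=; apply/andP; split; apply/eqP.
      by apply: big1 => l _; rewrite !mxE; have := yr l; case: (y 0 l) => a d /= ->; ring.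
    rewrite -[RHS]him; apply: eq_bigr => l _; rewrite !mxE; have := yr l.
    by case: (y 0 l) => a d /= ->; case: (c 0 l) => e f /=; ring.
  have := congr1 (@complex.Re R) hs; rewrite Re_sum /= => hre.
  apply/eqP; rewrite eq_complex Re_sum Im_sum /=; apply/andP; split; apply/eqP.
    by apply: big1 => l _; rewrite !mxE; have := yr l; case: (y 0 l) => a d /= ->; ring.
  apply: oppr_inj; rewrite oppr0 -[RHS]hre -sumrN; apply: eq_bigr => l _; rewrite !mxE; have := yr l.
  by case: (y 0 l) => a d /= ->; case: (c 0 l) => e f /=; ring.
have e1 : c1 = 0 by apply: real => v /key[].
have e2 : c2 = 0 by apply: real => v /key[].
apply/rowP => l; rewrite mxE; apply/eqP; rewrite eq_complex /=; apply/andP; split; apply/eqP.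
  by have := congr1 (fun M : 'rV_m => M 0 l) e1; rewrite !mxE.
by have := congr1 (fun M : 'rV_m => M 0 l) e2; rewrite !mxE.
Qed.

Lemma complete_frame n m (P : 'M[C]_(n, m)) : row_free P^T -> (m <= n)%N /\
  exists (Q : 'M[C]_(n, n - m)) (L : 'M[C]_(m + (n - m), n)), L *m row_mx P Q = 1%:M.
Proof.
move=> fP; have rP := eqP fP.
have mn : (m <= n)%N by rewrite -rP; exact: rank_leq_col.
split=> //.
have [Qt hQ] : exists Qt : 'M[C]_(n - m, n), row_free (col_mx P^T Qt).
  have h := mxrank_compl P^T; rewrite rP in h; rewrite -h; exists (row_base (P^T^C)%MS).
  rewrite /row_free -addsmxE (adds_eqmx (eqmx_refl P^T) (eq_row_base _)).
  by rewrite (eqP (addsmx_compl_full P^T)) h subnKC.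
have [B hB] := row_freeP hQ; exists Qt^T, B^T.
by rewrite -[P]trmxK -tr_col_mx -trmx_mul hB trmx1.
Qed.

Lemma inverse_other_side k n (A : 'M[C]_(n, k)) (L : 'M[C]_(k, n)) : k = n ->
  L *m A = 1%:M -> A *m L = 1%:M.
Proof. by move=> e; subst k; exact: mulmx1C. Qed.

End ComplexGradient.



Section ChartDerivatives.
Variable R : realType.
Local Notation C := R[i].

Lemma derive1_line (V W : normedModType R) (f : V -> W) v u :
  derive1 (fun t : R => f (v + t *: u)) 0 = 'D_u f v.
Proof.
rewrite derive1E /derive.
have E : (fun h : R => h^-1 *: (((fun t : R => f (v + t *: u)) \o shift 0) (h *: 1) - f (v + 0 *: u)))
    = (fun h : R => h^-1 *: ((f \o shift v) (h *: u) - f v)).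
  apply/funext => h /=; have h1 : h *: (1 : R) = h by exact: mulr1.
  by rewrite h1 scale0r !addr0 (addrC (h *: u)).
by rewrite E.
Qed.

Lemma class_Ck2_sub n m a (U W : set 'rV[R]_n) (f : 'rV[R]_n -> 'rV[R]_m) : U `<=` W ->
  class_Ck 2 a W f -> class_Ck 2 a U f.
Proof.
move=> UW [df hf]; split=> [x /UW /df //|i]; have [df1 hf1] := hf i.
split=> [x /UW /df1 //|j p Up]; have [e [K [e0 h]]] := hf1 j p (UW _ Up).
by exists e, K; split=> // x y /UW Ux /UW Uy; exact: h.
Qed.

Variables (n m : nat) (ch : chart R n m).

Definition real_coords (w : 'rV[C]_(n - m)) (y : 'rV[R]_m) := row_mx (realify w) y.

Lemma h_real_coords w y : h_real ch (real_coords w y) = chh ch w y.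
Proof. by rewrite /h_real /real_coords row_mxKl row_mxKr realifyK. Qed.

Lemma h_yE w y i j :
  h_y ch w y i j = partial (rshift _ j) (fun v => h_real ch v 0 i) (real_coords w y).
Proof.
rewrite mxE /partial -derive1_line; congr (derive1 _ 0); apply/funext => t.
rewrite -h_real_coords /real_coords; congr (h_real ch _ 0 i).
apply/rowP => l; rewrite [RHS]mxE; case: (split_ordP l) => l' ->.
  by rewrite !row_mxEl !mxE eq_lrshift andbF mulr0 addr0.
by rewrite !row_mxEr !mxE (inj_eq (@rshift_inj _ _)).
Qed.

Lemma realify_delta_re k (w : 'rV[C]_k) (t : R) j :
  realify (w + t%:C *: delta_mx 0 j) = realify w + t *: delta_mx 0 (lshift _ j).
Proof.
rewrite realifyD; congr (_ + _); apply/rowP => l; rewrite [RHS]mxE.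
case: (split_ordP l) => l' ->.
  by rewrite row_mxEl !mxE (inj_eq (@lshift_inj _ _)); case: (_ && _) => /=; ring.
by rewrite row_mxEr !mxE eq_rlshift andbF; case: (_ && _) => /=; ring.
Qed.

Lemma realify_delta_im k (w : 'rV[C]_k) (t : R) j :
  realify (w + ('i%C * t%:C) *: delta_mx 0 j) = realify w + t *: delta_mx 0 (rshift _ j).
Proof.
rewrite realifyD; congr (_ + _); apply/rowP => l; rewrite [RHS]mxE.
case: (split_ordP l) => l' ->.
  by rewrite row_mxEl !mxE eq_lrshift andbF; case: (_ && _) => /=; ring.
by rewrite row_mxEr !mxE (inj_eq (@rshift_inj _ _)); case: (_ && _) => /=; ring.
Qed.

Lemma real_coords_shift (u : 'rV[R]_(n - m + (n - m))) y (t : R) l :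
  row_mx (u + t *: delta_mx 0 l) y = row_mx u y + t *: delta_mx 0 (lshift m l).
Proof.
apply/rowP => k; rewrite [RHS]mxE; case: (split_ordP k) => k' ->.
  by rewrite !row_mxEl !mxE (inj_eq (@lshift_inj _ _)).
by rewrite !row_mxEr !mxE eq_rlshift andbF mulr0 addr0.
Qed.

Lemma h_wE w y i j :
  h_w ch w y i j = ((partial (lshift _ (lshift _ j)) (fun v => h_real ch v 0 i) (real_coords w y))%:C
    - 'i%C * (partial (lshift _ (rshift _ j)) (fun v => h_real ch v 0 i) (real_coords w y))%:C) / 2%:R.
Proof.
rewrite mxE /partial -!derive1_line.
have e1 : (fun t : R => chh ch (w + t%:C *: delta_mx 0 j) y 0 i)
    = (fun t : R => h_real ch (real_coords w y + t *: delta_mx 0 (lshift _ (lshift _ j))) 0 i).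
  apply/funext => t; rewrite -h_real_coords /real_coords realify_delta_re.
  by rewrite real_coords_shift.
have e2 : (fun t : R => chh ch (w + ('i%C * t%:C) *: delta_mx 0 j) y 0 i)
    = (fun t : R => h_real ch (real_coords w y + t *: delta_mx 0 (lshift _ (rshift _ j))) 0 i).
  apply/funext => t; rewrite -h_real_coords /real_coords realify_delta_im.
  by rewrite real_coords_shift.
by rewrite -e1 -e2.
Qed.

Lemma h_domainP w y : h_domain ch (real_coords w y) <-> in_polydisc ch w y.
Proof. by rewrite /h_domain /= /real_coords row_mxKl row_mxKr realifyK. Qed.

End ChartDerivatives.

Section GraphChart.
Variables (R : realType) (n m : nat) (eps : R).
Hypothesis heps : 0 < eps < 1.
Local Notation C := R[i].
Local Notation toC := (map_mx (real_complex R)).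
Variables (U : set 'rV[R]_(n + n)) (rho : 'rV[R]_(n + n) -> 'rV[R]_m).
Hypotheses (oU : open U) (hrho : class_Ck 2 eps U rho).
Variables (p : 'rV[C]_n) (Q : 'M[C]_(n, n - m)) (L : 'M[C]_(m + (n - m), n)) (r : R).
Let P q : 'M[C]_(n, m) := cgrad ('J rho q).
Let L1 : 'M[C]_(m, n) := usubmx L.
Let L2 : 'M[C]_(n - m, n) := dsubmx L.
Hypotheses (mn : (m <= n)%N) (hL : L *m row_mx (P (realify p)) Q = 1%:M).

Definition frame_x : 'M[R]_(m, n + n) := realmx L1.
Definition frame_v : 'M[R]_(n - m + (n - m) + m, n + n) :=
  col_mx (col_mx (realmx L2) (realmx ('i%C *: L2))) (realmx ('i%C *: L1)).

Lemma frame_inverse : [/\ L1 *m P (realify p) = 1%:M, L1 *m Q = 0, L2 *m P (realify p) = 0,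
  L2 *m Q = 1%:M & P (realify p) *m L1 + Q *m L2 = 1%:M].
Proof.
have := hL; rewrite -{1}[L]vsubmxK mul_col_row -/L1 -/L2 -[1%:M]submxK => /eq_block_mx[-> -> -> ->].
have h := inverse_other_side (subnKC mn) hL.
have := h; rewrite -{1}[L]vsubmxK mul_row_col => ->.
by split=> //; apply/matrixP => i j; rewrite !mxE ?eq_lrshift ?eq_rlshift
  ?(inj_eq (@lshift_inj _ _)) ?(inj_eq (@rshift_inj _ _)).
Qed.

Lemma frame_x_mul q : frame_x *m 'J rho q = map_mx (@complex.Re R) (L1 *m P q).
Proof. exact: realmx_mul_J. Qed.

Lemma frame_v_mul q : frame_v *m 'J rho q =
  col_mx (col_mx (map_mx (@complex.Re R) (L2 *m P q)) (map_mx (@complex.Re R) ('i%C *: (L2 *m P q))))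
    (map_mx (@complex.Re R) ('i%C *: (L1 *m P q))).
Proof. by rewrite /frame_v !mul_col_mx !realmx_mul_J -!scalemxAl. Qed.

Lemma frame_x1 : frame_x *m 'J rho (realify p) = 1%:M.
Proof.
have [h _ _ _ _] := frame_inverse; rewrite frame_x_mul h.
by apply/matrixP => i j; rewrite !mxE; case: (i == j).
Qed.

Lemma frame_v0 : frame_v *m 'J rho (realify p) = 0.
Proof.
have [h1 _ h2 _ _] := frame_inverse; rewrite frame_v_mul h1 h2 scaler0.
rewrite !map_mx0 col_mx0 (_ : map_mx _ _ = 0) ?col_mx0 //.
by apply/matrixP => i j; rewrite !mxE; case: (i == j) => /=; ring.
Qed.

Hypothesis r0 : 0 < r.

Definition graph_chart : chart R n m := Chart (P (realify p)) Q r
  (fun w y => graph_fun rho (realify p) frame_x frame_v (real_coords w y)).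

Lemma frame_coords u : realify u = frame (realify p) frame_x frame_v (coord_x graph_chart p u)
  (real_coords (coord_w graph_chart p u) (coord_y graph_chart p u)).
Proof.
have [_ _ _ _ h] := frame_inverse.
rewrite /frame /real_coords /frame_v mul_row_col {3}/realify mul_row_col /frame_x !mul_realmx.
rewrite -!realifyD; congr realify; rewrite /coord_x /coord_y /coord_w /=.
set z := (u - p) *m P (realify p); set w := (u - p) *m Q.
have split k (x : 'rV[C]_k) : x = toC (map_mx (@complex.Re R) x) + 'i%C *: toC (map_mx (@complex.Im R) x).
  by apply/rowP => j; rewrite !mxE [LHS]complexE.
have zE : toC (map_mx (@complex.Re R) z) *m L1 + toC (map_mx (@complex.Im R) z) *m ('i%C *: L1) = z *m L1.
  by rewrite {3}(split _ z) mulmxDl -scalemxAl -scalemxAr.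
have wE : toC (map_mx (@complex.Re R) w) *m L2 + toC (map_mx (@complex.Im R) w) *m ('i%C *: L2) = w *m L2.
  by rewrite {3}(split _ w) mulmxDl -scalemxAl -scalemxAr.
rewrite wE addrA addrAC -(addrA p) zE -addrA /z /w -!mulmxA -mulmxDr h mulmx1.
by rewrite addrC subrK.
Qed.

Hypothesis rp : rho (realify p) = 0.
Let q x v := frame (realify p) frame_x frame_v x v.
Hypothesis hU : forall x v, `|x| < r -> `|v| < r -> U (q x v) /\ frame_x *m 'J rho (q x v) \in unitmx.
Hypothesis hC : forall x v x' v', `|x| < r -> `|v| < r -> `|x'| < r -> `|v'| < r ->
  `|rho (q x v) - rho (q x' v') - (x - x')| <= 1 / 4 * (`|x - x'| + `|v - v'|).

Lemma h_real_graph : h_real graph_chart = graph_fun rho (realify p) frame_x frame_v.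
Proof.
apply/funext => v; rewrite /h_real /=; congr (graph_fun _ _ _ _ _).
by rewrite /real_coords complexifyK hsubmxK.
Qed.

Lemma h_domain_ball : h_domain graph_chart `<=` [set v | `|v| < r].
Proof.
move=> v [/= hw hy]; have hw' := (rvC_norm_lt _ r0).1 hw.
have lt2 (x : 'rV[R]_(n - m + (n - m) + m)) : (forall i, `|x 0 i| < r) -> `|x| < r.
  move=> h; have : ball (0 : 'rV[R]_(n - m + (n - m) + m)) r x.
    by split=> // i j; rewrite (ord1 i) -ball_normE /= mxE sub0r normrN.
  by rewrite -ball_normE /= sub0r normrN.
apply: lt2 => i; case: (split_ordP i) => l ->.
  have := hw' ; rewrite -[v]hsubmxK row_mxEl; move: (lsubmx v) => u hu.
  rewrite row_mxKl in hu.
  rewrite -(complexifyK u); case: (split_ordP l) => k ->.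
    by rewrite row_mxEl mxE; apply: le_lt_trans (Re_le_cabs _) _; exact: hu.
  by rewrite row_mxEr mxE; apply: le_lt_trans (Im_le_cabs _) _; exact: hu.
rewrite -[v]hsubmxK row_mxEr; apply: le_lt_trans (rv_coord_le _ _) _.
by move: hy; rewrite -{1}[v]hsubmxK row_mxKr.
Qed.

Lemma graph_chart_regular : [/\ class_Ck 2 eps (h_domain graph_chart) (h_real graph_chart),
  chh graph_chart 0 0 = 0 & forall v, 'd (h_real graph_chart) 0 v = 0].
Proof.
rewrite h_real_graph; split.
- exact: class_Ck2_sub h_domain_ball (graph_fun_class heps oU hrho r0 rp hU hC).
- by rewrite /= /real_coords realify0 row_mx0 (graph_fun0 r0 rp hC).
- have n0 : `|0 : 'rV[R]_(n - m + (n - m) + m)| < r by rewrite normr0.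
  have [dg Jg] := graph_fun_diff oU hrho r0 rp hU hC n0.
  have J0 : 'J (graph_fun rho (realify p) frame_x frame_v) 0 = 0.
    rewrite Jg /graph_slope (graph_fun0 r0 rp hC) /frame !mul0mx !addr0.
    by rewrite frame_v0 mul0mx oppr0.
  by move=> v; rewrite -deriveE // deriveEjacobian // J0 mulmx0.
Qed.

Lemma graph_chart_frame : row_free (row_mx (chP graph_chart) (chQ graph_chart)) &&
  row_full (row_mx (chP graph_chart) (chQ graph_chart)).
Proof.
apply/andP; split; [apply/row_freeP|apply/row_fullP]; exists L => //.
exact: inverse_other_side (subnKC mn) hL.
Qed.

Lemma graph_chart_point u : in_polydisc graph_chart (coord_w graph_chart p u) (coord_y graph_chart p u) ->
  `|coord_x graph_chart p u| < r -> rho (realify u) = 0 ->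
  coord_x graph_chart p u = chh graph_chart (coord_w graph_chart p u) (coord_y graph_chart p u).
Proof.
move=> hp xr ru; apply: (graph_fun_uniq r0 rp hC) => //.
  exact: h_domain_ball (proj2 (h_domainP _ _ _) hp).
by rewrite -frame_coords.
Qed.

(** Along the graph [h_y] is read off the matrix [L1 P], whose value at the
    origin of the chart is the identity. *)
Lemma graph_chart_hy u : in_polydisc graph_chart (coord_w graph_chart p u) (coord_y graph_chart p u) ->
  coord_x graph_chart p u = chh graph_chart (coord_w graph_chart p u) (coord_y graph_chart p u) ->
  let al := L1 *m P (realify u) in
  map_mx (@complex.Re R) al \in unitmx /\
  h_y graph_chart (coord_w graph_chart p u) (coord_y graph_chart p u) =
  (map_mx (@complex.Im R) al *m invmx (map_mx (@complex.Re R) al))^T.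
Proof.
move=> hp hx al.
set v := real_coords (coord_w graph_chart p u) (coord_y graph_chart p u).
have vr : `|v| < r by exact: h_domain_ball (proj2 (h_domainP _ _ _) hp).
have qE : frame (realify p) frame_x frame_v (graph_fun rho (realify p) frame_x frame_v v) v = realify u.
  by rewrite (frame_coords u) hx.
have [dg Jg] := graph_fun_diff oU hrho r0 rp hU hC vr.
have [_ uX] := hU (graph_fun_lt r0 rp hC vr) vr.
rewrite /q qE frame_x_mul -/al in uX; split=> //.
apply/matrixP => i j; rewrite h_yE h_real_graph -/v -jacobianE // Jg /graph_slope qE.
rewrite frame_x_mul frame_v_mul -/al mul_col_mx.
move: (invmx _) => B; move: (al) => al'; rewrite [LHS]mxE col_mxEd [RHS]mxE.
rewrite !mxE -sumrN; apply: eq_bigr => l _; rewrite !mxE.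
by case: (al' j l) => x y /=; ring.
Qed.

End GraphChart.



Section HolomorphicMatrices.
Variable R : realType.
Local Notation C := R[i].

Lemma holo_ext (f g : C -> C) : (forall z, closed_disc z -> f z = g z) -> holo f -> holo g.
Proof.
move=> fg [/continuous_discP cf df]; split.
  apply/continuous_discP => z z1 e e0; have [q q0 h] := cf z z1 e e0; exists q => // w w1 wz.
  by rewrite -!fg ?closed_discE //; exact: h.
move=> z hz; have [l dl] := (derivable_cdiff f z).1 (df z hz); apply/derivable_cdiff; exists l.
rewrite discE in hz; apply: cdiff_ext hz _ dl => w w1.
by rewrite fg // closed_discE ltW.
Qed.

Lemma holo_invmx m (E : C -> 'M[C]_m) : (forall z, closed_disc z -> E z \in unitmx) ->
  (forall i j, holo (fun z => E z i j)) -> forall i j, holo (fun z => invmx (E z) i j).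
Proof.
move=> uE hE.
have h := alg_invmx (P := @holo R) (@holo_ext) (@holo_cst R) (@holoD R) (@holoM R) (@holoV R) uE hE.
exact h.
Qed.

Lemma holo_mulmx k l n (A : C -> 'M[C]_(k, l)) (B : C -> 'M[C]_(l, n)) :
  (forall i j, holo (fun z => A z i j)) -> (forall i j, holo (fun z => B z i j)) ->
  forall i j, holo (fun z => (A z *m B z) i j).
Proof.
move=> hA hB.
have h := alg_mulmx (P := @holo R) (@holo_cst R) (@holoD R) (@holoM R) hA hB.
exact h.
Qed.

End HolomorphicMatrices.

Section TumanovEquation.
Variables (R : realType) (d : R).
Hypothesis d01 : 0 < d < 1.
Local Notation C := R[i].
Local Notation toC := (map_mx (real_complex R)).

Lemma mx_norm_le k l (A : 'M[R]_(k, l)) c : 0 <= c -> (forall i j, `|A i j| <= c) -> `|A| <= c.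
Proof.
move=> c0 h; rewrite /Num.Def.normr /= mx_normrE (bigmax_le _ c0) //= => -[i j] _.
Qed.

Lemma mx_entry_le k l (A : 'M[R]_(k, l)) i j : `|A i j| <= `|A|.
Proof.
rewrite [leRHS]/Num.Def.normr /= mx_normrE.
exact: (le_bigmax _ (fun x : 'I_k * 'I_l => `|A x.1 x.2|) (i, j)).
Qed.

Lemma C1_circle_mx k l (A : circle R -> 'M[R]_(k, l)) :
  C1_circle d A <-> forall i j, exists K, Bnd d K (fun s => A s i j).
Proof.
pose g t := A (expi t).
have ent t i j : derivable g t 1 -> (derive1 g t) i j = derive1 (fun t => g t i j) t.
  by move=> dg; rewrite !derive1E derive_mx // mxE.
split=> [[dA [K hK]] i j|h].
  apply: (C1_circle_Bnd d01); split=> [t|]; first exact: ((derivable_mxP _ _ _).1 (dA t) i j).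
  exists K => s t; rewrite -!ent //; apply: le_trans (hK s t).
  by have := mx_entry_le (derive1 g s - derive1 g t) i j; rewrite !mxE.
have c i j : C1_circle d (fun s => A s i j) by have [K /(Bnd_C1_circle)] := h i j.
have dg t : derivable g t 1.
  by apply/derivable_mxP => i j; have [dd _] := c i j; exact: dd.
split=> //.
have /choice[K hK] : forall ij : 'I_k * 'I_l, exists K, forall s t,
    `|derive1 (fun t => g t ij.1 ij.2) s - derive1 (fun t => g t ij.1 ij.2) t| <= K * `|s - t| `^ d.
  by move=> ij; have [_] := c ij.1 ij.2.
exists (\sum_ij `|K ij|) => s t; have p := powR_ge0 `|s - t| d.
apply: mx_norm_le => [|i j]; first by rewrite mulr_ge0 ?sumr_ge0.
have -> : (derive1 g s - derive1 g t) i j = derive1 (fun t => g t i j) s - derive1 (fun t => g t i j) t.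
  by rewrite -!ent // !mxE.
apply: le_trans (hK (i, j) s t) _; rewrite ler_wpM2r //; apply: le_trans (ler_norm _) _.
by rewrite (bigD1 (i, j)) //= lerDl sumr_ge0.
Qed.

Variables (n m : nat).

Lemma twisted_entry phi (ch : chart R n m) G T s i j : (forall s, G s = 1%:M - T s) ->
  G_twisted phi ch G s i j = (i == j)%:R + 'i%C * ((G s *m h_y_on ch phi s) i j +i* T s i j).
Proof.
move=> GT; rewrite /G_twisted mulmxDr mulmx1 -scalemxAr -map_mxM.
have -> (A B : 'M[R]_m) : (toC A + 'i%C *: toC B) i j = (A i j)%:C + 'i%C * (B i j)%:C.
  by rewrite !mxE.
have -> : G s i j = (i == j)%:R - T s i j by rewrite GT !mxE.
move: ((G s *m _) i j) (T s i j) => x y.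
by case: (i == j) => /=; apply/eqP; rewrite eq_complex /=; apply/andP; split; apply/eqP; ring.
Qed.

Lemma tumanov_uniqueness phi (ch : chart R n m) G (E : C -> 'M[C]_m) :
  solves_G d phi ch G ->
  (forall i j, extension (fun s => G_twisted phi ch G s i j) (fun z => E z i j)) ->
  (forall z, closed_disc z -> E z \in unitmx) ->
  forall G', solves_G d phi ch G' -> G' = G.
Proof.
move=> [uG cG [T [hT GT]]] hE uE G' [uG' cG' [T' [hT' GT']]].
have /choice[F' hF'] : forall ij : 'I_m * 'I_m, exists F, extension
    (fun s => (G' s *m h_y_on ch phi s) ij.1 ij.2 +i* T' s ij.1 ij.2) F.
  by move=> ij; have [_] := hT' ij.1 ij.2.
pose E' z : 'M[C]_m := \matrix_(i, j) ((i == j)%:R + 'i%C * F' (i, j) z).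
have hE' i j : holo (fun z => E' z i j).
  under eq_fun do rewrite mxE.
  have [cF dF _] := hF' (i, j).
  have h1 := holoM (holo_cst 'i%C) (conj cF dF); exact (holoD (holo_cst _) h1).
have EG' (s : circle R) : E' (val s) = G_twisted phi ch G' s.
  by apply/matrixP => i j; rewrite mxE (twisted_entry _ _ _ _ _ GT'); have [_ _ ->] := hF' (i, j).
have EG (s : circle R) : E (val s) = G_twisted phi ch G s.
  by apply/matrixP => i j; have [_ _ ->] := hE i j.
pose W z := E' z *m invmx (E z).
have hE0 i j : holo (fun z => E z i j).
  have [cF dF _] := hE i j; exact (conj cF dF).
have hI := holo_invmx uE hE0.
have hW := holo_mulmx hE' hI.
have uEs (s : circle R) : E (val s) \in unitmx by apply: uE; rewrite closed_discE cabs_circle.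
have Ws (s : circle R) : W (val s) = toC (G' s *m invmx (G s)).
  apply: (can_inj (mulmxK (uEs s))); rewrite /W mulmxKV // EG' EG /G_twisted mulmxA -map_mxM.
  by rewrite mulmxKV.
have Wc (s : circle R) i j : W (val s) i j = W 0 i j.
  have im (s' : circle R) : complex.Im (W (val s') i j) = 0 by rewrite Ws mxE.
  have h := holo_real_cst (hW i j) im s; exact h.
have one (H S : circle R -> 'M[R]_m) : (forall i j, is_T1 (fun s => (H s *m h_y_on ch phi s) i j)
    (fun s => S s i j)) -> (forall s, H s = 1%:M - S s) -> H (circle_one R) = 1%:M.
  move=> hS HS; rewrite HS (_ : S _ = 0) ?subr0 //.
  by apply/matrixP => i j; have [h _] := hS i j; rewrite h mxE.
have W1 (s : circle R) : W (val s) = 1%:M.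
  have -> : W (val s) = W (val (circle_one R)) by apply/matrixP => i j; rewrite !Wc.
  by rewrite Ws (one _ _ hT GT) (one _ _ hT' GT') invmx1 mulmx1 map_mx1.
apply/funext => s; have := W1 s; rewrite Ws -[1%:M](map_mx1 (real_complex R)).
move=> /map_mx_inj h; by rewrite -[LHS](mulmxKV (uG s)) h mul1mx.
Qed.

Lemma tumanov_solution : exists2 k, 0 < k & forall phi (ch : chart R n m) a1 a2,
  MB d k (fun s => a1 s - 1%:M) -> MB d k a2 -> (forall s, a1 s \in unitmx) ->
  (forall s, h_y_on ch phi s = (a2 s *m invmx (a1 s))^T) ->
  exists G, [/\ solves_G d phi ch G, forall G', solves_G d phi ch G' -> G' = G &
    exists E : C -> 'M[C]_m,
      (forall i j, extension (fun s => G_twisted phi ch G s i j) (fun z => E z i j)) /\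
      forall z, closed_disc z -> E z \in unitmx].
Proof.
pose e : R := 1 / (m%:R + 1).
have m0 : 0 <= m%:R :> R by [].
have e0 : 0 < e by rewrite divr_gt0 //; lra.
have me : m%:R * e < 1.
  by rewrite /e mulrA mulr1 ltr_pdivrMr ?mul1r; lra.
have [k k0 hk] := @neumann_solution R d d01 m e e0; exists k => // phi ch a1 a2 ha1 ha2 ua hy.
have [i j|i j|Gn [GnB GnE GnT TB hF]] := hk (fun s => (a1 s - 1%:M)^T) (fun s => (a2 s)^T).
- by under eq_fun do rewrite mxE; exact: ha1.
- by under eq_fun do rewrite mxE; exact: ha2.
pose T := T1mx (fun s => Gn s *m (a2 s)^T).
pose G s := Gn s *m (a1 s)^T.
have GT s : G s = 1%:M - T s.
  have := GnE s; rewrite -/T => <-; rewrite addrK /G -{2}[Gn s]mulmx1 -mulmxDr -{1}(trmx1 _ m) -raddfD /=.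
  by rewrite addrC subrK.
have Gh s : G s *m h_y_on ch phi s = Gn s *m (a2 s)^T.
  rewrite hy trmx_mul /G -mulmxA (mulmxA (a1 s)^T) -trmx_mul mulVmx ?trmx1 ?mul1mx //.
have sG : solves_G d phi ch G.
  split.
  - move=> s; rewrite GT; apply: (@small_perturbation_unitR _ _ _ e) => // i j.
    by rewrite mxE normrN; exact: (Bnd_le s (TB i j)).
  - apply/C1_circle_mx => i j; exists (`|(i == j)%:R : R| + e).
    have -> : (fun s => G s i j) = (fun s => (i == j)%:R + - T s i j).
      by apply/funext => s; rewrite GT; move: (T s) => A; rewrite !mxE.
    have h1 := Bnd_cst d ((i == j)%:R : R); have h2 := Bnd_N (TB i j).
    exact: (Bnd_D h1 h2).
  - exists T; split=> // i j.
    have -> : (fun s => (G s *m h_y_on ch phi s) i j) = (fun s => (Gn s *m (a2 s)^T) i j).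
      by apply/funext => s; rewrite Gh.
    exact: GnT.
have /choice[F hF'] : forall ij : 'I_m * 'I_m, exists F : C -> C,
    extension (fun s => (Gn s *m (a2 s)^T) ij.1 ij.2 +i* T s ij.1 ij.2) F /\
    forall z : C, closed_disc z -> cabs (F z) <= e.
  by move=> ij; have [F h1 h2] := hF ij.1 ij.2; exists F.
pose E z : 'M[C]_m := 1%:M + \matrix_(i, j) ('i%C * F (i, j) z).
have hE i j : extension (fun s => G_twisted phi ch G s i j) (fun z => E z i j).
  have -> : (fun z => E z i j) = (fun z => (i == j)%:R + 'i%C * F (i, j) z).
    by apply/funext => z; rewrite !mxE.
  have [[cF dF vF] _] := hF' (i, j).
  have h1 := holoM (holo_cst 'i%C) (conj cF dF); have [h2 h3] := holoD (holo_cst ((i == j)%:R : C)) h1.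
  split; [exact h2|exact h3|move=> s].
  by rewrite (twisted_entry _ _ _ _ _ GT) Gh vF.
have uE z : closed_disc z -> E z \in unitmx.
  move=> hz; apply: (@small_perturbation_unit _ _ _ e) => // i j.
  have [_ h] := hF' (i, j); rewrite mxE cabsM.
  have -> : cabs 'i%C = 1 :> R by rewrite /cabs /= expr0n expr1n add0r sqrtr1.
  by rewrite mul1r; exact: h.
exists G; split=> //; last by exists E.
exact: tumanov_uniqueness sG hE uE.
Qed.

End TumanovEquation.



Section LocalChoice.
Variables (R : realType) (n m : nat) (eps delta : R).
Hypotheses (heps : 0 < eps < 1) (hdelta : 0 < delta < eps).
Local Notation C := R[i].
Local Notation toC := (map_mx (real_complex R)).

Let d01 : 0 < delta < 1.
Proof. by case/andP: hdelta => -> h; case/andP: heps => _; exact: lt_trans. Qed.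
Let de : delta <= eps. Proof. by case/andP: hdelta => _ /ltW. Qed.

Lemma common_large (I : finType) (Q : I -> R -> Prop) :
  (forall x M M', M <= M' -> Q x M -> Q x M') -> (forall x, exists M, Q x M) ->
  exists2 M, 0 < M & forall x, Q x M.
Proof.
move=> hQ /choice[f hf]; exists (1 + \sum_x `|f x|); first by rewrite ltr_pwDl // sumr_ge0.
move=> x; apply: hQ (hf x); rewrite (bigD1 x) //= addrCA; apply: le_trans (ler_norm _) _.
by rewrite lerDl addr_ge0 // sumr_ge0.
Qed.

Lemma entries_bounded k l (A : 'M[C]_(k, l)) : exists2 b, 0 <= b & forall i j, cabs (A i j) <= b.
Proof.
have [||b b0 hb] := @common_large (('I_k * 'I_l)%type) (fun ij b => cabs (A ij.1 ij.2) <= b).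
- by move=> x M M' MM /le_trans; apply.
- by move=> x; exists (cabs (A x.1 x.2)).
by exists b => [|i j]; [exact: ltW|exact: (hb (i, j))].
Qed.

Lemma cabs_sum (I : Type) (r : seq I) (F : I -> C) : cabs (\sum_(l <- r) F l) <= \sum_(l <- r) cabs (F l).
Proof.
elim: r => [|x r ih]; first by rewrite !big_nil cabs0.
by rewrite !big_cons; apply: le_trans (cabsD _ _) _; rewrite lerD2l.
Qed.

Lemma cabs_mulmx k l h (A : 'M[C]_(k, l)) (B : 'M[C]_(l, h)) a b : 0 <= a -> 0 <= b ->
  (forall i j, cabs (A i j) <= a) -> (forall i j, cabs (B i j) <= b) ->
  forall i j, cabs ((A *m B) i j) <= l%:R * (a * b).
Proof.
move=> a0 b0 hA hB i j; rewrite mxE; apply: le_trans (cabs_sum _ _) _.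
apply: (@le_trans _ _ (\sum_(k < l) a * b)); last by rewrite sumr_const card_ord mulr_natl.
by apply: ler_sum => c _; rewrite cabsM ler_pM ?cabs_ge0.
Qed.

Lemma realmx_le k l (A : 'M[C]_(k, l)) a : (forall i j, cabs (A i j) <= a) ->
  forall i j, `|realmx A i j| <= a.
Proof.
move=> hA i j; case: (split_ordP j) => l' ->.
  by rewrite row_mxEl mxE; apply: le_trans (Re_le_cabs _) _.
by rewrite row_mxEr mxE; apply: le_trans (Im_le_cabs _) _.
Qed.

Lemma Bnd_lin N (c : 'I_N -> R) (f : 'I_N -> circle R -> R) a B : 0 <= B ->
  (forall l, `|c l| <= a) -> (forall l, Bnd delta B (f l)) ->
  Bnd delta (N%:R * (6 * a * B)) (fun s => \sum_l c l * f l s).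
Proof.
move=> B0; case: N c f => [|N] c f hc hf.
  under eq_fun do rewrite big_ord0.
  by have := Bnd_cst delta (0 : R); rewrite normr0 mul0r.
have a0 : 0 <= a by apply: le_trans (hc ord0).
apply: Bnd_sum => [//|l]; first by rewrite !mulr_ge0.
have h := Bnd_M d01 (Bnd_cst delta (c l)) (hf l).
by apply: Bnd_mono h; rewrite ler_wpM2r // ler_wpM2l.
Qed.

Lemma cabs_realify (v : 'rV[C]_n) j : cabs (v 0 j) <= 2 * `|realify v|.
Proof.
apply: le_trans (cabs_le _) _.
have h1 := rv_coord_le (realify v) (lshift n j).
have h2 := rv_coord_le (realify v) (rshift n j).
rewrite row_mxEl mxE in h1; rewrite row_mxEr mxE in h2.
by lra.
Qed.

Lemma cgrad_close (J J' : 'M[R]_(n + n, m)) e : (forall i j, `|J i j - J' i j| <= e) ->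
  forall i j, cabs (cgrad J i j - cgrad J' i j) <= 2 * e.
Proof.
move=> h i j; rewrite !mxE; apply: le_trans (cabs_le _) _ => /=.
have h1 := h (lshift n i) j; have := h (rshift n i) j.
by rewrite -normrN opprB opprK addrC => h2; lra.
Qed.

Lemma MB_lin N (A : 'M[R]_(m, N)) (F : circle R -> 'M[R]_(N, m)) (G : 'M[R]_(N, m)) (a B k : R) : 0 <= B ->
  N%:R * (6 * a * B) <= k -> (forall i j, `|A i j| <= a) ->
  (forall l b, Bnd delta B (fun s => F s l b - G l b)) -> MB delta k (fun s => A *m (F s - G)).
Proof.
move=> B0 hk hA hF i b.
have h := Bnd_lin B0 (hA i) (fun l => hF l b).
have -> : (fun s => (A *m (F s - G)) i b) = (fun s => \sum_l A i l * (F s l b - G l b)).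
  by apply/funext => s; rewrite mxE; apply: eq_bigr => l _; rewrite !mxE.
exact: Bnd_mono hk h.
Qed.

Lemma realmx_i_mul k l (A : 'M[C]_(k, n)) (J : 'M[R]_(n + n, l)) :
  realmx ('i%C *: A) *m J = - map_mx (@complex.Im R) (A *m cgrad J).
Proof.
rewrite realmx_mul_J -scalemxAl; apply/matrixP => i j.
by move: (A *m cgrad J) => B; rewrite !mxE; case: (B i j) => x y /=; ring.
Qed.

Lemma map_Im1 k : map_mx (@complex.Im R) (1%:M : 'M[C]_k) = 0.
Proof. by apply/matrixP => i j; rewrite !mxE; case: (i == j). Qed.

Lemma mulmxB_eq (S : nzRingType) k l h (A : 'M[S]_(k, l)) (X Y : 'M[S]_(l, h)) Z W :
  A *m X = Z -> A *m Y = W -> A *m (X - Y) = Z - W.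
Proof. by move=> <- <-; rewrite mulmxBr. Qed.

Lemma oppr_mulmxB_eq (S : nzRingType) k l h (A : 'M[S]_(k, l)) (X Y : 'M[S]_(l, h)) Z :
  A *m X = - Z -> A *m Y = 0 -> - (A *m (X - Y)) = Z.
Proof. by move=> h1 h2; rewrite mulmxBr h1 h2 subr0 opprK. Qed.

(** Frames of [C^n] adapted to the complex gradients near [P0], with uniform bounds. *)
Lemma frame_near (P0 : 'M[C]_(n, m)) (Q : 'M[C]_(n, n - m)) (L0 : 'M[C]_(m + (n - m), n)) :
  L0 *m row_mx P0 Q = 1%:M -> exists eta kap, [/\ 0 < eta, eta <= 1, 0 <= kap,
    forall i j, cabs (Q i j) <= kap &
    forall P : 'M[C]_(n, m), (forall i j, cabs (P i j - P0 i j) <= eta) ->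
     (forall i j, cabs (P i j) <= kap) /\
     exists2 L : 'M[C]_(m + (n - m), n), L *m row_mx P Q = 1%:M & forall i j, cabs (L i j) <= kap].
Proof.
move=> hL0; have [b b0 hb] := entries_bounded L0; have [b1 b10 hb1] := entries_bounded P0.
have [b2 b20 hb2] := entries_bounded Q.
pose k : R := (m + (n - m))%:R; have k0 : 0 <= k by [].
have n0 : 0 <= n%:R :> R by [].
pose T := 1 + 2 * (k * (n%:R * b)).
have knb : 0 <= k * (n%:R * b) by rewrite !mulr_ge0.
have T1 : 1 <= T by rewrite /T; lra.
have T0 : 0 < T by lra.
have eT : T^-1 * T = 1 by rewrite mulVf // gt_eqF.
have eta0 : 0 < T^-1 by rewrite invr_gt0.
have eta1 : T^-1 <= 1 by rewrite invf_le1.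
have kb0 : 0 <= k * (2 * b) by rewrite !mulr_ge0.
exists T^-1, (b1 + 1 + b2 + k * (2 * b)); split=> //; first by lra.
  by move=> i j; apply: le_trans (hb2 i j) _; lra.
move=> P hP; split=> [i j|].
  rewrite -(subrK (P0 i j) (P i j)); apply: le_trans (cabsD _ _) _.
  by have := hP i j; have := hb1 i j; lra.
pose A : 'M[C]_(m + (n - m)) := L0 *m row_mx (P - P0) (0 : 'M_(n, n - m)).
have hA i j : cabs (A i j) <= n%:R * (b * T^-1).
  apply: cabs_mulmx => //; first exact: ltW.
  move=> {}i {}j; case: (split_ordP j) => l ->; first by rewrite row_mxEl !mxE; exact: hP.
  by rewrite row_mxEr mxE cabs0 ltW.
have kf : k * (n%:R * (b * T^-1)) <= 1 / 2.
  have -> : k * (n%:R * (b * T^-1)) = k * (n%:R * b) * T^-1 by ring.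
  have : T^-1 * (2 * (k * (n%:R * b))) <= T^-1 * T by rewrite ler_wpM2l ?(ltW eta0) // /T; lra.
  by rewrite eT; lra.
have LA : L0 *m row_mx P Q = 1%:M + A.
  rewrite /A -hL0 -mulmxDr add_row_mx addr0 (_ : P0 + (P - P0) = P) // addrC subrK //.
have u : 1%:M + A \in unitmx by apply: small_perturbation_unit hA _; rewrite -/k; lra.
exists (invmx (1%:M + A) *m L0); first by rewrite -mulmxA LA mulVmx.
have hB := inverse_bound hA kf (mulVmx u).
move=> i j; apply: le_trans (cabs_mulmx (ler0n _ 2) b0 hB hb i j) _; rewrite -/k; lra.
Qed.

Variables (M M' : set 'rV[C]_n).
Hypotheses (hM' : generic_submanifold eps m M') (MM' : M `<=` M').

Lemma local_tumanov_choice p0 : M' p0 -> exists2 r, 0 < r & forall phi,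
  analytic_disc delta phi -> (forall s : circle R, M (phi (val s))) ->
  (forall j, cabs ((phi 1 - p0) 0 j) <= r) -> disc_size delta phi < r ->
  exists (ch : chart R n m) (G : circle R -> 'M[R]_m), tumanov_choice eps delta M phi ch G.
Proof.
move=> Mp0; have [sub gen] := hM'; pose q0 := realify p0.
have Sq0 : (@realify R n @` M') q0 by exists p0.
have [U [rho [oU Uq0 hrho zero rank]]] := sub _ Sq0.
have inj u : M' u -> U (realify u) -> rho (realify u) = 0.
  by move=> Mu Uu; apply/(zero _ Uu); exists u.
have [drho sJ] := class_Ck2_jacobian oU hrho.
pose P q : 'M[C]_(n, m) := cgrad ('J rho q).
have fP : row_free (P q0)^T.
  apply: (generic_rank (T := tangentC M' p0) (rank _ Uq0)); last exact: gen.
  move=> v; apply: (tangent_kernel oU Uq0 (drho _ Uq0)) => q Uq Sq.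
  by apply/(zero _ Uq).
have [mn [Q [L0 hL0]]] := complete_frame fP.
have [eta [kap [eta0 eta1 kap0 hQ hframe]]] := frame_near hL0.
have eta2 : 2 * (eta / 2) = eta by field.
have [ra ra0 hra] := jacobian_close heps oU hrho Uq0 (divr_gt0 eta0 (ltr0n R 2)).
have [rb rb0 hrb] := implicit_contraction heps (n - m + (n - m) + m) oU hrho Uq0 kap0.
have [k0 k00 hsol] := @tumanov_solution R delta d01 n m.
have [N N0 hN] : exists2 N : R, 0 < N & forall ijl : ('I_(n + n) * 'I_m) * 'I_(n + n),
    let f q := 'J rho q ijl.1.1 ijl.1.2 in
    [/\ 0 < N, forall x, `|x - q0| < 1 / N -> U x /\ `|partial ijl.2 f x| <= N &
     forall x y, `|x - q0| < 1 / N -> `|y - q0| < 1 / N ->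
      `|partial ijl.2 f x - partial ijl.2 f y| <= N * `|x - y| `^ eps].
  apply: common_large => [[[i j] l] A B AB [A0 h1 h2]|[[i j] l]] /=.
    have B0 : 0 < B by exact: lt_le_trans AB.
    have le : 1 / B <= 1 / A by rewrite !div1r lef_pV2.
    split=> // [x xB|x y xB yB].
      by have [Ux h] := h1 x (lt_le_trans xB le); split=> //; exact: le_trans AB.
    apply: le_trans (h2 x y (lt_le_trans xB le) (lt_le_trans yB le)) _.
    by rewrite ler_wpM2r // powR_ge0.
  have [_ /(_ l)] := sJ i j; move: (partial l _) => g lh.
  have [e [K [e0 K0 h1 h2]]] := LH_near heps lh Uq0 ltr01.
  have [e' e'0 hU] := open_ball_sub oU Uq0.
  pose A := 1 + e^-1 + e'^-1 + K + `|g q0|.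
  have a1 : 0 < e^-1 by rewrite invr_gt0.
  have a2 : 0 < e'^-1 by rewrite invr_gt0.
  have a3 := normr_ge0 (g q0).
  have A0 : 0 < A by rewrite /A; lra.
  have Ae : 1 / A <= e by rewrite div1r -[leRHS]invrK lef_pV2 ?posrE ?invr_gt0 // /A; lra.
  have Ae' : 1 / A <= e' by rewrite div1r -[leRHS]invrK lef_pV2 ?posrE ?invr_gt0 // /A; lra.
  exists A; split=> // [x xA|x y xA yA].
    have Ux : U x by apply: hU; exact: lt_le_trans Ae'.
    split=> //; have := h2 x Ux (lt_le_trans xA Ae).
    by have := ler_normD (g x - g q0) (g q0); rewrite subrK /A; lra.
  have Ux : U x by apply: hU; exact: lt_le_trans Ae'.
  have Uy : U y by apply: hU; exact: lt_le_trans Ae'.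
  apply: le_trans (h1 x y Ux Uy (lt_le_trans xA Ae) (lt_le_trans yA Ae)) _.
  by rewrite ler_wpM2r ?powR_ge0 // /A; lra.
pose D : R := (n + n)%:R; have D0 : 0 <= D by [].
have n0 : 0 <= n%:R :> R by [].
pose big := D * (6 * kap * (8 * (D * (N * 32)))).
have big0 : 0 <= big by rewrite /big !mulr_ge0 // ltW.
pose ob := rb / (n%:R * kap + 1).
have nk : 0 <= n%:R * kap by rewrite mulr_ge0.
have ob0 : 0 < ob by rewrite /ob divr_gt0 //; lra.
have obE : ob * (n%:R * kap + 1) = rb by rewrite /ob divfK // gt_eqF //; lra.
have ob_lt : n%:R * (ob * kap) < rb.
  have -> : n%:R * (ob * kap) = ob * (n%:R * kap) by ring.
  by rewrite -[ltRHS]obE ltr_pM2l //; lra.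
have z0 : 0 <= n%:R * (ob * kap) by exact: mulr_ge0 n0 (mulr_ge0 (ltW ob0) kap0).
pose T := 1 + ob^-1 + N + ra^-1 + rb^-1 + big / k0.
have i1 : 0 < ob^-1 by rewrite invr_gt0.
have i2 : 0 < ra^-1 by rewrite invr_gt0.
have i3 : 0 < rb^-1 by rewrite invr_gt0.
have i4 : 0 <= big / k0 by rewrite divr_ge0 // ltW.
have T0 : 0 < T by rewrite /T; lra.
pose r := 1 / (100 * T).
have r0 : 0 < r by rewrite divr_gt0 // mulr_gt0.
have rT X : X <= T -> r * X <= 1 / 100.
  move=> XT; have : r * X <= r * T by rewrite ler_wpM2l // ltW.
  by rewrite {2}/r (_ : 1 / (100 * T) * T = 1 / 100) //; field; rewrite gt_eqF.
have rinv X : 0 < X -> X^-1 <= T -> 100 * r <= X.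
  move=> X0 /rT; rewrite ler_pdivrMr // => h; lra.
have r1 : 100 * r <= 1 by apply: rinv; rewrite ?invr1 // /T; lra.
have r_ob : 100 * r <= ob by apply: rinv => //; rewrite /T; lra.
have r_ra : 100 * r <= ra by apply: rinv => //; rewrite /T; lra.
have r_rb : 100 * r <= rb by apply: rinv => //; rewrite /T; lra.
have r_N : 100 * r <= 1 / N.
  by rewrite div1r; apply: rinv; rewrite ?invr_gt0 // invrK /T; lra.
have r_big : big * r <= k0.
  have hT : big / k0 <= T by rewrite /T; lra.
  by have := rT _ hT; rewrite mulrA ler_pdivrMr // mulrC; lra.
have lt_ra : r < ra by lra.
have lt_rb : r < rb by lra.
have r33 : 32 * r + r < 1 / N by lra.
have r64 : 64 * r < ob by lra.
have r32 : 0 <= 32 * r <= 1 by apply/andP; split; lra.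
have r320 : 0 <= 32 * r by case/andP: r32.
have NP : 0 <= 8 * (D * (N * (32 * r))).
  exact: mulr_ge0 (ler0n R 8) (mulr_ge0 D0 (mulr_ge0 (ltW N0) r320)).
have bigE : (n + n)%:R * (6 * kap * (8 * (D * (N * (32 * r))))) <= k0.
  have E (x y z w : R) : x * (6 * y * (8 * (x * (z * (32 * w))))) = x * (6 * y * (8 * (x * (z * 32)))) * w.
    by ring.
  by have := r_big; rewrite /big -E.
exists r => // phi [C1phi hphi] phiM p_near hsize.
set p := phi 1 in p_near.
pose q s := realify (phi (val (s : circle R))).
have bq := disc_boundary d01 C1phi hsize.
have q1 : q (circle_one R) = realify p by [].
have qs s j : realify (phi (val s) - phi 1) 0 j = q s 0 j - q (circle_one R) 0 j.
  by rewrite q1 realifyB rv_subE.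
have Bq j : Bnd delta (32 * r) (fun s => q s 0 j - q (circle_one R) 0 j).
  by under eq_fun do rewrite -qs; exact: bq.
have qp s : `|q s - realify p| <= 32 * r.
  apply: rv_norm_le => [|j]; first exact: r320.
  by rewrite rv_subE -q1; exact: (Bnd_le s (Bq j)).
have pq0 : `|realify p - q0| <= r.
  rewrite -realifyB; apply: rv_norm_le => [|j]; first exact: ltW.
  have hp (i : 'I_1) l : cabs ((p - p0) i l) <= r by rewrite (ord1 i); exact: p_near.
  exact: (realmx_le hp 0 j).
have qq0 s : `|q s - q0| < 1 / N.
  rewrite -(subrK (realify p) (q s)) -addrA; apply: le_lt_trans (ler_normD _ _) _.
  exact: le_lt_trans (lerD (qp s) pq0) r33.
have [Up Jp] : U (realify p) /\ forall i j, `|'J rho (realify p) i j - 'J rho q0 i j| <= eta / 2.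
  exact: hra (le_lt_trans pq0 lt_ra).
have Mp : M p by have := phiM (circle_one R).
have rp : rho (realify p) = 0 by apply: inj => //; exact: MM'.
have [|hP [L hL Lkap]] := hframe (P (realify p)).
  by move=> i j; rewrite -eta2; exact: (cgrad_close Jp i j).
have kap_i (k l : nat) (A : 'M[C]_(k, l)) : (forall i j, cabs (A i j) <= kap) ->
    forall i j, cabs (('i%C *: A) i j) <= kap.
  move=> hA i j; rewrite mxE cabsM (_ : cabs 'i%C = 1) ?mul1r //.
  by rewrite /cabs /= expr0n expr1n add0r sqrtr1.
have L1k i j : cabs (usubmx L i j) <= kap by rewrite mxE.
have L2k i j : cabs (dsubmx L i j) <= kap by rewrite mxE.
have [|||hU hC] := hrb (realify p) (frame_x L) (frame_v L) _ _ _ (frame_x1 mn hL) (frame_v0 mn hL).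
- exact: le_lt_trans pq0 lt_rb.
- exact: realmx_le.
- move=> i j; case: (split_ordP i) => i' ->; last first.
    by rewrite col_mxEd; apply: realmx_le; exact: kap_i.
  rewrite col_mxEu; case: (split_ordP i') => i'' ->; first by rewrite col_mxEu; exact: realmx_le.
  by rewrite col_mxEd; apply: realmx_le; exact: kap_i.
pose ch := graph_chart rho p Q L rb.
have small u : (forall j, cabs ((u - p) 0 j) <= ob) ->
    in_polydisc ch (coord_w ch p u) (coord_y ch p u) /\ `|coord_x ch p u| < rb.
  move=> hu; have lt := ob_lt.
  have hu' (i : 'I_1) j : cabs ((u - p) i j) <= ob by rewrite (ord1 i); exact: hu.
  have b1 := cabs_mulmx (ltW ob0) kap0 hu' hP.
  have b2 := cabs_mulmx (ltW ob0) kap0 hu' hQ.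
  split; first split.
  - apply/(rvC_norm_lt _ rb0) => j; have b2j := b2 0 j; exact: le_lt_trans b2j lt.
  - apply: le_lt_trans lt; apply: rv_norm_le => // j; rewrite mxE.
    have b1j := b1 0 j; exact: le_trans (Im_le_cabs _) b1j.
  - apply: le_lt_trans lt; apply: rv_norm_le => // j; rewrite mxE.
    have b1j := b1 0 j; exact: le_trans (Re_le_cabs _) b1j.
have on_graph u : M u -> (forall j, cabs ((u - p) 0 j) <= ob) ->
    in_polydisc ch (coord_w ch p u) (coord_y ch p u) /\
    coord_x ch p u = chh ch (coord_w ch p u) (coord_y ch p u).
  move=> Mu hu; have [h1 h2] := small u hu; split=> //.
  apply: (graph_chart_point mn hL rb0 rp hC) => //; apply: inj; first exact: MM'.
  rewrite (frame_coords rb mn hL u).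
  have [] // := hU (coord_x ch p u) (real_coords (coord_w ch p u) (coord_y ch p u)) h2.
  exact: (h_domain_ball rb0 (proj2 (h_domainP _ _ _) h1)).
have phi_near s j : cabs ((phi (val (s : circle R)) - p) 0 j) <= 64 * r.
  apply: le_trans (cabs_realify _ j) _; rewrite realifyB.
  have -> : 64 * r = 2 * (32 * r) by ring.
  by apply: ler_wpM2l; [exact: ler0n|exact: (qp s)].
have phi_graph s : in_polydisc ch (coord_w ch p (phi (val (s : circle R)))) (coord_y ch p (phi (val s))) /\
    coord_x ch p (phi (val s)) = chh ch (coord_w ch p (phi (val s))) (coord_y ch p (phi (val s))).
  apply: on_graph; first exact: phiM.
  by move=> j; exact: le_trans (phi_near s j) (ltW r64).
have adapted : adapted_chart eps M phi ch.
  have [g1 g2 g3] := graph_chart_regular heps oU hrho mn hL rb0 rp hU hC.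
  split=> //; first exact: (graph_chart_frame rb mn hL).
  have obC : (0 : C) < ob%:C by rewrite ltcR.
  exists (ball p ob%:C); split; first exact: ball_open.
    move=> s; split=> // i j; rewrite (ord1 i) -ball_normE /= distrC.
    have := phi_near s j; rewrite !mxE cabsE ltcR => h; exact: le_lt_trans h r64.
  move=> u Mu [_ hu]; apply: on_graph; first exact: Mu.
  move=> j; have := hu 0 j.
  by rewrite -ball_normE /= distrC !mxE cabsE ltcR => /ltW.
pose J s := 'J rho (q s).
have BJ i b : Bnd delta (8 * (D * (N * (32 * r)))) (fun s => J s i b - 'J rho (realify p) i b).
  apply: (composition_bound (e := eps) d01 heps de (p := q0) (r := 1 / N)
    (f := fun x => 'J rho x i b) (q := q)) => //.
  - exact: ltW.
  - move=> x xN; have [df _] := sJ i b; apply: df.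
    have [_ h _] := hN (i, b, i); by have [] := h x xN.
  - by move=> l x xN; have [_ h _] := hN (i, b, l); have [] := h x xN.
  - by move=> l x y xN yN; have [_ _ h] := hN (i, b, l); exact: h.
have BL (A : 'M[C]_(m, n)) : (forall i j, cabs (A i j) <= kap) ->
    MB delta k0 (fun s => realmx A *m (J s - 'J rho (realify p))).
  by move=> hA; exact: (MB_lin NP bigE (realmx_le hA) BJ).
pose al s := usubmx L *m cgrad (J s).
have [F1 _ _ _ _] := frame_inverse mn hL.
have JRe s : realmx (usubmx L) *m (J s - 'J rho (realify p)) = map_mx (@complex.Re R) (al s) - 1%:M.
  have e1 : realmx (usubmx L) *m J s = map_mx (@complex.Re R) (al s) := realmx_mul_J (usubmx L) (J s).
  have e2 : realmx (usubmx L) *m 'J rho (realify p) = 1%:M := frame_x1 mn hL.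
  exact (mulmxB_eq e1 e2).
have JIm s : - (realmx ('i%C *: usubmx L) *m (J s - 'J rho (realify p))) = map_mx (@complex.Im R) (al s).
  have e1 : realmx ('i%C *: usubmx L) *m J s = - map_mx (@complex.Im R) (al s) :=
    realmx_i_mul (usubmx L) (J s).
  have e2 : realmx ('i%C *: usubmx L) *m 'J rho (realify p) = 0.
    rewrite (realmx_i_mul (usubmx L) ('J rho (realify p))) F1 map_Im1; exact: oppr0.
  exact (oppr_mulmxB_eq e1 e2).
have BL1 := BL (usubmx L) L1k; have BL2 := BL ('i%C *: usubmx L) (kap_i _ _ _ L1k).
have [] := hsol phi ch (fun s => map_mx (@complex.Re R) (al s)) (fun s => map_mx (@complex.Im R) (al s)).
- by move=> i j; under eq_fun do rewrite -JRe; exact: (BL1 i j).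
- move=> i j; under eq_fun do rewrite -JIm mxE; exact: (Bnd_N (BL2 i j)).
- move=> s; have [h1 h2] := phi_graph s.
  by have [] := graph_chart_hy oU hrho mn hL rb0 rp hU hC h1 h2.
- move=> s; have [h1 h2] := phi_graph s.
  by have [] := graph_chart_hy oU hrho mn hL rb0 rp hU hC h1 h2.
by move=> G [s1 s2 s3]; exists ch, G; split.
Qed.

End LocalChoice.



Section GlobalChoice.
Variables (R : realType) (n m : nat) (eps delta : R).
Hypotheses (heps : 0 < eps < 1) (hdelta : 0 < delta < eps).
Local Notation C := R[i].
Variables (M M' : set 'rV[C]_n).
Hypotheses (hM' : generic_submanifold eps m M') (hMM' : relatively_compact_open_in M M').

Lemma global_tumanov_choice : exists2 R0, 0 < R0 & forall phi,
  analytic_disc delta phi -> (forall s : circle R, M (phi (val s))) -> disc_size delta phi < R0 ->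
  exists (ch : chart R n m) (G : circle R -> 'M[R]_m), tumanov_choice eps delta M phi ch G.
Proof.
have [MM' _ cpt] := hMM'.
pose P (k : R) (p : 'rV[C]_n) := forall phi, phi 1 = p -> analytic_disc delta phi ->
  (forall s : circle R, M (phi (val s))) -> disc_size delta phi < 1 / k ->
  exists (ch : chart R n m) (G : circle R -> 'M[R]_m), tumanov_choice eps delta M phi ch G.
have := (compact_near_coveringP _).1 cpt _ +oo%R P _.
case.
  move=> p [_ M'p]; have [r r0 hr] := local_tumanov_choice heps hdelta hM' MM' M'p.
  have rC : (0 : C) < r%:C by rewrite ltcR.
  exists (ball p r%:C, [set k | 1 / r < k]).
    split; first exact: nbhsx_ballx.
    by exists (1 / r); split=> //; exact: num_real.
  case=> x k /= [[_ px] rk] phi phi1 aphi phiM hsize; apply: hr => //.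
    move=> j; have := px 0 j; rewrite -ball_normE /= distrC -phi1.
    have -> : phi 1 0 j - p 0 j = (phi 1 - p) 0 j by rewrite !mxE.
    by rewrite cabsE ltcR => /ltW.
  apply: lt_le_trans hsize _; have k0 : 0 < k by apply: lt_trans rk; rewrite divr_gt0.
  by rewrite ler_pdivrMr // mulrC -ler_pdivrMr // ltW.
move=> N [_ hN]; pose k := Num.max N 0 + 1.
have k0 : 0 < k by rewrite ltr_pwDr // le_max lexx orbT.
have Nk : N < k by rewrite ltr_pwDr // le_max lexx.
exists (1 / k) => [|phi aphi phiM hsize]; first by rewrite divr_gt0.
have Mp : M (phi 1) by have := phiM (circle_one R).
apply: (hN k Nk (phi 1)) => //; split; last exact: MM'.
exact: subset_closure.
Qed.

End GlobalChoice.



Section RealGradient.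
Variable R : realType.
Local Notation C := R[i].
Local Notation toC := (map_mx (real_complex R)).

Definition rgrad n m (B : 'M[C]_(n, m)) : 'M[R]_(n + n, m) :=
  col_mx (map_mx (@complex.Re R) B) (- map_mx (@complex.Im R) B).

Lemma realify_rgrad n m (v : 'rV[C]_n) (B : 'M[C]_(n, m)) :
  realify v *m rgrad B = map_mx (@complex.Re R) (v *m B).
Proof.
rewrite realify_mul_J; congr (map_mx _ (v *m _)); apply/matrixP => i j.
by rewrite mxE /rgrad col_mxEu col_mxEd !mxE; case: (B i j) => x y /=; rewrite opprK.
Qed.

Lemma rgradB n m (A B : 'M[C]_(n, m)) : rgrad (A - B) = rgrad A - rgrad B.
Proof.
rewrite /rgrad opp_col_mx add_col_mx; congr col_mx; apply/matrixP => i j; rewrite !mxE.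
  by case: (A i j) => a b; case: (B i j).
by case: (A i j) => a b; case: (B i j) => c e /=; ring.
Qed.

Lemma rgrad_mul n m k (A : 'M[C]_(n, m)) (X : 'M[R]_(m, k)) : rgrad (A *m toC X) = rgrad A *m X.
Proof.
rewrite /rgrad mul_col_mx; congr col_mx; apply/matrixP => i j; rewrite !mxE.
  by rewrite Re_sum; apply: eq_bigr => l _; rewrite !mxE; case: (A i l) => a b /=; ring.
by rewrite Im_sum -sumrN; apply: eq_bigr => l _; rewrite !mxE; case: (A i l) => a b /=; ring.
Qed.

Lemma rgrad_inj n m (A B : 'M[C]_(n, m)) : rgrad A = rgrad B -> A = B.
Proof.
move=> /eq_col_mx[h1 h2]; apply/matrixP => i j.
have e1 := congr1 (fun M : 'M_(n, m) => M i j) h1; have e2 := congr1 (fun M : 'M_(n, m) => M i j) h2.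
move: e1 e2; rewrite !mxE; case: (A i j) => a b; case: (B i j) => c e /= -> h.
by congr (_ +i* _); apply: oppr_inj.
Qed.

Lemma grad_affine n k (q0 : 'rV[R]_n) (A : 'M[R]_(n, k)) j x :
  grad_at (fun q => ((q - q0) *m A) 0 j) x (fun i => A i j).
Proof.
move=> e e0; exists 1 => // y _.
have -> : ((y - q0) *m A) 0 j - ((x - q0) *m A) 0 j = \sum_i A i j * (y - x) 0 i.
  by rewrite !mxE -sumrB; apply: eq_bigr => i _; rewrite !mxE; ring.
by rewrite subrr normr0; exact: mulr_ge0 (ltW e0) _.
Qed.

Lemma affine_derive n k (q0 : 'rV[R]_n) (A : 'M[R]_(n, k)) x :
  differentiable (fun q => (q - q0) *m A) x /\
  forall i j, ('D_(delta_mx 0 i) (fun q => (q - q0) *m A) x) 0 j = A i j.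
Proof.
have dA : differentiable (fun q => (q - q0) *m A) x.
  by apply/differentiable_rvP => j; exact: (grad_at_differentiable (grad_affine q0 A j x)).1.
split=> // i j; rewrite derive_coord //.
exact: (grad_at_differentiable (grad_affine q0 A j x)).2.
Qed.

(** A linear map vanishing on the kernel of [J] factors through [J]. *)
Lemma factor_through n m k (J : 'M[R]_(n, m)) (X : 'M[R]_(m, n)) (K : 'M[R]_(n, k)) :
  X *m J = 1%:M -> (forall v : 'rV[R]_n, v *m J = 0 -> v *m K = 0) -> K = J *m (X *m K).
Proof.
move=> XJ h; apply/row_matrixP => i.
have : row i (1%:M - J *m X) *m K = 0.
  by apply: h; rewrite -row_mul mulmxBl mul1mx -mulmxA XJ mulmx1 subrr row0.
by rewrite -row_mul mulmxBl mul1mx raddfB /= => /eqP; rewrite subr_eq0 mulmxA => /eqP.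
Qed.

End RealGradient.

Section TangentCurves.
Variables (R : realType) (eps : R).
Hypothesis heps : 0 < eps < 1.

(** The curve is [t |-> p + g(t v) X + t v], with [g] given by the implicit
    function theorem in the frame made of a right inverse [X] of the Jacobian
    and of the projection [1 - J X] onto its kernel. *)
Lemma tangent_curve N m (S U : set 'rV[R]_N) (rho : 'rV[R]_N -> 'rV[R]_m) p X v :
  open U -> U p -> class_Ck 2 eps U rho -> rho p = 0 -> (forall q, U q -> rho q = 0 -> S q) ->
  X *m 'J rho p = 1%:M -> v *m 'J rho p = 0 -> tangent S p v.
Proof.
move=> oU Up hrho rp zero XJ vJ; pose V : 'M[R]_N := 1%:M - 'J rho p *m X.
have VJ : V *m 'J rho p = 0 by rewrite /V mulmxBl mul1mx -mulmxA XJ mulmx1 subrr.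
have vV : v *m V = v by rewrite /V mulmxBr mulmx1 mulmxA vJ mul0mx subr0.
have [x M M' MM|ij|kap kap0 hkap] := @common_large R (('I_m * 'I_N) + ('I_N * 'I_N))%type
  (fun ij b => match ij with inl x => `|X x.1 x.2| <= b | inr x => `|V x.1 x.2| <= b end).
- by case: x => x /le_trans; apply.
- by case: ij => x; [exists (`|X x.1 x.2|) | exists (`|V x.1 x.2|)].
have [r r0 hr] := implicit_contraction heps N oU hrho Up (ltW kap0).
have [|||hU hC] := hr p X V _ _ _ XJ VJ.
- by rewrite subrr normr0.
- by move=> i j; exact: (hkap (inl (i, j))).
- by move=> i j; exact: (hkap (inr (i, j))).
pose g := graph_fun rho p X V.
have n0 : `|0 : 'rV[R]_N| < r by rewrite normr0.
have [dg Jg] := graph_fun_diff oU hrho r0 rp hU hC n0.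
have g0 : g 0 = 0 by exact: graph_fun0 r0 rp hC.
have Jg0 : 'J g 0 = 0.
  by rewrite Jg /graph_slope (graph_fun0 r0 rp hC) /frame !mul0mx !addr0 VJ mul0mx oppr0.
have small : \forall t \near (0 : R), `|t *: v| < r.
  have c0 : 0 < 1 + `|v| by rewrite ltr_pwDl.
  apply/nbhs_ballP; exists (r / (1 + `|v|)) => /=; first by rewrite divr_gt0.
  move=> t; rewrite /ball /= sub0r normrN ltr_pdivlMr // normrZ => h.
  by apply: le_lt_trans h; rewrite ler_wpM2l // lerDr.
exists (fun t => frame p X V (g (t *: v)) (t *: v)); split.
- by rewrite scale0r g0 /frame !mul0mx !addr0.
- apply: filterS small => t tv; apply: zero.
    by have [] := hU _ _ (graph_fun_lt r0 rp hC tv) tv.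
  by have [] := graph_funP r0 rp hC tv.
- have dcoord j : is_derive (0 : R) 1 (fun t : R => (t *: v) 0 j) (v 0 j).
    have -> : (fun t : R => (t *: v) 0 j) = (fun t => v 0 j * t + 0).
      by apply/funext => t; rewrite mxE addr0 mulrC.
    exact: daffine.
  have dgl l : is_derive (0 : R) 1 (fun t : R => g (t *: v) 0 l) 0.
    have dgl0 : differentiable (fun w => g w 0 l) ((0 : R) *: v).
      by rewrite scale0r; exact: ((differentiable_rvP g 0).1 dg l).
    apply: dE (is_derive_chain dcoord dgl0) _; apply: big1 => i _.
    by rewrite scale0r -jacobianE // Jg0 mxE mul0r.
  have dco i : is_derive (0 : R) 1 (fun t : R => frame p X V (g (t *: v)) (t *: v) 0 i) (v 0 i).
    have -> : (fun t : R => frame p X V (g (t *: v)) (t *: v) 0 i)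
        = (fun t => (p 0 i + t * v 0 i) + \sum_l X l i * g (t *: v) 0 l).
      apply/funext => t; rewrite /frame -scalemxAl vV.
      move: (g (t *: v)) => w; rewrite !mxE addrAC; congr (_ + _).
      by apply: eq_bigr => l _; rewrite mulrC.
    have h1 : is_derive (0 : R) 1 (fun t : R => p 0 i + t * v 0 i) (v 0 i).
      have -> : (fun t : R => p 0 i + t * v 0 i) = (fun t => v 0 i * t + p 0 i).
        by apply/funext => t; rewrite addrC mulrC.
      exact: daffine.
    have h2 : is_derive (0 : R) 1 (fun t : R => \sum_l X l i * g (t *: v) 0 l) 0.
      elim: (index_enum _) => [|l s ih].
        by under eq_fun do rewrite big_nil; exact: is_derive_cst.
      under eq_fun do rewrite big_cons.
      by apply: dE (is_derive_add (dZ (X l i) (dgl l)) ih) _; rewrite mulr0 addr0.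
    by apply: dE (is_derive_add h1 h2) _; rewrite addr0.
  have dm : derivable (fun t : R => frame p X V (g (t *: v)) (t *: v)) 0 1.
    by apply/derivable_mxP => i j; rewrite (ord1 i); case: (dco j).
  apply: DeriveDef => //; rewrite derive_mx //; apply/matrixP => i j; rewrite mxE (ord1 i).
  exact: (@derive_val _ _ _ _ _ _ _ (dco j)).
Qed.

End TangentCurves.



Section ConormalBundle.
Variables (R : realType) (n m : nat) (eps : R).
Hypothesis heps : 0 < eps < 1.
Local Notation C := R[i].
Local Notation toC := (map_mx (real_complex R)).
Variables (M : set 'rV[C]_n) (phi : C -> 'rV[C]_n) (ch : chart R n m).
Hypotheses (hM : generic_submanifold eps m M) (phiM : forall s : circle R, M (phi (val s))).
Hypothesis hch : adapted_chart eps M phi ch.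
Let P := chP ch.
Let Q := chQ ch.
Let p0 := phi 1.

Definition chart_map : 'M[R]_(n + n, n - m + (n - m) + m) :=
  row_mx (row_mx (rgrad Q) (rgrad ((- 'i%C) *: Q))) (rgrad ((- 'i%C) *: P)).

Lemma Re_mulNi k l h (A : 'M[C]_(k, l)) (B : 'M[C]_(l, h)) :
  map_mx (@complex.Re R) (A *m ((- 'i%C) *: B)) = map_mx (@complex.Im R) (A *m B).
Proof.
rewrite -scalemxAr; apply/matrixP => i j; move: (A *m B) => D; rewrite !mxE.
by case: (D i j) => x y /=; ring.
Qed.

Lemma chart_mapE u : (realify u - realify p0) *m chart_map
  = real_coords (coord_w ch p0 u) (coord_y ch p0 u).
Proof.
by rewrite -realifyB /chart_map !mul_mx_row !realify_rgrad !Re_mulNi.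
Qed.

Lemma coord_xE u : (realify u - realify p0) *m rgrad P = coord_x ch p0 u.
Proof. by rewrite -realifyB realify_rgrad. Qed.

Lemma h_domain_open : open (h_domain ch).
Proof.
have [_ r0 _ _ _] := hch.
rewrite openE => v [hw hy]; have hw' := (rvC_norm_lt _ r0).1 hw.
have [j e1 e2 _ ee h v' v'e|j|e e0 he] := @common_radius R (n - m) (fun j e => forall v' : 'rV[R]_(n - m + (n - m) + m),
  `|v' - v| < e -> cabs (complexify (lsubmx v') 0 j) < chr ch).
- by apply: h; exact: lt_le_trans ee.
- pose x := cabs (complexify (lsubmx v) 0 j); have xr : x < chr ch by exact: hw'.
  exists ((chr ch - x) / 2) => [|v' hv]; first by rewrite divr_gt0 // subr_gt0.
  have h1 := le_lt_trans (rv_coord_le (v' - v) (lshift _ (lshift _ j))) hv.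
  have h2 := le_lt_trans (rv_coord_le (v' - v) (lshift _ (rshift _ j))) hv.
  rewrite !rv_subE in h1 h2.
  have h3 := cabs_le (complexify (lsubmx v') 0 j - complexify (lsubmx v) 0 j).
  have := cabsD (complexify (lsubmx v') 0 j - complexify (lsubmx v) 0 j) (complexify (lsubmx v) 0 j).
  rewrite subrK -/x => h4; apply: le_lt_trans h4 _.
  move: h3; rewrite !mxE /= !(mul0r, mulr0, mul1r, mulr1, subr0, add0r, addr0, oppr0, sub0r) => h3.
  by move: h1 h2 h3; move: (v' _ _) (v _ _) (v' _ _) (v _ _) => a b c d; lra.
apply/nbhs_ballP; exists (Num.min e (chr ch - `|rsubmx v|)) => /=.
  by rewrite lt_min e0 subr_gt0.
move=> v'; rewrite -ball_normE /= distrC lt_min => /andP[h1 h2]; split.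
  by apply/(rvC_norm_lt _ r0) => j; exact: he.
have h3 : `|rsubmx v' - rsubmx v| <= `|v' - v|.
  by apply: rv_norm_le => // j; have := rv_coord_le (v' - v) (rshift _ j); rewrite !mxE.
have := ler_normD (rsubmx v' - rsubmx v) (rsubmx v); rewrite subrK => h4.
by apply: le_lt_trans h4 _; lra.
Qed.

Lemma chart_point (s : circle R) :
  in_polydisc ch (coord_w ch p0 (phi (val s))) (coord_y ch p0 (phi (val s))).
Proof. by have [_ _ _ _ [W [_ Os hO]]] := hch; have [] := hO _ (phiM s) (Os s). Qed.

Definition chart_curve (s : circle R) :=
  real_coords (coord_w ch p0 (phi (val s))) (coord_y ch p0 (phi (val s))).

Lemma chart_curve_domain s : h_domain ch (chart_curve s).
Proof. exact: (proj2 (h_domainP _ _ _) (chart_point s)). Qed.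

Let H s := 'J (h_real ch) (chart_curve s).

Lemma h_real_diff s : differentiable (h_real ch) (chart_curve s).
Proof. by have [_ _ hC _ _] := hch; have [dh _] := hC; apply: dh; exact: chart_curve_domain. Qed.

Lemma h_y_on_jacobian s i j : h_y_on ch phi s i j = H s (rshift _ j) i.
Proof. by rewrite /h_y_on h_yE /H jacobianE //; exact: h_real_diff. Qed.

Lemma h_w_on_jacobian s i j : h_w_on ch phi s i j =
  ((H s (lshift _ (lshift _ j)) i)%:C - 'i%C * (H s (lshift _ (rshift _ j)) i)%:C) / 2%:R.
Proof. by rewrite /h_w_on h_wE /H !jacobianE //; exact: h_real_diff. Qed.

(** The complex gradient of the function [x - h(w, y)], which defines [M] along the curve. *)
Definition graph_gradient s : 'M[C]_(n, m) :=
  P *m (1%:M + 'i%C *: toC (h_y_on ch phi s)^T) - Q *m (2%:R *: (h_w_on ch phi s)^T).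

Lemma graph_gradientE s : rgrad P - chart_map *m H s = rgrad (graph_gradient s).
Proof.
pose Hr := usubmx (usubmx (H s)); pose Hi := dsubmx (usubmx (H s)); pose Hy := dsubmx (H s).
have HE : H s = col_mx (col_mx Hr Hi) Hy by rewrite !vsubmxK.
have e1 : (h_y_on ch phi s)^T = Hy.
  by apply/matrixP => i j; rewrite [LHS]mxE h_y_on_jacobian [RHS]mxE.
have e2 : 2%:R *: (h_w_on ch phi s)^T = toC Hr - 'i%C *: toC Hi.
  apply/matrixP => i j; rewrite [LHS]mxE [(_^T) i j]mxE h_w_on_jacobian mulrC divfK ?pnatr_eq0 //.
  by rewrite /Hr /Hi; move: (H s) => H'; rewrite !mxE.
have -> : graph_gradient s = P - Q *m toC Hr - ((- 'i%C) *: Q) *m toC Hi - ((- 'i%C) *: P) *m toC Hy.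
  rewrite /graph_gradient e1 e2 mulmxDr mulmx1 mulmxBr -!scalemxAr -!scalemxAl.
  move: (Q *m _) (Q *m _) (P *m _) => A1 A2 A3.
  by apply/matrixP => i j; rewrite !mxE; ring.
rewrite !rgradB !rgrad_mul HE /chart_map mul_row_col mul_row_col.
by rewrite !opprD !addrA.
Qed.

Lemma tangent_gradient s v : tangentC M (phi (val s)) v -> map_mx (@complex.Re R) (v *m graph_gradient s) = 0.
Proof.
move=> tv; rewrite -realify_rgrad -graph_gradientE.
pose Phi q := (q - realify p0) *m rgrad P - h_real ch ((q - realify p0) *m chart_map).
set q1 := realify (phi (val s)).
have [dA hA] := affine_derive (realify p0) (rgrad P) q1.
have [dW hW] := affine_derive (realify p0) chart_map q1.
have Wq1 : (q1 - realify p0) *m chart_map = chart_curve s by exact: chart_mapE.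
have dh : differentiable (h_real ch) ((q1 - realify p0) *m chart_map).
  by rewrite Wq1; exact: h_real_diff.
have dhW : differentiable (fun q => h_real ch ((q - realify p0) *m chart_map)) q1.
  exact: (differentiable_comp dW dh).
have dPhi : differentiable Phi q1 by exact: differentiableB.
have JPhi : 'J Phi q1 = rgrad P - chart_map *m H s.
  apply/matrixP => i b; rewrite jacobianE // /partial.
  have d1 := (differentiable_rvP _ _).1 dA b; have d2 := (differentiable_rvP _ _).1 dhW b.
  have -> : (fun y => Phi y 0 b) = (fun y => ((y - realify p0) *m rgrad P) 0 b)
     - (fun y => h_real ch ((y - realify p0) *m chart_map) 0 b).
    by apply/funext => y; rewrite /Phi rv_subE.
  rewrite (deriveB (diff_derivable d1) (diff_derivable d2)) -derive_coord // hA.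
  have dhb := (differentiable_rvP _ _).1 dh b.
  have ch1 := derive_chain (delta_mx 0 i) dW dhb; rewrite Wq1 in ch1.
  have E (A B : 'M[R]_(n + n, m)) : (A - B) i b = A i b - B i b by rewrite !mxE.
  rewrite E [(chart_map *m H s) i b]mxE.
  have e2 : 'D_(delta_mx 0 i) (fun y => h_real ch ((y - realify p0) *m chart_map) 0 b) q1
      = \sum_l chart_map i l * H s l b.
    apply: etrans ch1 _; apply: eq_bigr => l _; rewrite hW /H jacobianE; first exact: mulrC.
    exact: h_real_diff.
  exact (congr1 (fun z => rgrad P i b - z) e2).
have [_ _ _ _ [W [oO Os hO]]] := hch.
have /nbhs_ballP[e /= e0 he] := open_nbhs_nbhs (conj oO (Os s)).
have [e1 e10 eE] : exists2 e1 : R, 0 < e1 & e = e1%:C.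
  move: e0; case: (e) => a b; rewrite ltcE /= => /andP[/eqP hb ha].
  by exists a => //; rewrite hb.
pose V := [set q : 'rV[R]_(n + n) | `|q - q1| < e1 / 2].
have oV : open V.
  have -> : V = ball q1 (e1 / 2) by apply/seteqP; split=> q; rewrite /V -ball_normE /= distrC.
  exact: ball_open.
have Vq1 : V q1 by rewrite /V /= subrr normr0 divr_gt0.
rewrite -JPhi; apply: (tangent_kernel oV Vq1 dPhi _ tv) => q Vq [u Mu uq].
have Ou : W u.
  apply: he; split=> // i j; rewrite (ord1 i) -ball_normE /= distrC eE.
  have -> : u 0 j - phi (val s) 0 j = (u - phi (val s)) 0 j by rewrite !mxE.
  rewrite cabsE ltcR; apply: le_lt_trans (cabs_realify _ _) _.
  by rewrite realifyB uq; move: Vq; rewrite /V /= -/q1 => h; rewrite mulrC -ltr_pdivlMr.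
have [_ hx] := hO u Mu Ou.
by rewrite /Phi -uq coord_xE chart_mapE h_real_coords hx subrr.
Qed.

Lemma chart_dual : exists (L1 : 'M[C]_(m, n)) (L2 : 'M[C]_(n - m, n)),
  [/\ L1 *m P = 1%:M, L1 *m Q = 0, L2 *m P = 0 & L2 *m Q = 1%:M].
Proof.
have [/andP[_ /row_fullP[L hL]] _ _ _ _] := hch; exists (usubmx L), (dsubmx L).
move: hL; rewrite -{1}[L]vsubmxK mul_col_row -[1%:M]submxK => /eq_block_mx[-> -> -> ->].
by split; apply/matrixP => i j; rewrite !mxE ?eq_lrshift ?eq_rlshift
  ?(inj_eq (@lshift_inj _ _)) ?(inj_eq (@rshift_inj _ _)).
Qed.

Lemma conormalE s a : conormal M (phi (val s)) a <->
  exists c : 'rV[R]_m, a = 'i%C *: (toC c *m (graph_gradient s)^T).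
Proof.
have dotE (u v : 'rV[C]_n) : \sum_(j < n) u 0 j * v 0 j = (v *m u^T) 0 0.
  by rewrite mxE; apply: eq_bigr => j _; rewrite mxE mulrC.
split=> [ha|[c ->] v tv]; last first.
  have h := tangent_gradient tv; rewrite dotE linearZ /= trmx_mul trmxK -scalemxAr mulmxA.
  move: (v *m graph_gradient s) h => y hy; rewrite mxE.
  have yr l : complex.Re (y 0 l) = 0 by have := congr1 (fun A : 'rV_m => A 0 l) hy; rewrite !mxE.
  have -> : (y *m (toC c)^T) 0 0 = 0 +i* \sum_l complex.Im (y 0 l) * c 0 l.
    rewrite mxE; apply/eqP; rewrite eq_complex Re_sum Im_sum /=; apply/andP; split; apply/eqP.
      by apply: big1 => l _; rewrite !mxE; have := yr l; case: (y 0 l) => x z /= ->; ring.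
    by apply: eq_bigr => l _; rewrite !mxE; have := yr l; case: (y 0 l) => x z /= ->; ring.
  by rewrite /=; ring.
have [sub _] := hM; set q1 := realify (phi (val s)).
have Sq1 : (@realify R n @` M) q1 by exists (phi (val s)).
have [U [rho [oU Uq1 hrho zero rank]]] := sub _ Sq1.
have [X XJ] : exists X, X *m 'J rho q1 = 1%:M.
  by apply/row_fullP; rewrite /row_full rank.
have rp : rho q1 = 0 by apply/(zero _ Uq1).
have tan q : q *m 'J rho q1 = 0 -> tangentC M (phi (val s)) (complexify q).
  move=> qJ; rewrite /tangentC complexifyK.
  apply: (tangent_curve heps oU Uq1 hrho rp _ XJ qJ) => q' Uq' rq'.
  exact/(zero _ Uq').
pose A : 'cV[C]_n := (- 'i%C) *: a^T.
have fA := factor_through (K := rgrad A) XJ; have fB := factor_through (K := rgrad (graph_gradient s)) XJ.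
have {}fB : rgrad (graph_gradient s) = 'J rho q1 *m (X *m rgrad (graph_gradient s)).
  apply: fB => q qJ; have := tangent_gradient (tan _ qJ).
  by rewrite -realify_rgrad complexifyK.
have {}fA : rgrad A = 'J rho q1 *m (X *m rgrad A).
  apply: fA => q qJ; rewrite -[q]complexifyK realify_rgrad Re_mulNi.
  apply/matrixP => i j; rewrite (ord1 i) (ord1 j) [LHS]mxE [RHS]mxE -dotE; exact: ha _ (tan _ qJ).
have [L1 [L2 [LP LQ _ _]]] := chart_dual.
have uS : X *m rgrad (graph_gradient s) \in unitmx.
  rewrite -unitmx_tr -row_free_unit -kermx_eq0; apply/rowV0P => c /sub_kermxP hc.
  have hc' : X *m rgrad (graph_gradient s) *m c^T = 0 by apply: trmx_inj; rewrite trmx_mul trmxK hc trmx0.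
  have Bc : graph_gradient s *m toC c^T = 0.
    apply: rgrad_inj; rewrite rgrad_mul fB -mulmxA hc' mulmx0.
    by rewrite /rgrad !map_mx0 oppr0 col_mx0.
  have := congr1 (mulmx L1) Bc; rewrite mulmx0 mulmxA /graph_gradient mulmxBr !mulmxA.
  rewrite LP LQ mul0mx subr0 mul1mx => h.
  apply/rowP => j; have := congr1 (fun A : 'cV_m => complex.Re (A j 0)) h.
  rewrite mulmxDl mul1mx -scalemxAl -map_mxM; move: (_ *m c^T) => D; rewrite !mxE /=.
  by move=> h'; rewrite -[RHS]h'; ring.
move: (X *m rgrad (graph_gradient s)) (X *m rgrad A) fB uS fA => S c fB uS fA.
exists (invmx S *m c)^T.
have AE : A = graph_gradient s *m toC (invmx S *m c).
  by apply: rgrad_inj; rewrite rgrad_mul fB fA -mulmxA (mulmxA S) mulmxV // mul1mx.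
have -> : a = 'i%C *: A^T.
  by rewrite /A linearZ /= trmxK scalerA mulrN -expr2 sqr_i opprK scale1r.
by rewrite {1}AE trmx_mul map_trmx.
Qed.

End ConormalBundle.



Section RealDimension.
Variable R : realType.

Lemma has_real_dim_transfer (K : nzRingType) (iota : R -> K) (m : nat) (V : lmodType K)
    (S : set 'rV[R]_m) (T : set V) (f : 'rV[R]_m -> V) d :
  (forall x u v, f (x *: u + v) = iota x *: f u + f v) -> iota 0 = 0 -> iota 1 = 1 ->
  (forall u, f u = 0 -> u = 0) -> (forall w, T w <-> exists2 v, S v & w = f v) ->
  has_real_dim id S d <-> has_real_dim iota T d.
Proof.
move=> fl i0 i1 f0 ST.
have f00 : f 0 = 0.
  by have := fl 1 0 0; rewrite scale1r i1 scale1r addr0 -[LHS]addr0 => /addrI.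
have fsum (I : Type) (r : seq I) (c : I -> R) (b : I -> 'rV[R]_m) :
    f (\sum_(i <- r) c i *: b i) = \sum_(i <- r) iota (c i) *: f (b i).
  by elim: r => [|i r ih]; rewrite ?big_nil // !big_cons fl ih.
have finj u v : f u = f v -> u = v.
  move=> uv; apply/eqP; rewrite -subr_eq0; apply/eqP/f0.
  have : f (u - v) + f v = f u by rewrite -[f (u - v)]scale1r -i1 -fl scale1r subrK.
  by rewrite uv -[X in _ = X]add0r => /addIr.
split=> [[b [bfree bspan]]|[b [bfree bspan]]].
  exists (fun i => f (b i)); split=> [c|w].
    by rewrite -fsum => /f0; exact: bfree.
  split=> [/ST[v /bspan[c vE] ->]|[c ->]]; first by exists c; rewrite vE fsum.
  by apply/ST; exists (\sum_i c i *: b i); [apply/bspan; exists c|rewrite fsum].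
have Tb i : T (b i).
  apply/bspan; exists (fun j => (j == i)%:R); rewrite (bigD1 i) //= eqxx i1 scale1r.
  by rewrite big1 ?addr0 // => j /negbTE ->; rewrite i0 scale0r.
have /choice[v hv] : forall i, exists v, S v /\ b i = f v.
  by move=> i; have /ST[v Sv e] := Tb i; exists v.
exists v; split=> [c h|w].
  apply: bfree; rewrite (eq_bigr (fun i => iota (c i) *: f (v i))); last by move=> i _; have [_ ->] := hv i.
  by rewrite -fsum h f00.
have E c : \sum_(i < d) iota (c i) *: b i = f (\sum_(i < d) c i *: v i).
  by rewrite fsum; apply: eq_bigr => i _; have [_ ->] := hv i.
split=> [Sw|[c wE]].
  have /bspan[c] : T (f w) by apply/ST; exists w.
  by rewrite E => /finj wE; exists c.
have /ST[w' Sw' /finj ->//] : T (f w).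
by apply/bspan; exists c; rewrite E wE.
Qed.

Lemma subspace_dim m (S : set 'rV[R]_m) : S 0 -> (forall x u v, S u -> S v -> S (x *: u + v)) ->
  exists2 d, (d <= m)%N & has_real_dim id S d.
Proof.
move=> S0 Slin.
pose Q k := `[< exists A : 'M[R]_(k, m), row_free A /\ forall i, S (row i A) >].
have exQ : exists k, Q k.
  exists 0%N; apply/asboolP; exists 0; split=> [|[]//].
  by rewrite /row_free mxrank0.
have boundQ k : Q k -> (k <= m)%N.
  by move=> /asboolP[A [/eqP rA _]]; have := rank_leq_col A; rewrite rA.
have [d Qd dmax] := ex_maxnP exQ boundQ.
exists d; first exact: boundQ.
have [A [fA SA]] := asboolP _ Qd.
have sumE (c : 'I_d -> R) : \sum_(i < d) c i *: row i A = (\row_i c i) *m A.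
  by rewrite mulmx_sum_row; apply: eq_bigr => i _; rewrite mxE.
exists (fun i => row i A); split=> [c|v].
  rewrite sumE => h i; have : \row_i c i = 0 by apply: (row_free_inj fA); rewrite h mul0mx.
  by move=> /(congr1 (fun u : 'rV_d => u 0 i)); rewrite !mxE.
split=> [Sv|[c ->]]; last first.
  by elim/big_rec: _ => // i x _ Sx; apply: Slin.
have [/submxP[c ->]|nv] := boolP (v <= A)%MS.
  exists (fun i => c 0 i); rewrite sumE; congr (_ *m A).
  by apply/rowP => i; rewrite mxE.
have : Q (d + 1)%N.
  apply/asboolP; exists (col_mx A v); split.
    rewrite -kermx_eq0; apply/rowV0P => u /sub_kermxP.
    rewrite -[u]hsubmxK mul_row_col; move: (lsubmx u) (rsubmx u) => u1 u2.
    rewrite [u2]mx11_scalar mul_scalar_mx; have [->|un] := eqVneq (u2 0 0) 0.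
      rewrite scale0r addr0 => h; have -> : u1 = 0 by apply: (row_free_inj fA); rewrite h mul0mx.
      by rewrite raddf0 row_mx0.
    move=> h; case/negP: nv; apply/submxP; exists (- ((u2 0 0)^-1 *: u1)).
    rewrite mulNmx -scalemxAl; apply: (scalerI un); rewrite scalerN scalerA mulfV // scale1r.
    by apply/eqP; rewrite -addr_eq0 addrC h.
  move=> i; case: (split_ordP i) => j ->; rewrite ?rowKu ?rowKd //.
  by rewrite (ord1 j) row_id.
by move=> /dmax; rewrite addn1 ltnn.
Qed.

End RealDimension.

Section ExtensionAlgebra.
Variable R : realType.
Local Notation C := R[i].
Implicit Types f g : circle R -> C.

Lemma extends_holo f : extends_holomorphically f <-> exists F, holo F /\ forall s, F (val s) = f s.
Proof.
split=> [[F [cF dF hF]]|[F [hF eF]]]; exists F; first by split; first exact (conj cF dF).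
have [cF dF] := hF; split; [exact cF|exact dF|exact eF].
Qed.

Lemma extends_cst k : extends_holomorphically (fun _ : circle R => k : C).
Proof. apply/extends_holo; exists (fun=> k); split=> //; exact: holo_cst. Qed.

Lemma extends_D f g : extends_holomorphically f -> extends_holomorphically g ->
  extends_holomorphically (fun s => f s + g s).
Proof.
move=> /extends_holo[F [hF eF]] /extends_holo[F' [hF' eF']]; apply/extends_holo.
exists (fun z => F z + F' z); split; first exact (holoD hF hF').
by move=> s; rewrite eF eF'.
Qed.

Lemma extends_M f g : extends_holomorphically f -> extends_holomorphically g ->
  extends_holomorphically (fun s => f s * g s).
Proof.
move=> /extends_holo[F [hF eF]] /extends_holo[F' [hF' eF']]; apply/extends_holo.
exists (fun z => F z * F' z); split; first exact (holoM hF hF').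
by move=> s; rewrite eF eF'.
Qed.

Lemma extends_mulmx k l n (A : circle R -> 'M[C]_(k, l)) (B : circle R -> 'M[C]_(l, n)) :
  (forall i j, extends_holomorphically (fun s => A s i j)) ->
  (forall i j, extends_holomorphically (fun s => B s i j)) ->
  forall i j, extends_holomorphically (fun s => (A s *m B s) i j).
Proof. exact: (alg_mulmx extends_cst extends_D extends_M). Qed.

End ExtensionAlgebra.

Section SmoothAlgebra.
Variables (R : realType) (d : R).
Hypothesis d01 : 0 < d < 1.
Local Notation C := R[i].

Definition C1r (f : circle R -> R) := exists K, Bnd d K f.
Definition C1c (f : circle R -> C) := C1r (fun s => complex.Re (f s)) /\ C1r (fun s => complex.Im (f s)).

Lemma C1r_cst k : C1r (fun=> k). Proof. by exists `|k|; exact: Bnd_cst. Qed.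
Lemma C1r_D f g : C1r f -> C1r g -> C1r (fun s => f s + g s).
Proof. by move=> [K h] [K' h']; exists (K + K'); exact: Bnd_D. Qed.
Lemma C1r_M f g : C1r f -> C1r g -> C1r (fun s => f s * g s).
Proof. by move=> [K h] [K' h']; exists (6 * K * K'); exact: Bnd_M. Qed.

Lemma C1c_cst k : C1c (fun=> k). Proof. by split; exact: C1r_cst. Qed.
Lemma C1c_D f g : C1c f -> C1c g -> C1c (fun s => f s + g s).
Proof.
move=> [f1 f2] [g1 g2]; split.
  by under eq_fun do rewrite raddfD; exact: C1r_D.
by under eq_fun do rewrite raddfD; exact: C1r_D.
Qed.
Lemma C1c_M f g : C1c f -> C1c g -> C1c (fun s => f s * g s).
Proof.
move=> [f1 f2] [g1 g2]; split.
  have -> : (fun s => complex.Re (f s * g s)) = (fun s => complex.Re (f s) * complex.Re (g s)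
      + (-1) * (complex.Im (f s) * complex.Im (g s))).
    by apply/funext => s; case: (f s) (g s) => a b [a' b'] /=; ring.
  by apply: C1r_D; [exact: C1r_M|apply: C1r_M; [exact: C1r_cst|exact: C1r_M]].
have -> : (fun s => complex.Im (f s * g s)) = (fun s => complex.Re (f s) * complex.Im (g s)
    + complex.Im (f s) * complex.Re (g s)).
  by apply/funext => s; case: (f s) (g s) => a b [a' b'] /=; ring.
by apply: C1r_D; exact: C1r_M.
Qed.

Lemma C1c_real f : C1r f -> C1c (fun s => (f s)%:C).
Proof. by move=> hf; split=> //=; exact: C1r_cst. Qed.

Lemma C1c_mulmx k l n (A : circle R -> 'M[C]_(k, l)) (B : circle R -> 'M[C]_(l, n)) :
  (forall i j, C1c (fun s => A s i j)) -> (forall i j, C1c (fun s => B s i j)) ->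
  forall i j, C1c (fun s => (A s *m B s) i j).
Proof. exact: (alg_mulmx C1c_cst C1c_D C1c_M). Qed.

Lemma C1r_mulmx k l n (A : circle R -> 'M[R]_(k, l)) (B : circle R -> 'M[R]_(l, n)) :
  (forall i j, C1r (fun s => A s i j)) -> (forall i j, C1r (fun s => B s i j)) ->
  forall i j, C1r (fun s => (A s *m B s) i j).
Proof. exact: (alg_mulmx C1r_cst C1r_D C1r_M). Qed.

End SmoothAlgebra.

Section DefectAsKernel.
Variables (R : realType) (n m : nat) (eps delta : R).
Hypotheses (heps : 0 < eps < 1) (hdelta : 0 < delta < eps).
Local Notation C := R[i].
Local Notation toC := (map_mx (real_complex R)).
Variables (M : set 'rV[C]_n) (phi : C -> 'rV[C]_n) (ch : chart R n m) (G : circle R -> 'M[R]_m).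
Hypotheses (hM : generic_submanifold eps m M) (phiM : forall s : circle R, M (phi (val s))).
Hypotheses (hphi : analytic_disc delta phi) (hch : adapted_chart eps M phi ch)
  (hG : solves_G delta phi ch G).
Variable E : C -> 'M[C]_m.
Hypotheses (hE : forall i j, extension (fun s => G_twisted phi ch G s i j) (fun z => E z i j))
  (uE : forall z, closed_disc z -> E z \in unitmx).

Let d01 : 0 < delta < 1.
Proof. by case/andP: hdelta => -> h; case/andP: heps => _; exact: lt_trans. Qed.
Let de : delta <= eps. Proof. by case/andP: hdelta => _ /ltW. Qed.

Let B := graph_gradient phi ch.

Lemma twisted_extends i j : extends_holomorphically (fun s => G_twisted phi ch G s i j).
Proof. by exists (fun z => E z i j); exact: hE. Qed.

Lemma twisted_unit s : G_twisted phi ch G s \in unitmx.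
Proof.
have -> : G_twisted phi ch G s = E (val s) by apply/matrixP => i j; have [_ _ ->] := hE i j.
by apply: uE; rewrite closed_discE cabs_circle.
Qed.

Lemma curve_C1 k : C1r delta (fun s => chart_curve phi ch s 0 k).
Proof.
have [C1phi _] := hphi.
have sz : disc_size delta phi < disc_size delta phi + 1 by rewrite ltrDl.
have hb j := disc_boundary d01 C1phi sz j.
have -> : (fun s => chart_curve phi ch s 0 k)
    = (fun s => (realify (phi (val s) - phi 1) *m chart_map ch) 0 k).
  by apply/funext => s; rewrite /chart_curve -chart_mapE realifyB.
apply: (C1r_mulmx d01) => i j; last exact: C1r_cst.
by rewrite (ord1 i); exists (32 * (disc_size delta phi + 1)); exact: hb.
Qed.

Lemma jacobian_C1 k i : C1r delta (fun s => 'J (h_real ch) (chart_curve phi ch s) k i).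
Proof.
have [_ _ hC _ _] := hch; have oD := h_domain_open hch.
have [_ sJ] := class_Ck2_jacobian oD hC.
apply: (composition_C1 d01 heps de oD (sJ k i) _ curve_C1) => s.
exact: (chart_curve_domain phiM hch).
Qed.

Lemma h_y_C1 i j : C1r delta (fun s => h_y_on ch phi s i j).
Proof.
have -> : (fun s => h_y_on ch phi s i j)
    = (fun s => 'J (h_real ch) (chart_curve phi ch s) (rshift _ j) i).
  by apply/funext => s; exact: (h_y_on_jacobian phiM hch).
exact: jacobian_C1.
Qed.

Lemma h_w_C1 i j : C1c delta (fun s => h_w_on ch phi s i j).
Proof.
have -> : (fun s => h_w_on ch phi s i j) = (fun s =>
    ('J (h_real ch) (chart_curve phi ch s) (lshift _ (lshift _ j)) i)%:C * (2%:R)^-1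
    + (- 'i%C / 2%:R) * ('J (h_real ch) (chart_curve phi ch s) (lshift _ (rshift _ j)) i)%:C).
  apply/funext => s; rewrite (h_w_on_jacobian phiM hch).
  by move: ('J _ _ _ _) ('J _ _ _ _) => x y; ring.
apply: C1c_D; first by apply: (C1c_M d01); [exact: C1c_real (jacobian_C1 _ _)|exact: C1c_cst].
by apply: (C1c_M d01); [exact: C1c_cst|exact: C1c_real (jacobian_C1 _ _)].
Qed.

Definition section_of (c : 'rV[R]_m) (s : circle R) : 'rV[C]_n :=
  'i%C *: (toC (c *m G s) *m (B s)^T).

Lemma gradient_trmx s : (B s)^T = (1%:M + 'i%C *: toC (h_y_on ch phi s)) *m (chP ch)^T
   - (2%:R *: h_w_on ch phi s) *m (chQ ch)^T.
Proof.
rewrite /B /graph_gradient linearB /= !trmx_mul linearD /= trmx1 !linearZ /=.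
by rewrite trmxK -map_trmx trmxK.
Qed.

(** In the frame dual to [(P, Q)] the two blocks of [i c B^T] are [i c (1 + i h_y)] and [- 2 i c h_w]. *)
Lemma section_blocks : exists (L1 : 'M[C]_(n, m)) (L2 : 'M[C]_(n, n - m)), forall s (c : 'rV[C]_m),
  c *m (B s)^T *m L1 = c *m (1%:M + 'i%C *: toC (h_y_on ch phi s)) /\
  c *m (B s)^T *m L2 = - (2%:R *: (c *m h_w_on ch phi s)).
Proof.
have [L1 [L2 [h1 h2 h3 h4]]] := chart_dual hch; exists L1^T, L2^T => s c.
have tr k l (X : 'M[C]_(k, n)) (Y : 'M[C]_(n, l)) Z : X *m Y = Z -> Y^T *m X^T = Z^T.
  by move=> <-; rewrite trmx_mul.
rewrite gradient_trmx -!mulmxA !mulmxBl -!mulmxA.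
rewrite (tr _ _ _ _ _ h1) (tr _ _ _ _ _ h2) (tr _ _ _ _ _ h3) (tr _ _ _ _ _ h4).
rewrite !trmx1 !trmx0 !mulmx0 !mulmx1 subr0 sub0r; split=> //.
by rewrite mulmxN -scalemxAr.
Qed.

Lemma twistedE s (c : 'rV[R]_m) :
  toC (c *m G s) *m (1%:M + 'i%C *: toC (h_y_on ch phi s)) = toC c *m G_twisted phi ch G s.
Proof. by rewrite /G_twisted mulmxA -map_mxM. Qed.

Lemma section_of_holomorphic c : V_phi phi ch G c -> holomorphic_sections M delta phi (section_of c).
Proof.
move=> Vc; have [_ cG _] := hG; have CG := (C1_circle_mx d01 G).1 cG.
split.
- by move=> s; apply/(conormalE heps hM phiM hch); exists (c *m G s).
- have hc i j : C1c delta (fun s => section_of c s i j).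
    rewrite /section_of; under eq_fun do rewrite mxE.
    apply: (C1c_M d01); first exact: C1c_cst.
    apply: (C1c_mulmx d01) => i' j'.
      under eq_fun do rewrite mxE; apply: C1c_real.
      by apply: (C1r_mulmx d01) => k l; [exact: C1r_cst|exact: CG].
    under eq_fun do rewrite gradient_trmx.
    have e1 : C1c delta (fun s => ((1%:M + 'i%C *: toC (h_y_on ch phi s)) *m (chP ch)^T) i' j').
      apply: (C1c_mulmx d01) => k l; last exact: C1c_cst.
      have -> : (fun s => (1%:M + 'i%C *: toC (h_y_on ch phi s)) k l)
          = (fun s => (k == l)%:R + 'i%C * (h_y_on ch phi s k l)%:C).
        by apply/funext => s; move: (h_y_on ch phi s) => D; rewrite !mxE.
      apply: C1c_D; first exact: C1c_cst.
      by apply: (C1c_M d01); [exact: C1c_cst|exact: C1c_real (h_y_C1 k l)].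
    have e2 : C1c delta (fun s => ((2%:R *: h_w_on ch phi s) *m (chQ ch)^T) i' j').
      apply: (C1c_mulmx d01) => k l; last exact: C1c_cst.
      have -> : (fun s => (2%:R *: h_w_on ch phi s) k l) = (fun s => 2%:R * h_w_on ch phi s k l).
        by apply/funext => s; move: (h_w_on ch phi s) => D; rewrite !mxE.
      by apply: (C1c_M d01); [exact: C1c_cst|exact: h_w_C1].
    have -> : (fun s => ((1%:M + 'i%C *: toC (h_y_on ch phi s)) *m (chP ch)^T
        - (2%:R *: h_w_on ch phi s) *m (chQ ch)^T) i' j')
      = (fun s => ((1%:M + 'i%C *: toC (h_y_on ch phi s)) *m (chP ch)^T) i' j'
        + (-1) * ((2%:R *: h_w_on ch phi s) *m (chQ ch)^T) i' j').
      apply/funext => s; move: (_ *m (chP ch)^T) (_ *m (chQ ch)^T) => X Y.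
      by rewrite !mxE mulN1r.
    by apply: C1c_D => //; apply: (C1c_M d01) => //; exact: C1c_cst.
  apply/(C1_circle_mx d01) => i j; rewrite /realify; case: (split_ordP j) => k ->.
    have [[K hK] _] := hc i k; exists K.
    by under eq_fun do rewrite row_mxEl mxE.
  have [_ [K hK]] := hc i k; exists K.
  by under eq_fun do rewrite row_mxEr mxE.
- move=> j.
  have -> : (fun s => section_of c s 0 j) = (fun s => 'i%C *
     ((toC c *m G_twisted phi ch G s *m (chP ch)^T) 0 j
      + (- 2%:R) * (toC (c *m G s) *m h_w_on ch phi s *m (chQ ch)^T) 0 j)).
    apply/funext => s; rewrite /section_of gradient_trmx -twistedE mulmxBr mulmxA.
    rewrite -scalemxAl -scalemxAr -mulmxA; move: (_ *m (chP ch)^T) => X.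
    rewrite (mulmxA _ (h_w_on _ _ _)); move: (_ *m (chQ ch)^T) => Y.
    by rewrite !mxE; ring.
  apply: extends_M; first exact: extends_cst.
  apply: extends_D.
    apply: extends_mulmx => k l; last exact: extends_cst.
    by apply: extends_mulmx => k' l'; [exact: extends_cst|exact: twisted_extends].
  apply: extends_M; first exact: extends_cst.
  apply: extends_mulmx => k l; last exact: extends_cst.
  by rewrite (ord1 k); exact: Vc.
Qed.

Lemma holomorphic_section_of a : holomorphic_sections M delta phi a ->
  exists2 c, V_phi phi ch G c & a = section_of c.
Proof.
move=> [con _ ext]; have [uG _ _] := hG.
have /choice[c hc] : forall s, exists c : 'rV[R]_m, a s = 'i%C *: (toC c *m (B s)^T).
  by move=> s; apply/(conormalE heps hM phiM hch); exact: con.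
have [L1 [L2 hL]] := section_blocks.
have extr k (L : 'M[C]_(n, k)) i j : extends_holomorphically (fun s => (a s *m L) i j).
  by apply: extends_mulmx => i' j'; [rewrite (ord1 i'); exact: ext|exact: extends_cst].
have /choice[F hF] : forall j, exists F, holo F /\ forall s : circle R, F (val s) = (a s *m L1) 0 j.
  by move=> j; apply/extends_holo; exact: extr.
pose Fr z : 'rV[C]_m := \row_j ((- 'i%C) * F j z).
have hFr i j : holo (fun z => Fr z i j).
  under eq_fun do rewrite mxE.
  have [h _] := hF j; exact (holoM (holo_cst (- 'i%C)) h).
have ii : (- 'i%C) * 'i%C = 1 :> C by rewrite mulNr -expr2 sqr_i opprK.
have FrE (s : circle R) : Fr (val s) = toC (c s) *m (1%:M + 'i%C *: toC (h_y_on ch phi s)).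
  have [<- _] := hL s (toC (c s)); apply/rowP => j; rewrite mxE; have [_ ->] := hF j.
  by rewrite hc -scalemxAl [X in _ * X]mxE mulrA ii mul1r.
have hE0 i j : holo (fun z => E z i j) by have [cF dF _] := hE i j; exact (conj cF dF).
have hW := holo_mulmx hFr (holo_invmx uE hE0).
have EE (s : circle R) : E (val s) = G_twisted phi ch G s.
  by apply/matrixP => i j; have [_ _ ->] := hE i j.
have Ws (s : circle R) : Fr (val s) *m invmx (E (val s)) = toC (c s *m invmx (G s)).
  apply: (can_inj (mulmxK (twisted_unit s))); rewrite EE mulmxKV ?twisted_unit // FrE.
  by rewrite -twistedE mulmxKV.
have im i j (s : circle R) : complex.Im ((Fr (val s) *m invmx (E (val s))) i j) = 0 by rewrite Ws mxE.
pose c0 := c (circle_one R) *m invmx (G (circle_one R)).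
have cc s : c s = c0 *m G s.
  rewrite -[LHS](mulmxKV (uG s)); congr (_ *m G s); apply: (map_mx_inj (f := real_complex R)).
  rewrite /c0 -!Ws; apply/matrixP => i j.
  have h1 := holo_real_cst (hW i j) (im i j) s.
  have h2 := holo_real_cst (hW i j) (im i j) (circle_one R).
  exact (etrans h1 (esym h2)).
exists c0; last by apply/funext => s; rewrite hc cc.
move=> j.
have -> : (fun s => (toC (c0 *m G s) *m h_w_on ch phi s) 0 j)
    = (fun s => ('i%C / 2%:R) * (a s *m L2) 0 j).
  apply/funext => s; rewrite hc cc -scalemxAl; have [_ ->] := hL s (toC (c0 *m G s)).
  move: (toC _ *m _) => X; rewrite !mxE.
  have -> : 'i%C / 2%:R * ('i%C * - (2%:R * X 0 j)) = (- 'i%C * 'i%C) * X 0 j * (2%:R / 2%:R) by ring.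
  by rewrite ii mul1r divff ?mulr1 // pnatr_eq0.
by apply: extends_M; [exact: extends_cst|exact: extr].
Qed.

Lemma section_of_linear x u v :
  section_of (x *: u + v) = (x%:C : C) *: section_of u + section_of v.
Proof.
apply/funext => s; rewrite [RHS]/(_ + _) /= /section_of mulmxDl -scalemxAl map_mxD map_mxZ mulmxDl scalerDr.
by rewrite -scalemxAl !scalerA (mulrC 'i%C).
Qed.

Lemma section_of_inj u : section_of u = 0 -> u = 0.
Proof.
move=> h; pose s := circle_one R; have [L1 [L2 hL]] := section_blocks.
have := congr1 (fun f : circle R -> 'rV[C]_n => f s *m L1) h; rewrite /section_of mul0mx -scalemxAl.
have [-> _] := hL s (toC (u *m G s)); rewrite twistedE => /eqP; rewrite scaler_eq0.
rewrite (negbTE (neq0Ci _)) /= => /eqP h0.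
apply: (map_mx_inj (f := real_complex R)); rewrite map_mx0.
by apply: (can_inj (mulmxK (twisted_unit s))); rewrite h0 mul0mx.
Qed.

Lemma defect_dim_iff k :
  has_real_dim id (V_phi phi ch G) k <-> defect_is M delta phi k.
Proof.
apply: (has_real_dim_transfer (f := section_of)) => //.
- exact: section_of_linear.
- exact: section_of_inj.
- move=> a; split=> [/holomorphic_section_of[c Vc ->]|[c Vc ->]]; first by exists c.
  exact: section_of_holomorphic.
Qed.

Lemma V_phi_dim : exists2 k, (k <= m)%N & has_real_dim id (V_phi phi ch G) k.
Proof.
apply: subspace_dim => [j|x u v Vu Vv j].
  by under eq_fun do rewrite mul0mx map_mx0 mul0mx mxE; exact: extends_cst.
have -> : (fun s => (toC ((x *: u + v) *m G s) *m h_w_on ch phi s) 0 j)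
    = (fun s => x%:C * (toC (u *m G s) *m h_w_on ch phi s) 0 j + (toC (v *m G s) *m h_w_on ch phi s) 0 j).
  apply/funext => s; rewrite mulmxDl -scalemxAl map_mxD map_mxZ mulmxDl -scalemxAl.
  by move: (_ *m h_w_on _ _ _) (_ *m h_w_on _ _ _) => X Y; rewrite !mxE.
by apply: extends_D => //; apply: extends_M => //; exact: extends_cst.
Qed.

End DefectAsKernel.

Theorem proposition3 (R : realType) (n m : nat) (eps delta : R)
    (M : set 'rV[R[i]]_n)
    (heps : 0 < eps < 1) (hdelta : 0 < delta < eps)
    (hM : generic_submanifold eps m M)
    (hM' : exists M' : set 'rV[R[i]]_n,
       generic_submanifold eps m M' /\ relatively_compact_open_in M M') :
  exists R0 : R, 0 < R0 /\
    forall phi : R[i] -> 'rV[R[i]]_n,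
      analytic_disc delta phi ->
      (forall s : circle R, M (phi (val s))) ->
      disc_size delta phi < R0 ->
      (exists (ch : chart R n m) (G : circle R -> 'M[R]_m),
         tumanov_choice eps delta M phi ch G) /\
      exists d : nat,
        [/\ defect_is M delta phi d,
            forall (ch : chart R n m) (G : circle R -> 'M[R]_m),
              tumanov_choice eps delta M phi ch G ->
              has_real_dim id (V_phi phi ch G) d &
            (d <= m)%N].
Proof.
have [M' [gM' rel]] := hM'.
have [R0 R00 hR0] := global_tumanov_choice heps hdelta gM' rel.
exists R0; split=> // phi hphi phiM hsize; have choice_ex := hR0 phi hphi phiM hsize.
split=> //; have [ch0 [G0 [adapted0 solves0 _ [E0 [ext0 unit0]]]]] := choice_ex.
have [d dm dimV] := V_phi_dim phi ch0 G0; exists d; split=> //.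
  exact: (proj1 (defect_dim_iff heps hdelta hM phiM hphi adapted0 solves0 ext0 unit0 d)).
move=> ch G [adapted solves _ [E [extE unitE]]].
apply: (proj2 (defect_dim_iff heps hdelta hM phiM hphi adapted solves extE unitE d)).
exact: (proj1 (defect_dim_iff heps hdelta hM phiM hphi adapted0 solves0 ext0 unit0 d)).
Qed.
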